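(* Let $\mathcal P=\mathcal{L}ie^1_2\mathcal{B}i$ (over $\mathbb K=\mathbb R$) be the quadratic dioperad defined in the context and let $\mathcal P_\infty$ be its minimal resolution. There is a one-to-one correspondence between representations of $\mathcal P_\infty$ in $\mathbb R^n$ and formal bi-Hamiltonian structures on $\mathbb R^n$ vanishing at the origin.
   Context: Conventions: $\mathbb K$ is a field of characteristic zero (here $\mathbb R$); $V[i]_j=V_{i+j}$ for a graded vector space $V$; differentials have degree $+1$; $\mathbb 1_n$ and $\mathrm{sgn}_n$ are the trivial and sign representations of the symmetric group $\mathbb S_n$. An $\mathbb S$-bimodule $M$ is a family of $(\mathbb S_m,\mathbb S_n)$-bimodules $M(m,n)$ ($n$ inputs, $m$ outputs). $\mathcal F(M)$ is the free dioperad on $M$ (connected directed graphs of genus $0$ with vertices decorated by $M$), and $\mathcal F_{(s)}(M)$ is the part with $s$ vertices. All composites are read from inputs (top) to outputs (bottom). The dioperad $\mathcal P=\mathcal{L}ie^1_2\mathcal{B}i=\mathcal F(M)/(R)$: $M(1,2)=\mathbb 1_1\otimes(\mathbb 1_2[-1])$ with basis $\ell$ (degree $1$, symmetric in its inputs), $M(2,1)=(\mathrm{sgn}_2\oplus\mathrm{sgn}_2)\otimes\mathbb 1_1$ with basis $\delta_1,\delta_2$ (degree $0$, skew in their outputs), and $M(m,n)=0$ otherwise. Write $\ell\ell(a,b,c)$ for the composite ''apply $\ell$ to inputs $a,b$, then $\ell$ to the result and input $c$''; $\delta_x\delta_y(a,b,c)$ for the composite ''apply $\delta_x$ to the input; its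 second output is output $c$; apply $\delta_y$ to its first output, giving outputs $a,b$''; $\delta_x\ell$ for $\delta_x$ applied to $\ell$ of inputs $1,2$, with outputs $1,2$; and $C_x(i,j;k,l)$ for the composite ''apply $\delta_x$ to input $i$; its first output is output $k$; apply $\ell$ to (its second output, input $j$), giving output $l$''. The relations $R$ are: (1) $\ell\ell(1,2,3)+\ell\ell(2,3,1)+\ell\ell(3,1,2)$; (2) $\delta_x\delta_x(1,2,3)+\delta_x\delta_x(2,3,1)+\delta_x\delta_x(3,1,2)$ for $x=1,2$; (3) $\sum_{(a,b,c)}\big(\delta_1\delta_2(a,b,c)+\delta_2\delta_1(a,b,c)\big)$, the sum over $(a,b,c)\in\{(1,2,3),(2,3,1),(3,1,2)\}$; (4) $\delta_x\ell-C_x(1,2;1,2)-C_x(2,1;1,2)+C_x(1,2;2,1)+C_x(2,1;2,1)$ for $x=1,2$. The minimal resolution $\mathcal P_\infty$ is the minimal quasi-free resolution of $\mathcal P$: a free dioperad $\mathcal F(E)$ with a differential $\partial$ satisfying $\partial(E)\subset\bigoplus_{s\ge2}\mathcal F_{(s)}(E)$, together with a quasi-isomorphism of dg dioperads to $\mathcal P$ (with zero differential on $\mathcal P$); concretely, the Koszul resolution, i.e. the cobar construction on the Koszul dual codioperad of $\mathcal P$. A representation of $\mathcal P_\infty$ in a dg vector space $W$ is a morphism of dg dioperads $\mathcal P_\infty\to\mathcal End_W$, $\mathcal End_W(m,n)=\mathrm{Hom}(W^{\otimes n},W^{\otimes m})$ (equivalently, a representation of the dg prop generated by $\mathcal P_\infty$).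 Here $\mathbb R^n$ is concentrated in degree $0$. A formal bi-Hamiltonian structure on $\mathbb R^n$ is a pair of formal bivector fields $\Gamma_1,\Gamma_2$ on $\mathbb R^n$ (coefficients in $\mathbb R[[t^1,\dots,t^n]]$) such that $[\Gamma_1,\Gamma_1]=[\Gamma_1,\Gamma_2]=[\Gamma_2,\Gamma_2]=0$ for the Schouten bracket, i.e. a pair of Poisson structures whose sum is again a Poisson structure. It vanishes at the origin if $\Gamma_1$ and $\Gamma_2$ both vanish at the origin. The intended correspondence is the natural one, in which the components of a representation are the Taylor coefficients of the bivector fields. *)

(* Defs.v *)
From HB Require Import structures.
From mathcomp Require Import all_boot all_order all_algebra.
From mathcomp Require Import reals.

Set Implicit Arguments.
Unset Strict Implicit.
Unset Printing Implicit Defensive.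

Import Order.TTheory GRing.Theory Num.Theory.
Local Open Scope ring_scope.

(* Inputs and outputs are labelled by arbitrary finite types, so that an
   S-bimodule is a functor on pairs of finite sets and bijections; the
   skeletal M(m, n) is M 'I_m 'I_n.  A composition along one edge takes x, one
   of whose outputs is marked, and y, one of whose inputs is marked; marks are
   the point None of an option type.  Everywhere x is above y: the convention
   for Koszul signs is that in [comp x y] the letter x comes before y. *)

Section Relabelings.
Variables A B C : Type.

Definition sumf (A' B' : Type) (f : A -> A') (g : B -> B') (u : A + B) :
    A' + B' :=
  match u with inl a => inl (f a) | inr b => inr (g b) end.

Definition optl (u : option A + B) : option (A + B) :=
  match u with
  | inl None => None | inl (Some a) => Some (inl a) | inr b => Some (inr b)
  end.

Definition optr (u : A + option B) : option (A + B) :=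
  match u with
  | inl a => Some (inl a) | inr None => None | inr (Some b) => Some (inr b)
  end.

Definition optlV (u : option (A + B)) : option A + B :=
  match u with
  | None => inl None | Some (inl a) => inl (Some a) | Some (inr b) => inr b
  end.

Definition optrV (u : option (A + B)) : A + option B :=
  match u with
  | None => inr None | Some (inl a) => inl a | Some (inr b) => inr (Some b)
  end.

Definition sumA (u : (A + B) + C) : A + (B + C) :=
  match u with
  | inl (inl a) => inl a | inl (inr b) => inr (inl b) | inr c => inr (inr c)
  end.

Definition sumAC (u : (A + B) + C) : (A + C) + B :=
  match u with
  | inl (inl a) => inl (inl a) | inl (inr b) => inr b | inr c => inl (inr c)
  end.

Definition sumCA (u : A + (B + C)) : B + (A + C) :=
  match u with
  | inl a => inr (inl a) | inr (inl b) => inl b | inr (inr c) => inr (inr c)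
  end.

Definition swapo (u : option (option A)) : option (option A) :=
  match u with
  | None => Some None | Some None => None | Some (Some a) => Some (Some a)
  end.

Definition unvoidl (u : void + A) : A :=
  match u with inl v => of_void A v | inr a => a end.

Definition unvoidr (u : A + void) : A :=
  match u with inl a => a | inr v => of_void A v end.

Definition unoptl (u : option void + A) : option A :=
  match u with inl _ => None | inr a => Some a end.

Definition unoptr (u : A + option void) : option A :=
  match u with inl a => Some a | inr _ => None end.

End Relabelings.

(* J = a + complement of a, for a : {set J}. *)
Definition join (J : finType) (a : {set J})
    (u : {x | x \in a} + {x | x \notin a}) : J :=
  match u with inl x => val x | inr x => val x end.

Definition split_set (J : finType) (a : {set J}) (x : J) :
    {x | x \in a} + {x | x \notin a} :=
  match boolP (x \in a) with
  | AltTrue h => inl (exist _ x h)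
  | AltFalse h => inr (exist _ x h)
  end.

Definition ksgn (K : fieldType) (p : int) : K := (-1) ^ p.

Record grading (K : fieldType) (V : lmodType K) (hdeg : int -> V -> Prop) :
    Prop := Grading {
  hdeg0 : forall p, hdeg p 0;
  hdegP : forall p (a : K) x y, hdeg p x -> hdeg p y -> hdeg p (a *: x + y);
  hdeg_span : forall x, exists (s : seq int) (f : int -> V),
    (forall p, hdeg p (f p)) /\ x = \sum_(p <- s) f p;
  hdeg_indep : forall (s : seq int) (f : int -> V), uniq s ->
    (forall p, hdeg p (f p)) -> \sum_(p <- s) f p = 0 ->
    forall p, p \in s -> f p = 0
}.

(* [act f g] relabels outputs along f and inputs along g; its value is
   irrelevant, and unconstrained, unless f and g are bijective. *)
Record bimodule (K : fieldType) := Bimodule {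
  sp :> finType -> finType -> lmodType K;
  hdeg : forall J I, int -> sp J I -> Prop;
  hdeg_grading : forall J I, grading (@hdeg J I);
  act : forall (J J' I I' : finType), (J -> J') -> (I -> I') ->
    sp J I -> sp J' I';
  act_linear : forall (J J' I I' : finType) (f : J -> J') (g : I -> I'),
    bijective f -> bijective g -> linear (act f g);
  act_hdeg : forall (J J' I I' : finType) (f : J -> J') (g : I -> I') p x,
    bijective f -> bijective g -> hdeg p x -> hdeg p (act f g x);
  act_id : forall (J I : finType) (x : sp J I), act id id x = x;
  act_comp : forall (J J' J'' I I' I'' : finType)
    (f : J -> J') (f' : J' -> J'') (g : I -> I') (g' : I' -> I'')
    (x : sp J I),
    bijective f -> bijective f' -> bijective g -> bijective g' ->
    act f' g' (act f g x) = act (f' \o f) (g' \o g) x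
}.

Record bimod_hom (K : fieldType) (M N : bimodule K) := BimodHom {
  bh_fun :> forall J I : finType, M J I -> N J I;
  bh_linear : forall J I, linear (@bh_fun J I);
  bh_hdeg : forall J I p (x : M J I), hdeg p x -> hdeg p (bh_fun x);
  bh_act : forall (J J' I I' : finType) (f : J -> J') (g : I -> I')
    (x : M J I), bijective f -> bijective g ->
    bh_fun (act f g x) = act f g (bh_fun x)
}.

Section Shift.
Variables (K : fieldType) (k : int) (M : bimodule K).

Lemma shift_grading (J I : finType) :
  grading (fun p (x : M J I) => hdeg (k + p) x).
Proof.
have [h0 hP hs hi] := hdeg_grading M J I.
split=> [p|p a x y|x|s f us hf sf0 p ps]; [exact: h0|exact: hP| |].
  have [s [f [hf ->]]] := hs x.
  exists [seq p - k | p <- s], (fun p => f (k + p)); split=> [p|]; first exact: hf.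
  by rewrite big_map; apply: eq_bigr => p _; rewrite addrC subrK.
have h := hi [seq k + q | q <- s] (fun q => f (q - k)).
have <- : f (k + p - k) = f p by rewrite addrC addKr.
apply: h; first by rewrite map_inj_uniq //; exact: addrI.
- by move=> q; have := hf (q - k); rewrite addrC subrK.
- rewrite big_map -[RHS]sf0; apply: eq_bigr => q _.
  by rewrite [k + q]addrC addrK.
- by apply/mapP; exists p.
Qed.

(* M[k], with M[k]_p = M_{k+p} *)
Definition shift : bimodule K := {|
  sp := sp M;
  hdeg := fun J I p x => @hdeg K M J I (k + p) x;
  hdeg_grading := shift_grading;
  act := @act K M;
  act_linear := @act_linear K M;
  act_hdeg := fun J J' I I' f g p => @act_hdeg K M J J' I I' f g (k + p);
  act_id := @act_id K M;
  act_comp := @act_comp K M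
|}.

End Shift.

(* The three associativity axioms are those of a three-vertex graph of genus
   0: a chain, one vertex above two others, two vertices above a third. *)
Record dioperad (K : fieldType) := Dioperad {
  dio_mod :> bimodule K;
  comp : forall J1 I1 J2 I2 : finType,
    dio_mod (option J1) I1 -> dio_mod J2 (option I2) ->
    dio_mod (J1 + J2)%type (I1 + I2)%type;
  dunit : dio_mod (option void) (option void);
  comp_linearl : forall (J1 I1 J2 I2 : finType) (y : dio_mod J2 (option I2)),
    linear (fun x : dio_mod (option J1) I1 => comp x y);
  comp_linearr : forall (J1 I1 J2 I2 : finType) (x : dio_mod (option J1) I1),
    linear (fun y : dio_mod J2 (option I2) => comp x y);
  comp_hdeg : forall (J1 I1 J2 I2 : finType) (x : dio_mod (option J1) I1)
    (y : dio_mod J2 (option I2)) p q,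
    hdeg p x -> hdeg q y -> hdeg (p + q) (comp x y);
  comp_act : forall (J1 J1' I1 I1' J2 J2' I2 I2' : finType)
    (f1 : J1 -> J1') (g1 : I1 -> I1') (f2 : J2 -> J2') (g2 : I2 -> I2')
    (x : dio_mod (option J1) I1) (y : dio_mod J2 (option I2)),
    bijective f1 -> bijective g1 -> bijective f2 -> bijective g2 ->
    comp (act (omap f1) g1 x) (act f2 (omap g2) y)
    = act (sumf f1 f2) (sumf g1 g2) (comp x y);
  dunit_hdeg : hdeg 0 dunit;
  dunit_compl : forall (J I : finType) (y : dio_mod J (option I)),
    act (@unvoidl J) (@unoptl I) (comp dunit y) = y;
  dunit_compr : forall (J I : finType) (x : dio_mod (option J) I),
    act (@unoptr J) (@unvoidr I) (comp x dunit) = x;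
  comp_chain : forall (J1 I1 J2 I2 J3 I3 : finType)
    (x : dio_mod (option J1) I1) (y : dio_mod (option J2) (option I2))
    (z : dio_mod J3 (option I3)),
    act (@sumA J1 J2 J3) (@sumA I1 I2 I3)
      (comp (act (@optr J1 J2) id (comp x y)) z)
    = comp x (act id (@optl I2 I3) (comp y z));
  comp_below : forall (J1 I1 J2 I2 J3 I3 : finType)
    (x : dio_mod (option (option J1)) I1) (y : dio_mod J2 (option I2))
    (z : dio_mod J3 (option I3)) q r,
    hdeg q y -> hdeg r z ->
    act (@sumAC J1 J2 J3) (@sumAC I1 I2 I3)
      (comp (act (@optl J1 J2) id (comp x y)) z)
    = ksgn K (q * r) *:
      comp (act (@optl J1 J3) id (comp (act (@swapo J1) id x) z)) y;
  comp_above : forall (J1 I1 J2 I2 J3 I3 : finType)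
    (x : dio_mod (option J1) I1) (y : dio_mod (option J2) I2)
    (z : dio_mod J3 (option (option I3))) p q,
    hdeg p x -> hdeg q y ->
    act (@sumCA J1 J2 J3) (@sumCA I1 I2 I3)
      (comp x (act id (@optr I2 I3) (comp y z)))
    = ksgn K (p * q) *:
      comp y (act id (@optr I1 I3) (comp x (act id (@swapo I3) z)))
}.

Record dioperad_hom (K : fieldType) (D D' : dioperad K) := DioperadHom {
  dh_hom :> bimod_hom D D';
  dh_comp : forall (J1 I1 J2 I2 : finType)
    (x : D (option J1) I1) (y : D J2 (option I2)),
    dh_hom _ _ (comp x y) = comp (dh_hom _ _ x) (dh_hom _ _ y);
  dh_unit : dh_hom _ _ (dunit D) = dunit D'
}.

Record dgdioperad (K : fieldType) := DgDioperad {
  dg_dio :> dioperad K;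
  diff : forall J I : finType, dg_dio J I -> dg_dio J I;
  diff_linear : forall J I, linear (@diff J I);
  diff_hdeg : forall J I p (x : dg_dio J I), hdeg p x -> hdeg (p + 1) (diff x);
  diff_diff : forall J I (x : dg_dio J I), diff (diff x) = 0;
  diff_act : forall (J J' I I' : finType) (f : J -> J') (g : I -> I')
    (x : dg_dio J I), bijective f -> bijective g ->
    diff (act f g x) = act f g (diff x);
  diff_comp : forall (J1 I1 J2 I2 : finType) (x : dg_dio (option J1) I1)
    (y : dg_dio J2 (option I2)) p, hdeg p x ->
    diff (comp x y) = comp (diff x) y + ksgn K p *: comp x (diff y)
}.

Record dg_hom (K : fieldType) (D D' : dgdioperad K) := DgHom {
  dgh_hom :> dioperad_hom D D';
  dgh_diff : forall J I (x : D J I),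
    dgh_hom _ _ (diff x) = diff (dgh_hom _ _ x)
}.

Definition quasi_iso (K : fieldType) (D D' : dgdioperad K) (h : dg_hom D D') :=
  forall J I : finType,
    (forall x : D J I, diff x = 0 -> (exists w, h _ _ x = diff w) ->
       exists v, x = diff v)
    /\ (forall y : D' J I, diff y = 0 ->
       exists2 x, diff x = 0 & exists w, h _ _ x - y = diff w).

Section ZeroDifferential.
Variables (K : fieldType) (D : dioperad K).
Let d (J I : finType) (x : D J I) : D J I := 0.

Lemma zero_linear J I : linear (@d J I).
Proof. by move=> a x y; rewrite /d scaler0 addr0. Qed.

Lemma zero_hdeg J I p (x : D J I) : hdeg p x -> hdeg (p + 1) (d x).
Proof. by move=> _; apply: (hdeg0 (hdeg_grading D J I)). Qed.

Lemma act0 (M : bimodule K) (J J' I I' : finType) (f : J -> J') (g : I -> I') :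
  bijective f -> bijective g -> act f g (0 : M J I) = 0.
Proof.
move=> bf bg; have := act_linear bf bg (-1) (0 : M J I) 0.
by rewrite scaleN1r oppr0 addr0 scaleN1r addNr.
Qed.

Lemma zero_act (J J' I I' : finType) (f : J -> J') (g : I -> I')
    (x : D J I) : bijective f -> bijective g ->
  d (act f g x) = act f g (d x).
Proof. by move=> bf bg; rewrite /d act0. Qed.

Lemma zero_comp (J1 I1 J2 I2 : finType) (x : D (option J1) I1)
    (y : D J2 (option I2)) p : hdeg p x ->
  d (comp x y) = comp (d x) y + ksgn K p *: comp x (d y).
Proof.
move=> _; rewrite /d.
have := comp_linearl y (-1) (0 : D (option J1) I1) 0.
rewrite scaleN1r oppr0 addr0 scaleN1r addNr => ->.
have := comp_linearr x (-1) (0 : D J2 (option I2)) 0.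
by rewrite scaleN1r oppr0 addr0 scaleN1r addNr => ->; rewrite scaler0 addr0.
Qed.

Definition dg0 : dgdioperad K := {|
  dg_dio := D; diff := d;
  diff_linear := zero_linear; diff_hdeg := zero_hdeg;
  diff_diff := fun _ _ _ => erefl; diff_act := zero_act; diff_comp := zero_comp
|}.

End ZeroDifferential.

(* F with iota : E -> F is the free dioperad on E. *)
Definition is_free (K : fieldType) (E : bimodule K) (F : dioperad K)
    (iota : bimod_hom E F) : Prop :=
  forall (D : dioperad K) (g : bimod_hom E D),
  exists h : dioperad_hom F D,
    (forall J I (e : E J I), h _ _ (iota _ _ e) = g _ _ e)
    /\ forall h' : dioperad_hom F D,
         (forall J I (e : E J I), h' _ _ (iota _ _ e) = g _ _ e) ->
         forall J I (x : F J I), h' _ _ x = h _ _ x.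

Definition bilinear_form (K : fieldType) (A B : lmodType K)
    (T : A -> B -> K) : Prop :=
  (forall y, scalar (T^~ y)) /\ (forall x, scalar (T x)).

Definition trilinear_form (K : fieldType) (A B C : lmodType K)
    (T : A -> B -> C -> K) : Prop :=
  [/\ forall y z, scalar (fun x => T x y z),
      forall x z, scalar (fun y => T x y z) &
      forall x y, scalar (T x y)].

Definition sweedler (K : fieldType) (A B V : lmodType K)
    (s : seq (int * A * B)) (F : int -> A -> B -> V) : V :=
  \sum_(t <- s) F t.1.1 t.1.2 t.2.

(* A coaugmented codioperad, given by its coaugmentation coideal with its
   infinitesimal (two-vertex) decompositions.  The tensor
   [dec c] = sum c' (x) c'' is a finite list of triples (|c'|, c', c'') with c'
   homogeneous; such lists are meaningful only up to equality in the tensor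
   product, that is up to having the same value under every multilinear form.
   The arity condition [cod_reduced] makes the codioperad conilpotent. *)
Record codioperad (K : fieldType) := Codioperad {
  cod_mod :> bimodule K;
  dec : forall J1 I1 J2 I2 : finType, cod_mod (J1 + J2)%type (I1 + I2)%type ->
    seq (int * cod_mod (option J1) I1 * cod_mod J2 (option I2));
  cod_reduced : forall (J I : finType) (c : cod_mod J I),
    ~~ [&& 1 <= #|J|, 1 <= #|I| & 3 <= #|J| + #|I|]%N -> c = 0;
  dec_hdegl : forall (J1 I1 J2 I2 : finType)
    (c : cod_mod (J1 + J2)%type (I1 + I2)%type) t,
    t \in dec c -> hdeg t.1.1 t.1.2;
  dec_hdegr : forall (J1 I1 J2 I2 : finType)
    (c : cod_mod (J1 + J2)%type (I1 + I2)%type) p t,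
    hdeg p c -> t \in dec c -> hdeg (p - t.1.1) t.2;
  dec_linear : forall (J1 I1 J2 I2 : finType)
    (T : cod_mod (option J1) I1 -> cod_mod J2 (option I2) -> K),
    bilinear_form T ->
    scalar (fun c => sweedler (dec c) (fun _ x y => T x y : K^o));
  dec_act : forall (J1 J1' I1 I1' J2 J2' I2 I2' : finType)
    (f1 : J1 -> J1') (g1 : I1 -> I1') (f2 : J2 -> J2') (g2 : I2 -> I2')
    (T : cod_mod (option J1') I1' -> cod_mod J2' (option I2') -> K) c,
    bijective f1 -> bijective g1 -> bijective f2 -> bijective g2 ->
    bilinear_form T ->
    sweedler (dec (act (sumf f1 f2) (sumf g1 g2) c))
      (fun _ x y => T x y : K^o)
    = sweedler (dec c)
      (fun _ x y => T (act (omap f1) g1 x) (act f2 (omap g2) y) : K^o);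
  dec_chain : forall (J1 I1 J2 I2 J3 I3 : finType)
    (T : cod_mod (option J1) I1 -> cod_mod (option J2) (option I2) ->
         cod_mod J3 (option I3) -> K)
    (c : cod_mod ((J1 + J2) + J3)%type ((I1 + I2) + I3)%type),
    trilinear_form T ->
    sweedler (dec c) (fun _ u z =>
      sweedler (dec (act (@optrV J1 J2) id u)) (fun _ x y => T x y z : K^o))
    = sweedler (dec (act (@sumA J1 J2 J3) (@sumA I1 I2 I3) c)) (fun _ x v =>
      sweedler (dec (act id (@optlV I2 I3) v)) (fun _ y z => T x y z : K^o));
  dec_below : forall (J1 I1 J2 I2 J3 I3 : finType)
    (T : cod_mod (option (option J1)) I1 -> cod_mod J2 (option I2) ->
         cod_mod J3 (option I3) -> K)
    (c : cod_mod ((J1 + J2) + J3)%type ((I1 + I2) + I3)%type) p,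
    trilinear_form T -> hdeg p c ->
    sweedler (dec c) (fun _ u z =>
      sweedler (dec (act (@optlV J1 J2) id u)) (fun _ x y => T x y z : K^o))
    = sweedler (dec (act (@sumAC J1 J2 J3) (@sumAC I1 I2 I3) c)) (fun q u y =>
      sweedler (dec (act (@optlV J1 J3) id u)) (fun r x z =>
        ksgn K ((p - q) * (q - r)) * T (act (@swapo J1) id x) y z : K^o));
  dec_above : forall (J1 I1 J2 I2 J3 I3 : finType)
    (T : cod_mod (option J1) I1 -> cod_mod (option J2) I2 ->
         cod_mod J3 (option (option I3)) -> K)
    (c : cod_mod (J1 + (J2 + J3))%type (I1 + (I2 + I3))%type),
    trilinear_form T ->
    sweedler (dec c) (fun _ x v =>
      sweedler (dec (act id (@optrV I2 I3) v)) (fun _ y z => T x y z : K^o))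
    = sweedler (dec (act (@sumCA J1 J2 J3) (@sumCA I1 I2 I3) c)) (fun q y v =>
      sweedler (dec (act id (@optrV I1 I3) v)) (fun r x z =>
        ksgn K (q * r) * T x y (act id (@swapo I3) z) : K^o))
}.

Record codioperad_hom (K : fieldType) (C C' : codioperad K) :=
    CodioperadHom {
  ch_hom :> bimod_hom C C';
  ch_dec : forall (J1 I1 J2 I2 : finType)
    (T : C' (option J1) I1 -> C' J2 (option I2) -> K)
    (c : C (J1 + J2)%type (I1 + I2)%type),
    bilinear_form T ->
    sweedler (dec (ch_hom _ _ c)) (fun _ x y => T x y : K^o)
    = sweedler (dec c) (fun _ x y => T (ch_hom _ _ x) (ch_hom _ _ y) : K^o)
}.

(* The sum over all two-vertex graphs of (-1)^|c'| f(c') o f(c''); the sign is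
   that of (s^-1 (x) s^-1)(c' (x) c''). *)
Definition desuspended_dec (K : fieldType) (C : codioperad K) (D : dioperad K)
    (f : forall J I : finType, C J I -> D J I) (J I : finType) (c : C J I) :
    D J I :=
  \sum_(a : {set J}) \sum_(b : {set I})
    act (@join J a) (@join I b)
      (sweedler (dec (act (@split_set J a) (@split_set I b) c))
        (fun p x y => ksgn K p *: comp (f _ _ x) (f _ _ y))).

(* [P] is a dioperad generated by [j : M -> P] subject to quadratic relations;
   [phi] stands for a map C -> sM.  As P_(2) = F_(2)(M) / R, the condition
   says that C -> F^c(sM)_(2) / s^2 R vanishes. *)
Definition corelations (K : fieldType) (M : bimodule K) (P : dioperad K)
    (j : bimod_hom M P) (C : codioperad K) (phi : bimod_hom C (shift 1 M)) :
    Prop :=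
  forall (J I : finType) (c : C J I),
    desuspended_dec (fun J I x => j J I (phi J I x)) c = 0.

(* The codioperad cogenerated by sM with corelations s^2 R. *)
Definition is_koszul_dual (K : fieldType) (M : bimodule K) (P : dioperad K)
    (j : bimod_hom M P) (C : codioperad K) (kappa : bimod_hom C (shift 1 M)) :
    Prop :=
  corelations j kappa
  /\ forall (D : codioperad K) (phi : bimod_hom D (shift 1 M)),
       corelations j phi ->
       exists h : codioperad_hom D C,
         (forall J I (x : D J I), kappa _ _ (h _ _ x) = phi _ _ x)
         /\ forall h' : codioperad_hom D C,
              (forall J I (x : D J I), kappa _ _ (h' _ _ x) = phi _ _ x) ->
              forall J I (x : D J I), h' _ _ x = h _ _ x.

(* Q = F(s^-1 C) with the differential induced by the decompositions of C *)
Definition is_cobar (K : fieldType) (C : codioperad K) (Q : dgdioperad K)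
    (iota : bimod_hom (shift (-1) C) Q) : Prop :=
  is_free iota
  /\ forall (J I : finType) (c : C J I),
       diff (iota J I c)
       = desuspended_dec (fun J I (x : C J I) => iota J I x) c.

(* In the labels bool, [false] is first and [true] second. *)
Section Relations.
Variables (K : fieldType) (D : dioperad K).
Variables (l : D unit bool) (d : 'I_2 -> D bool unit).

Let only (u : unit) : option void := None.
Let first (b : bool) : option unit := if b then Some tt else None.
Let second (b : bool) : option unit := if b then None else Some tt.

Definition ell_ell (a b c : 'I_3) : D unit 'I_3 :=
  act (fun _ : void + unit => tt)
    (fun u : bool + unit =>
       match u with inl false => a | inl true => b | inr _ => c end)
    (comp (act only id l) (act id first l)).

Definition delta_delta (x y : 'I_2) (a b c : 'I_3) : D 'I_3 unit :=
  act (fun u : unit + bool =>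
         match u with inl _ => c | inr false => a | inr true => b end)
    (fun _ : unit + void => tt)
    (comp (act first id (d x)) (act id only (d y))).

Definition delta_ell (x : 'I_2) : D bool bool :=
  act (@unvoidl bool) (@unvoidr bool)
    (comp (act only id l) (act id only (d x))).

Definition cross (x : 'I_2) (i j k m : bool) : D bool bool :=
  act (fun u : unit + unit => match u with inl _ => k | inr _ => m end)
    (fun u : unit + unit => match u with inl _ => i | inr _ => j end)
    (comp (act second id (d x)) (act id first l)).

Let i1 : 'I_3 := inord 0.
Let i2 : 'I_3 := inord 1.
Let i3 : 'I_3 := inord 2.

Definition lie12bi_relations : Prop :=
  [/\ ell_ell i1 i2 i3 + ell_ell i2 i3 i1 + ell_ell i3 i1 i2 = 0,
      forall x, delta_delta x x i1 i2 i3 + delta_delta x x i2 i3 i1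
                + delta_delta x x i3 i1 i2 = 0,
      (delta_delta 0 1 i1 i2 i3 + delta_delta 1 0 i1 i2 i3)
      + (delta_delta 0 1 i2 i3 i1 + delta_delta 1 0 i2 i3 i1)
      + (delta_delta 0 1 i3 i1 i2 + delta_delta 1 0 i3 i1 i2) = 0 &
      forall x, delta_ell x
                - cross x false true false true - cross x true false false true
                + cross x false true true false + cross x true false true false
                = 0].

End Relations.

Record lie12bi_generators (K : fieldType) := Lie12BiGenerators {
  gens :> bimodule K;
  ell : gens unit bool;
  delta : 'I_2 -> gens bool unit;
  ell_hdeg : hdeg 1 ell;
  delta_hdeg : forall x, hdeg 0 (delta x);
  ell_sym : act id negb ell = ell;
  delta_skew : forall x, act negb id (delta x) = - delta x;
  ell_basis : forall u : gens unit bool, exists! a : K, u = a *: ell;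
  delta_basis : forall u : gens bool unit,
    exists! a : K * K, u = a.1 *: delta 0 + a.2 *: delta 1;
  gens_zero : forall (J I : finType) (u : gens J I),
    (#|J|, #|I|) \notin [:: (1%N, 2%N); (2%N, 1%N)] -> u = 0
}.

(* P = F(M) / (R) *)
Record lie12bi (K : fieldType) := Lie12Bi {
  lb_gens : lie12bi_generators K;
  lb_dio :> dioperad K;
  lb_incl : bimod_hom lb_gens lb_dio;
  lb_relations : lie12bi_relations (lb_incl _ _ (ell lb_gens))
                   (fun x => lb_incl _ _ (delta lb_gens x));
  lb_universal : forall (D : dioperad K) (g : bimod_hom lb_gens D),
    lie12bi_relations (g _ _ (ell lb_gens)) (fun x => g _ _ (delta lb_gens x)) ->
    exists h : dioperad_hom lb_dio D,
      (forall J I (e : lb_gens J I), h _ _ (lb_incl _ _ e) = g _ _ e)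
      /\ forall h' : dioperad_hom lb_dio D,
           (forall J I (e : lb_gens J I), h' _ _ (lb_incl _ _ e) = g _ _ e) ->
           forall J I (x : lb_dio J I), h' _ _ x = h _ _ x
}.

(* The cobar construction on the Koszul dual codioperad, with its
   quasi-isomorphism to P.  Minimality is visible in [is_cobar]: the
   differential of a generator is a sum of graphs with two vertices. *)
Record koszul_resolution (K : fieldType) (P : lie12bi K) := KoszulResolution {
  kr_dual : codioperad K;
  kr_kappa : bimod_hom kr_dual (shift 1 (lb_gens P));
  kr_koszul_dual : is_koszul_dual (lb_incl P) kr_kappa;
  kr_dg :> dgdioperad K;
  kr_iota : bimod_hom (shift (-1) kr_dual) kr_dg;
  kr_cobar : is_cobar kr_iota;
  kr_aug : dg_hom kr_dg (dg0 P);
  kr_aug_iota : forall (J I : finType) (c : kr_dual J I),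
    kr_aug J I (kr_iota J I c) = lb_incl P J I (kr_kappa J I c);
  kr_quasi_iso : quasi_iso kr_aug
}.

(* End_W for W = K^n in degree 0.  A basis of the tensor power of W indexed by
   I is given by the maps I -> 'I_n, and an element of Hom(W^(x)I, W^(x)J) is
   its matrix v |-> (coefficient of v.1 in the image of v.2). *)
Section Endomorphisms.
Variables (K : fieldType) (n : nat).

Definition hom_tensor (J I : finType) : lmodType K :=
  {ffun {ffun J -> 'I_n} * {ffun I -> 'I_n} -> K^o}.

Implicit Types J I : finType.

Definition end_hdeg J I (p : int) (x : hom_tensor J I) : Prop :=
  p = 0 \/ x = 0.

Definition end_act J J' I I' (f : J -> J') (g : I -> I')
    (x : hom_tensor J I) : hom_tensor J' I' :=
  [ffun v : {ffun J' -> 'I_n} * {ffun I' -> 'I_n} =>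
     x ([ffun j => v.1 (f j)], [ffun i => v.2 (g i)])].

Definition ocons (A : finType) (s : 'I_n) (h : A -> 'I_n) :
    {ffun option A -> 'I_n} :=
  [ffun o => if o is Some a then h a else s].

Definition end_comp J1 I1 J2 I2
    (x : hom_tensor (option J1) I1) (y : hom_tensor J2 (option I2)) :
    hom_tensor (J1 + J2)%type (I1 + I2)%type :=
  [ffun v : {ffun J1 + J2 -> 'I_n} * {ffun I1 + I2 -> 'I_n} =>
     \sum_(s < n)
       (x (ocons s (fun j => v.1 (inl j)), [ffun i => v.2 (inl i)]) : K)
       * y ([ffun j => v.1 (inr j)], ocons s (fun i => v.2 (inr i)))].

Definition end_unit : hom_tensor (option void) (option void) :=
  [ffun v : {ffun option void -> 'I_n} * {ffun option void -> 'I_n} =>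
     (v.1 None == v.2 None)%:R].

Lemma end_grading J I : grading (@end_hdeg J I).
Proof.
split.
- by move=> p; right.
- move=> p a x y [->|->]; first by left.
  by case=> [->|->]; [left|right; rewrite scaler0 addr0].
- move=> x; exists [:: 0], (fun p => if p == 0 then x else 0); split.
    by move=> p; case: eqP => [->|_]; [left|right].
  by rewrite big_seq1 eqxx.
- move=> s f us hf s0 p ps.
  have f0 q : q != 0 -> f q = 0 by case: (hf q) => [->|//]; rewrite eqxx.
  have [p0|/f0//] := eqVneq p 0.
  by move: s0; rewrite (bigD1_seq p) //= big1 ?addr0 // => q; rewrite p0; apply: f0.
Qed.

Lemma end_act_linear J J' I I' (f : J -> J') (g : I -> I') :
  bijective f -> bijective g -> linear (@end_act J J' I I' f g).
Proof. by move=> _ _ a x y; apply/ffunP => v; rewrite !ffunE. Qed.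

Lemma end_act_hdeg J J' I I' (f : J -> J') (g : I -> I') p x :
  bijective f -> bijective g -> end_hdeg p x -> end_hdeg p (end_act f g x).
Proof.
move=> _ _ [->|->]; [by left|right].
by apply/ffunP => v; rewrite !ffunE.
Qed.

Lemma end_act_id J I (x : hom_tensor J I) : end_act id id x = x.
Proof.
apply/ffunP => -[u v]; rewrite ffunE /=.
by congr (x (_, _)); apply/ffunP => i; rewrite ffunE.
Qed.

Lemma end_act_comp J J' J'' I I' I'' (f : J -> J') (f' : J' -> J'')
    (g : I -> I') (g' : I' -> I'') (x : hom_tensor J I) :
  bijective f -> bijective f' -> bijective g -> bijective g' ->
  end_act f' g' (end_act f g x) = end_act (f' \o f) (g' \o g) x.
Proof.
move=> _ _ _ _; apply/ffunP => -[u v]; rewrite !ffunE /=.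
by congr (x (_, _)); apply/ffunP => i; rewrite !ffunE.
Qed.

Local Ltac ffun_ext :=
  apply/ffunP; do 4?[case]; intros; rewrite !ffunE /= ?ffunE //= ?ffunE.

Definition end_bimodule : bimodule K := {|
  sp := hom_tensor; hdeg := end_hdeg; hdeg_grading := end_grading;
  act := end_act; act_linear := end_act_linear; act_hdeg := end_act_hdeg;
  act_id := end_act_id; act_comp := end_act_comp
|}.

Lemma end_comp_linearl J1 I1 J2 I2 (y : hom_tensor J2 (option I2)) :
  linear (fun x : hom_tensor (option J1) I1 => end_comp x y).
Proof.
move=> a x x'; apply/ffunP => v; rewrite !ffunE scaler_sumr -big_split /=.
by apply: eq_bigr => s _; rewrite !ffunE mulrDl; congr (_ + _); exact: (esym (mulrA _ _ _)).
Qed.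

Lemma end_comp_linearr J1 I1 J2 I2 (x : hom_tensor (option J1) I1) :
  linear (fun y : hom_tensor J2 (option I2) => end_comp x y).
Proof.
move=> a y y'; apply/ffunP => v; rewrite !ffunE scaler_sumr -big_split /=.
by apply: eq_bigr => s _; rewrite !ffunE mulrDr; congr (_ + _); exact: mulrCA.
Qed.

Lemma end_comp_hdeg J1 I1 J2 I2 (x : hom_tensor (option J1) I1)
    (y : hom_tensor J2 (option I2)) p q :
  end_hdeg p x -> end_hdeg q y -> end_hdeg (p + q) (end_comp x y).
Proof.
case=> [->|->]; last first.
  by right; apply/ffunP => v; rewrite !ffunE big1 // => s _; rewrite ffunE mul0r.
case=> [->|->]; first by left; rewrite addr0.
by right; apply/ffunP => v; rewrite !ffunE big1 // => s _; rewrite ffunE mulr0.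
Qed.

Lemma end_comp_act J1 J1' I1 I1' J2 J2' I2 I2' (f1 : J1 -> J1')
    (g1 : I1 -> I1') (f2 : J2 -> J2') (g2 : I2 -> I2')
    (x : hom_tensor (option J1) I1) (y : hom_tensor J2 (option I2)) :
  bijective f1 -> bijective g1 -> bijective f2 -> bijective g2 ->
  end_comp (end_act (omap f1) g1 x) (end_act f2 (omap g2) y)
  = end_act (sumf f1 f2) (sumf g1 g2) (end_comp x y).
Proof.
move=> _ _ _ _; apply/ffunP => -[u v]; rewrite !ffunE /=.
apply: eq_bigr => s _; rewrite !ffunE /=.
by congr (x (_, _) * y (_, _)); ffun_ext.
Qed.

Lemma end_unit_hdeg : end_hdeg 0 end_unit.
Proof. by left. Qed.

Lemma end_unit_compl J I (y : hom_tensor J (option I)) :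
  end_act (@unvoidl J) (@unoptl I) (end_comp end_unit y) = y.
Proof.
apply/ffunP => -[u v]; rewrite !ffunE /= (bigD1 (v None)) //= big1 => [|s sv].
  rewrite !ffunE eqxx mul1r addr0.
  by congr (y (_, _)); ffun_ext.
by rewrite !ffunE /= (negPf sv) mul0r.
Qed.

Lemma end_unit_compr J I (x : hom_tensor (option J) I) :
  end_act (@unoptr J) (@unvoidr I) (end_comp x end_unit) = x.
Proof.
apply/ffunP => -[u v]; rewrite !ffunE /= (bigD1 (u None)) //= big1 => [|s sv].
  rewrite !ffunE eqxx mulr1 addr0.
  by congr (x (_, _)); ffun_ext.
by rewrite !ffunE /= eq_sym (negPf sv) mulr0.
Qed.

Lemma end_comp_chain J1 I1 J2 I2 J3 I3 (x : hom_tensor (option J1) I1)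
    (y : hom_tensor (option J2) (option I2)) (z : hom_tensor J3 (option I3)) :
  end_act (@sumA J1 J2 J3) (@sumA I1 I2 I3)
    (end_comp (end_act (@optr J1 J2) id (end_comp x y)) z)
  = end_comp x (end_act id (@optl I2 I3) (end_comp y z)).
Proof.
apply/ffunP => -[u v]; rewrite !ffunE /=.
under eq_bigr => s _ do rewrite !ffunE mulr_suml.
under [RHS]eq_bigr => s _ do rewrite !ffunE mulr_sumr.
rewrite exchange_big /=; apply: eq_bigr => s _; apply: eq_bigr => t _.
rewrite mulrA.
by congr (x (_, _) * y (_, _) * z (_, _)); ffun_ext.
Qed.

Lemma end_comp_below J1 I1 J2 I2 J3 I3
    (x : hom_tensor (option (option J1)) I1) (y : hom_tensor J2 (option I2))
    (z : hom_tensor J3 (option I3)) q r :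
  end_hdeg q y -> end_hdeg r z ->
  end_act (@sumAC J1 J2 J3) (@sumAC I1 I2 I3)
    (end_comp (end_act (@optl J1 J2) id (end_comp x y)) z)
  = ksgn K (q * r) *:
    end_comp (end_act (@optl J1 J3) id
      (end_comp (end_act (@swapo J1) id x) z)) y.
Proof.
move=> hy hz; suff E : end_act (@sumAC J1 J2 J3) (@sumAC I1 I2 I3)
    (end_comp (end_act (@optl J1 J2) id (end_comp x y)) z)
  = end_comp (end_act (@optl J1 J3) id
      (end_comp (end_act (@swapo J1) id x) z)) y.
  case: hy hz => [->|y0] hz; first by rewrite mul0r /ksgn expr0z scale1r.
  rewrite E; suff -> : end_comp (end_act (@optl J1 J3) id
      (end_comp (end_act (@swapo J1) id x) z)) y = 0 by rewrite scaler0.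
  by apply/ffunP => v; rewrite !ffunE big1 // => s _; rewrite y0 !ffunE mulr0.
apply/ffunP => -[u v]; rewrite !ffunE /=.
under eq_bigr => s _ do rewrite !ffunE mulr_suml.
under [RHS]eq_bigr => s _ do rewrite !ffunE mulr_suml.
rewrite exchange_big /=; apply: eq_bigr => s _; apply: eq_bigr => t _.
rewrite !ffunE mulrAC.
by congr (x (_, _) * z (_, _) * y (_, _)); ffun_ext.
Qed.

Lemma end_comp_above J1 I1 J2 I2 J3 I3 (x : hom_tensor (option J1) I1)
    (y : hom_tensor (option J2) I2)
    (z : hom_tensor J3 (option (option I3))) p q :
  end_hdeg p x -> end_hdeg q y ->
  end_act (@sumCA J1 J2 J3) (@sumCA I1 I2 I3)
    (end_comp x (end_act id (@optr I2 I3) (end_comp y z)))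
  = ksgn K (p * q) *:
    end_comp y (end_act id (@optr I1 I3)
      (end_comp x (end_act id (@swapo I3) z))).
Proof.
move=> hx hy; suff E : end_act (@sumCA J1 J2 J3) (@sumCA I1 I2 I3)
    (end_comp x (end_act id (@optr I2 I3) (end_comp y z)))
  = end_comp y (end_act id (@optr I1 I3)
      (end_comp x (end_act id (@swapo I3) z))).
  case: hy hx => [->|y0] hx; first by rewrite mulr0 /ksgn expr0z scale1r.
  rewrite E; suff -> : end_comp y (end_act id (@optr I1 I3)
      (end_comp x (end_act id (@swapo I3) z))) = 0 by rewrite scaler0.
  by apply/ffunP => v; rewrite !ffunE big1 // => s _; rewrite y0 !ffunE mul0r.
apply/ffunP => -[u v]; rewrite !ffunE /=.
under eq_bigr => s _ do rewrite !ffunE mulr_sumr.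
under [RHS]eq_bigr => s _ do rewrite !ffunE mulr_sumr.
rewrite exchange_big /=; apply: eq_bigr => s _; apply: eq_bigr => t _.
rewrite !ffunE mulrCA.
by congr (y (_, _) * (x (_, _) * z (_, _))); ffun_ext.
Qed.

Definition end_dioperad : dioperad K := {|
  dio_mod := end_bimodule;
  comp := end_comp : forall J1 I1 J2 I2 : finType,
    end_bimodule (option J1) I1 -> end_bimodule J2 (option I2) ->
    end_bimodule (J1 + J2)%type (I1 + I2)%type;
  dunit := end_unit : end_bimodule (option void) (option void);
  comp_linearl := end_comp_linearl; comp_linearr := end_comp_linearr;
  comp_hdeg := end_comp_hdeg; comp_act := end_comp_act;
  dunit_hdeg := end_unit_hdeg;
  dunit_compl := end_unit_compl; dunit_compr := end_unit_compr;
  comp_chain := end_comp_chain; comp_below := end_comp_below;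
  comp_above := end_comp_above
|}.

End Endomorphisms.

(* representations of Q in K^n *)
Definition representation (K : fieldType) (Q : dgdioperad K) (n : nat) : Type :=
  dg_hom Q (dg0 (end_dioperad K n)).

(* A formal power series in t^1, ..., t^n, as the family of its coefficients;
   series are compared coefficientwise. *)
Section FormalPoisson.
Variables (K : fieldType) (n : nat).

Definition series : Type := {ffun 'I_n -> nat} -> K.

Definition mul_series (f g : series) : series := fun m =>
  \sum_(b : {dffun forall i : 'I_n, 'I_(m i).+1})
    f [ffun i => b i : nat] * g [ffun i => (m i - b i)%N].

Definition deriv_series (l : 'I_n) (f : series) : series := fun m =>
  (m l).+1%:R * f [ffun i => (m i + (i == l))%N].

Definition const_coef (f : series) : K := f [ffun=> 0%N].

(* The formal bivector field (1/2) sum_ij G i j d_i /\ d_j *)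
Record bivector := Bivector {
  bv_coef :> 'I_n -> 'I_n -> series;
  bv_skew : forall i j m, bv_coef i j m = - bv_coef j i m
}.

Definition schouten_term (G H : bivector) (i j k : 'I_n) : series := fun m =>
  \sum_(l < n) (mul_series (G l i) (deriv_series l (H j k)) m
                + mul_series (H l i) (deriv_series l (G j k)) m).

(* The coefficients of the Schouten bracket [G, H], up to a universal nonzero
   factor. *)
Definition schouten (G H : bivector) (i j k : 'I_n) : series := fun m =>
  schouten_term G H i j k m + schouten_term G H j k i m
  + schouten_term G H k i j m.

Definition schouten_commute (G H : bivector) : Prop :=
  forall i j k m, schouten G H i j k m = 0.

Record bihamiltonian := BiHamiltonian {
  bh_bv :> 'I_2 -> bivector;
  bh_11 : schouten_commute (bh_bv 0) (bh_bv 0);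
  bh_12 : schouten_commute (bh_bv 0) (bh_bv 1);
  bh_22 : schouten_commute (bh_bv 1) (bh_bv 1)
}.

Definition vanishes_at_origin (G : bihamiltonian) : Prop :=
  forall x i j, const_coef (G x i j) = 0.

Definition bihamiltonian0 : Type := {G : bihamiltonian | vanishes_at_origin G}.

(* The Taylor coefficient d_(a 0) ... d_(a (k - 1)) f at the origin *)
Definition taylor (f : series) (k : nat) (a : 'I_k -> 'I_n) : K :=
  const_coef (foldr (fun s g => deriv_series (a s) g) f (enum 'I_k)).

End FormalPoisson.

(* For each k, [c 0 k] and [c 1 k] form a basis of E(2, k + 1), identified with
   that of the Koszul dual codioperad; for k = 0 they lie over delta_1 and
   delta_2. *)
Definition generators_2_k (K : fieldType) (P : lie12bi K)
    (Q : koszul_resolution P)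
    (c : 'I_2 -> forall k : nat, kr_dual Q bool 'I_k.+1) : Prop :=
  (forall x, act id (fun _ : 'I_1 => tt) (kr_kappa Q _ _ (c x 0%N))
             = delta (lb_gens P) x)
  /\ forall (k : nat) (u : kr_dual Q bool 'I_k.+1),
       exists! a : K * K, u = a.1 *: c 0 k + a.2 *: c 1 k.

(* The Taylor coefficients of G are the components of rho: the (i, j)
   component of rho(c x k)(e_(a 0), ..., e_(a k)) is
   d_(a 0) ... d_(a k) G_x^(ij) at the origin. *)
Definition taylor_components (K : fieldType) (P : lie12bi K)
    (Q : koszul_resolution P)
    (c : 'I_2 -> forall k : nat, kr_dual Q bool 'I_k.+1) (n : nat)
    (rho : representation Q n) (G : bihamiltonian0 K n) : Prop :=
  forall (x : 'I_2) (k : nat) (i j : 'I_n) (a : {ffun 'I_k.+1 -> 'I_n}),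
    taylor (sval G x i j) a
    = (rho bool 'I_k.+1 (kr_iota Q _ _ (c x k)) : hom_tensor K n bool 'I_k.+1)
        ([ffun o : bool => if o then j else i], a).

(* Main.v *)
(* The Koszul dual codioperad C has an explicit model.  For m, n >= 1 and
   m + n >= 3 its component with m outputs and n inputs lies in degree 1 - m and
   has a basis ev 0, ..., ev (m - 1), on which relabelings act by the sign of the
   permutation of the outputs; up to sign, ev t decomposes along every two-vertex
   tree into the sum of the ev k (x) ev l with k + l = t.  So t counts the
   occurrences of delta_2.

   The model satisfies the corelations, hence maps to C, and this map is
   bijective by induction on the arity.  An element of C with vanishing
   decompositions and vanishing projection to the cogenerators is zero, by the
   uniqueness half of the universal property; so it suffices that the
   coefficients of ev k (x) ev l in the decompositions of an element of C depend
   only on k + l.  With two vertices this says that the relations of P are the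
   only ones, which is seen in a test dioperad where they can be evaluated; with
   three or more vertices it follows from coassociativity along chains.

   A representation on a space in degree 0 only sees the generators with two
   outputs, two for each number of inputs, symmetric in the inputs and skew in
   the outputs: these are the Taylor coefficients of two bivector fields vanishing
   at the origin.  Compatibility with the differential is a condition for each
   ev t with three outputs, t = 0, 1, 2, and by the Leibniz rule the three
   conditions are the vanishing of the Taylor coefficients of [G1, G1], [G1, G2]
   and [G2, G2]. *)

Require Import Defs.
From HB Require Import structures.
From mathcomp Require Import all_boot all_order all_algebra.
From mathcomp Require Import perm boolp reals.
From mathcomp Require Import zify ring.
Import Defs.

Set Implicit Arguments.
Unset Strict Implicit.
Unset Printing Implicit Defensive.

Import Order.TTheory GRing.Theory Num.Theory.
Local Open Scope ring_scope.

(** * Enumeration order and inversions *)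

(** [P], its resolution and the dual codioperad [C] are given by universal properties only, so
    elements of [C] cannot be written down beforehand and linear independence in [P] cannot be read
    off from a normal form. The first obstacle is met by mapping codioperads into [C]: the model, to
    obtain the comparison map, and the elements of one degree without decompositions and projection,
    to force them to vanish. The second is met by mapping [P] to a dioperad with explicit
    coordinates on two-vertex composites. All composites of three vertices may be set to zero there,
    so that only a unit has to be adjoined.

    The signs follow one rule: after suspension each output counts as odd and each input as even.
    The decomposition in the model carries exactly the sign that desuspension introduces, so the
    signs drop out of suitably normalized coefficients.

    Besides the factorials in Taylor coefficients, the only integer to be inverted is 2: it appears
    in the coordinates of the test dioperad, and in the bracket of a bivector field with itself. *)

Lemma enum_sumE (A B : finType) :
  enum {: A + B} = [seq inl a | a <- enum A] ++ [seq inr b | b <- enum B].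
Proof. by rewrite !enumT {1}unlock /= /sum_enum. Qed.

Lemma enum_optionE (A : finType) :
  enum {: option A} = None :: [seq Some a | a <- enum A].
Proof. by rewrite !enumT {1}unlock. Qed.

(* All Koszul signs refer to the order in which a finite type is enumerated; in
   [bool], [true] comes first. *)
Definition rlt (J : finType) (a b : J) : bool :=
  (index a (enum J) < index b (enum J))%N.

Lemma index_inl (A B : finType) (a : A) :
  index (inl a : A + B) (enum {: A + B}) = index a (enum A).
Proof.
by rewrite enum_sumE index_cat (mem_map (@inl_inj A B)) mem_enum inE
  (index_map (@inl_inj A B)).
Qed.

Lemma index_inr (A B : finType) (b : B) :
  index (inr b : A + B) (enum {: A + B}) = (#|A| + index b (enum B))%N.
Proof.
rewrite enum_sumE index_cat (index_map (@inr_inj A B)) size_map -cardE.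
by case: ifP => // /mapP[].
Qed.

Lemma rlt_inl (A B : finType) (a b : A) :
  rlt (inl a : A + B) (inl b) = rlt a b.
Proof. by rewrite /rlt !index_inl. Qed.

Lemma rlt_inr (A B : finType) (a b : B) :
  rlt (inr a : A + B) (inr b) = rlt a b.
Proof. by rewrite /rlt !index_inr ltn_add2l. Qed.

Lemma rlt_inlr (A B : finType) (a : A) (b : B) :
  rlt (inl a : A + B) (inr b).
Proof.
rewrite /rlt index_inl index_inr ltn_addr // cardE.
by rewrite index_mem mem_enum.
Qed.

Lemma rlt_total (J : finType) (a b : J) : a != b -> rlt b a = ~~ rlt a b.
Proof.
move=> ab; rewrite /rlt -leqNgt [RHS]leq_eqVlt; case: eqP => // e.
by case/negP: ab; apply/eqP; apply: (@index_inj _ a (enum J)); rewrite ?mem_enum.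
Qed.

Lemma rlt2N (J : finType) (a b : J) : rlt a b && rlt b a = false.
Proof.
by case: (eqVneq a b) => [->|/rlt_total->]; rewrite ?andbN // andbb /rlt ltnn.
Qed.

Lemma rlt_irr (J : finType) (a : J) : rlt a a = false.
Proof. by rewrite /rlt ltnn. Qed.

Lemma rlt_inrl (A B : finType) (a : A) (b : B) :
  rlt (inr b : A + B) (inl a) = false.
Proof. by rewrite rlt_total ?rlt_inlr. Qed.

Lemma rlt_Some (A : finType) (a b : A) : rlt (Some a) (Some b) = rlt a b.
Proof. by rewrite /rlt enum_optionE /= ltnS !index_map //; move=> ? ? []. Qed.

Lemma rlt_None (A : finType) (a : A) : rlt None (Some a).
Proof. by rewrite /rlt enum_optionE. Qed.

Lemma rlt_SomeN (A : finType) (a : A) : rlt (Some a) None = false.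
Proof. by rewrite /rlt enum_optionE. Qed.

Lemma enum_boolE : enum {: bool} = [:: true; false].
Proof. by rewrite enumT unlock. Qed.

Lemma rlt_bool (a b : bool) : rlt a b = a && ~~ b.
Proof. by rewrite /rlt enum_boolE; case: a; case: b. Qed.

Definition rltE := (rlt_inl, rlt_inr, rlt_inlr, rlt_inrl, rlt_Some, rlt_None,
  rlt_SomeN, rlt_irr, rlt_bool).

Lemma big_option (R : Type) (idx : R) (op : Monoid.law idx) (A : finType)
    (F : option A -> R) :
  \big[op/idx]_o F o = op (F None) (\big[op/idx]_a F (Some a)).
Proof.
have enumE (T : finType) : index_enum T = enum T by rewrite enumT [index_enum T]unlock.
by rewrite enumE enum_optionE big_cons big_map enumE.
Qed.

Section Inversions.
Implicit Types A B C J : finType.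

(** Source and target may differ, since relabelings such as [sumAC] change the type. For a bijection
    the parity of [ninv] is its sign relative to the two enumerations. *)
Definition ninv A B (f : A -> B) : nat :=
  \sum_a \sum_b (rlt a b && rlt (f b) (f a)).

Lemma ninv_sum A B C (f : A + B -> C) :
  ninv f = (ninv (f \o inl) + ninv (f \o inr)
           + \sum_a \sum_b rlt (f (inr b)) (f (inl a)))%N.
Proof.
rewrite /ninv big_sumType /= addnAC; congr addn.
  rewrite -big_split; apply: eq_bigr => a _; rewrite big_sumType /=.
  by congr addn; apply: eq_bigr => b _; rewrite !rltE.
apply: eq_bigr => a _; rewrite big_sumType /= big1 => [|b _]; last by rewrite !rltE.
by rewrite add0n; apply: eq_bigr => b _; rewrite !rltE.
Qed.

Lemma ninv_option A C (f : option A -> C) :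
  ninv f = (ninv (f \o Some) + \sum_a rlt (f (Some a)) (f None))%N.
Proof.
rewrite /ninv big_option [RHS]addnC; congr addn.
by rewrite big_option /= rltE add0n; apply: eq_bigr => b _; rewrite !rltE.
apply: eq_bigr => a _; rewrite big_option /= !rltE add0n.
by apply: eq_bigr => b _; rewrite !rltE.
Qed.

Lemma ninv_mono A B (f : A -> B) : {mono f : a b / rlt a b} -> ninv f = 0%N.
Proof.
move=> h; rewrite /ninv big1 // => a _; rewrite big1 // => b _; rewrite h.
by case: (eqVneq a b) => [->|/rlt_total->]; rewrite ?rltE ?andbN.
Qed.

Lemma ninv_id A : ninv (@id A) = 0%N.
Proof. exact: ninv_mono. Qed.

Lemma ninv_comp_mono A B C (f : A -> B) (g : B -> C) :
  {mono g : a b / rlt a b} -> ninv (g \o f) = ninv f.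
Proof. by move=> h; apply: eq_bigr => a _; apply: eq_bigr => b _; rewrite /= h. Qed.

Lemma ninv_sumf (A A' B B' : finType) (f : A -> A') (g : B -> B') :
  ninv (sumf f g) = (ninv f + ninv g)%N.
Proof.
rewrite ninv_sum [X in (_ + X)%N]big1 => [|a _]; last first.
  by rewrite big1 // => b _; rewrite /= rltE.
rewrite addn0 (_ : _ \o inl = inl \o f) // (_ : _ \o inr = inr \o g) //.
by rewrite (ninv_comp_mono f (@rlt_inl A' B')) (ninv_comp_mono g (@rlt_inr A' B')).
Qed.

Lemma ninv_omap (A A' : finType) (f : A -> A') : ninv (omap f) = ninv f.
Proof.
rewrite ninv_option [X in (_ + X)%N]big1 => [|a _]; last by rewrite /= rltE.
by rewrite addn0 (_ : _ \o Some = Some \o f) // (ninv_comp_mono f (@rlt_Some A')).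
Qed.

Lemma ninv_sumA A B C : ninv (@sumA A B C) = 0%N.
Proof. by apply: ninv_mono => -[[a|b]|c] [[a'|b']|c']; rewrite /= !rltE. Qed.

Lemma ninv_optlV A B : ninv (@optlV A B) = 0%N.
Proof. by apply: ninv_mono => -[[a|b]|] [[a'|b']|]; rewrite /= !rltE. Qed.

Lemma ninv_inr (A : finType) : ninv (@inr void A) = 0%N.
Proof. by apply: ninv_mono => a b; rewrite !rltE. Qed.

(** [None] is enumerated first in [option (A + B)], while its image stands after all of [A] in
    [A + option B]: it crosses exactly the elements of [A]. *)
Lemma ninv_optrV A B : ninv (@optrV A B) = #|A|.
Proof.
rewrite ninv_option ninv_mono; last by move=> -[a|b] [a'|b']; rewrite /= !rltE.
rewrite big_sumType /= [X in (_ + (_ + X))%N]big1 => [|b _]; last by rewrite !rltE.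
by under eq_bigr do rewrite rltE; rewrite sum1_card addn0.
Qed.

(** Only the blocks [B] and [C] are exchanged, and every pair across them is inverted. *)
Lemma ninv_sumAC A B C : ninv (@sumAC A B C) = (#|B| * #|C|)%N.
Proof.
rewrite ninv_sum ninv_mono; last by move=> -[a|b] [a'|b']; rewrite /= !rltE.
rewrite ninv_mono; last by move=> c c'; rewrite /= !rltE.
rewrite big_sumType /= big1 => [|a _]; last by rewrite big1 // => c _; rewrite !rltE.
under eq_bigr do under eq_bigr do rewrite rltE.
by rewrite sum_nat_const sum1_card.
Qed.

Lemma ninv_sumCA A B C : ninv (@sumCA A B C) = (#|A| * #|B|)%N.
Proof.
rewrite ninv_sum ninv_mono; last by move=> a a'; rewrite /= !rltE.
rewrite ninv_mono; last by move=> -[b|c] [b'|c']; rewrite /= !rltE.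
under eq_bigr => a _.
  rewrite big_sumType /= [X in (_ + X)%N]big1 => [|b _]; last by rewrite !rltE.
  under eq_bigr do rewrite rltE.
  over.
by rewrite /= sum1_card !addn0 sum_nat_const.
Qed.

Lemma ninv_swapo A : ninv (@swapo A) = 1%N.
Proof.
rewrite ninv_option ninv_option ninv_mono; last by move=> a a'; rewrite /= !rltE.
rewrite big_option /= rltE !big1 // => a _; by rewrite /= !rltE.
Qed.

(** Whether [g] reverses a pair depends only on the unordered pair, so the parity of [ninv g] can be
    counted over the images under [f] of pairs in the source. For each such pair the reversals by
    [f] and by [g] add up modulo 2. *)
Lemma ninv_comp A B C (f : A -> B) (g : B -> C) : bijective f -> injective g ->
  odd (ninv (g \o f)) = odd (ninv f) (+) odd (ninv g).
Proof.
case=> f' fK f'K ginj.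
have finj := can_inj fK.
pose P (D : finType) (F : D -> D -> bool) :=
  \big[addb/false]_(p : D * D | rlt p.1 p.2) F p.1 p.2.
have oddE (D E : finType) (h : D -> E) : odd (ninv h) = P _ (fun a b => rlt (h b) (h a)).
  rewrite /ninv pair_bigA /= (big_morph odd oddD (erefl _)) /P big_mkcond /=.
  rewrite [RHS]big_mkcond /=; apply: eq_bigr => -[a b] _ /=.
  by rewrite oddb; case: (rlt a b).
pose F c d := rlt (g d) (g c) (+) rlt d c.
have Fsym c d : F c d = F d c.
  rewrite /F; case: (eqVneq c d) => [->//|cd].
  rewrite (rlt_total cd) (@rlt_total _ (g c) (g d)) ?addbN ?addNb ?negbK //.
  by rewrite (inj_eq ginj).
(* Unordered pairs are represented by their increasing ordering; the reindexing map sorts the image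
   of a pair under [f]. *)
have PF : P _ F = P _ (fun a b => F (f a) (f b)).
  rewrite /P (reindex_onto
    (fun p : A * A => if rlt (f p.1) (f p.2) then (f p.1, f p.2) else (f p.2, f p.1))
    (fun q : B * B => if rlt (f' q.1) (f' q.2) then (f' q.1, f' q.2) else (f' q.2, f' q.1))) /=; last first.
    move=> [c d] /= cd; case: (boolP (rlt (f' c) (f' d))) => h; rewrite /= !f'K ?cd //.
    by move: cd; case: (eqVneq c d) => [->|/rlt_total->]; rewrite ?rltE // => ->.
  have aux (a b : A) : rlt a b -> a != b by apply: contraTneq => ->; rewrite rltE.
  apply: eq_big => [[a b] /=|[a b] /=].
    case: (boolP (rlt (f a) (f b))) => /= h; rewrite !fK.
      rewrite h; case: ifP => /= ab; first by rewrite eqxx.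
      by apply/eqP => -[ba _]; rewrite ba rltE in h.
    case: (eqVneq a b) => [->|ab]; first by rewrite !rltE.
    rewrite (rlt_total (a := f a)) ?(inj_eq finj) // h (rlt_total ab).
    case: ifP => /= ba; rewrite ?(negbTE ba) ?eqxx //.
      by apply/eqP => -[e _]; rewrite e eqxx in ab.
    by move/negbFE: ba.
  by case: ifP => //= _ _; rewrite Fsym.
rewrite !oddE.
have -> : P _ (fun a b => rlt (g b) (g a)) = P _ F.
  apply: eq_bigr => -[c d] /= cd; rewrite /F.
  by have := rlt2N c d; rewrite cd /= => ->; rewrite addbF.
rewrite PF /P -big_split /=; apply: eq_bigr => -[a b] /= _.
by rewrite /F addbC addbK.
Qed.

End Inversions.

(** * The model of the Koszul dual codioperad *)

Section Sign.
Variable K : fieldType.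

Definition osg (A B : finType) (f : A -> B) : K := (-1) ^+ ninv f.

Lemma osg_comp (A B C : finType) (f : A -> B) (g : B -> C) :
  bijective f -> injective g -> osg (g \o f) = osg f * osg g.
Proof.
by move=> bf ig; rewrite /osg -signr_odd ninv_comp // signr_addb !signr_odd.
Qed.

Lemma osgK (A B : finType) (f : A -> B) : osg f * osg f = 1.
Proof. by rewrite /osg -exprMn mulrNN mulr1 expr1n. Qed.

Lemma osg_neq0 (A B : finType) (f : A -> B) : osg f != 0.
Proof. by rewrite /osg signr_eq0. Qed.

Lemma osg_id (A : finType) : osg (@id A) = 1.
Proof. by rewrite /osg ninv_id. Qed.

Lemma osg_omap (A B : finType) (f : A -> B) : osg (omap f) = osg f.
Proof. by rewrite /osg ninv_omap. Qed.

Lemma osg_sumf (A B A' B' : finType) (f : A -> A') (g : B -> B') :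
  osg (sumf f g) = osg f * osg g.
Proof. by rewrite /osg ninv_sumf exprD. Qed.

Lemma ksgn0 : ksgn K 0 = 1. Proof. exact: expr0z. Qed.

Lemma ksgnD p q : ksgn K (p + q) = ksgn K p * ksgn K q.
Proof. by rewrite /ksgn expfzDr // oppr_eq0 oner_eq0. Qed.

Lemma ksgn_nat (n : nat) : ksgn K n%:Z = (-1) ^+ n.
Proof. by []. Qed.

Lemma ksgnK p : ksgn K p * ksgn K p = 1.
Proof. by rewrite /ksgn -expfzMl mulrNN mulr1 exp1rz. Qed.

Lemma ksgnN p : ksgn K (- p) = ksgn K p.
Proof.
have h := ksgnK p.
by rewrite -[LHS]mulr1 -h mulrA -ksgnD addNr ksgn0 mul1r.
Qed.

Lemma conc_grading (V : lmodType K) (d : int) :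
  grading (fun (p : int) (x : V) => p = d \/ x = 0).
Proof.
split.
- by move=> p; right.
- move=> p a x y [->|->]; first by left.
  by case=> [->|->]; [left|right; rewrite scaler0 addr0].
- move=> x; exists [:: d], (fun p => if p == d then x else 0); split.
    by move=> p; case: eqP => [->|_]; [left|right].
  by rewrite big_seq1 eqxx.
- move=> s f us hf s0 p ps.
  have f0 q : q != d -> f q = 0 by case: (hf q) => [->|//]; rewrite eqxx.
  have [p0|/f0//] := eqVneq p d.
  by move: s0; rewrite (bigD1_seq p) //= big1 ?addr0 // => q; rewrite p0; apply: f0.
Qed.

End Sign.

Section Model.
Variable K : fieldType.
Implicit Types J I : finType.

Definition stable J I := [&& (1 <= #|J|), (1 <= #|I|) & (3 <= #|J| + #|I|)]%N.

Definition dm J I := if stable J I then #|J| else 0%N.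

Definition msp J I : lmodType K := {ffun 'I_(dm J I) -> K^o}.

(** Coefficients are indexed by all natural numbers, with value 0 past the end, so that indices of
    different components can be added without casts between ordinals. *)
Definition cf (d : nat) (u : {ffun 'I_d -> K^o}) (k : nat) : K :=
  oapp u 0 (insub k).

Lemma cfE d (u : {ffun 'I_d -> K^o}) (i : 'I_d) : cf u i = u i.
Proof. by rewrite /cf valK. Qed.

Lemma cf_out d (u : {ffun 'I_d -> K^o}) k : (d <= k)%N -> cf u k = 0.
Proof. by move=> h; rewrite /cf insubN // -leqNgt. Qed.

Lemma cfP d (u v : {ffun 'I_d -> K^o}) :
  (forall k, (k < d)%N -> cf u k = cf v k) -> u = v.
Proof. by move=> h; apply/ffunP => i; rewrite -!cfE h. Qed.

Lemma cf_linear d (a : K) (u v : {ffun 'I_d -> K^o}) k :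
  cf (a *: u + v) k = a * cf u k + cf v k.
Proof.
rewrite /cf; case: insub => [i|] /=; first by rewrite !ffunE.
by rewrite mulr0 addr0.
Qed.

Lemma cf_ffun d (F : nat -> K) k :
  cf ([ffun i : 'I_d => F i] : {ffun 'I_d -> K^o}) k = if (k < d)%N then F k else 0.
Proof.
case: ltnP => h; last exact: cf_out.
by rewrite (cfE _ (Ordinal h)) ffunE.
Qed.

Definition ev d (k : nat) : {ffun 'I_d -> K^o} := [ffun i : 'I_d => (val i == k)%:R : K].

Lemma cf_ev d k l : (l < d)%N -> cf (ev d k) l = (l == k)%:R.
Proof. by move=> h; rewrite (cf_ffun _ (fun i => (i == k)%:R)) h. Qed.

Lemma ev_sum d (u : {ffun 'I_d -> K^o}) : u = \sum_(k < d) cf u k *: ev d k.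
Proof.
apply/ffunP => i; rewrite sum_ffunE (bigD1 i) //= big1 => [|j ji]; last first.
  have ji' : (val i == val j) = false by apply/negbTE; rewrite eq_sym.
  by rewrite !ffunE ji'; exact: mulr0.
by rewrite !ffunE cfE eqxx addr0; exact/esym/mulr1.
Qed.

(** After suspension [ell] has degree 0 and [delta x] degree -1. Grafting uses up one output, and 1
    - m is additive under it. *)
Definition mdeg J : int := 1 - #|J|%:Z.

Definition mact J J' I I' (f : J -> J') (g : I -> I') (u : msp J I) : msp J' I' :=
  [ffun i : 'I_(dm J' I') => osg K f * cf u i].

Lemma dm_bij J J' I I' (f : J -> J') (g : I -> I') :
  bijective f -> bijective g -> dm J' I' = dm J I.
Proof. by move=> bf bg; rewrite /dm /stable (bij_eq_card bf) (bij_eq_card bg). Qed.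

Lemma cf_act J J' I I' (f : J -> J') (g : I -> I') (u : msp J I) k :
  bijective f -> bijective g -> cf (mact f g u) k = osg K f * cf u k.
Proof.
move=> bf bg; rewrite (cf_ffun _ (fun i => osg K f * cf u i)).
by case: ltnP => //; rewrite (dm_bij bf bg) => h; rewrite cf_out ?mulr0.
Qed.

Lemma mact_linear J J' I I' (f : J -> J') (g : I -> I') :
  bijective f -> bijective g -> linear (mact f g).
Proof.
move=> _ _ a x y; apply/ffunP => i; rewrite !ffunE cf_linear mulrDr.
by congr (_ + _); exact: mulrCA.
Qed.

Lemma mact_hdeg J J' I I' (f : J -> J') (g : I -> I') (p : int) (x : msp J I) :
  bijective f -> bijective g -> p = mdeg J \/ x = 0 -> p = mdeg J' \/ mact f g x = 0.
Proof.
move=> bf _ [->|->]; first by left; rewrite /mdeg (bij_eq_card bf).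
by right; apply/ffunP => i; rewrite !ffunE /cf; case: insub => [j|] /=; rewrite ?ffunE mulr0.
Qed.

Lemma mact_id J I (x : msp J I) : mact id id x = x.
Proof. by apply/ffunP => i; rewrite !ffunE osg_id mul1r cfE. Qed.

Lemma mact_comp J J' J'' I I' I'' (f : J -> J') (f' : J' -> J'')
    (g : I -> I') (g' : I' -> I'') (x : msp J I) :
  bijective f -> bijective f' -> bijective g -> bijective g' ->
  mact f' g' (mact f g x) = mact (f' \o f) (g' \o g) x.
Proof.
move=> bf bf' bg bg'; apply/ffunP => i; rewrite [LHS]ffunE [RHS]ffunE cf_act //.
by rewrite osg_comp ?mulrA 1?[osg K f' * _]mulrC //; exact: bij_inj.
Qed.

Definition model_bimodule : bimodule K := {|
  sp := msp; hdeg := fun J I p x => p = mdeg J \/ x = 0;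
  hdeg_grading := fun J I => conc_grading _ _;
  act := mact; act_linear := mact_linear; act_hdeg := mact_hdeg;
  act_id := mact_id; act_comp := mact_comp
|}.

(** The recorded degree is that of a component with outputs [option J1], and [(-1) ^+ #|J1|] is the
    corresponding [ksgn], so that it cancels against the sign in [desuspended_dec]. *)
Definition mdec (J1 I1 J2 I2 : finType) (u : msp (J1 + J2)%type (I1 + I2)%type) :
    seq (int * msp (option J1) I1 * msp J2 (option I2)) :=
  [seq (- #|J1|%:Z, ev _ a, ((-1) ^+ #|J1| * cf u (a + b)) *: ev _ b)
     | a <- iota 0 (dm (option J1) I1), b <- iota 0 (dm J2 (option I2))].

Lemma mdecE (J1 I1 J2 I2 : finType) (u : msp (J1 + J2)%type (I1 + I2)%type)
    (V : lmodType K) (F : int -> msp (option J1) I1 -> msp J2 (option I2) -> V) :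
  sweedler (mdec u) F = \sum_(a < dm (option J1) I1) \sum_(b < dm J2 (option I2))
    F (- #|J1|%:Z) (ev _ a) (((-1) ^+ #|J1| * cf u (a + b)) *: ev _ b).
Proof.
rewrite /sweedler /mdec big_allpairs_dep /=.
have iotaE n : iota 0 n = index_iota 0 n by rewrite /index_iota subn0.
rewrite iotaE big_mkord; apply: eq_bigr => a _.
by rewrite iotaE big_mkord.
Qed.

(** The largest indices are [#|J1|] above and [#|J2| - 1] below: their sum is the largest index of
    the composite, so no pair of basis vectors points outside the basis. *)
Lemma dm_comp J1 I1 J2 I2 (a b : nat) :
  (a < dm (option J1) I1)%N -> (b < dm J2 (option I2))%N ->
  (a + b < dm (J1 + J2)%type (I1 + I2)%type)%N.
Proof.
rewrite /dm /stable !card_sum !card_option.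
by do 2 (case: ifP => // /and3P[? ? ?]); case: ifP; lia.
Qed.

End Model.

(** * Scalar-valued and linear maps given by unbundled hypotheses *)

Section Forms.
Variable K : fieldType.

Section Scalar.
Variables (A : lmodType K) (f : A -> K).
Hypothesis hf : scalar f.

Lemma scalar0 : f 0 = 0.
Proof. by have := hf (-1) 0 0; rewrite scaler0 addr0 mulN1r addNr. Qed.

Lemma scalarZ a x : f (a *: x) = a * f x.
Proof. by have := hf a x 0; rewrite scalar0 !addr0. Qed.

Lemma scalarD x y : f (x + y) = f x + f y.
Proof. by have := hf 1 x y; rewrite scale1r mul1r. Qed.

Lemma scalar_sum (T : Type) (r : seq T) (F : T -> A) :
  f (\sum_(i <- r) F i) = \sum_(i <- r) f (F i).
Proof. exact: (big_morph f scalarD scalar0). Qed.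
End Scalar.

Section Linear.
Variables (A B : lmodType K) (f : A -> B).
Hypothesis hf : linear f.

Lemma lin0 : f 0 = 0.
Proof. by have := hf (-1) 0 0; rewrite scaler0 addr0 scaleN1r addNr. Qed.

Lemma linZ a x : f (a *: x) = a *: f x.
Proof. by have := hf a x 0; rewrite lin0 !addr0. Qed.

Lemma linD x y : f (x + y) = f x + f y.
Proof. by have := hf 1 x y; rewrite !scale1r. Qed.

Lemma linN x : f (- x) = - f x.
Proof. by rewrite -scaleN1r linZ scaleN1r. Qed.

Lemma linB x y : f (x - y) = f x - f y.
Proof. by rewrite linD linN. Qed.

Lemma lin_sum (T : Type) (r : seq T) (P : pred T) (F : T -> A) :
  f (\sum_(i <- r | P i) F i) = \sum_(i <- r | P i) f (F i).
Proof. exact: (big_morph f linD lin0). Qed.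
End Linear.

Lemma scalar_sumf (A : lmodType K) (T : Type) (r : seq T) (F : T -> A -> K) :
  (forall i, scalar (F i)) -> scalar (fun x => \sum_(i <- r) F i x).
Proof.
move=> h a x y; rewrite mulr_sumr -big_split; apply: eq_bigr => i _; exact: h.
Qed.

Lemma scalar_mul (A : lmodType K) (c : K) (f : A -> K) :
  scalar f -> scalar (fun x => c * f x).
Proof. by move=> h a x y; rewrite h mulrDr mulrCA. Qed.
End Forms.

Lemma eq_bign (V : nmodType) (m n : nat) (F G : nat -> V) : m = n ->
  (forall i, (i < m)%N -> F i = G i) ->
  \sum_(0 <= i < m) F i = \sum_(0 <= i < n) G i.
Proof. by move=> <- h; apply: eq_big_nat => i /andP[_ /h]. Qed.

Lemma sign_eq (K : fieldType) m n : odd m = odd n -> (-1) ^+ m = (-1) ^+ n :> K.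
Proof. by move=> h; rewrite -signr_odd h signr_odd. Qed.

(** * The codioperad axioms for the model *)

Section ModelCodioperad.
Variable K : fieldType.
Implicit Types J I : finType.
Local Notation msp := (@msp K).
Local Notation ev := (@ev K).
Local Notation osg := (@osg K).

Lemma mdecT (J1 I1 J2 I2 : finType) (u : msp (J1 + J2)%type (I1 + I2)%type)
    (T : msp (option J1) I1 -> msp J2 (option I2) -> K) : bilinear_form T ->
  sweedler (mdec u) (fun _ x y => T x y : K^o) =
  \sum_(0 <= a < dm (option J1) I1) \sum_(0 <= b < dm J2 (option I2))
    (-1) ^+ #|J1| * cf u (a + b) * T (ev _ a) (ev _ b).
Proof.
case=> _ hT; rewrite mdecE big_mkord; apply: eq_bigr => a _.
rewrite big_mkord; apply: eq_bigr => b _; exact: (scalarZ (hT _)).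
Qed.

(** All terms of [mdec] record the same degree, so a form that depends on the degree, as in the
    axioms with Koszul signs, has to be bilinear for that degree only. *)
Lemma mdecTp (J1 I1 J2 I2 : finType) (u : msp (J1 + J2)%type (I1 + I2)%type)
    (T : int -> msp (option J1) I1 -> msp J2 (option I2) -> K) :
  bilinear_form (T (- #|J1|%:Z)) ->
  sweedler (mdec u) (fun p x y => T p x y : K^o) =
  \sum_(0 <= a < dm (option J1) I1) \sum_(0 <= b < dm J2 (option I2))
    (-1) ^+ #|J1| * cf u (a + b) * T (- #|J1|%:Z) (ev _ a) (ev _ b).
Proof. by move=> hT; rewrite -(mdecT _ hT) !mdecE. Qed.

Lemma mact_ev J J' I I' (f : J -> J') (g : I -> I') k :
  bijective f -> bijective g ->
  mact f g (ev (dm J I) k) = osg f *: ev (dm J' I') k :> msp J' I'.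
Proof.
move=> bf bg; apply: cfP => i hi; rewrite (@cf_act _ _ _ _ _ f g) //.
rewrite -[_ *: _]addr0 cf_linear (cf_ffun _ (fun=> 0)) hi addr0.
by rewrite !cf_ev // -?(dm_bij bf bg).
Qed.

Lemma mdec_linear (J1 I1 J2 I2 : finType)
    (T : msp (option J1) I1 -> msp J2 (option I2) -> K) : bilinear_form T ->
  scalar (fun c => sweedler (mdec c) (fun _ x y => T x y : K^o)).
Proof.
move=> hT c x y; rewrite !mdecT // mulr_sumr -big_split; apply: eq_bigr => a _ /=.
rewrite mulr_sumr -big_split; apply: eq_bigr => b _ /=; rewrite cf_linear; ring.
Qed.

Lemma sumf_bij (A A' B B' : Type) (f : A -> A') (g : B -> B') :
  bijective f -> bijective g -> bijective (sumf f g).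
Proof.
move=> [f' h1 h2] [g' h3 h4]; exists (sumf f' g') => -[a|b] /=;
  by rewrite ?h1 ?h2 ?h3 ?h4.
Qed.

Lemma omap_bij (A A' : Type) (f : A -> A') : bijective f -> bijective (omap f).
Proof.
by move=> [f' h1 h2]; exists (omap f') => -[a|] //=; rewrite ?h1 ?h2.
Qed.

Lemma act_bilinear (M : bimodule K) J1 J1' I1 I1' J2 J2' I2 I2'
    (f1 : J1 -> J1') (g1 : I1 -> I1') (f2 : J2 -> J2') (g2 : I2 -> I2')
    (T : M J1' I1' -> M J2' I2' -> K) :
  bijective f1 -> bijective g1 -> bijective f2 -> bijective g2 ->
  bilinear_form T -> bilinear_form (fun x y => T (act f1 g1 x) (act f2 g2 y)).
Proof.
move=> b1 b2 b3 b4 [h1 h2]; split=> [y|x] a u v /=.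
  by rewrite (act_linear b1 b2) h1.
by rewrite (act_linear b3 b4) h2.
Qed.

Lemma mdec_act (J1 J1' I1 I1' J2 J2' I2 I2' : finType)
    (f1 : J1 -> J1') (g1 : I1 -> I1') (f2 : J2 -> J2') (g2 : I2 -> I2')
    (T : msp (option J1') I1' -> msp J2' (option I2') -> K)
    (c : msp (J1 + J2)%type (I1 + I2)%type) :
    bijective f1 -> bijective g1 -> bijective f2 -> bijective g2 ->
    bilinear_form T ->
    sweedler (mdec (mact (sumf f1 f2) (sumf g1 g2) c))
      (fun _ x y => T x y : K^o)
    = sweedler (mdec c)
      (fun _ x y => T (mact (omap f1) g1 x) (mact f2 (omap g2) y) : K^o).
Proof.
move=> b1 b2 b3 b4 hT.
have hT' := @act_bilinear (model_bimodule K) _ _ _ _ _ _ _ _ (omap f1) g1 f2 (omap g2) T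
  (omap_bij b1) b2 b3 (omap_bij b4) hT.
rewrite (mdecT _ hT) (mdecT _ hT').
apply: eq_bign => [|a ha]; first exact: dm_bij (omap_bij b1) b2.
apply: eq_bign => [|b hb]; first exact: dm_bij b3 (omap_bij b4).
rewrite (cf_act _ _ (sumf_bij b1 b3) (sumf_bij b2 b4)) -(bij_eq_card b1).
case: hT => h1 h2; rewrite /= !mact_ev //; try exact: omap_bij.
rewrite (scalarZ (h1 _)) (scalarZ (h2 _)) osg_sumf osg_omap; ring.
Qed.

Lemma big_nat_eq (d k : nat) (F : nat -> K) : (k < d)%N ->
  \sum_(0 <= a < d) (k == a)%:R * F a = F k.
Proof.
move=> h; rewrite big_mkord (bigD1 (Ordinal h)) //= eqxx mul1r big1 ?addr0 // => i hi.
by rewrite eq_sym -val_eqE /= in hi *; rewrite (negbTE hi) mul0r.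
Qed.

Section Triple.
Variables (J1 I1 J2 I2 J3 I3 : finType).

Lemma collapse_aux (s u s' e t : K) :
  s * u * (s' * e * t) = e * (s * s' * u * t).
Proof. by ring. Qed.

(** The inner decomposition of a basis vector of index [a] contributes only when [a] is [x + y]; the
    hypothesis puts that index in range, so the sum over [a] collapses to one term. Here the upper
    factor is decomposed again, in [collapse2] the lower one. *)
Lemma collapse1 (d12 d1 d2 d3 : nat) (s s' : K) (u : nat -> K) (T : nat -> nat -> nat -> K) :
  (forall x y, x < d1 -> y < d2 -> x + y < d12)%N ->
  \sum_(0 <= a < d12) \sum_(0 <= c < d3) s * u (a + c)%N *
    (\sum_(0 <= x < d1) \sum_(0 <= y < d2) s' * (x + y == a)%N%:R * T x y c)
  = \sum_(0 <= x < d1) \sum_(0 <= y < d2) \sum_(0 <= c < d3)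
      s * s' * u (x + y + c)%N * T x y c.
Proof.
move=> h; rewrite exchange_big /=; under eq_bigr => c _.
  under eq_bigr => a _.
    rewrite mulr_sumr; under eq_bigr => x _ do rewrite mulr_sumr.
    over.
  rewrite exchange_big /=; under eq_bigr => x _ do rewrite exchange_big /=.
  over.
rewrite exchange_big /=; apply: eq_big_nat => x /andP[_ hx].
rewrite exchange_big /=; apply: eq_big_nat => y /andP[_ hy]; apply: eq_bigr => c _.
under eq_bigr => a _ do rewrite collapse_aux.
by rewrite (big_nat_eq (fun a => s * s' * u (a + c)%N * T x y c)) //; exact: h.
Qed.

Lemma collapse2 (d23 d1 d2 d3 : nat) (s s' : K) (u : nat -> K) (T : nat -> nat -> nat -> K) :
  (forall x y, x < d2 -> y < d3 -> x + y < d23)%N ->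
  \sum_(0 <= x < d1) \sum_(0 <= a < d23) s * u (x + a)%N *
    (\sum_(0 <= y < d2) \sum_(0 <= c < d3) s' * (y + c == a)%N%:R * T x y c)
  = \sum_(0 <= x < d1) \sum_(0 <= y < d2) \sum_(0 <= c < d3)
      s * s' * u (x + y + c)%N * T x y c.
Proof.
move=> h; apply: eq_big_nat => x /andP[_ hx].
under eq_bigr => a _.
  rewrite mulr_sumr; under eq_bigr => y _ do rewrite mulr_sumr.
  over.
rewrite exchange_big /=; apply: eq_big_nat => y /andP[_ hy].
rewrite exchange_big /=; apply: eq_big_nat => c /andP[_ hc].
under eq_bigr => a _ do rewrite collapse_aux.
by rewrite (big_nat_eq (fun a => s * s' * u (x + a)%N * T x y c)) ?addnA //; exact: h.
Qed.

Lemma cf_act_ev (J I J' I' : finType) (f : J -> J') (g : I -> I') a k :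
  bijective f -> bijective g -> (k < dm J I)%N ->
  cf (mact f g (ev (dm J I) a)) k = osg f * (k == a)%:R.
Proof. by move=> bf bg hk; rewrite cf_act // cf_ev. Qed.

Lemma bilinear_decl (A1 B1 A2 B2 J I : finType) (f : J -> (A1 + A2)%type)
    (g : I -> (B1 + B2)%type) (V : lmodType K)
    (T : msp (option A1) B1 -> msp A2 (option B2) -> V -> K) :
  bijective f -> bijective g -> trilinear_form T ->
  bilinear_form (fun (u : msp J I) z =>
    sweedler (mdec (mact f g u)) (fun _ x y => T x y z : K^o)).
Proof.
move=> bf bg [h1 h2 h3]; split=> [z a u v|u].
  rewrite (mact_linear bf bg).
  by apply: (mdec_linear (T := fun x y => T x y z)); split=> *; [apply: h1|apply: h2].
by apply: scalar_sumf => t; apply: h3.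
Qed.

Lemma bilinear_decr (A1 B1 A2 B2 J I : finType) (f : J -> (A1 + A2)%type)
    (g : I -> (B1 + B2)%type) (V : lmodType K)
    (T : V -> msp (option A1) B1 -> msp A2 (option B2) -> K) :
  bijective f -> bijective g -> trilinear_form T ->
  bilinear_form (fun z (u : msp J I) =>
    sweedler (mdec (mact f g u)) (fun _ x y => T z x y : K^o)).
Proof.
move=> bf bg [h1 h2 h3]; split=> [u|z a u v].
  by apply: scalar_sumf => t; apply: h1.
rewrite (mact_linear bf bg).
by apply: (mdec_linear (T := T z)); split=> *; [apply: h2|apply: h3].
Qed.

Lemma dm_gt0 J I : (0 < dm J I)%N = stable J I.
Proof. by rewrite /dm; case: ifP => // /and3P[]. Qed.

Lemma id_bij (A : Type) : bijective (@id A). Proof. by exists id. Qed.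
Lemma optrV_bij (A B : Type) : bijective (@optrV A B).
Proof. by exists (@optr A B) => [[[a|b]|]|[a|[b|]]]. Qed.
Lemma optlV_bij (A B : Type) : bijective (@optlV A B).
Proof. by exists (@optl A B) => [[[a|b]|]|[[a|]|b]]. Qed.
Lemma optr_bij (A B : Type) : bijective (@optr A B).
Proof. by exists (@optrV A B) => [[a|[b|]]|[[a|b]|]]. Qed.
Lemma optl_bij (A B : Type) : bijective (@optl A B).
Proof. by exists (@optlV A B) => [[[a|]|b]|[[a|b]|]]. Qed.
Lemma sumA_bij (A B C : Type) : bijective (@sumA A B C).
Proof.
exists (fun u : A + (B + C) => match u with
  | inl a => inl (inl a) | inr (inl b) => inl (inr b) | inr (inr c) => inr c end);
  by [case=> [[]|]|case=> [|[]]].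
Qed.
Lemma sumAC_bij (A B C : Type) : bijective (@sumAC A B C).
Proof. by exists (@sumAC A C B) => [[[]|]|[[]|]]. Qed.
Lemma sumCA_bij (A B C : Type) : bijective (@sumCA A B C).
Proof. by exists (@sumCA B A C) => [[|[]]|[|[]]]. Qed.
Lemma swapo_bij (A : Type) : bijective (@swapo A).
Proof. by exists (@swapo A) => [[[]|]|[[]|]]. Qed.

#[local] Hint Resolve id_bij optrV_bij optlV_bij optr_bij optl_bij sumA_bij sumAC_bij
  sumCA_bij swapo_bij : core.

(** Both sides have coefficient [cf c (x + y + z)] and sign [(-1) ^+ (#|J1| + #|J2|)]. On the left
    the mark of the lower edge crosses [J1] under [optrV], which compensates the sign of the inner
    decomposition. *)
Lemma mdec_chain 
    (T : msp (option J1) I1 -> msp (option J2) (option I2) ->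
         msp J3 (option I3) -> K)
    (c : msp ((J1 + J2) + J3)%type ((I1 + I2) + I3)%type) :
    trilinear_form T ->
    sweedler (mdec c) (fun _ u z =>
      sweedler (mdec (mact (@optrV J1 J2) id u)) (fun _ x y => T x y z : K^o))
    = sweedler (mdec (mact (@sumA J1 J2 J3) (@sumA I1 I2 I3) c)) (fun _ x v =>
      sweedler (mdec (mact id (@optlV I2 I3) v)) (fun _ y z => T x y z : K^o)).
Proof.
move=> hT.
rewrite (mdecT _ (bilinear_decl (optrV_bij J1 J2) (id_bij _) hT)).
rewrite (mdecT _ (bilinear_decr (id_bij _) (optlV_bij I2 I3) hT)).
have hl z : bilinear_form (fun x y => T x y z).
  by case: hT => h1 h2 h3; split=> *; [apply: h1|apply: h2].
have hr x : bilinear_form (T x).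
  by case: hT => h1 h2 h3; split=> *; [apply: h2|apply: h3].
transitivity (\sum_(0 <= x < dm (option J1) I1) \sum_(0 <= y < dm (option J2) (option I2))
   \sum_(0 <= z < dm J3 (option I3))
     (-1) ^+ #|{: J1 + J2}| * ((-1) ^+ #|J1| * osg (@optrV J1 J2)) * cf c (x + y + z) * T (ev _ x) (ev _ y) (ev _ z)).
  rewrite -(@collapse1 (dm (option (J1 + J2)) (I1 + I2)%type)); last first.
    move=> x y hx hy; rewrite -(dm_bij (optrV_bij J1 J2) (id_bij _)); exact: dm_comp.
  apply: eq_bigr => a _; apply: eq_bigr => z _; congr (_ * _).
  rewrite (mdecT _ (hl _)).
  apply: eq_big_nat => x /andP[_ hx]; apply: eq_big_nat => y /andP[_ hy].
  by rewrite (cf_act_ev _ (optrV_bij J1 J2) (id_bij _)) ?mulrA // -(dm_bij (optrV_bij J1 J2) (id_bij _)) dm_comp.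
transitivity (\sum_(0 <= x < dm (option J1) I1) \sum_(0 <= y < dm (option J2) (option I2))
   \sum_(0 <= z < dm J3 (option I3))
     (-1) ^+ #|J1| * ((-1) ^+ #|J2| * osg (@id (J2 + J3)%type)) *
    cf (mact (@sumA J1 J2 J3) (@sumA I1 I2 I3) c) (x + y + z) * T (ev _ x) (ev _ y) (ev _ z)).
  rewrite ?osg_id.
  apply: eq_bigr => x _; apply: eq_bigr => y _; apply: eq_bigr => z _.
  rewrite (cf_act _ _ (sumA_bij _ _ _) (sumA_bij _ _ _)) /osg ninv_sumA ninv_optrV card_sum exprD.
  by have := signrMK (R := K) #|J1|; move=> hs; rewrite -[RHS](mulrA _ _ (T _ _ _)) expr0; ring: (hs 1).
rewrite -(@collapse2 (dm (J2 + J3)%type (option (I2 + I3)))); last first.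
  move=> x y hx hy; rewrite -(dm_bij (id_bij _) (optlV_bij I2 I3)); exact: dm_comp.
apply: eq_bigr => x _; apply: eq_bigr => a _; congr (_ * _).
rewrite (mdecT _ (hr _)).
apply: eq_big_nat => y /andP[_ hy]; apply: eq_big_nat => z /andP[_ hz].
by rewrite (cf_act_ev _ (id_bij _) (optlV_bij I2 I3)) ?mulrA // -(dm_bij (id_bij _) (optlV_bij I2 I3)) dm_comp.
Qed.

(** Exchanging the two lower vertices, of degrees [1 - #|J2|] and [1 - #|J3|], costs their Koszul
    sign. It is balanced by [#|J2| * #|J3|] inversions of [sumAC], one of [swapo], and the different
    signs of the two outer decompositions. *)
Lemma mdec_below (T : msp (option (option J1)) I1 -> msp J2 (option I2) ->
         msp J3 (option I3) -> K)
    (c : msp ((J1 + J2) + J3)%type ((I1 + I2) + I3)%type) p :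
    trilinear_form T -> p = mdeg ((J1 + J2) + J3)%type \/ c = 0 ->
    sweedler (mdec c) (fun _ u z =>
      sweedler (mdec (mact (@optlV J1 J2) id u)) (fun _ x y => T x y z : K^o))
    = sweedler (mdec (mact (@sumAC J1 J2 J3) (@sumAC I1 I2 I3) c)) (fun q u y =>
      sweedler (mdec (mact (@optlV J1 J3) id u)) (fun r x z =>
        ksgn K ((p - q) * (q - r)) * T (mact (@swapo J1) id x) y z : K^o)).
Proof.
move=> hT hp.
have hl z : bilinear_form (fun x y => T x y z).
  by case: hT => h1 h2 h3; split=> *; [apply: h1|apply: h2].
pose T' s x z y := s * T (mact (@swapo J1) id x) y z.
have hT' s : trilinear_form (T' s).
  case: hT => h1 h2 h3; split=> *; rewrite /T'; apply: scalar_mul => //.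
  move=> a u v /=; rewrite (mact_linear (swapo_bij _) (id_bij _)); exact: h1.
have hl' s y : bilinear_form (fun x z => T' s x z y).
  by case: (hT' s) => h1 h2 h3; split=> *; [apply: h1|apply: h2].
rewrite (mdecT _ (bilinear_decl (optlV_bij J1 J2) (id_bij _) hT)).
(* The degrees in the axiom are constant: [q] is [- #|J1 + J3|] and [r] is [- #|option J1|], so the
   Koszul sign is a single scalar. *)
pose s0 := ksgn K ((p + #|{: J1 + J3}|%:Z) * (- #|{: J1 + J3}|%:Z + #|{: option J1}|%:Z)).
transitivity (\sum_(0 <= x < dm (option (option J1)) I1) \sum_(0 <= y < dm J2 (option I2))
   \sum_(0 <= z < dm J3 (option I3))
     (-1) ^+ #|{: J1 + J2}| * ((-1) ^+ #|{: option J1}| * osg (@optlV J1 J2)) * cf c (x + y + z) * T (ev _ x) (ev _ y) (ev _ z)).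
  rewrite -(@collapse1 (dm (option (J1 + J2)) (I1 + I2)%type)); last first.
    move=> x y hx hy; rewrite -(dm_bij (optlV_bij J1 J2) (id_bij _)); exact: dm_comp.
  apply: eq_bigr => a _; apply: eq_bigr => z _; congr (_ * _).
  rewrite (mdecT _ (hl _)).
  apply: eq_big_nat => x /andP[_ hx]; apply: eq_big_nat => y /andP[_ hy].
  by rewrite (cf_act_ev _ (optlV_bij J1 J2) (id_bij _)) ?mulrA // -(dm_bij (optlV_bij J1 J2) (id_bij _)) dm_comp.
transitivity (\sum_(0 <= x < dm (option (option J1)) I1) \sum_(0 <= z < dm J3 (option I3))
   \sum_(0 <= y < dm J2 (option I2))
     (-1) ^+ #|{: J1 + J3}| * ((-1) ^+ #|{: option J1}| * osg (@optlV J1 J3)) *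
    cf (mact (@sumAC J1 J2 J3) (@sumAC I1 I2 I3) c) (x + z + y) * T' s0 (ev _ x) (ev _ z) (ev _ y)).
  apply: eq_bigr => x _; rewrite exchange_big; apply: eq_bigr => z _; apply: eq_bigr => y _.
  rewrite (cf_act _ _ (sumAC_bij _ _ _) (sumAC_bij _ _ _)) /T'.
  rewrite (mact_ev _ (swapo_bij _) (id_bij _)) addnAC.
  have hl1 := (hl (ev _ z)).1 (ev _ y); rewrite (scalarZ hl1).
  (* If [c] is zero, its degree [p] is arbitrary and [s0] is unknown, but the coefficient
     vanishes. *)
  case: hp => [hp|->]; last first.
    have -> : cf (0 : msp ((J1 + J2) + J3)%type ((I1 + I2) + I3)%type) (x + z + y) = 0.
      by rewrite /cf; case: insub => //= i; rewrite ffunE.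
    by rewrite !(mulr0, mul0r).
  have -> : s0 = (-1) ^+ ((#|J2| + 1) * (#|J3| + 1)).
    rewrite -ksgn_nat /s0 hp /mdeg !card_sum card_option.
    have -> : ((1 - (#|J1| + #|J2| + #|J3|)%N%:Z + (#|J1| + #|J3|)%N%:Z)
             * (- (#|J1| + #|J3|)%N%:Z + #|J1|.+1%:Z))
      = ((#|J2| + 1) * (#|J3| + 1))%N%:Z + - ((#|J2| + #|J3|) * 2)%N%:Z by lia.
    rewrite ksgnD ksgnN !ksgn_nat -exprD; apply: sign_eq.
    by rewrite !(oddD, oddM) /= andbF addbF.
  rewrite /osg !ninv_optlV ninv_sumAC ninv_swapo !card_sum !card_option.
  set t := T _ _ _; set w := cf _ _.
  transitivity ((-1) ^+ (#|J1| + #|J2| + #|J1|.+1) * (w * t)).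
    by rewrite !exprD expr0; ring.
  transitivity ((-1) ^+ (#|J1| + #|J3| + #|J1|.+1 + #|J2| * #|J3| + (#|J2| + 1) * (#|J3| + 1) + 1) * (w * t)).
    congr (_ * _); apply: sign_eq; rewrite !(oddD, oddM) /=.
    by case: (odd #|J1|); case: (odd #|J2|); case: (odd #|J3|).
  by rewrite !exprD expr0 expr1; ring.
rewrite (@mdecTp _ _ _ _ _ (fun q u y =>
      sweedler (mdec (mact (@optlV J1 J3) id u)) (fun r x z =>
        ksgn K ((p - q) * (q - r)) * T (mact (@swapo J1) id x) y z : K^o))); last first.
  rewrite opprK.
  have -> : (fun (u : msp (option (J1 + J3))%type (I1 + I3)%type) y =>
      sweedler (mdec (mact (@optlV J1 J3) id u)) (fun r x z =>
        ksgn K ((p + #|{: J1 + J3}|%:Z) * (- #|{: J1 + J3}|%:Z - r)) * T (mact (@swapo J1) id x) y z : K^o))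
    = (fun u y => sweedler (mdec (mact (@optlV J1 J3) id u)) (fun _ x z => T' s0 x z y : K^o)).
    by apply/funext => u; apply/funext => y; rewrite !mdecE opprK.
  exact: (bilinear_decl (optlV_bij J1 J3) (id_bij _) (hT' _)).
rewrite -(@collapse1 (dm (option (J1 + J3)) (I1 + I3)%type)); last first.
  move=> x y hx hy; rewrite -(dm_bij (optlV_bij J1 J3) (id_bij _)); exact: dm_comp.
apply: eq_bigr => a _; apply: eq_bigr => y _; congr (_ * _).
rewrite (@mdecTp _ _ _ _ _ (fun r x z => ksgn K ((p - - #|{: J1 + J3}|%:Z) * (- #|{: J1 + J3}|%:Z - r)) * T (mact (@swapo J1) id x) (ev _ y) z)); last first.
  exact: hl'.
rewrite !opprK.
apply: eq_big_nat => x /andP[_ hx]; apply: eq_big_nat => z /andP[_ hz].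
by rewrite (cf_act_ev _ (optlV_bij J1 J3) (id_bij _)) ?mulrA // -(dm_bij (optlV_bij J1 J3) (id_bij _)) dm_comp.
Qed.

(** The upper vertices have degrees [- #|J1|] and [- #|J2|], so their Koszul sign is exactly the
    sign of [sumCA], which exchanges [J1] and [J2]; [swapo] acts on inputs and contributes no
    sign. *)
Lemma mdec_above (T : msp (option J1) I1 -> msp (option J2) I2 ->
         msp J3 (option (option I3)) -> K)
    (c : msp (J1 + (J2 + J3))%type (I1 + (I2 + I3))%type) :
    trilinear_form T ->
    sweedler (mdec c) (fun _ x v =>
      sweedler (mdec (mact id (@optrV I2 I3) v)) (fun _ y z => T x y z : K^o))
    = sweedler (mdec (mact (@sumCA J1 J2 J3) (@sumCA I1 I2 I3) c)) (fun q y v =>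
      sweedler (mdec (mact id (@optrV I1 I3) v)) (fun r x z =>
        ksgn K (q * r) * T x y (mact id (@swapo I3) z) : K^o)).
Proof.
move=> hT.
have hr x : bilinear_form (T x).
  by case: hT => h1 h2 h3; split=> *; [apply: h2|apply: h3].
pose T' s y x z := s * T x y (mact id (@swapo I3) z).
have hT' s : trilinear_form (T' s).
  case: hT => h1 h2 h3; split=> *; rewrite /T'; apply: scalar_mul => //.
  move=> a u v /=; rewrite (mact_linear (id_bij _) (swapo_bij _)); exact: h3.
have hr' s y : bilinear_form (T' s y).
  by case: (hT' s) => h1 h2 h3; split=> *; [apply: h2|apply: h3].
rewrite (mdecT _ (bilinear_decr (id_bij _) (optrV_bij I2 I3) hT)).
pose s0 := ksgn K (- #|J2|%:Z * - #|J1|%:Z).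
transitivity (\sum_(0 <= x < dm (option J1) I1) \sum_(0 <= y < dm (option J2) I2)
   \sum_(0 <= z < dm J3 (option (option I3)))
     (-1) ^+ #|J1| * ((-1) ^+ #|J2| * osg (@id (J2 + J3)%type)) * cf c (x + y + z) * T (ev _ x) (ev _ y) (ev _ z)).
  rewrite -(@collapse2 (dm (J2 + J3)%type (option (I2 + I3)))); last first.
    move=> x y hx hy; rewrite -(dm_bij (id_bij _) (optrV_bij I2 I3)); exact: dm_comp.
  apply: eq_bigr => x _; apply: eq_bigr => a _; congr (_ * _).
  rewrite (mdecT _ (hr _)).
  apply: eq_big_nat => y /andP[_ hy]; apply: eq_big_nat => z /andP[_ hz].
  by rewrite (cf_act_ev _ (id_bij _) (optrV_bij I2 I3)) ?mulrA // -(dm_bij (id_bij _) (optrV_bij I2 I3)) dm_comp.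
transitivity (\sum_(0 <= y < dm (option J2) I2) \sum_(0 <= x < dm (option J1) I1)
   \sum_(0 <= z < dm J3 (option (option I3)))
     (-1) ^+ #|J2| * ((-1) ^+ #|J1| * osg (@id (J1 + J3)%type)) *
    cf (mact (@sumCA J1 J2 J3) (@sumCA I1 I2 I3) c) (y + x + z) * T' s0 (ev _ y) (ev _ x) (ev _ z)).
  rewrite exchange_big; apply: eq_bigr => y _; apply: eq_bigr => x _; apply: eq_bigr => z _.
  rewrite (cf_act _ _ (sumCA_bij _ _ _) (sumCA_bij _ _ _)) /T'.
  rewrite (mact_ev _ (id_bij _) (swapo_bij _)) [(y + x)%N]addnC.
  rewrite (scalarZ ((hr _).2 _)).
  have -> : s0 = (-1) ^+ (#|J2| * #|J1|) by rewrite /s0 mulrNN.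
  rewrite /osg ninv_sumCA !ninv_id.
  set t := T _ _ _; set w := cf _ _.
  transitivity ((-1) ^+ (#|J1| + #|J2|) * (w * t)).
    by rewrite !exprD expr0; ring.
  transitivity ((-1) ^+ (#|J1| + #|J2| + #|J2| * #|J1| + #|J1| * #|J2|) * (w * t)).
    congr (_ * _); apply: sign_eq; rewrite !(oddD, oddM) /=.
    by case: (odd #|J1|); case: (odd #|J2|).
  by rewrite !exprD expr0; ring.
rewrite (@mdecTp _ _ _ _ _ (fun q y v =>
      sweedler (mdec (mact id (@optrV I1 I3) v)) (fun r x z =>
        ksgn K (q * r) * T x y (mact id (@swapo I3) z) : K^o))); last first.
  have -> : (fun y (v : msp (J1 + J3)%type (option (I1 + I3))%type) =>
      sweedler (mdec (mact id (@optrV I1 I3) v)) (fun r x z =>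
        ksgn K (- #|J2|%:Z * r) * T x y (mact id (@swapo I3) z) : K^o))
    = (fun y v => sweedler (mdec (mact id (@optrV I1 I3) v)) (fun _ x z => T' s0 y x z : K^o)).
    by apply/funext => u; apply/funext => y; rewrite !mdecE.
  exact: (bilinear_decr (id_bij _) (optrV_bij I1 I3) (hT' _)).
rewrite -(@collapse2 (dm (J1 + J3)%type (option (I1 + I3)))); last first.
  move=> x y hx hy; rewrite -(dm_bij (id_bij _) (optrV_bij I1 I3)); exact: dm_comp.
apply: eq_bigr => y _; apply: eq_bigr => a _; congr (_ * _).
rewrite (@mdecTp _ _ _ _ _ (fun r x z => ksgn K (- #|J2|%:Z * r) * T x (ev _ y) (mact id (@swapo I3) z))); last first.
  exact: hr'.
apply: eq_big_nat => x /andP[_ hx]; apply: eq_big_nat => z /andP[_ hz].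
by rewrite (cf_act_ev _ (id_bij _) (optrV_bij I1 I3)) ?mulrA // -(dm_bij (id_bij _) (optrV_bij I1 I3)) dm_comp.
Qed.
End Triple.

Lemma msp_reduced J I (c : msp J I) :
  ~~ [&& 1 <= #|J|, 1 <= #|I| & 3 <= #|J| + #|I|]%N -> c = 0.
Proof.
move=> h; apply: cfP => k hk.
by have : (0 < dm J I)%N by [exact: leq_ltn_trans hk]; rewrite dm_gt0 /stable (negbTE h).
Qed.

Lemma mdec_hdegl (J1 I1 J2 I2 : finType)
    (c : msp (J1 + J2)%type (I1 + I2)%type) t :
  t \in mdec c -> t.1.1 = mdeg (option J1) \/ t.1.2 = 0.
Proof.
move/allpairsPdep => [a [b [_ _ ->]]] /=; left.
by rewrite /mdeg card_option intS opprD addrA subrr add0r.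
Qed.

Lemma mdec_hdegr (J1 I1 J2 I2 : finType)
    (c : msp (J1 + J2)%type (I1 + I2)%type) p t :
  p = mdeg (J1 + J2)%type \/ c = 0 -> t \in mdec c ->
  p - t.1.1 = mdeg J2 \/ t.2 = 0.
Proof.
move=> hp /allpairsPdep[a [b [_ _ ->]]] /=.
case: hp => [->|->]; first by left; rewrite /mdeg card_sum PoszD opprD opprK addrA addrAC addrNK.
right; have -> : cf (0 : msp (J1 + J2)%type (I1 + I2)%type) (a + b) = 0.
  by rewrite /cf; case: insub => //= i; rewrite ffunE.
by rewrite mulr0 scale0r.
Qed.

Definition model : codioperad K :=
  @Codioperad K (model_bimodule K) (@mdec K) msp_reduced mdec_hdegl mdec_hdegr
    mdec_linear mdec_act mdec_chain mdec_below mdec_above.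

End ModelCodioperad.

(** * Subobjects and detection of zero *)

Section SubLmodule.
Variables (K : fieldType) (V : lmodType K).

(** Submodules are given by propositions; [asbool] turns them into boolean predicates, so that the
    subtype inherits the module structure. *)
Record linear_prop := LinearProp {
  lp_pred :> V -> Prop;
  lp0 : lp_pred 0;
  lpP : forall (a : K) x y, lp_pred x -> lp_pred y -> lp_pred (a *: x + y)
}.

Definition lp_mem (S : linear_prop) : {pred V} := [pred x | `[< S x >]].

Fact lp_closed S : submod_closed (lp_mem S).
Proof.
split=> [|a x y]; first by rewrite inE; apply/asboolP/lp0.
by rewrite !inE => /asboolP hx /asboolP hy; apply/asboolP/lpP.
Qed.

HB.instance Definition _ S := GRing.isSubmodClosed.Build K V (lp_mem S) (lp_closed S).

Record subl (S : linear_prop) := Subl { subl_val : V; _ : subl_val \in lp_mem S }.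
HB.instance Definition _ S := [isSub for @subl_val S].
HB.instance Definition _ S := [Choice of subl S by <:].
HB.instance Definition _ S := [SubChoice_isSubLmodule of subl S by <:].

Definition mk_subl (S : linear_prop) x (h : S x) : subl S :=
  Subl (asboolT h : x \in lp_mem S).

Lemma sublP (S : linear_prop) (x : subl S) : S (val x).
Proof. by apply/asboolP; case: x. Qed.

Lemma val_linear (S : linear_prop) (a : K) (x y : subl S) :
  val (a *: x + y) = a *: val x + val y.
Proof. exact: linearP. Qed.
End SubLmodule.

Section SubBimodule.
Variables (K : fieldType) (M : bimodule K).
Variable S : forall J I : finType, linear_prop (M J I).
Hypothesis Sact : forall (J J' I I' : finType) (f : J -> J') (g : I -> I') x,
  bijective f -> bijective g -> S J I x -> S J' I' (act f g x).
Hypothesis Sspan : forall J I x, S J I x -> exists (s : seq int) (f : int -> M J I),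
  (forall p, hdeg p (f p) /\ S J I (f p)) /\ x = \sum_(p <- s) f p.

Let sS J I : lmodType K := subl (S J I).

(** [Sspan] says that the submodule is graded: the homogeneous components can be chosen inside
    it. *)
Lemma sub_grading J I : grading (fun p (x : sS J I) => hdeg p (val x)).
Proof.
have [h0 hP _ hi] := hdeg_grading M J I; split.
- move=> p; rewrite linear0; exact: h0.
- move=> p a x y hx hy; rewrite val_linear; exact: hP.
- move=> x; have [s [f [hf e]]] := Sspan (sublP x).
  exists s, (fun p => mk_subl (hf p).2); split=> [p|]; first exact: (hf p).1.
  by apply: val_inj; rewrite e linear_sum.
- move=> s f us hf sf p ps; apply: val_inj; rewrite linear0.
  apply: (hi s (fun p => val (f p))) => //.
  by rewrite -linear_sum sf linear0.
Qed.

(* only bijective relabelings need to preserve [S] *)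
Definition sub_act (J J' I I' : finType) (f : J -> J') (g : I -> I') (x : sS J I) : sS J' I' :=
  match pselect (S J' I' (act f g (val x))) with
  | left h => mk_subl h
  | right _ => 0
  end.

Lemma val_sub_act (J J' I I' : finType) (f : J -> J') (g : I -> I') (x : sS J I) :
  bijective f -> bijective g -> val (sub_act f g x) = act f g (val x).
Proof.
move=> bf bg; rewrite /sub_act; case: pselect => // -[].
by apply: Sact => //; exact: sublP.
Qed.

Lemma sub_act_linear (J J' I I' : finType) (f : J -> J') (g : I -> I') :
  bijective f -> bijective g -> linear (@sub_act J J' I I' f g).
Proof.
move=> bf bg a x y; apply: val_inj; rewrite val_linear !val_sub_act // val_linear.
exact: act_linear.
Qed.

Lemma sub_act_hdeg (J J' I I' : finType) (f : J -> J') (g : I -> I') p (x : sS J I) :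
  bijective f -> bijective g -> hdeg p (val x) -> hdeg p (val (sub_act f g x)).
Proof. by move=> bf bg hx; rewrite val_sub_act //; exact: act_hdeg. Qed.

Lemma sub_act_id (J I : finType) (x : sS J I) : sub_act id id x = x.
Proof. by apply: val_inj; rewrite val_sub_act ?act_id //; exists id. Qed.

Lemma sub_act_comp (J J' J'' I I' I'' : finType)
    (f : J -> J') (f' : J' -> J'') (g : I -> I') (g' : I' -> I'') (x : sS J I) :
    bijective f -> bijective f' -> bijective g -> bijective g' ->
    sub_act f' g' (sub_act f g x) = sub_act (f' \o f) (g' \o g) x.
Proof.
move=> bf bf' bg bg'; apply: val_inj; rewrite !val_sub_act ?act_comp //;
  exact: bij_comp.
Qed.

Definition sub_bimodule : bimodule K := {|
  sp := sS; hdeg := fun J I p (x : sS J I) => hdeg p (val x);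
  hdeg_grading := sub_grading;
  act := sub_act; act_linear := sub_act_linear; act_hdeg := sub_act_hdeg;
  act_id := sub_act_id; act_comp := sub_act_comp
|}.

Definition sub_incl : bimod_hom sub_bimodule M :=
  @BimodHom K sub_bimodule M (fun J I (x : sS J I) => val x)
    (fun J I => @val_linear K _ (S J I)) (fun J I p x hx => hx)
    (fun J J' I I' f g x bf bg => @val_sub_act J J' I I' f g x bf bg).

End SubBimodule.

(** [split_set] matches on the proof supplied by [boolP]; generalizing over the whole [alt_spec]
    gives a case analysis in which that proof stays abstract. *)
Lemma split_setP (J : finType) (a : {set J}) (x : J) (Q : {x | x \in a} + {x | x \notin a} -> Prop) :
  (forall h : x \in a, Q (inl (exist _ x h))) ->
  (forall h : x \notin a, Q (inr (exist _ x h))) -> Q (split_set a x).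
Proof.
move=> h1 h2; suff: forall b (s : alt_spec (x \in a) (x \in a) b),
    Q (match s with AltTrue h => inl (exist _ x h) | AltFalse h => inr (exist _ x h) end) by exact.
by move=> b [].
Qed.

Lemma split_setK (J : finType) (a : {set J}) : cancel (@split_set J a) (@join J a).
Proof. by move=> x; pattern (split_set a x); apply: split_setP. Qed.

Lemma joinK (J : finType) (a : {set J}) : cancel (@join J a) (@split_set J a).
Proof.
move=> [[x hx]|[x hx]] /=; pattern (split_set a x); apply: split_setP => h.
- by rewrite (bool_irrelevance h hx).
- by case: (negP h).
- by case: (negP hx).
- by rewrite (bool_irrelevance h hx).
Qed.

Lemma join_bij (J : finType) (a : {set J}) : bijective (@join J a).
Proof. exists (@split_set J a); [exact: joinK|exact: split_setK]. Qed.

Lemma split_bij (J : finType) (a : {set J}) : bijective (@split_set J a).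
Proof. exists (@join J a); [exact: split_setK|exact: joinK]. Qed.

Section ZeroHom.
Variables (K : fieldType) (M N : bimodule K).

Definition zero_hom : bimod_hom M N :=
  @BimodHom K M N (fun J I _ => 0)
    (fun J I a x y => esym (etrans (addr0 _) (scaler0 _ a)))
    (fun J I p x _ => hdeg0 (hdeg_grading N J I) p)
    (fun J J' I I' f g x bf bg => esym (act0 N bf bg)).
End ZeroHom.

Section Detection.
Variables (K : fieldType) (M : bimodule K) (P : dioperad K) (j : bimod_hom M P).
Variables (C : codioperad K) (kappa : bimod_hom C (shift 1 M)).
Hypothesis C_dual : is_koszul_dual j kappa.

(** Vanishing is tested against all bilinear forms, because the lists [dec c] are meaningful only in
    the tensor product. All splittings are included, so that the notion is stable under
    relabeling. *)
Definition primitive (J I : finType) (c : C J I) : Prop :=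
  forall (J1 I1 J2 I2 : finType) (f : J -> (J1 + J2)%type) (g : I -> (I1 + I2)%type)
    (T : C (option J1) I1 -> C J2 (option I2) -> K),
    bijective f -> bijective g -> bilinear_form T ->
    sweedler (dec (act f g c)) (fun _ x y => T x y : K^o) = 0.

Section Fixed.
Variable p : int.

Let N (J I : finType) (c : C J I) : Prop :=
  [/\ hdeg p c, primitive c & kappa J I c = 0].

Let N0 J I : N (0 : C J I).
Proof.
split; [exact: hdeg0 (hdeg_grading _ _ _) _| |exact: lin0 (@bh_linear _ _ _ kappa J I)].
move=> J1 I1 J2 I2 f g T bf bg hT.
by rewrite (lin0 (act_linear bf bg)); exact: (scalar0 (dec_linear hT)).
Qed.

Let NP J I (a : K) (x y : C J I) : N x -> N y -> N (a *: x + y).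
Proof.
move=> [h1 h2 h3] [k1 k2 k3]; split.
- exact: hdegP (hdeg_grading _ _ _) _ _ _ _ h1 k1.
- move=> J1 I1 J2 I2 f g T bf bg hT.
  by rewrite (act_linear bf bg) (dec_linear hT) h2 // k2 // mulr0 addr0.
- by rewrite (@bh_linear _ _ _ kappa) h3 k3 scaler0 addr0.
Qed.

Let S J I := LinearProp (@N0 J I) (@NP J I).

Let Sact (J J' I I' : finType) (f : J -> J') (g : I -> I') (x : C J I) :
  bijective f -> bijective g -> S J I x -> S J' I' (act f g x).
Proof.
move=> bf bg [h1 h2 h3]; split; first exact: act_hdeg.
  move=> J1 I1 J2 I2 f' g' T bf' bg' hT.
  by rewrite act_comp //; apply: h2 => //; exact: bij_comp.
by rewrite (bh_act kappa) // h3; exact: (lin0 (act_linear (b := M) bf bg)).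
Qed.

Let Sspan J I (x : C J I) : S J I x -> exists (s : seq int) (f : int -> C J I),
  (forall p, hdeg p (f p) /\ S J I (f p)) /\ x = \sum_(p <- s) f p.
Proof.
move=> hx; exists [:: p], (fun q => if q == p then x else 0); split=> [q|].
  case: eqP => [->|_]; first by split; case: hx.
  by split; [exact: hdeg0 (hdeg_grading _ _ _) _|exact: N0].
by rewrite big_seq1 eqxx.
Qed.

Let B := sub_bimodule Sact Sspan.
Let bdec (J1 I1 J2 I2 : finType) (c : B (J1 + J2)%type (I1 + I2)%type) :
  seq (int * B (option J1) I1 * B J2 (option I2)) := [::].

Let swe0 (A A' V : lmodType K) (F : int -> A -> A' -> V) : sweedler [::] F = 0.
Proof. by rewrite /sweedler big_nil. Qed.

Definition trivial_codioperad : codioperad K.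
refine (@Codioperad K B bdec _ _ _ _ _ _ _ _); rewrite /bdec.
- move=> J I c h; apply: val_inj; rewrite linear0; exact: cod_reduced.
- by [].
- by [].
- by move=> J1 I1 J2 I2 T _ a x y; rewrite !swe0 mulr0 addr0.
- by move=> *; rewrite !swe0.
- by move=> *; rewrite !swe0.
- by move=> *; rewrite !swe0.
- by move=> *; rewrite !swe0.
Defined.

(* For fixed [p] such elements form a codioperad without decompositions, for
   which both the inclusion into [C] and the zero map lift the zero map. *)
Lemma primitive_eq0 J I (c : C J I) : hdeg p c -> primitive c -> kappa J I c = 0 -> c = 0.
Proof.
move=> h1 h2 h3.
have hN : S J I c by [].
have [_ univ] := C_dual.
pose phi : bimod_hom trivial_codioperad (shift 1 M) := zero_hom B (shift 1 M).
have phi_cor : corelations j phi.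
  move=> J' I' x; rewrite /desuspended_dec big1 // => a _; rewrite big1 // => b _.
  rewrite /sweedler /= big_nil; exact: act0 (join_bij a) (join_bij b).
have [h [_ hu]] := univ _ phi phi_cor.
have @incl : codioperad_hom trivial_codioperad C.
  refine (@CodioperadHom K trivial_codioperad C (sub_incl Sact Sspan) _).
  move=> J1 I1 J2 I2 T x hT; rewrite [RHS]big_nil.
  have [_ hp _] := sublP x.
  by have := hp J1 I1 J2 I2 id id T (id_bij _) (id_bij _) hT; rewrite act_id.
have @zer : codioperad_hom trivial_codioperad C.
  refine (@CodioperadHom K trivial_codioperad C (zero_hom B C) _).
  move=> J1 I1 J2 I2 T x hT; rewrite [RHS]big_nil; exact: (scalar0 (dec_linear hT)).
have e1 := hu incl _ J I (mk_subl hN).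
have e2 := hu zer _ J I (mk_subl hN).
rewrite -[c]/(incl J I (mk_subl hN)) e1 ?e2 -?e2 //.
- by move=> J' I' x; exact: (lin0 (@bh_linear _ _ _ kappa J' I')).
- by move=> J' I' x; have [_ _ ->] := sublP x.
Qed.
End Fixed.

End Detection.

Lemma unvoidl_bij (A : Type) : bijective (@unvoidl A).
Proof. by exists (@inr void A) => [[[]|]|]. Qed.
Lemma unvoidr_bij (A : Type) : bijective (@unvoidr A).
Proof. by exists (@inl A void) => [[|[]]|]. Qed.
Lemma unoptl_bij (A : Type) : bijective (@unoptl A).
Proof.
by exists (fun o : option A => if o is Some a then inr a else inl None) => [[[[]|]|a]|[a|]].
Qed.
Lemma unoptr_bij (A : Type) : bijective (@unoptr A).
Proof.
by exists (fun o : option A => if o is Some a then inl a else inr None) => [[a|[[]|]]|[a|]].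
Qed.

(** * Subdioperads and induction over a free dioperad *)

Section SubDioperad.
Variables (K : fieldType) (D : dioperad K).
Variable S : forall J I : finType, linear_prop (D J I).
Hypothesis Sact : forall (J J' I I' : finType) (f : J -> J') (g : I -> I') x,
  bijective f -> bijective g -> S J I x -> S J' I' (act f g x).
Hypothesis Sspan : forall J I x, S J I x -> exists (s : seq int) (f : int -> D J I),
  (forall p, hdeg p (f p) /\ S J I (f p)) /\ x = \sum_(p <- s) f p.
Hypothesis Scomp : forall (J1 I1 J2 I2 : finType) (x : D (option J1) I1) (y : D J2 (option I2)),
  S _ _ x -> S _ _ y -> S _ _ (comp x y).
Hypothesis Sunit : S _ _ (dunit D).

Let B := sub_bimodule Sact Sspan.

Definition sub_comp (J1 I1 J2 I2 : finType) (x : B (option J1) I1) (y : B J2 (option I2)) :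
    B (J1 + J2)%type (I1 + I2)%type :=
  mk_subl (Scomp (sublP x) (sublP y)).

Lemma val_comp (J1 I1 J2 I2 : finType) (x : B (option J1) I1) (y : B J2 (option I2)) :
  val (sub_comp x y) = comp (val x) (val y).
Proof. by []. Qed.

Let val_act (J J' I I' : finType) (f : J -> J') (g : I -> I') (x : B J I) :
  bijective f -> bijective g -> val (act f g x) = act f g (val x).
Proof. exact: val_sub_act. Qed.

Lemma val_scale J I (a : K) (x : B J I) : val (a *: x) = a *: val x.
Proof. exact: linearZ. Qed.

Definition sub_dioperad : dioperad K.
refine (@Dioperad K B sub_comp (mk_subl Sunit) _ _ _ _ _ _ _ _ _ _).
- by move=> *; move=> a x x'; apply: val_inj; rewrite val_linear !val_comp val_linear; exact: comp_linearl.
- by move=> *; move=> a x x'; apply: val_inj; rewrite val_linear !val_comp val_linear; exact: comp_linearr.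
- by move=> J1 I1 J2 I2 x y p q hx hy; exact: comp_hdeg.
- move=> J1 J1' I1 I1' J2 J2' I2 I2' f1 g1 f2 g2 x y b1 b2 b3 b4; apply: val_inj.
  rewrite val_act; [|exact: sumf_bij..].
  rewrite !val_comp !val_act //; try exact: omap_bij.
  exact: comp_act.
- exact: dunit_hdeg.
- move=> J I y; apply: val_inj; rewrite val_act; [|exact: unvoidl_bij|exact: unoptl_bij].
  exact: dunit_compl.
- move=> J I y; apply: val_inj; rewrite val_act; [|exact: unoptr_bij|exact: unvoidr_bij].
  exact: dunit_compr.
- move=> J1 I1 J2 I2 J3 I3 x y z; apply: val_inj.
  rewrite val_act; [|exact: sumA_bij..].
  rewrite !val_comp val_act; [|exact: optr_bij|exact: id_bij].
  rewrite val_act; [|exact: id_bij|exact: optl_bij].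
  exact: comp_chain.
- move=> J1 I1 J2 I2 J3 I3 x y z q r hy hz; apply: val_inj.
  rewrite val_act; [|exact: sumAC_bij..].
  rewrite val_scale !val_comp val_act; [|exact: optl_bij|exact: id_bij].
  rewrite val_act; [|exact: optl_bij|exact: id_bij].
  rewrite !val_comp val_act; [|exact: swapo_bij|exact: id_bij].
  exact: comp_below.
- move=> J1 I1 J2 I2 J3 I3 x y z q r hy hz; apply: val_inj.
  rewrite val_act; [|exact: sumCA_bij..].
  rewrite val_scale !val_comp val_act; [|exact: id_bij|exact: optr_bij].
  rewrite val_act; [|exact: id_bij|exact: optr_bij].
  rewrite !val_comp val_act; [|exact: id_bij|exact: swapo_bij].
  exact: comp_above.
Defined.

Definition sub_dincl : dioperad_hom sub_dioperad D :=
  @DioperadHom K sub_dioperad D (sub_incl Sact Sspan)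
    (fun _ _ _ _ _ _ => erefl) erefl.

End SubDioperad.

Definition id_hom (K : fieldType) (M : bimodule K) : bimod_hom M M :=
  @BimodHom K M M (fun _ _ x => x) (fun _ _ _ _ _ => erefl) (fun _ _ _ _ h => h)
    (fun _ _ _ _ _ _ _ _ _ => erefl).

Definition id_dhom (K : fieldType) (D : dioperad K) : dioperad_hom D D :=
  @DioperadHom K D D (id_hom D) (fun _ _ _ _ _ _ => erefl) erefl.

Definition comp_hom (K : fieldType) (M N L : bimodule K) (h' : bimod_hom N L) (h : bimod_hom M N) :
  bimod_hom M L.
refine (@BimodHom K M L (fun J I x => h' J I (h J I x)) _ _ _).
- by move=> J I a x y; rewrite !bh_linear.
- by move=> J I p x hx; do 2 apply: bh_hdeg.
- by move=> J J' I I' f g x bf bg; rewrite !bh_act.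
Defined.

Definition comp_dhom (K : fieldType) (D D' D'' : dioperad K) (h' : dioperad_hom D' D'')
    (h : dioperad_hom D D') : dioperad_hom D D''.
refine (@DioperadHom K D D'' (comp_hom h' h) _ _).
- by move=> J1 I1 J2 I2 x y /=; rewrite !dh_comp.
- by rewrite /= !dh_unit.
Defined.

(* The submodules [S] form a dioperad through which freeness factors the identity
   of [F]. *)
Lemma free_ind (K : fieldType) (E : bimodule K) (F : dioperad K) (iota : bimod_hom E F)
    (S : forall J I : finType, linear_prop (F J I)) :
  is_free iota ->
  (forall (J J' I I' : finType) (f : J -> J') (g : I -> I') x,
     bijective f -> bijective g -> S J I x -> S J' I' (act f g x)) ->
  (forall J I x, S J I x -> exists (s : seq int) (f : int -> F J I),
     (forall p, hdeg p (f p) /\ S J I (f p)) /\ x = \sum_(p <- s) f p) ->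
  (forall (J1 I1 J2 I2 : finType) (x : F (option J1) I1) (y : F J2 (option I2)),
     S _ _ x -> S _ _ y -> S _ _ (comp x y)) ->
  S _ _ (dunit F) ->
  (forall J I e, S J I (iota J I e)) ->
  forall J I x, S J I x.
Proof.
move=> hfree Sact Sspan Scomp Sunit Sgen J I x.
pose SF := sub_dioperad Sact Sspan Scomp Sunit.
have @g : bimod_hom E SF.
  refine (@BimodHom K E SF (fun J I e => mk_subl (Sgen J I e)) _ _ _).
  - by move=> ? ? a u v; apply: val_inj; rewrite val_linear; exact: bh_linear.
  - by move=> ? ? p u hu; exact: bh_hdeg.
  - move=> J1 J2 I1 I2 f g' u bf bg; apply: val_inj.
    rewrite (val_sub_act Sact) //; exact: bh_act.
have [h [hh _]] := hfree SF g.
have [h0 [_ hu]] := hfree F iota.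
have e1 := hu (id_dhom F) (fun _ _ _ => erefl) J I x.
have e2 := hu (comp_dhom (sub_dincl Sact Sspan Scomp Sunit) h) _ J I x.
rewrite -[x]/(id_dhom F J I x) e1 -e2; first exact: sublP.
by move=> J' I' e /=; rewrite hh.
Qed.

Lemma eq_act (K : fieldType) (M : bimodule K) (J J' I I' : finType)
    (f f' : J -> J') (g g' : I -> I') (x : M J I) :
  f =1 f' -> g =1 g' -> act f g x = act f' g' x.
Proof. by move=> /funext -> /funext ->. Qed.

(** The component depends only on the degree, so a degree repeated in the list contributes the same
    vector each time; multiplying by the multiplicity removes repetitions and makes the components
    vanish off the list. *)
Lemma span_uniq (K : fieldType) (V : lmodType K) (h : int -> V -> Prop) : grading h ->
  forall x, exists (s : seq int) (f : int -> V),
    uniq s /\ [/\ forall p, h p (f p), x = \sum_(p <- s) f p & forall p, p \notin s -> f p = 0].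
Proof.
move=> g x; have [s [f [hf ->]]] := hdeg_span g x.
exists (undup s), (fun p => f p *+ count_mem p s); split; first exact: undup_uniq.
split=> [p|| p ps].
- elim: (count_mem p s) => [|n IH]; first exact: hdeg0 g _.
  by have := hdegP g 1 (hf p) IH; rewrite scale1r mulrS.
- rewrite -big_undup_iterop_count; apply: eq_bigr => p _.
  by case: (count_mem p s).
- by rewrite mem_undup in ps; rewrite (count_memPn ps).
Qed.

(** * Unitalisation *)

(* Adjoining a unit to a composition [mu] all of whose triple composites vanish. *)
Section Unitalisation.
Variables (K : fieldType) (N : bimodule K).
Implicit Types J I : finType.
Variable mu : forall J1 I1 J2 I2 : finType, N (option J1) I1 -> N J2 (option I2) ->
  N (J1 + J2)%type (I1 + I2)%type.
Hypothesis mu_linl : forall J1 I1 J2 I2 (y : N J2 (option I2)),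
  linear (fun x : N (option J1) I1 => mu x y).
Hypothesis mu_linr : forall J1 I1 J2 I2 (x : N (option J1) I1),
  linear (fun y : N J2 (option I2) => mu x y).
Hypothesis mu_hdeg : forall J1 I1 J2 I2 (x : N (option J1) I1) (y : N J2 (option I2)) p q,
  hdeg p x -> hdeg q y -> hdeg (p + q) (mu x y).
Hypothesis mu_act : forall (J1 J1' I1 I1' J2 J2' I2 I2' : finType)
    (f1 : J1 -> J1') (g1 : I1 -> I1') (f2 : J2 -> J2') (g2 : I2 -> I2')
    (x : N (option J1) I1) (y : N J2 (option I2)),
    bijective f1 -> bijective g1 -> bijective f2 -> bijective g2 ->
    mu (act (omap f1) g1 x) (act f2 (omap g2) y)
    = act (sumf f1 f2) (sumf g1 g2) (mu x y).
Hypothesis mu_mul : forall J1 I1 J2 I2 J J3 I3 (f : (J1 + J2)%type -> option J)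
  (g : (I1 + I2)%type -> I3) I4
  (x : N (option J1) I1) (y : N J2 (option I2)) (z : N J3 (option I4)),
  bijective f -> bijective g -> mu (act f g (mu x y)) z = 0.
Hypothesis mu_mur : forall J1 I1 J2 I2 I J3 I3 (f : (J1 + J2)%type -> J3)
  (g : (I1 + I2)%type -> option I) J4
  (x : N (option J1) I1) (y : N J2 (option I2)) (z : N (option J4) I3),
  bijective f -> bijective g -> mu z (act f g (mu x y)) = 0.

(* The scalar multiples of the adjoined unit, relabeled. *)
Definition usp J I : lmodType K := {ffun 'I_((#|J| == 1%N) && (#|I| == 1%N)) -> K^o}.

Definition uv J I (u : usp J I) : K := cf u 0.

Lemma uv_eq J I (u v : usp J I) : uv u = uv v -> u = v.
Proof.
move=> h; apply: cfP => k; rewrite /uv in h.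
by case: k => [//|k] hk; rewrite !cf_out //; case: (_ && _) hk.
Qed.

Lemma uv_out J I (u : usp J I) : (#|J| == 1%N) && (#|I| == 1%N) = false -> uv u = 0.
Proof. by move=> h; rewrite /uv cf_out ?h. Qed.

Lemma uv0 J I : uv (0 : usp J I) = 0.
Proof. by rewrite /uv /cf; case: insub => [i|] //=; rewrite ffunE. Qed.

Lemma uv_linear J I (a : K) (u v : usp J I) : uv (a *: u + v) = a * uv u + uv v.
Proof. exact: cf_linear. Qed.

Lemma uv_ffun J I (c : K) : uv ([ffun=> c] : usp J I) =
  if (#|J| == 1%N) && (#|I| == 1%N) then c else 0.
Proof. by rewrite /uv (cf_ffun _ (fun=> c)); case: (_ && _). Qed.

Definition uact J J' I I' (f : J -> J') (g : I -> I') (u : usp J I) : usp J' I' :=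
  [ffun=> uv u].

Lemma uv_act J J' I I' (f : J -> J') (g : I -> I') (u : usp J I) :
  bijective f -> bijective g -> uv (uact f g u) = uv u.
Proof.
move=> bf bg; rewrite uv_ffun -(bij_eq_card bf) -(bij_eq_card bg).
by case: ifP => // h; rewrite uv_out.
Qed.

(** A unit above [n] only renames the marked input of [n] to the input of the unit. The sum over the
    one-element type [I1] names that input without a choice; [rho] is the same with the unit
    below. *)
Definition lam J1 I1 J2 I2 (u : usp (option J1) I1) (n : N J2 (option I2)) :
    N (J1 + J2)%type (I1 + I2)%type :=
  if (#|J1| == 0%N) && (#|I1| == 1%N)
  then \sum_(i : I1) uv u *: act inr (oapp inr (inl i)) n else 0.

Definition rho J1 I1 J2 I2 (n : N (option J1) I1) (u : usp J2 (option I2)) :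
    N (J1 + J2)%type (I1 + I2)%type :=
  if (#|J2| == 1%N) && (#|I2| == 0%N)
  then \sum_(j : J2) uv u *: act (oapp inl (inr j)) inl n else 0.

Definition umul J1 I1 J2 I2 (u : usp (option J1) I1) (v : usp J2 (option I2)) :
    usp (J1 + J2)%type (I1 + I2)%type :=
  [ffun=> uv u * uv v].

Lemma card1_unique (A : finType) (a b : A) : #|A| = 1%N -> b = a.
Proof. by move/eqP/fintype1P => [x hx]; rewrite (hx a) (hx b). Qed.

Lemma card0_absurd (A : finType) (a : A) : #|A| = 0%N -> False.
Proof. by move=> h; have := card0_eq h a; rewrite inE. Qed.

Lemma inr_bij0 J1 J2 : #|J1| = 0%N -> bijective (@inr J1 J2).
Proof.
move=> h; exists (fun z => match z with inl j => False_rect J2 (card0_absurd j h) | inr j => j end) => //.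
by move=> [j|//]; case: (card0_absurd j h).
Qed.

Lemma inl_bij0 J1 J2 : #|J2| = 0%N -> bijective (@inl J1 J2).
Proof.
move=> h; exists (fun z => match z with inr j => False_rect J1 (card0_absurd j h) | inl j => j end) => //.
by move=> [//|j]; case: (card0_absurd j h).
Qed.

Lemma oinr_bij I1 I2 (i : I1) : #|I1| = 1%N -> bijective (oapp inr (inl i) : option I2 -> I1 + I2)%type.
Proof.
move=> h; exists (fun z => match z with inl _ => None | inr j => Some j end) => -[] //=.
by move=> a; rewrite (card1_unique i a h).
Qed.

Lemma oinl_bij J1 J2 (j : J2) : #|J2| = 1%N -> bijective (oapp inl (inr j) : option J1 -> J1 + J2)%type.
Proof.
move=> h; exists (fun z => match z with inr _ => None | inl j => Some j end) => -[] //=.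
by move=> a; rewrite (card1_unique j a h).
Qed.

Lemma uv_mul J1 I1 J2 I2 (u : usp (option J1) I1) (v : usp J2 (option I2)) :
  uv (umul u v) = uv u * uv v.
Proof.
rewrite uv_ffun; case: ifP => // h.
case: (boolP ((#|{: option J1}| == 1%N) && (#|I1| == 1%N))) => [|/negbTE/uv_out->]; last by rewrite mul0r.
case: (boolP ((#|J2| == 1%N) && (#|{: option I2}| == 1%N))) => [|/negbTE/uv_out->]; last by rewrite mulr0.
by move: h; rewrite !card_sum !card_option => h; lia.
Qed.

Lemma lamE J1 I1 J2 I2 (u : usp (option J1) I1) (n : N J2 (option I2)) (i : I1) :
  #|J1| = 0%N -> #|I1| = 1%N -> lam u n = uv u *: act inr (oapp inr (inl i)) n.
Proof.
move=> h1 h2; rewrite /lam h1 h2 /= (bigD1 i) //= big1 ?addr0 // => k.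
by rewrite (card1_unique i k h2) eqxx.
Qed.

Lemma rhoE J1 I1 J2 I2 (n : N (option J1) I1) (u : usp J2 (option I2)) (j : J2) :
  #|J2| = 1%N -> #|I2| = 0%N -> rho n u = uv u *: act (oapp inl (inr j)) inl n.
Proof.
move=> h1 h2; rewrite /rho h1 h2 /= (bigD1 j) //= big1 ?addr0 // => k.
by rewrite (card1_unique j k h1) eqxx.
Qed.

Variant lam_spec J1 I1 J2 I2 : (usp (option J1) I1 -> N J2 (option I2) -> N (J1 + J2)%type (I1 + I2)%type) -> Prop :=
| LamSpec i of #|J1| = 0%N & #|I1| = 1%N :
    lam_spec (fun u n => uv u *: act inr (oapp inr (inl i)) n)
| LamZero of ((#|J1| == 0%N) && (#|I1| == 1%N)) = false : lam_spec (fun u n => 0).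

Lemma lamP J1 I1 J2 I2 : @lam_spec J1 I1 J2 I2 (@lam J1 I1 J2 I2).
Proof.
case h: ((#|J1| == 0%N) && (#|I1| == 1%N)); last first.
  have -> : @lam J1 I1 J2 I2 = fun u n => 0 by apply/funext => u; apply/funext => n; rewrite /lam h.
  exact: LamZero.
case/andP: h => /eqP h1 /eqP h2.
have /card_gt0P[i _] : (0 < #|I1|)%N by rewrite h2.
have -> : @lam J1 I1 J2 I2 = fun u n => uv u *: act inr (oapp inr (inl i)) n.
  by apply/funext => u; apply/funext => n; exact: lamE.
exact: LamSpec.
Qed.

Variant rho_spec J1 I1 J2 I2 : (N (option J1) I1 -> usp J2 (option I2) -> N (J1 + J2)%type (I1 + I2)%type) -> Prop :=
| RhoSpec j of #|J2| = 1%N & #|I2| = 0%N :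
    rho_spec (fun n u => uv u *: act (oapp inl (inr j)) inl n)
| RhoZero of ((#|J2| == 1%N) && (#|I2| == 0%N)) = false : rho_spec (fun n u => 0).

Lemma rhoP J1 I1 J2 I2 : @rho_spec J1 I1 J2 I2 (@rho J1 I1 J2 I2).
Proof.
case h: ((#|J2| == 1%N) && (#|I2| == 0%N)); last first.
  have -> : @rho J1 I1 J2 I2 = fun u n => 0 by apply/funext => u; apply/funext => n; rewrite /rho h.
  exact: RhoZero.
case/andP: h => /eqP h1 /eqP h2.
have /card_gt0P[i _] : (0 < #|J2|)%N by rewrite h1.
have -> : @rho J1 I1 J2 I2 = fun n u => uv u *: act (oapp inl (inr i)) inl n.
  by apply/funext => u; apply/funext => n; exact: rhoE.
exact: RhoSpec.
Qed.

Lemma lam_linl J1 I1 J2 I2 (n : N J2 (option I2)) : linear (fun u : usp (option J1) I1 => lam u n).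
Proof.
case: lamP => [i h1 h2|_] a x y; last by rewrite scaler0 addr0.
by rewrite uv_linear scalerDl scalerA.
Qed.

Lemma lam_linr J1 I1 J2 I2 (u : usp (option J1) I1) : linear (fun n : N J2 (option I2) => lam u n).
Proof.
case: lamP => [i h1 h2|_] a x y; last by rewrite scaler0 addr0.
rewrite (act_linear (inr_bij0 _ h1) (oinr_bij _ _ h2)) scalerDr !scalerA.
by rewrite mulrC.
Qed.

Lemma rho_linl J1 I1 J2 I2 (u : usp J2 (option I2)) : linear (fun n : N (option J1) I1 => rho n u).
Proof.
case: rhoP => [j h1 h2|_] a x y; last by rewrite scaler0 addr0.
rewrite (act_linear (oinl_bij _ _ h1) (inl_bij0 _ h2)) scalerDr !scalerA.
by rewrite mulrC.
Qed.

Lemma rho_linr J1 I1 J2 I2 (n : N (option J1) I1) : linear (fun u : usp J2 (option I2) => rho n u).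
Proof.
case: rhoP => [j h1 h2|_] a x y; last by rewrite scaler0 addr0.
by rewrite uv_linear scalerDl scalerA.
Qed.

Lemma mu0l J1 I1 J2 I2 (y : N J2 (option I2)) : mu (0 : N (option J1) I1) y = 0.
Proof. exact: lin0 (mu_linl y). Qed.
Lemma mu0r J1 I1 J2 I2 (x : N (option J1) I1) : mu x (0 : N J2 (option I2)) = 0.
Proof. exact: lin0 (mu_linr x). Qed.

Ltac bij := lazymatch goal with
  | |- bijective (ssrfun.comp _ _) => apply: bij_comp; bij
  | |- bijective (omap _) => apply: omap_bij; bij
  | |- bijective (sumf _ _) => apply: sumf_bij; bij
  | |- _ => solve [ assumption | exact: id_bij | exact: optl_bij | exact: optr_bij
    | exact: optlV_bij | exact: optrV_bij | exact: sumA_bij | exact: sumAC_bij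
    | exact: sumCA_bij | exact: swapo_bij | exact: unvoidl_bij | exact: unvoidr_bij
    | exact: unoptl_bij | exact: unoptr_bij | exact: inr_bij0 | exact: inl_bij0
    | exact: oinr_bij | exact: oinl_bij ]
  end.

Lemma actZ J J' I I' (f : J -> J') (g : I -> I') (a : K) (x : N J I) :
  bijective f -> bijective g -> act f g (a *: x) = a *: act f g x.
Proof. by move=> bf bg; exact: linZ (act_linear bf bg) _ _. Qed.

Lemma muZl J1 I1 J2 I2 a (x : N (option J1) I1) (y : N J2 (option I2)) :
  mu (a *: x) y = a *: mu x y.
Proof. exact: (linZ (mu_linl y)). Qed.
Lemma muZr J1 I1 J2 I2 a (x : N (option J1) I1) (y : N J2 (option I2)) :
  mu x (a *: y) = a *: mu x y.
Proof. exact: (linZ (mu_linr x)). Qed.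

Lemma mu_actl J1 J1' I1 I1' J2 I2 (f1 : J1 -> J1') (g1 : I1 -> I1') f
    (x : N (option J1) I1) (y : N J2 (option I2)) :
  f =1 omap f1 -> bijective f1 -> bijective g1 ->
  mu (act f g1 x) y = act (sumf f1 id) (sumf g1 id) (mu x y).
Proof.
move=> /funext -> b1 b2; rewrite -mu_act //; try exact: id_bij.
congr mu; rewrite -[LHS](act_id (b := N)); apply: eq_act => // -[] //.
Qed.

Lemma mu_actr J1 I1 J2 J2' I2 I2' (f2 : J2 -> J2') (g2 : I2 -> I2') g
    (x : N (option J1) I1) (y : N J2 (option I2)) :
  g =1 omap g2 -> bijective f2 -> bijective g2 ->
  mu x (act f2 g y) = act (sumf id f2) (sumf id g2) (mu x y).
Proof.
move=> /funext -> b1 b2; rewrite -mu_act //; try exact: id_bij.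
congr mu; rewrite -[LHS](act_id (b := N)); apply: eq_act => // -[] //.
Qed.

Lemma lam_or J1 I1 : (exists2 i : I1, #|J1| = 0%N & #|I1| = 1%N) \/
  (forall J2 I2 u n, @lam J1 I1 J2 I2 u n = 0).
Proof.
case h: ((#|J1| == 0%N) && (#|I1| == 1%N)); last by right=> *; rewrite /lam h.
case/andP: h => /eqP h1 /eqP h2; left.
by have /card_gt0P[i _] : (0 < #|I1|)%N by [rewrite h2]; exists i.
Qed.

Lemma rho_or J2 I2 : (exists2 j : J2, #|J2| = 1%N & #|I2| = 0%N) \/
  (forall J1 I1 n u, @rho J1 I1 J2 I2 n u = 0).
Proof.
case h: ((#|J2| == 1%N) && (#|I2| == 0%N)); last by right=> *; rewrite /rho h.
case/andP: h => /eqP h1 /eqP h2; left.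
by have /card_gt0P[i _] : (0 < #|J2|)%N by [rewrite h1]; exists i.
Qed.

Lemma N_act0 J J' I I' (f : J -> J') (g : I -> I') :
  bijective f -> bijective g -> act f g (0 : N J I) = 0.
Proof. by move=> bf bg; exact: (lin0 (act_linear bf bg)). Qed.

(** The lemmas [chain_a] to [chain_f] treat the six mixed placements of unit multiples and elements
    of [N] in a chain of three. The common reason is that a unit only relabels, and [mu] is
    equivariant. *)
Lemma chain_a J1 I1 J2 I2 J3 I3 (u : usp (option J1) I1) (n2 : N (option J2) (option I2))
    (n3 : N J3 (option I3)) :
  act (@sumA J1 J2 J3) (@sumA I1 I2 I3) (mu (act (@optr J1 J2) id (lam u n2)) n3)
  = lam u (act id (@optl I2 I3) (mu n2 n3)).
Proof.
case: (lam_or J1 I1) => [[i h1 h2]|h0]; last by rewrite !h0 N_act0 ?mu0l ?N_act0 //; bij.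
rewrite !(lamE _ _ i) // actZ; try bij.
rewrite muZl actZ; try bij.
congr (_ *: _); rewrite !act_comp; try bij.
rewrite (@mu_actl _ _ _ _ _ _ (@inr J1 J2)); try bij; try by case.
rewrite !act_comp; try bij.
by apply: eq_act => [[j|j]|[[k|]|k]].
Qed.

(** A unit between two vertices can be absorbed by either neighbour; both ways require [J2] and [I2]
    to be empty. *)
Lemma rl_or J2 I2 : (#|{: option J2}| = 1%N /\ #|J2| = 0%N) /\ (#|{: option I2}| = 1%N /\ #|I2| = 0%N) \/
  (forall J1 I1 n u, @rho J1 I1 (option J2) I2 n u = 0) /\
  (forall J3 I3 u n, @lam J2 (option I2) J3 I3 u n = 0).
Proof.
rewrite !card_option.
case: (eqVneq #|J2| 0%N) => [->|h]; last first.
  by right; split=> *; rewrite /rho /lam ?card_option ?eqSS (negbTE h).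
case: (eqVneq #|I2| 0%N) => [->|h]; last first.
  by right; split=> *; rewrite /rho /lam ?card_option ?eqSS (negbTE h) andbF.
by left.
Qed.

Lemma chain_b J1 I1 J2 I2 J3 I3 (n1 : N (option J1) I1) (u : usp (option J2) (option I2))
    (n3 : N J3 (option I3)) :
  act (@sumA J1 J2 J3) (@sumA I1 I2 I3) (mu (act (@optr J1 J2) id (rho n1 u)) n3)
  = mu n1 (act id (@optl I2 I3) (lam u n3)).
Proof.
case: (rl_or J2 I2) => [[[a1 a2] [a3 a4]]|[-> ->]]; last by rewrite !N_act0 ?mu0l ?mu0r ?N_act0 //; bij.
rewrite (rhoE _ _ None) // (lamE _ _ None) // !actZ; try bij.
rewrite muZl muZr actZ; try bij.
congr (_ *: _); rewrite !act_comp; try bij.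
rewrite (@mu_actl _ _ _ _ _ _ (@inl J1 J2)); try bij; try by case.
rewrite (@mu_actr _ _ _ _ _ _ (@inr J2 J3) (@inr I2 I3)); try bij; try by case.
rewrite !act_comp; try bij.
by apply: eq_act => [[j|j]|[k|k]].
Qed.

Lemma chain_c J1 I1 J2 I2 J3 I3 (u1 : usp (option J1) I1) (u2 : usp (option J2) (option I2))
    (n3 : N J3 (option I3)) :
  act (@sumA J1 J2 J3) (@sumA I1 I2 I3) (lam (uact (@optr J1 J2) id (umul u1 u2)) n3)
  = lam u1 (act id (@optl I2 I3) (lam u2 n3)).
Proof.
have E : uv (uact (@optr J1 J2) id (umul u1 u2)) = uv u1 * uv u2.
  by rewrite uv_act ?uv_mul //; bij.
(* A product of two unit multiples is nonzero only if both factors have arity (1, 1); otherwise both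
   sides are shown to vanish. *)
case c1: ((#|J1| == 0%N) && (#|I1| == 1%N) && ((#|J2| == 0%N) && (#|I2| == 0%N))).
  case/andP: c1 => /andP[/eqP h1 /eqP h2] /andP[/eqP h3 /eqP h4].
  have /card_gt0P[i _] : (0 < #|I1|)%N by rewrite h2.
  have h5 : #|{: option I2}| = 1%N by rewrite card_option h4.
  have h6 : #|{: J1 + J2}| = 0%N by rewrite card_sum h1 h3.
  have h7 : #|{: I1 + I2}| = 1%N by rewrite card_sum h2 h4.
  rewrite (lamE _ _ (inl i)) // (lamE _ _ i) // (lamE _ _ None) // E !actZ; try bij.
  rewrite scalerA; congr (_ *: _); rewrite !act_comp; try bij.
  by apply: eq_act => [j|[k|]].
have -> : lam u1 (act id (@optl I2 I3) (lam u2 n3)) = 0.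
  case: (lam_or J1 I1) => [[i k1 k2]|->//].
  rewrite k1 k2 /= in c1.
  have -> : lam u2 n3 = 0 by rewrite /lam card_option eqSS c1.
  rewrite N_act0; try bij.
  exact: lin0 (lam_linr _).
case: (lam_or (J1 + J2)%type (I1 + I2)%type) => [[i h1 h2]|->]; last by rewrite N_act0 //; bij.
rewrite (lamE _ _ i) // E; have -> : uv u1 * uv u2 = 0.
  case: (boolP ((#|{: option J1}| == 1%N) && (#|I1| == 1%N))) => [k1|/negbTE/uv_out->]; last by rewrite mul0r.
  case: (boolP ((#|{: option J2}| == 1%N) && (#|{: option I2}| == 1%N))) => [k2|/negbTE/uv_out->]; last by rewrite mulr0.
  by move: c1 k1 k2; rewrite !card_option; lia.
by rewrite scale0r N_act0 //; bij.
Qed.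

Lemma chain_d J1 I1 J2 I2 J3 I3 (n1 : N (option J1) I1) (n2 : N (option J2) (option I2))
    (u : usp J3 (option I3)) :
  act (@sumA J1 J2 J3) (@sumA I1 I2 I3) (rho (act (@optr J1 J2) id (mu n1 n2)) u)
  = mu n1 (act id (@optl I2 I3) (rho n2 u)).
Proof.
case: (rho_or J3 I3) => [[j h1 h2]|h0]; last by rewrite !h0 !N_act0 ?mu0r ?N_act0 //; bij.
rewrite !(rhoE _ _ j) // !actZ; try bij.
rewrite muZr; congr (_ *: _); rewrite !act_comp; try bij.
rewrite (@mu_actr _ _ _ _ _ _ (oapp inl (inr j) : option J2 -> J2 + J3)%type (@inl I2 I3)); try bij; try by case.
by apply: eq_act => [[k|[k|]]|[k|k]].
Qed.

Lemma chain_e J1 I1 J2 I2 J3 I3 (u1 : usp (option J1) I1) (n : N (option J2) (option I2))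
    (u3 : usp J3 (option I3)) :
  act (@sumA J1 J2 J3) (@sumA I1 I2 I3) (rho (act (@optr J1 J2) id (lam u1 n)) u3)
  = lam u1 (act id (@optl I2 I3) (rho n u3)).
Proof.
case: (rho_or J3 I3) => [[j h1 h2]|h0]; last first.
  by rewrite !h0 !N_act0 ?(lin0 (lam_linr _)) //; bij.
case: (lam_or J1 I1) => [[i k1 k2]|h0]; last first.
  by rewrite !h0 !N_act0 ?(lin0 (rho_linl _)) ?N_act0 //; bij.
rewrite !(rhoE _ _ j) // !(lamE _ _ i) // !actZ; try bij.
rewrite !scalerA mulrC; congr (_ *: _); rewrite !act_comp; try bij.
by apply: eq_act => [[k|]|[k|]].
Qed.

Lemma chain_f J1 I1 J2 I2 J3 I3 (n : N (option J1) I1) (u2 : usp (option J2) (option I2))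
    (u3 : usp J3 (option I3)) :
  act (@sumA J1 J2 J3) (@sumA I1 I2 I3) (rho (act (@optr J1 J2) id (rho n u2)) u3)
  = rho n (uact id (@optl I2 I3) (umul u2 u3)).
Proof.
have E : uv (uact id (@optl I2 I3) (umul u2 u3)) = uv u2 * uv u3.
  by rewrite uv_act ?uv_mul //; bij.
case c1: ((#|J2| == 0%N) && (#|I2| == 0%N) && ((#|J3| == 1%N) && (#|I3| == 0%N))).
  case/andP: c1 => /andP[/eqP h1 /eqP h2] /andP[/eqP h3 /eqP h4].
  have /card_gt0P[j _] : (0 < #|J3|)%N by rewrite h3.
  have h5 : #|{: option J2}| = 1%N by rewrite card_option h1.
  have h6 : #|{: J2 + J3}| = 1%N by rewrite card_sum h1 h3.
  have h7 : #|{: I2 + I3}| = 0%N by rewrite card_sum h2 h4.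
  rewrite (rhoE _ _ (inr j)) // (rhoE _ _ j) // (rhoE _ _ None) // E !actZ; try bij.
  rewrite scalerA mulrC; congr (_ *: _); rewrite !act_comp; try bij.
  by apply: eq_act => [[k|]|k].
have -> : rho (act (@optr J1 J2) id (rho n u2)) u3 = 0.
  case: (rho_or J3 I3) => [[i k1 k2]|->//].
  rewrite k1 k2 /= andbT in c1.
  have -> : rho n u2 = 0 by rewrite /rho card_option eqSS c1.
  rewrite N_act0; try bij.
  exact: lin0 (rho_linl _).
rewrite N_act0; try bij.
case: (rho_or (J2 + J3)%type (I2 + I3)%type) => [[i h1 h2]|-> //].
rewrite (rhoE _ _ i) // E; have -> : uv u2 * uv u3 = 0; last by rewrite scale0r.
case: (boolP ((#|{: option J2}| == 1%N) && (#|{: option I2}| == 1%N))) => [k1|/negbTE/uv_out->]; last by rewrite mul0r.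
case: (boolP ((#|J3| == 1%N) && (#|{: option I3}| == 1%N))) => [k2|/negbTE/uv_out->]; last by rewrite mulr0.
by move: c1 k1 k2; rewrite !card_option; lia.
Qed.

Lemma lam_cond J1 I1 J2 I2 (u : usp (option (option J1)) I1) (n : N J2 (option I2)) :
  lam u n = 0.
Proof. by rewrite /lam card_option. Qed.

Lemma rho_cond J1 I1 J2 I2 (n : N (option J1) I1) (u : usp J2 (option (option I2))) :
  rho n u = 0.
Proof. by rewrite /rho card_option andbF. Qed.

Lemma below_a J1 I1 J2 I2 J3 I3 (n1 : N (option (option J1)) I1) (u : usp J2 (option I2))
    (n3 : N J3 (option I3)) :
  act (@sumAC J1 J2 J3) (@sumAC I1 I2 I3) (mu (act (@optl J1 J2) id (rho n1 u)) n3)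
  = rho (act (@optl J1 J3) id (mu (act (@swapo J1) id n1) n3)) u.
Proof.
case: (rho_or J2 I2) => [[j h1 h2]|h0]; last by rewrite !h0 !N_act0 ?mu0l ?N_act0 //; bij.
rewrite !(rhoE _ _ j) // !actZ; try bij.
rewrite muZl actZ; try bij.
congr (_ *: _); rewrite !act_comp; try bij.
rewrite (_ : act (@optl J1 J2 \o oapp inl (inr j)) (id \o inl) n1
  = act (omap (oapp inl (inr j) : option J1 -> J1 + J2)%type) (@inl I1 I2) (act (@swapo J1) id n1)); last first.
  by rewrite act_comp; try bij; apply: eq_act => // -[[]|].
rewrite (@mu_actl _ _ _ _ _ _ (oapp inl (inr j) : option J1 -> J1 + J2)%type) //; try bij.
rewrite !act_comp; try bij.
by apply: eq_act => [[[k|]|k]|[k|k]].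
Qed.

(** This is [below_a] read backwards with the two lower vertices exchanged: [swapo] is an
    involution, and [sumAC] is inverse to [sumAC] with the blocks exchanged. *)
Lemma below_a' J1 I1 J2 I2 J3 I3 (n1 : N (option (option J1)) I1) (u : usp J3 (option I3))
    (n2 : N J2 (option I2)) :
  act (@sumAC J1 J2 J3) (@sumAC I1 I2 I3) (rho (act (@optl J1 J2) id (mu n1 n2)) u)
  = mu (act (@optl J1 J3) id (rho (act (@swapo J1) id n1) u)) n2.
Proof.
have -> : mu n1 n2 = mu (act (@swapo J1) id (act (@swapo J1) id n1)) n2.
  by congr mu; rewrite act_comp; try bij; rewrite -[LHS](act_id (b := N)); apply: eq_act => // -[[]|].
rewrite -below_a act_comp; try bij.
by rewrite -[RHS](act_id (b := N)); apply: eq_act => -[[]|].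
Qed.

Lemma below_b J1 I1 J2 I2 J3 I3 (n : N (option (option J1)) I1) (u2 : usp J2 (option I2))
    (u3 : usp J3 (option I3)) :
  act (@sumAC J1 J2 J3) (@sumAC I1 I2 I3) (rho (act (@optl J1 J2) id (rho n u2)) u3)
  = rho (act (@optl J1 J3) id (rho (act (@swapo J1) id n) u3)) u2.
Proof.
case: (rho_or J2 I2) => [[j h1 h2]|h0]; last first.
  by rewrite !h0 !N_act0 ?(lin0 (rho_linl _)) ?N_act0 //; bij.
case: (rho_or J3 I3) => [[j3 h3 h4]|h0]; last first.
  by rewrite !h0 !N_act0 ?(lin0 (rho_linl _)) //; bij.
rewrite !(rhoE _ _ j) // !(rhoE _ _ j3) // !actZ; try bij.
rewrite !scalerA mulrC; congr (_ *: _); rewrite !act_comp; try bij.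
by apply: eq_act => [[[k|]|]|k].
Qed.

Lemma above_a J1 I1 J2 I2 J3 I3 (n1 : N (option J1) I1) (u : usp (option J2) I2)
    (n3 : N J3 (option (option I3))) :
  act (@sumCA J1 J2 J3) (@sumCA I1 I2 I3) (mu n1 (act id (@optr I2 I3) (lam u n3)))
  = lam u (act id (@optr I1 I3) (mu n1 (act id (@swapo I3) n3))).
Proof.
case: (lam_or J2 I2) => [[j h1 h2]|h0]; last by rewrite !h0 !N_act0 ?mu0r ?N_act0 //; bij.
rewrite !(lamE _ _ j) // !actZ; try bij.
rewrite muZr actZ; try bij.
congr (_ *: _); rewrite !act_comp; try bij.
rewrite (_ : act (id \o inr) (@optr I2 I3 \o oapp inr (inl j)) n3
  = act (@inr J2 J3) (omap (oapp inr (inl j) : option I3 -> I2 + I3)%type) (act id (@swapo I3) n3)); last first.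
  by rewrite act_comp; try bij; apply: eq_act => // -[[]|].
rewrite (@mu_actr _ _ _ _ _ _ (@inr J2 J3) (oapp inr (inl j) : option I3 -> I2 + I3)%type) //; try bij.
rewrite !act_comp; try bij.
by apply: eq_act => [[k|k]|[k|[k|]]].
Qed.

Lemma above_a' J1 I1 J2 I2 J3 I3 (n2 : N (option J2) I2) (u : usp (option J1) I1)
    (n3 : N J3 (option (option I3))) :
  act (@sumCA J1 J2 J3) (@sumCA I1 I2 I3) (lam u (act id (@optr I2 I3) (mu n2 n3)))
  = mu n2 (act id (@optr I1 I3) (lam u (act id (@swapo I3) n3))).
Proof.
have -> : mu n2 n3 = mu n2 (act id (@swapo I3) (act id (@swapo I3) n3)).
  by congr mu; rewrite act_comp; try bij; rewrite -[LHS](act_id (b := N)); apply: eq_act => // -[[]|].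
rewrite -above_a act_comp; try bij.
by rewrite -[RHS](act_id (b := N)); apply: eq_act => -[|[]].
Qed.

Lemma above_b J1 I1 J2 I2 J3 I3 (u1 : usp (option J1) I1) (u2 : usp (option J2) I2)
    (n : N J3 (option (option I3))) :
  act (@sumCA J1 J2 J3) (@sumCA I1 I2 I3) (lam u1 (act id (@optr I2 I3) (lam u2 n)))
  = lam u2 (act id (@optr I1 I3) (lam u1 (act id (@swapo I3) n))).
Proof.
case: (lam_or J1 I1) => [[j h1 h2]|h0]; last first.
  by rewrite !h0 !N_act0 ?(lin0 (lam_linr _)) //; bij.
case: (lam_or J2 I2) => [[j2 h3 h4]|h0]; last first.
  by rewrite !h0 !N_act0 ?(lin0 (lam_linr _)) ?N_act0 //; bij.
rewrite !(lamE _ _ j) // !(lamE _ _ j2) // !actZ; try bij.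
rewrite !scalerA mulrC; congr (_ *: _); rewrite !act_comp; try bij.
by apply: eq_act => [k|[[k|]|]].
Qed.

Definition dsp J I : lmodType K := (usp J I * N J I)%type.

Definition dhdeg J I (p : int) (x : dsp J I) : Prop := (p = 0 \/ x.1 = 0) /\ hdeg p x.2.

Definition dact J J' I I' (f : J -> J') (g : I -> I') (x : dsp J I) : dsp J' I' :=
  (uact f g x.1, act f g x.2).

Definition dcomp J1 I1 J2 I2 (x : dsp (option J1) I1) (y : dsp J2 (option I2)) :
    dsp (J1 + J2)%type (I1 + I2)%type :=
  (umul x.1 y.1, mu x.2 y.2 + lam x.1 y.2 + rho x.2 y.1).

Definition dun : dsp (option void) (option void) := ([ffun=> 1], 0).

Lemma card_optvoid : #|{: option void}| = 1%N.
Proof. by rewrite card_option card_void. Qed.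

Lemma uv_dun : uv dun.1 = 1.
Proof. by rewrite uv_ffun ifT //; apply/andP; split; apply/eqP; exact: card_optvoid. Qed.

Lemma dsp_eq J I (x y : dsp J I) : x.1 = y.1 -> x.2 = y.2 -> x = y.
Proof. by case: x y => [a b] [c d] /= -> ->. Qed.

Lemma dgrading J I : grading (@dhdeg J I).
Proof.
have [h0 hP hs hi] := conc_grading (usp J I) 0.
have [k0 kP ks ki] := hdeg_grading N J I.
split.
- by move=> p; split; [right|exact: k0].
- move=> p a x y [a1 a2] [b1 b2]; split; [exact: hP|exact: kP].
- move=> [u n]; have [s [f [us [hf sf fs]]]] := span_uniq (hdeg_grading N J I) n.
  (* Degree 0 is added to accommodate the unit component; if it was missing from [s], the component
     of [n] in degree 0 is zero by [fs]. *)
  exists (undup (0 :: s)), (fun p => ((p == 0)%:R *: u, f p)); split.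
    by move=> p; split=> //=; case: (p =P 0) => [->|_]; [left|right; rewrite scale0r].
  have sum1 (r : seq int) F : (\sum_(p <- r) F p : dsp J I).1 = \sum_(p <- r) (F p).1.
    by elim: r => [|p r IH]; rewrite ?big_nil // !big_cons -IH.
  have sum2 (r : seq int) F : (\sum_(p <- r) F p : dsp J I).2 = \sum_(p <- r) (F p).2.
    by elim: r => [|p r IH]; rewrite ?big_nil // !big_cons -IH.
  apply: dsp_eq; rewrite ?sum1 ?sum2 /=.
    have m0 : 0 \in undup (0 :: s) by rewrite mem_undup inE eqxx.
    rewrite (bigD1_seq 0 m0 (undup_uniq _)) /= ?eqxx ?mulr1n scale1r big1 ?addr0 // => q.
    by move/negbTE => ->; rewrite scale0r.
  rewrite {1}sf; case: ifP => h0s; first by rewrite undup_id.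
  by rewrite big_cons fs ?h0s // add0r undup_id.
- move=> s f us hf sf p ps.
  have sum1 (r : seq int) F : (\sum_(p <- r) F p : dsp J I).1 = \sum_(p <- r) (F p).1.
    by elim: r => [|q r IH]; rewrite ?big_nil // !big_cons -IH.
  have sum2 (r : seq int) F : (\sum_(p <- r) F p : dsp J I).2 = \sum_(p <- r) (F p).2.
    by elim: r => [|q r IH]; rewrite ?big_nil // !big_cons -IH.
  apply: dsp_eq.
    apply: (hi s (fun p => (f p).1)) => // [q|]; first exact: (hf q).1.
    by rewrite -sum1 sf.
  apply: (ki s (fun p => (f p).2)) => // [q|]; first exact: (hf q).2.
  by rewrite -sum2 sf.
Qed.

Lemma uact_linear J J' I I' (f : J -> J') (g : I -> I') : linear (@uact J J' I I' f g).
Proof. by move=> a x y; apply/ffunP => z; rewrite !ffunE uv_linear. Qed.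

Definition dbimodule : bimodule K.
refine (@Bimodule K dsp dhdeg dgrading dact _ _ _ _).
- move=> J J' I I' f g bf bg a x y; apply: dsp_eq; [exact: uact_linear|exact: act_linear].
- move=> J J' I I' f g p x bf bg [h1 h2]; split; last exact: act_hdeg.
  by case: h1 => [->|h]; [left|right; rewrite /= h (lin0 (uact_linear f g))].
- move=> J I x; apply: dsp_eq; last exact: act_id.
  by apply: uv_eq; rewrite uv_act //; exact: id_bij.
- move=> J J' J'' I I' I'' f f' g g' x b1 b2 b3 b4.
  by apply: dsp_eq; [apply: uv_eq; rewrite !uv_act //; bij|exact: act_comp].
Defined.

Lemma umul_linl J1 I1 J2 I2 (v : usp J2 (option I2)) : linear (fun u : usp (option J1) I1 => umul u v).
Proof.
by move=> a x y; apply: uv_eq; rewrite uv_linear !uv_mul uv_linear mulrDl mulrA.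
Qed.

Lemma umul_linr J1 I1 J2 I2 (u : usp (option J1) I1) : linear (fun v : usp J2 (option I2) => umul u v).
Proof.
by move=> a x y; apply: uv_eq; rewrite uv_linear !uv_mul uv_linear mulrDr mulrCA.
Qed.

Lemma umul0l J1 I1 J2 I2 (v : usp J2 (option I2)) : umul (0 : usp (option J1) I1) v = 0.
Proof. exact: lin0 (umul_linl v). Qed.

Lemma umul0r J1 I1 J2 I2 (u : usp (option J1) I1) : umul u (0 : usp J2 (option I2)) = 0.
Proof. exact: lin0 (umul_linr u). Qed.

Lemma lam_hdeg J1 I1 J2 I2 (u : usp (option J1) I1) (n : N J2 (option I2)) p :
  hdeg p n -> hdeg p (lam u n).
Proof.
move=> h; have g := hdeg_grading N (J1 + J2)%type (I1 + I2)%type.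
case: (lam_or J1 I1) => [[i h1 h2]|->]; last exact: hdeg0 g _.
rewrite (lamE _ _ i) // -[_ *: _]addr0; apply: (hdegP g _ _ (hdeg0 g _)).
by apply: act_hdeg h; bij.
Qed.

Lemma rho_hdeg J1 I1 J2 I2 (n : N (option J1) I1) (u : usp J2 (option I2)) p :
  hdeg p n -> hdeg p (rho n u).
Proof.
move=> h; have g := hdeg_grading N (J1 + J2)%type (I1 + I2)%type.
case: (rho_or J2 I2) => [[i h1 h2]|->]; last exact: hdeg0 g _.
rewrite (rhoE _ _ i) // -[_ *: _]addr0; apply: (hdegP g _ _ (hdeg0 g _)).
by apply: act_hdeg h; bij.
Qed.

Lemma hdegD (V : lmodType K) (h : int -> V -> Prop) p x y : grading h -> h p x -> h p y -> h p (x + y).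
Proof. by move=> g hx hy; have := hdegP g 1 hx hy; rewrite scale1r. Qed.

Lemma dcomp_hdeg J1 I1 J2 I2 (x : dsp (option J1) I1) (y : dsp J2 (option I2)) p q :
  dhdeg p x -> dhdeg q y -> dhdeg (p + q) (dcomp x y).
Proof.
move=> [h1 h2] [k1 k2]; have g := hdeg_grading N (J1 + J2)%type (I1 + I2)%type.
split=> /=.
  case: h1 => [->|->]; last by right; exact: umul0l.
  by case: k1 => [->|->]; [left|right; exact: umul0r].
apply: (hdegD g); first apply: (hdegD g); first exact: mu_hdeg.
  case: h1 => [->|->]; first by rewrite add0r; exact: lam_hdeg.
  by rewrite (lin0 (lam_linl _)); exact: hdeg0 g _.
case: k1 => [->|->]; first by rewrite addr0; exact: rho_hdeg.
by rewrite (lin0 (rho_linr _)); exact: hdeg0 g _.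
Qed.

Lemma umul_act J1 J1' I1 I1' J2 J2' I2 I2' (f1 : J1 -> J1') (g1 : I1 -> I1')
    (f2 : J2 -> J2') (g2 : I2 -> I2') (u : usp (option J1) I1) (v : usp J2 (option I2)) :
  bijective f1 -> bijective g1 -> bijective f2 -> bijective g2 ->
  umul (uact (omap f1) g1 u) (uact f2 (omap g2) v) = uact (sumf f1 f2) (sumf g1 g2) (umul u v).
Proof.
move=> b1 b2 b3 b4; apply: uv_eq.
by rewrite uv_mul !uv_act ?uv_mul //; bij.
Qed.

Lemma lam_act J1 J1' I1 I1' J2 J2' I2 I2' (f1 : J1 -> J1') (g1 : I1 -> I1')
    (f2 : J2 -> J2') (g2 : I2 -> I2') (u : usp (option J1) I1) (n : N J2 (option I2)) :
  bijective f1 -> bijective g1 -> bijective f2 -> bijective g2 ->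
  lam (uact (omap f1) g1 u) (act f2 (omap g2) n) = act (sumf f1 f2) (sumf g1 g2) (lam u n).
Proof.
move=> b1 b2 b3 b4; have e1 := bij_eq_card b1; have e2 := bij_eq_card b2.
case c: ((#|J1| == 0%N) && (#|I1| == 1%N)); last by rewrite /lam -e1 -e2 c N_act0 //; bij.
case/andP: c => /eqP h1 /eqP h2; have /card_gt0P[i _] : (0 < #|I1|)%N by rewrite h2.
rewrite (lamE _ _ i) // (lamE _ _ (g1 i)) -?e1 -?e2 // actZ; try bij.
rewrite uv_act; try bij.
have k1 : bijective (@inr J1' J2') by apply: inr_bij0; rewrite -e1.
have k2 : bijective (oapp inr (inl (g1 i)) : option I2' -> I1' + I2')%type.
  by apply: oinr_bij; rewrite -e2.
congr (_ *: _); rewrite !act_comp; try bij.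
by apply: eq_act => // -[].
Qed.

Lemma rho_act J1 J1' I1 I1' J2 J2' I2 I2' (f1 : J1 -> J1') (g1 : I1 -> I1')
    (f2 : J2 -> J2') (g2 : I2 -> I2') (n : N (option J1) I1) (u : usp J2 (option I2)) :
  bijective f1 -> bijective g1 -> bijective f2 -> bijective g2 ->
  rho (act (omap f1) g1 n) (uact f2 (omap g2) u) = act (sumf f1 f2) (sumf g1 g2) (rho n u).
Proof.
move=> b1 b2 b3 b4; have e1 := bij_eq_card b3; have e2 := bij_eq_card b4.
case c: ((#|J2| == 1%N) && (#|I2| == 0%N)); last by rewrite /rho -e1 -e2 c N_act0 //; bij.
case/andP: c => /eqP h1 /eqP h2; have /card_gt0P[i _] : (0 < #|J2|)%N by rewrite h1.
rewrite (rhoE _ _ i) // (rhoE _ _ (f2 i)) -?e1 -?e2 // actZ; try bij.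
rewrite uv_act; try bij.
have k1 : bijective (@inl I1' I2') by apply: inl_bij0; rewrite -e2.
have k2 : bijective (oapp inl (inr (f2 i)) : option J1' -> J1' + J2')%type.
  by apply: oinl_bij; rewrite -e1.
congr (_ *: _); rewrite !act_comp; try bij.
by apply: eq_act => // -[].
Qed.

Lemma muD1 J1 I1 J2 I2 (x x' : N (option J1) I1) (y : N J2 (option I2)) :
  mu (x + x') y = mu x y + mu x' y.
Proof. exact: (linD (mu_linl y)). Qed.
Lemma muD2 J1 I1 J2 I2 (x : N (option J1) I1) (y y' : N J2 (option I2)) :
  mu x (y + y') = mu x y + mu x y'.
Proof. exact: (linD (mu_linr x)). Qed.
Lemma lamD J1 I1 J2 I2 (u : usp (option J1) I1) (y y' : N J2 (option I2)) :
  lam u (y + y') = lam u y + lam u y'.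
Proof. exact: (linD (lam_linr u)). Qed.
Lemma rhoD J1 I1 J2 I2 (x x' : N (option J1) I1) (u : usp J2 (option I2)) :
  rho (x + x') u = rho x u + rho x' u.
Proof. exact: (linD (rho_linl u)). Qed.
Lemma actD J J' I I' (f : J -> J') (g : I -> I') (x y : N J I) :
  bijective f -> bijective g -> act f g (x + y) = act f g x + act f g y.
Proof. by move=> bf bg; exact: (linD (act_linear bf bg)). Qed.

Lemma lam_below J1 I1 J2 I2 J3 I3 (u : usp (option (option J1)) I1) (v : usp J2 (option I2))
  (n : N J3 (option I3)) : lam (uact (@optl J1 J2) id (umul u v)) n = 0.
Proof.
rewrite /lam; case: ifP => // _; apply: big1 => i _.
by rewrite uv_act ?uv_mul ?(uv_out u) ?mul0r ?scale0r ?card_option //; bij.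
Qed.

Lemma rho_above J1 I1 J2 I2 J3 I3 (u : usp (option J2) I2) (v : usp J3 (option (option I3)))
  (n : N (option J1) I1) : rho n (uact id (@optr I2 I3) (umul u v)) = 0.
Proof.
rewrite /rho; case: ifP => // _; apply: big1 => i _.
by rewrite uv_act ?uv_mul ?(uv_out v) ?mulr0 ?scale0r ?card_option ?andbF //; bij.
Qed.

(** A homogeneous multiple of the unit vanishes or has degree 0, so Koszul signs involving it are
    trivial. *)
Lemma swap_mulN (p q : int) (a : Prop) (V : lmodType K) (x : V) :
  (p = 0 \/ a) -> (a -> x = 0) -> x = ksgn K (p * q) *: x.
Proof.
move=> [->|ha] h; first by rewrite mul0r ksgn0 scale1r.
by rewrite h // scaler0.
Qed.

Lemma swap_mul (p q : int) (a : Prop) (V : lmodType K) (x : V) :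
  (p = 0 \/ a) -> (a -> x = 0) -> x = ksgn K (q * p) *: x.
Proof. by rewrite mulrC; exact: swap_mulN. Qed.

(** Expanding a triple composite gives eight products, according to which factors are unit
    multiples. Three elements of [N] give 0 by hypothesis, three unit multiples concern only the
    first component, and the mixed products are compared one by one. *)
Definition unital : dioperad K.
refine (@Dioperad K dbimodule dcomp dun _ _ _ _ _ _ _ _ _ _).
- move=> J1 I1 J2 I2 y a x x'; apply: dsp_eq => /=; first exact: umul_linl.
  rewrite mu_linl lam_linl rho_linl !scalerDr.
  rewrite [LHS](AC ((2*2)*2) ((1*3*5)*(2*4*6))). reflexivity.
- move=> J1 I1 J2 I2 y a x x'; apply: dsp_eq => /=; first exact: umul_linr.
  rewrite mu_linr lam_linr rho_linr !scalerDr.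
  rewrite [LHS](AC ((2*2)*2) ((1*3*5)*(2*4*6))). reflexivity.
- exact: dcomp_hdeg.
- move=> J1 J1' I1 I1' J2 J2' I2 I2' f1 g1 f2 g2 x y b1 b2 b3 b4.
  apply: dsp_eq => /=; first exact: umul_act.
  by rewrite mu_act // lam_act // rho_act // !actD //; bij.
- by split; [left|exact: hdeg0 (hdeg_grading _ _ _) _].
- move=> J I y; apply: dsp_eq => /=.
    apply: uv_eq; rewrite uv_act; try bij.
    by rewrite uv_mul (uv_dun : uv dun.1 = 1) mul1r.
  rewrite mu0l (lin0 (rho_linl _)) add0r addr0 (lamE _ _ None) ?card_void ?card_option ?card_void //.
  rewrite (uv_dun : uv dun.1 = 1) scale1r act_comp; try bij; last 2 first.
  - by apply: inr_bij0; rewrite card_void.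
  - by apply: oinr_bij; rewrite card_option card_void.
  rewrite -[RHS](act_id (b := N)); apply: eq_act => // -[] //.
- move=> J I y; apply: dsp_eq => /=.
    apply: uv_eq; rewrite uv_act; try bij.
    by rewrite uv_mul (uv_dun : uv dun.1 = 1) mulr1.
  rewrite mu0r (lin0 (lam_linr _)) !add0r (rhoE _ _ None) ?card_void ?card_option ?card_void //.
  rewrite (uv_dun : uv dun.1 = 1) scale1r act_comp; try bij; last 2 first.
  - by apply: oinl_bij; rewrite card_option card_void.
  - by apply: inl_bij0; rewrite card_void.
  rewrite -[RHS](act_id (b := N)); apply: eq_act => // -[] //.
- move=> J1 I1 J2 I2 J3 I3 x y z; apply: dsp_eq => /=.
    by apply: uv_eq; rewrite !(uv_act, uv_mul) ?mulrA //; bij.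
  rewrite !(actD _ _ (id_bij _) (optl_bij _ _)) !(actD _ _ (optr_bij _ _) (id_bij _)).
  rewrite !(muD1, muD2, lamD, rhoD) !actD; try bij.
  rewrite mu_mul ?mu_mur; try bij.
  rewrite chain_a chain_b chain_c chain_d chain_e chain_f N_act0; try bij.
  by rewrite !add0r [LHS](AC (3*3) (2*4*(1*3*5)*6)).
- move=> J1 I1 J2 I2 J3 I3 x y z q r [hy _] [hz _]; apply: dsp_eq.
    change (uact (@sumAC J1 J2 J3) (@sumAC I1 I2 I3) (umul (uact (@optl J1 J2) id (umul x.1 y.1)) z.1)
      = ksgn K (q * r) *: umul (uact (@optl J1 J3) id (umul (uact (@swapo J1) id x.1) z.1)) y.1).
    apply: uv_eq; rewrite -[_ *: _]addr0 uv_linear !(uv_act, uv_mul); try bij.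
    by rewrite (uv_out x.1) ?card_option // uv0 !mul0r mulr0 addr0.
  change (act (@sumAC J1 J2 J3) (@sumAC I1 I2 I3)
     (mu (act (@optl J1 J2) id (mu x.2 y.2 + lam x.1 y.2 + rho x.2 y.1)) z.2
      + lam (uact (@optl J1 J2) id (umul x.1 y.1)) z.2
      + rho (act (@optl J1 J2) id (mu x.2 y.2 + lam x.1 y.2 + rho x.2 y.1)) z.1)
    = ksgn K (q * r) *: (mu (act (@optl J1 J3) id (mu (act (@swapo J1) id x.2) z.2
        + lam (uact (@swapo J1) id x.1) z.2 + rho (act (@swapo J1) id x.2) z.1)) y.2
      + lam (uact (@optl J1 J3) id (umul (uact (@swapo J1) id x.1) z.1)) y.2
      + rho (act (@optl J1 J3) id (mu (act (@swapo J1) id x.2) z.2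
        + lam (uact (@swapo J1) id x.1) z.2 + rho (act (@swapo J1) id x.2) z.1)) y.1)).
  rewrite !lam_below !lam_cond !addr0 !actD; try bij.
  rewrite !(muD1, rhoD) !actD; try bij.
  rewrite !mu_mul; try bij.
  rewrite N_act0 ?add0r; try bij.
  rewrite below_a below_a' below_b !scalerDr.
  rewrite addrCA; congr (_ + (_ + _)).
  - apply: (@swap_mul r q (z.1 = 0)) => // ->.
    by rewrite (lin0 (rho_linr _)) N_act0 ?mu0l //; bij.
  - apply: (@swap_mulN q r (y.1 = 0)) => // ->; exact: (lin0 (rho_linr _)).
  - apply: (@swap_mulN q r (y.1 = 0)) => // ->; exact: (lin0 (rho_linr _)).
- move=> J1 I1 J2 I2 J3 I3 x y z q r [hx _] [hy _]; apply: dsp_eq.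
    change (uact (@sumCA J1 J2 J3) (@sumCA I1 I2 I3) (umul x.1 (uact id (@optr I2 I3) (umul y.1 z.1)))
      = ksgn K (q * r) *: umul y.1 (uact id (@optr I1 I3) (umul x.1 (uact id (@swapo I3) z.1)))).
    apply: uv_eq; rewrite -[_ *: _]addr0 uv_linear !(uv_act, uv_mul); try bij.
    by rewrite (uv_out z.1) ?card_option ?andbF // uv0 !mulr0 addr0.
  change (act (@sumCA J1 J2 J3) (@sumCA I1 I2 I3)
     (mu x.2 (act id (@optr I2 I3) (mu y.2 z.2 + lam y.1 z.2 + rho y.2 z.1))
      + lam x.1 (act id (@optr I2 I3) (mu y.2 z.2 + lam y.1 z.2 + rho y.2 z.1))
      + rho x.2 (uact id (@optr I2 I3) (umul y.1 z.1)))
    = ksgn K (q * r) *: (mu y.2 (act id (@optr I1 I3) (mu x.2 (act id (@swapo I3) z.2)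
        + lam x.1 (act id (@swapo I3) z.2) + rho x.2 (uact id (@swapo I3) z.1)))
      + lam y.1 (act id (@optr I1 I3) (mu x.2 (act id (@swapo I3) z.2)
        + lam x.1 (act id (@swapo I3) z.2) + rho x.2 (uact id (@swapo I3) z.1)))
      + rho y.2 (uact id (@optr I1 I3) (umul x.1 (uact id (@swapo I3) z.1))))).
  rewrite !rho_above !rho_cond !addr0 !actD; try bij.
  rewrite !(muD2, lamD) !actD; try bij.
  rewrite !mu_mur; try bij.
  rewrite N_act0 ?add0r; try bij.
  rewrite above_a above_a' above_b !scalerDr.
  rewrite addrCA; congr (_ + (_ + _)).
  - apply: (@swap_mulN q r (x.1 = 0)) => // ->.
    by rewrite (lin0 (lam_linl _)) N_act0 ?mu0r //; bij.
  - apply: (@swap_mul r q (y.1 = 0)) => // ->; exact: (lin0 (lam_linl _)).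
  - apply: (@swap_mul r q (y.1 = 0)) => // ->; exact: (lin0 (lam_linl _)).
Defined.

End Unitalisation.

(** * The test dioperad *)

Section TestDioperad.
Variable K : fieldType.
Implicit Types J I : finType.

(* Coordinates, first of the generators: delta_x with a distinguished output, and
   ell; then of two-vertex composites: delta_x and delta_y, in either order, with
   outputs p of delta_x and q of delta_y (arity (3, 1)), delta_x and ell with output k and input
   i (arity (2, 2)), and ell below ell with inputs p, q (arity (1, 3)). *)
Definition yix J I : finType :=
  (('I_2 * J + unit) + (('I_2 * 'I_2 * (J * J) + 'I_2 * (J * I)) + I * I))%type.

Definition ymap J J' I I' (f : J -> J') (g : I -> I') (z : yix J I) : yix J' I' :=
  match z with
  | inl (inl (x, j)) => inl (inl (x, f j))
  | inl (inr u) => inl (inr u)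
  | inr (inl (inl (xy, (p, q)))) => inr (inl (inl (xy, (f p, f q))))
  | inr (inl (inr (x, (k, i)))) => inr (inl (inr (x, (f k, g i))))
  | inr (inr (p, q)) => inr (inr (g p, g q))
  end.

Definition ydeg J I (z : yix J I) : int :=
  match z with
  | inl (inl _) => 0 | inl (inr _) => 1
  | inr (inl (inl _)) => 0 | inr (inl (inr _)) => 1 | inr (inr _) => 2%:Z
  end.

Lemma ymap_id J I (z : yix J I) : ymap id id z = z.
Proof. by case: z => [[[x j]|u]|[[[xy [p q]]|[x [k i]]]|[p q]]]. Qed.

Lemma ymap_comp J J' J'' I I' I'' (f : J -> J') (f' : J' -> J'') (g : I -> I') (g' : I' -> I'') z :
  ymap f' g' (ymap f g z) = ymap (f' \o f) (g' \o g) z.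
Proof. by case: z => [[[x j]|u]|[[[xy [p q]]|[x [k i]]]|[p q]]]. Qed.

Lemma ymapK J J' I I' (f : J -> J') (g : I -> I') f' g' :
  cancel f f' -> cancel g g' -> cancel (ymap f g) (ymap f' g').
Proof.
move=> h1 h2 [[[x j]|u]|[[[xy [p q]]|[x [k i]]]|[p q]]] //=; by rewrite ?h1 ?h2.
Qed.

Lemma ydeg_map J J' I I' (f : J -> J') (g : I -> I') z : ydeg (ymap f g z) = ydeg z.
Proof. by case: z => [[[x j]|u]|[[[xy [p q]]|[x [k i]]]|[p q]]]. Qed.

Definition ysp J I : lmodType K := {ffun yix J I -> K^o}.

(** Pushforward along [ymap f g]. Summing over fibres defines it for all maps and makes it linear
    without bijectivity. *)
Definition yact J J' I I' (f : J -> J') (g : I -> I') (F : ysp J I) : ysp J' I' :=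
  [ffun z => \sum_(w | ymap f g w == z) F w].

Lemma yactV J J' I I' (f : J -> J') (g : I -> I') f' g' (F : ysp J I) z :
  cancel f f' -> cancel f' f -> cancel g g' -> cancel g' g ->
  yact f g F z = F (ymap f' g' z).
Proof.
move=> h1 h2 h3 h4; rewrite ffunE (big_pred1 (ymap f' g' z)) // => w /=.
by apply/eqP/eqP => [<-|->]; rewrite ymapK.
Qed.

Lemma yact_linear J J' I I' (f : J -> J') (g : I -> I') : linear (@yact J J' I I' f g).
Proof.
move=> a x y; apply/ffunP => z; rewrite !ffunE scaler_sumr -big_split.
by apply: eq_bigr => w _; rewrite !ffunE.
Qed.

Definition yhdeg J I (p : int) (F : ysp J I) : Prop := forall z, ydeg z != p -> F z = 0.

Lemma ygrading J I : grading (@yhdeg J I).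
Proof.
split=> [p z _|p a x y hx hy z hz|x|s f us hf sf p ps].
- by rewrite ffunE.
- by rewrite !ffunE hx // hy // addr0; exact: mulr0.
- exists (undup [seq ydeg z | z <- enum {: yix J I}]),
    (fun p => [ffun z => if ydeg z == p then x z else 0]); split.
    by move=> p z /negbTE h; rewrite ffunE h.
  apply/ffunP => z; rewrite sum_ffunE.
  have hz : ydeg z \in undup [seq ydeg z | z <- enum {: yix J I}].
    by rewrite mem_undup map_f // mem_enum.
  rewrite (bigD1_seq _ hz (undup_uniq _)) /= ffunE eqxx big1 ?addr0 // => q.
  by rewrite ffunE eq_sym => /negbTE ->.
- apply/ffunP => z; rewrite [RHS]ffunE; have [zp|/(hf p)//] := eqVneq (ydeg z) p.
  have := congr1 (fun F : ysp J I => F z) sf; rewrite sum_ffunE [RHS]ffunE.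
  rewrite (bigD1_seq _ ps us) /= big1 ?addr0 // => q hq.
  by apply: hf; rewrite zp eq_sym.
Qed.

Lemma yact_hdeg J J' I I' (f : J -> J') (g : I -> I') p (x : ysp J I) :
  bijective f -> bijective g -> yhdeg p x -> yhdeg p (yact f g x).
Proof.
move=> [f' h1 h2] [g' h3 h4] hx z hz; rewrite (yactV _ _ h1 h2 h3 h4).
by apply: hx; rewrite ydeg_map.
Qed.

Lemma yact_id J I (x : ysp J I) : yact id id x = x.
Proof. by apply/ffunP => z; rewrite (@yactV _ _ _ _ _ _ id id) // ymap_id. Qed.

Lemma yact_comp J J' J'' I I' I'' (f : J -> J') (f' : J' -> J'')
    (g : I -> I') (g' : I' -> I'') (x : ysp J I) :
    bijective f -> bijective f' -> bijective g -> bijective g' ->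
    yact f' g' (yact f g x) = yact (f' \o f) (g' \o g) x.
Proof.
move=> [a a1 a2] [b b1 b2] [c c1 c2] [d d1 d2]; apply/ffunP => z.
rewrite (yactV _ _ b1 b2 d1 d2) (yactV _ _ a1 a2 c1 c2) ymap_comp.
rewrite (@yactV _ _ _ _ _ _ (a \o b) (c \o d)) //;
  by move=> ? /=; rewrite ?(a1, b1, c1, d1) ?(a2, b2, c2, d2).
Qed.

Definition ybimodule : bimodule K := {|
  sp := ysp; hdeg := yhdeg; hdeg_grading := ygrading;
  act := yact; act_linear := fun J J' I I' f g _ _ => yact_linear f g;
  act_hdeg := yact_hdeg; act_id := yact_id; act_comp := yact_comp
|}.

Definition yd J I (F : ysp J I) (x : 'I_2) (j : J) : K := F (inl (inl (x, j))).
Definition yl J I (F : ysp J I) : K := F (inl (inr tt)).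

Section Mu.
Variables (J1 I1 J2 I2 : finType).
Implicit Types (F : ysp (option J1) I1) (G : ysp J2 (option I2)).

Definition muE F G (x y : 'I_2) (p q : (J1 + J2)%type) : K :=
  match p, q with inl _, inr k => yd F x None * yd G y k | _, _ => 0 end.

(** Each coordinate is a functional on two-vertex composites chosen to annihilate the relations. In
    arity (3, 1) the two vertical orders of [delta_x] and [delta_y] are added, which yields the
    co-Jacobi relations. In arity (1, 3) a difference of two indicators kills the cyclic sum. In
    arity (2, 2) the minus sign for [ell] above [delta] balances that composite against the one
    cross with the same output [k] and input [i] at its upper vertex. *)
Definition ymuV F G (z : yix (J1 + J2)%type (I1 + I2)%type) : K :=
  match z with
   | inl _ => 0
   | inr (inl (inl (xy, (p, q)))) => muE F G xy.1 xy.2 p q + muE F G xy.2 xy.1 q p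
   | inr (inl (inr (x, (inl _, inl _)))) => yd F x None * yl G
   | inr (inl (inr (x, (inr k, _)))) => - (yl F * yd G x k)
   | inr (inl (inr (x, (inl _, inr _)))) => 0
   | inr (inr (p, q)) => yl F * yl G *
       ((if p is inr _ then 1 else 0) - (if q is inr _ then 1 else 0))
   end.

Definition ymu F G : ysp (J1 + J2)%type (I1 + I2)%type := [ffun z => ymuV F G z].

End Mu.

Lemma yd_linear J I (a : K) (F F' : ysp J I) x j : yd (a *: F + F') x j = a * yd F x j + yd F' x j.
Proof. by rewrite /yd !ffunE. Qed.
Lemma yl_linear J I (a : K) (F F' : ysp J I) : yl (a *: F + F') = a * yl F + yl F'.
Proof. by rewrite /yl !ffunE. Qed.

Lemma ymu_linl J1 I1 J2 I2 (G : ysp J2 (option I2)) :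
  linear (fun F : ysp (option J1) I1 => ymu F G).
Proof.
move=> a F F'; apply/ffunP => z; rewrite !ffunE.
case: z => [z|[[[[x y] [[p|p] [q|q]]]|[x [[k|k] [i|i]]]]|[[p|p] [q|q]]]] /=;
  rewrite /muE /= ?yd_linear ?yl_linear /GRing.scale /=; ring.
Qed.

Lemma ymu_linr J1 I1 J2 I2 (F : ysp (option J1) I1) :
  linear (fun G : ysp J2 (option I2) => ymu F G).
Proof.
move=> a G G'; apply/ffunP => z; rewrite !ffunE.
case: z => [z|[[[[x y] [[p|p] [q|q]]]|[x [[k|k] [i|i]]]]|[[p|p] [q|q]]]] /=;
  rewrite /muE /= ?yd_linear ?yl_linear /GRing.scale /=; ring.
Qed.

Lemma yd_hdeg J I (F : ysp J I) p x j : yhdeg p F -> p = 0 \/ yd F x j = 0.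
Proof.
by move=> h; case: (eqVneq p 0) => [->|hp]; [left|right; apply: h; rewrite /= eq_sym].
Qed.
Lemma yl_hdeg J I (F : ysp J I) p : yhdeg p F -> p = 1 \/ yl F = 0.
Proof.
by move=> h; case: (eqVneq p 1) => [->|hp]; [left|right; apply: h; rewrite /= eq_sym].
Qed.

Lemma ymu_hdeg J1 I1 J2 I2 (F : ysp (option J1) I1) (G : ysp J2 (option I2)) p q :
  yhdeg p F -> yhdeg q G -> yhdeg (p + q) (ymu F G).
Proof.
move=> hF hG z hz; rewrite ffunE.
have hd x y j : p + q != 0 -> yd F x None * yd G y j = 0.
  case: (yd_hdeg x None hF) => [->|->]; last by rewrite mul0r.
  by case: (yd_hdeg y j hG) => [->|->]; rewrite ?mulr0.
have h1 x : p + q != 1 -> yd F x None * yl G = 0.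
  case: (yd_hdeg x None hF) => [->|->]; last by rewrite mul0r.
  by case: (yl_hdeg hG) => [->|->]; rewrite ?mulr0.
have h2 x j : p + q != 1 -> yl F * yd G x j = 0.
  case: (yl_hdeg hF) => [->|->]; last by rewrite mul0r.
  by case: (yd_hdeg x j hG) => [->|->]; rewrite ?mulr0.
have h3 : p + q != 2%:Z -> yl F * yl G = 0.
  case: (yl_hdeg hF) => [->|->]; last by rewrite mul0r.
  by case: (yl_hdeg hG) => [->|->]; rewrite ?mulr0.
rewrite eq_sym in hz.
case: z hz => [z|[[[[x y] [[u|u] [v|v]]]|[x [[k|k] [i|i]]]]|[[u|u] [v|v]]]] //= hz;
  by rewrite /muE /= ?hd ?h1 ?h2 ?h3 ?oppr0 ?addr0 ?mul0r.
Qed.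

Lemma ymu_act (J1 J1' I1 I1' J2 J2' I2 I2' : finType)
    (f1 : J1 -> J1') (g1 : I1 -> I1') (f2 : J2 -> J2') (g2 : I2 -> I2')
    (x : ysp (option J1) I1) (y : ysp J2 (option I2)) :
    bijective f1 -> bijective g1 -> bijective f2 -> bijective g2 ->
    ymu (yact (omap f1) g1 x) (yact f2 (omap g2) y)
    = yact (sumf f1 f2) (sumf g1 g2) (ymu x y).
Proof.
move=> [a a1 a2] [b b1 b2] [c c1 c2] [d d1 d2]; apply/ffunP => z.
rewrite (@yactV _ _ _ _ _ _ (sumf a c) (sumf b d)); last first.
- by case=> ? /=; rewrite ?b2 ?d2.
- by case=> ? /=; rewrite ?b1 ?d1.
- by case=> ? /=; rewrite ?a2 ?c2.
- by case=> ? /=; rewrite ?a1 ?c1.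
have hx z' : yact (omap f1) g1 x z' = x (ymap (omap a) b z').
  by apply: yactV => //; case=> //= ?; rewrite ?a1 ?a2.
have hy z' : yact f2 (omap g2) y z' = y (ymap c (omap d) z').
  by apply: yactV => //; case=> //= ?; rewrite ?d1 ?d2.
rewrite !ffunE.
by case: z => [z|[[[[? ?] [[u|u] [v|v]]]|[? [[k|k] [i|i]]]]|[[u|u] [v|v]]]] //=;
  try (by case: z => [[? ?]|?]); rewrite /muE /= /yd /yl ?hx ?hy.
Qed.

Lemma ymu_d0 J1 I1 J2 I2 J I (f : (J1 + J2)%type -> J) (g : (I1 + I2)%type -> I)
  (F : ysp (option J1) I1) (G : ysp J2 (option I2)) x j :
  bijective f -> bijective g -> yd (yact f g (ymu F G)) x j = 0.
Proof.
by move=> [a a1 a2] [b b1 b2]; rewrite /yd (yactV _ _ a1 a2 b1 b2) ffunE.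
Qed.

Lemma ymu_l0 J1 I1 J2 I2 J I (f : (J1 + J2)%type -> J) (g : (I1 + I2)%type -> I)
  (F : ysp (option J1) I1) (G : ysp J2 (option I2)) :
  bijective f -> bijective g -> yl (yact f g (ymu F G)) = 0.
Proof.
by move=> [a a1 a2] [b b1 b2]; rewrite /yl (yactV _ _ a1 a2 b1 b2) ffunE.
Qed.

(** A composite has zero coordinates among the generators, and [ymu] reads only those; hence every
    triple composite vanishes. *)
Lemma ymu_mul J1 I1 J2 I2 J J3 I3 (f : (J1 + J2)%type -> option J)
  (g : (I1 + I2)%type -> I3) I4
  (x : ysp (option J1) I1) (y : ysp J2 (option I2)) (z : ysp J3 (option I4)) :
  bijective f -> bijective g -> ymu (yact f g (ymu x y)) z = 0.
Proof.
move=> bf bg; apply/ffunP => w; rewrite [LHS]ffunE [RHS]ffunE.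
case: w => [w|[[[[? ?] [[u|u] [v|v]]]|[? [[k|k] [i|i]]]]|[[u|u] [v|v]]]] //=;
  by rewrite /muE /= ?(ymu_d0 _ _ _ _ bf bg) ?(ymu_l0 _ _ bf bg) ?mul0r ?oppr0 ?addr0.
Qed.

Lemma ymu_mur J1 I1 J2 I2 I J3 I3 (f : (J1 + J2)%type -> J3)
  (g : (I1 + I2)%type -> option I) J4
  (x : ysp (option J1) I1) (y : ysp J2 (option I2)) (z : ysp (option J4) I3) :
  bijective f -> bijective g -> ymu z (yact f g (ymu x y)) = 0.
Proof.
move=> bf bg; apply/ffunP => w; rewrite [LHS]ffunE [RHS]ffunE.
case: w => [w|[[[[? ?] [[u|u] [v|v]]]|[? [[k|k] [i|i]]]]|[[u|u] [v|v]]]] //=;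
  by rewrite /muE /= ?(ymu_d0 _ _ _ _ bf bg) ?(ymu_l0 _ _ bf bg) ?mulr0 ?mul0r ?oppr0 ?addr0.
Qed.

Definition test_dioperad : dioperad K :=
  @unital K ybimodule ymu ymu_linl ymu_linr ymu_hdeg ymu_act ymu_mul ymu_mur.

End TestDioperad.

Lemma card_bij (A B : finType) : #|A| = #|B| -> exists f : A -> B, bijective f.
Proof.
move=> h; exists (fun a => enum_val (cast_ord h (enum_rank a))).
exists (fun b => enum_val (cast_ord (esym h) (enum_rank b))) => x.
  by rewrite enum_valK cast_ordK enum_rankK.
by rewrite enum_valK cast_ordKV enum_rankK.
Qed.

Lemma unit_bij (A : finType) (f : unit -> A) : #|A| = 1%N -> bijective f.
Proof.
by move=> h; exists (fun=> tt) => [[]//|a]; exact: card1_unique.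
Qed.

Lemma to_unit_bij (A : finType) (f : A -> unit) : #|A| = 1%N -> bijective f.
Proof.
move=> h; have /card_gt0P[a _] : (0 < #|A|)%N by rewrite h.
by exists (fun=> a) => [b|[]]; [exact: card1_unique|case: (f a)].
Qed.

Definition bpair (A : Type) (p : A * A) (b : bool) : A := if b then p.2 else p.1.

(** Independence is applied to the family with [x] in degree [p] and [- x] in degree [q]. *)
Lemma hdeg_uniq (K : fieldType) (V : lmodType K) (h : int -> V -> Prop) p q x :
  grading h -> h p x -> h q x -> p != q -> x = 0.
Proof.
move=> g hp hq pq.
have hN : h q (- x).
  by have := hdegP g (-1) hq (hdeg0 g q); rewrite scaleN1r addr0.
pose f r := if r == p then x else if r == q then - x else 0.
have := @hdeg_indep _ _ _ g [:: p; q] f _ _ _ p _; rewrite /f eqxx; apply.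
- by rewrite /= inE pq.
- move=> r; case: (eqVneq r p) => [->//|_]; case: (eqVneq r q) => [->//|_]; exact: hdeg0 g _.
- by rewrite big_cons big_seq1 eqxx eq_sym (negbTE pq) eqxx subrr.
- by rewrite inE eqxx.
Qed.

(** * Cogenerators *)

Section Generators.
Variables (K : fieldType) (G : lie12bi_generators K).
Implicit Types J I : finType.
Local Notation M := (gens G).

Definition dcomb d (u : {ffun 'I_d -> K^o}) : M bool unit :=
  \sum_(x < 2) cf u x *: delta G x.

(** The projection of the model onto the cogenerators. In the relevant arities the sum over
    increasing pairs has a single term, which labels the generator without choosing a bijection. *)
Definition phi0 J I (u : msp K J I) : M J I :=
  if (#|J| == 2%N) && (#|I| == 1%N) then
    \sum_(p : J * J | rlt p.1 p.2) \sum_(i : I) act (bpair p) (fun _ : unit => i) (dcomb u)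
  else if (#|J| == 1%N) && (#|I| == 2%N) then
    \sum_(j : J) \sum_(p : I * I | rlt p.1 p.2) act (fun _ : unit => j) (bpair p) (cf u 0 *: ell G)
  else 0.

Definition bsgn J (f : bool -> J) : K := if rlt (f false) (f true) then 1 else -1.

(** [false] is the first output of [delta], but [true] is enumerated first in [bool]; hence the
    minus sign. *)
Lemma bsgnE J (f : bool -> J) : bsgn f = - osg K f.
Proof.
rewrite /osg /ninv !big_bool /= !rltE /= !add0n !addn0 /bsgn.
by case: rlt; rewrite ?expr1 ?opprK.
Qed.

Lemma act_swapd J I (f : bool -> J) (g : unit -> I) d (u : {ffun 'I_d -> K^o}) :
  bijective f -> bijective g ->
  act (f \o negb) g (dcomb u) = - act f g (dcomb u).
Proof.
have bn : bijective negb by exists negb => -[].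
move=> bf bg; rewrite -[g in LHS]/(g \o id) -act_comp //; last exact: id_bij.
have bid := id_bij unit.
rewrite /dcomb (lin_sum (act_linear bn bid)).
rewrite -(linN (act_linear bf bg)) -sumrN; congr act; apply: eq_bigr => x _.
by rewrite (linZ (act_linear bn bid)) delta_skew scalerN.
Qed.

Lemma phi0_dE J I (f : bool -> J) (g : unit -> I) (u : msp K J I) :
  bijective f -> bijective g -> phi0 u = bsgn f *: act f g (dcomb u).
Proof.
move=> bf bg; have hJ : #|J| = 2%N by rewrite -(bij_eq_card bf) card_bool.
have hI : #|I| = 1%N by rewrite -(bij_eq_card bg) card_unit.
rewrite /phi0 hJ hI /=.
have fne : f false != f true by rewrite (inj_eq (bij_inj bf)).
have sI (F : I -> M J I) : \sum_(i : I) F i = F (g tt).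
  rewrite (bigD1 (g tt)) //= big1 ?addr0 // => i.
  by rewrite (card1_unique (g tt) i hI) eqxx.
have fsurj j : j = f false \/ j = f true.
  by case: bf => f' _ fK; rewrite -(fK j); case: (f' j); [right|left].
rewrite /bsgn; case: ifP => h; rewrite ?scale1r ?scaleN1r.
  rewrite (big_pred1 (f false, f true)) => [|[a b] /=].
    by rewrite sI; apply: eq_act => [[]|[]].
  rewrite xpair_eqE; apply/idP/andP => [|[/eqP-> /eqP->]//].
  case: (fsurj a) => ->; case: (fsurj b) => ->; rewrite ?rltE ?eqxx //.
  by move=> k; have := rlt2N (f false) (f true); rewrite h k.
have h' : rlt (f true) (f false) by rewrite (rlt_total fne) h.
rewrite (big_pred1 (f true, f false)) => [|[a b] /=].
  by rewrite sI -(act_swapd _ bf bg); apply: eq_act => [[]|[]].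
rewrite xpair_eqE; apply/idP/andP => [|[/eqP-> /eqP->]//].
by case: (fsurj a) => ->; case: (fsurj b) => ->; rewrite ?rltE ?eqxx ?h.
Qed.

Lemma act_swapl J I (f : unit -> J) (g : bool -> I) (a : K) :
  bijective f -> bijective g ->
  act f (g \o negb) (a *: ell G) = act f g (a *: ell G).
Proof.
have bn : bijective negb by exists negb => -[].
move=> bf bg; rewrite -[f in LHS]/(f \o id) -act_comp //; last exact: id_bij.
by rewrite (linZ (act_linear (id_bij _) bn)) ell_sym.
Qed.

Lemma phi0_lE J I (f : unit -> J) (g : bool -> I) (u : msp K J I) :
  bijective f -> bijective g -> phi0 u = act f g (cf u 0 *: ell G).
Proof.
move=> bf bg; have hJ : #|J| = 1%N by rewrite -(bij_eq_card bf) card_unit.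
have hI : #|I| = 2%N by rewrite -(bij_eq_card bg) card_bool.
rewrite /phi0 hJ hI /=.
have gne : g false != g true by rewrite (inj_eq (bij_inj bg)).
have sI (F : J -> M J I) : \sum_(i : J) F i = F (f tt).
  rewrite (bigD1 (f tt)) //= big1 ?addr0 // => i.
  by rewrite (card1_unique (f tt) i hJ) eqxx.
have gsurj j : j = g false \/ j = g true.
  by case: bg => f' _ fK; rewrite -(fK j); case: (f' j); [right|left].
rewrite sI; case: (boolP (rlt (g false) (g true))) => h.
  rewrite (big_pred1 (g false, g true)) => [|[a b] /=].
    by apply: eq_act => [[]|[]].
  rewrite xpair_eqE; apply/idP/andP => [|[/eqP-> /eqP->]//].
  case: (gsurj a) => ->; case: (gsurj b) => ->; rewrite ?rltE ?eqxx //.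
  by move=> k; have := rlt2N (g false) (g true); rewrite h k.
have h' : rlt (g true) (g false) by rewrite (rlt_total gne) h.
rewrite (big_pred1 (g true, g false)) => [|[a b] /=].
  by rewrite -(act_swapl _ bf bg); apply: eq_act => [[]|[]].
rewrite xpair_eqE; apply/idP/andP => [|[/eqP-> /eqP->]//].
by case: (gsurj a) => ->; case: (gsurj b) => ->; rewrite ?rltE ?eqxx ?(negbTE h).
Qed.

Definition weight1 J I := ((#|J| == 2%N) && (#|I| == 1%N)) || ((#|J| == 1%N) && (#|I| == 2%N)).

Lemma phi0_out J I (u : msp K J I) : ~~ weight1 J I -> phi0 u = 0.
Proof. by rewrite negb_or /phi0 => /andP[/negbTE-> /negbTE->]. Qed.

Variant weight1_spec J I : bool -> Prop :=
| W1d (f : bool -> J) (g : unit -> I) of bijective f & bijective g : weight1_spec J I true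
| W1l (f : unit -> J) (g : bool -> I) of bijective f & bijective g : weight1_spec J I true
| W1n : weight1_spec J I false.

Lemma weight1P J I : weight1_spec J I (weight1 J I).
Proof.
rewrite /weight1; case: (boolP (_ && _)) => [/andP[/eqP h1 /eqP h2]|_] /=.
  have [f bf] : exists f : bool -> J, bijective f by apply: card_bij; rewrite card_bool h1.
  have [g bg] : exists g : unit -> I, bijective g by apply: card_bij; rewrite card_unit h2.
  exact: W1d bf bg.
case: (boolP (_ && _)) => [/andP[/eqP h1 /eqP h2]|_] /=; last exact: W1n.
have [f bf] : exists f : unit -> J, bijective f by apply: card_bij; rewrite card_unit h1.
have [g bg] : exists g : bool -> I, bijective g by apply: card_bij; rewrite card_bool h2.
exact: W1l bf bg.
Qed.

Lemma weight1_bij J J' I I' (f : J -> J') (g : I -> I') :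
  bijective f -> bijective g -> weight1 J' I' = weight1 J I.
Proof. by move=> bf bg; rewrite /weight1 (bij_eq_card bf) (bij_eq_card bg). Qed.

Lemma dcomb_linear d (a : K) (u v : {ffun 'I_d -> K^o}) :
  dcomb (a *: u + v) = a *: dcomb u + dcomb v.
Proof.
rewrite /dcomb scaler_sumr -big_split; apply: eq_bigr => x _ /=.
by rewrite cf_linear scalerDl scalerA.
Qed.

Lemma phi0_linear J I : linear (@phi0 J I).
Proof.
move=> a u v; case: (weight1P J I) (@phi0_out J I) => [f g bf bg _|f g bf bg _|h]; last first.
- by rewrite !h // scaler0 addr0.
- rewrite !(phi0_lE _ bf bg) cf_linear scalerDl -scalerA; exact: act_linear.
- rewrite !(phi0_dE _ bf bg) dcomb_linear (act_linear bf bg) scalerDr !scalerA.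
  by rewrite [a * _]mulrC.
Qed.

Lemma phi0_act J J' I I' (f : J -> J') (g : I -> I') (u : msp K J I) :
  bijective f -> bijective g -> phi0 (mact f g u) = act f g (phi0 u).
Proof.
move=> bf bg; case E: _ / (weight1P J I) => [f0 g0 bf0 bg0|f0 g0 bf0 bg0|]; last first.
- rewrite !phi0_out ?(weight1_bij bf bg) ?E //.
  by rewrite (lin0 (act_linear bf bg)).
- have b1 := bij_comp bf bf0; have b2 := bij_comp bg bg0.
  rewrite (phi0_lE _ b1 b2) (phi0_lE _ bf0 bg0) act_comp // cf_act //.
  have -> : osg K f = 1; last by rewrite mul1r.
  rewrite /osg /ninv big1 // => a _; rewrite big1 // => b _.
  have h : #|J| = 1%N by rewrite -(bij_eq_card bf0) card_unit.
  by rewrite (card1_unique a b h) rltE.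
- have b1 := bij_comp bf bf0; have b2 := bij_comp bg bg0.
  rewrite (phi0_dE _ b1 b2) (phi0_dE _ bf0 bg0) (linZ (act_linear bf bg)) act_comp //.
  have -> : dcomb (mact f g u) = osg K f *: dcomb u.
    rewrite /dcomb scaler_sumr; apply: eq_bigr => x _.
    by rewrite cf_act // scalerA.
  rewrite (linZ (act_linear b1 b2)) scalerA; congr (_ *: _).
  by rewrite !bsgnE osg_comp ?mulNr -?mulrA ?osgK ?mulr1 //; exact: bij_inj.
Qed.

Lemma act_inj (N : bimodule K) J J' I I' (f : J -> J') (g : I -> I') :
  bijective f -> bijective g -> injective (@act K N J J' I I' f g).
Proof.
move=> bf bg x y e; case: (bf) (bg) => f' fK f'K [g' gK g'K].
have bf' : bijective f' by exists f.
have bg' : bijective g' by exists g.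
have h z : act f' g' (act f g z) = z.
  by rewrite act_comp //; transitivity (act id id z); [exact: eq_act|exact: act_id].
by rewrite -[x]h e h.
Qed.

Lemma act_surj (N : bimodule K) J J' I I' (f : J -> J') (g : I -> I') (y : N J' I') :
  bijective f -> bijective g -> exists x, y = act f g x.
Proof.
move=> bf bg; case: (bf) (bg) => f' fK f'K [g' gK g'K].
exists (act f' g' y); rewrite act_comp //; [|by exists f|by exists g].
transitivity (act id id y); first by rewrite act_id.
by apply: eq_act => ? /=; rewrite ?f'K ?g'K.
Qed.

Lemma dm_weight1d J I : #|J| = 2%N -> #|I| = 1%N -> dm J I = 2%N.
Proof. by move=> h1 h2; rewrite /dm /stable h1 h2. Qed.
Lemma dm_weight1l J I : #|J| = 1%N -> #|I| = 2%N -> dm J I = 1%N.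
Proof. by move=> h1 h2; rewrite /dm /stable h1 h2. Qed.

Lemma dcomb_inj d (u v : {ffun 'I_d -> K^o}) : (d <= 2)%N -> dcomb u = dcomb v -> u = v.
Proof.
move=> hd e; have [a [_ ua]] := delta_basis (dcomb u).
have h w : dcomb w = dcomb u -> a = (cf (w : {ffun 'I_d -> K^o}) 0, cf w 1).
  move=> ew; apply: ua; rewrite -ew /dcomb big_ord_recl big_ord1 /=.
  by congr (_ + _ *: delta G _); exact: val_inj.
have eu := h u erefl; have ev := h v (esym e).
have [e0 e1] : (cf u 0, cf u 1) = (cf v 0, cf v 1) by rewrite -eu -ev.
apply: cfP => -[|[|k]] // hk; lia.
Qed.

Lemma phi0_inj J I (u v : msp K J I) : weight1 J I -> phi0 u = phi0 v -> u = v.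
Proof.
case: (weight1P J I) => // f g bf bg _.
  have hJ : #|J| = 2%N by rewrite -(bij_eq_card bf) card_bool.
  have hI : #|I| = 1%N by rewrite -(bij_eq_card bg) card_unit.
  rewrite !(phi0_dE _ bf bg) => /(scalerI _) e.
  apply: dcomb_inj; first by rewrite dm_weight1d.
  apply: (act_inj bf bg); apply: e.
  by rewrite bsgnE oppr_eq0 osg_neq0.
have hJ : #|J| = 1%N by rewrite -(bij_eq_card bf) card_unit.
have hI : #|I| = 2%N by rewrite -(bij_eq_card bg) card_bool.
rewrite !(phi0_lE _ bf bg) => /(act_inj bf bg) e.
have [a [_ ua]] := ell_basis (cf u 0 *: ell G).
have e0 : cf u 0 = cf v 0 by rewrite -(ua _ erefl) -(ua _ e).
by apply: cfP => -[|k] // hk; have := dm_weight1l hJ hI; lia.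
Qed.

Lemma phi0_surj J I (m : M J I) : exists u, phi0 u = m.
Proof.
case E: _ / (weight1P J I) => [f g bf bg|f g bf bg|].
- have hJ : #|J| = 2%N by rewrite -(bij_eq_card bf) card_bool.
  have hI : #|I| = 1%N by rewrite -(bij_eq_card bg) card_unit.
  have [x ->] := act_surj m bf bg.
  have [[a b] [/= -> _]] := delta_basis x.
  exists (bsgn f *: ([ffun i : 'I_(dm J I) => (if val i == 0%N then a else b) : K^o] : msp K J I)).
  rewrite (linZ (@phi0_linear J I)) (phi0_dE _ bf bg) scalerA.
  have -> : bsgn f * bsgn f = 1 by rewrite bsgnE mulrNN osgK.
  rewrite scale1r /dcomb big_ord_recl big_ord1.
  rewrite !(cf_ffun _ (fun i => if i == 0%N then a else b)) dm_weight1d //=.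
  by congr act; congr (_ + _ *: delta G _); exact: val_inj.
- have hJ : #|J| = 1%N by rewrite -(bij_eq_card bf) card_unit.
  have hI : #|I| = 2%N by rewrite -(bij_eq_card bg) card_bool.
  have [x ->] := act_surj m bf bg.
  have [a [-> _]] := ell_basis x.
  exists ([ffun i : 'I_(dm J I) => a : K^o] : msp K J I).
  by rewrite (phi0_lE _ bf bg) (cf_ffun _ (fun=> a)) dm_weight1l.
- exists 0; rewrite (lin0 (@phi0_linear J I)); apply/esym/gens_zero.
  move/negbT: E; rewrite /weight1; apply: contra.
  by rewrite !inE !xpair_eqE orbC.
Qed.

(** A section of [phi0], and its inverse in the arities of the generators. In all other arities
    [phi0] has zero target and the value 0 keeps [psi] linear and equivariant. *)
Definition psi J I (m : M J I) : msp K J I :=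
  if weight1 J I then projT1 (cid (phi0_surj m)) else 0.

Lemma phi0_psi J I (m : M J I) : phi0 (psi m) = m.
Proof.
rewrite /psi; case: ifP => [_|h]; first by case: cid.
rewrite (lin0 (@phi0_linear J I)); have [u <-] := phi0_surj m.
by rewrite phi0_out ?h.
Qed.

Lemma psi_eq J I (m : M J I) u : weight1 J I -> phi0 u = m -> psi m = u.
Proof. by move=> h e; apply: phi0_inj => //; rewrite phi0_psi e. Qed.

Lemma psi_phi0 J I (u : msp K J I) : weight1 J I -> psi (phi0 u) = u.
Proof. by move=> h; exact: psi_eq. Qed.

Lemma psi_out J I (m : M J I) : ~~ weight1 J I -> psi m = 0.
Proof. by rewrite /psi => /negbTE ->. Qed.

Lemma psi_linear J I : linear (@psi J I).
Proof.
move=> a x y; case: (boolP (weight1 J I)) => h; last by rewrite !psi_out // scaler0 addr0.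
by apply: psi_eq => //; rewrite phi0_linear !phi0_psi.
Qed.

Lemma psi_act J J' I I' (f : J -> J') (g : I -> I') (m : M J I) :
  bijective f -> bijective g -> psi (act f g m) = mact f g (psi m).
Proof.
move=> bf bg; case: (boolP (weight1 J I)) => h.
  by apply: psi_eq; rewrite ?(weight1_bij bf bg) // phi0_act // phi0_psi.
by rewrite !psi_out ?(weight1_bij bf bg) // (lin0 (mact_linear bf bg)).
Qed.

Lemma phi0_hdeg J I p (u : msp K J I) : p = mdeg J \/ u = 0 -> hdeg (1 + p) (phi0 u).
Proof.
case=> [->|->]; last by rewrite (lin0 (@phi0_linear J I)); exact: hdeg0 (hdeg_grading _ _ _) _.
have g := hdeg_grading M.
case E: _ / (weight1P J I) => [f0 g0 bf bg|f0 g0 bf bg|].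
- rewrite (phi0_dE _ bf bg) /mdeg -(bij_eq_card bf) card_bool.
  rewrite -[_ *: _]addr0; apply: (hdegP (g _ _)) (hdeg0 (g _ _) _).
  apply: act_hdeg => //.
  rewrite /dcomb big_ord_recl big_ord1; apply: (hdegP (g _ _)); first exact: delta_hdeg.
  rewrite -[_ *: _]addr0; apply: (hdegP (g _ _)) (hdeg0 (g _ _) _); exact: delta_hdeg.
- rewrite (phi0_lE _ bf bg) /mdeg -(bij_eq_card bf) card_unit.
  apply: act_hdeg => //; rewrite subrr addr0.
  rewrite -[_ *: _]addr0; apply: (hdegP (g _ _)) (hdeg0 (g _ _) _); exact: ell_hdeg.
- by rewrite phi0_out ?E //; exact: hdeg0.
Qed.

Definition phi0_hom : bimod_hom (model K) (shift 1 M) :=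
  @BimodHom K (model K) (shift 1 M) phi0 phi0_linear phi0_hdeg
    (fun J J' I I' f g u bf bg => phi0_act u bf bg).

(** Every generator lies in the image of [phi0], so its degree is determined by its number of
    outputs. *)
Lemma gens_deg J I p (m : M J I) : hdeg p m -> p = 1 + mdeg J \/ m = 0.
Proof.
move=> hp; have hq : hdeg (1 + mdeg J) m.
  by rewrite -(phi0_psi m); apply: phi0_hdeg; left.
by case: (eqVneq p (1 + mdeg J)) => [->|ne]; [left|right; exact: hdeg_uniq (hdeg_grading _ _ _) hp hq ne].
Qed.

End Generators.

Definition isl (A B : Type) (u : A + B) : bool := if u is inl _ then true else false.

(** Any splitting differs only by relabelings of the two parts from the one given by the subset sent
    to the left, so two-vertex trees may be indexed by subsets. *)
Lemma split_factor (J J1 J2 : finType) (f : J -> (J1 + J2)%type) (a : {set J}) :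
  bijective f -> (forall x, (x \in a) = isl (f x)) ->
  exists (f1 : J1 -> {x | x \in a}) (f2 : J2 -> {x | x \notin a}),
    [/\ bijective f1, bijective f2 & @split_set J a =1 sumf f1 f2 \o f].
Proof.
move=> [f' fK f'K] ha.
have h1 j : f' (inl j) \in a by rewrite ha f'K.
have h2 j : f' (inr j) \notin a by rewrite ha f'K.
pose f1 j : {x | x \in a} := exist (fun x => is_true (x \in a)) (f' (inl j)) (h1 j).
pose f2 j : {x | x \notin a} := exist (fun x => is_true (x \notin a)) (f' (inr j)) (h2 j).
have g1P (y : {x | x \in a}) : exists j, f (val y) = inl j.
  by case: y => x hx /=; move: (hx); rewrite ha; case: (f x) => // j _; exists j.
have g2P (y : {x | x \notin a}) : exists j, f (val y) = inr j.
  by case: y => x hx /=; move: (hx); rewrite ha; case: (f x) => // j _; exists j.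
exists f1, f2; split.
- exists (fun y => projT1 (cid (g1P y))) => [i|y].
    by case: cid => k /=; rewrite f'K => -[].
  by apply: val_inj => /=; case: cid => k /= <-; rewrite fK.
- exists (fun y => projT1 (cid (g2P y))) => [i|y].
    by case: cid => k /=; rewrite f'K => -[].
  by apply: val_inj => /=; case: cid => k /= <-; rewrite fK.
- move=> x /=; apply: (can_inj (@joinK J a)); rewrite split_setK.
  by case e : (f x) => [i|i] /=; rewrite -e fK.
Qed.

(** * Coefficients of decompositions *)

Section Coefficients.
Variables (K : fieldType) (C : codioperad K).
Variable eps : forall J I : finType, C J I -> msp K J I.
Hypothesis eps_linear : forall J I, linear (@eps J I).
Hypothesis eps_act : forall (J J' I I' : finType) (f : J -> J') (g : I -> I') x,
  bijective f -> bijective g -> eps (act f g x) = mact f g (eps x).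
Implicit Types J I : finType.

Lemma eps_form J1 I1 J2 I2 k l :
  bilinear_form (fun (x : C J1 I1) (y : C J2 I2) => cf (eps x) k * cf (eps y) l).
Proof.
split=> [y|x] a u v /=; rewrite eps_linear cf_linear; first by rewrite mulrDl mulrA.
by rewrite mulrDr mulrCA.
Qed.

(* The coefficient of ev k (x) ev l in the decomposition of c along the
   splitting (f, g), with the sign it has in the model removed. *)
Definition splitc J I J1 I1 J2 I2 (f : J -> (J1 + J2)%type) (g : I -> (I1 + I2)%type)
    (c : C J I) (k l : nat) : K :=
  osg K f * (-1) ^+ #|J1| *
  sweedler (dec (act f g c)) (fun _ x y => cf (eps x) k * cf (eps y) l : K^o).

Lemma splitc_linear J I J1 I1 J2 I2 (f : J -> (J1 + J2)%type) (g : I -> (I1 + I2)%type) k l :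
  bijective f -> bijective g -> scalar (fun c => splitc f g c k l).
Proof.
move=> bf bg a x y; rewrite /splitc (act_linear bf bg) (dec_linear (eps_form _ _ _ _ k l)); ring.
Qed.

(** The signs of [f1] and [f2] occur twice, once in the sign of the splitting and once in the action
    on the two factors. *)
Lemma splitc_equiv J I J1 I1 J2 I2 J1' I1' J2' I2' (f : J -> (J1 + J2)%type)
    (g : I -> (I1 + I2)%type) (f1 : J1 -> J1') (f2 : J2 -> J2') (g1 : I1 -> I1') (g2 : I2 -> I2')
    (c : C J I) k l :
  bijective f -> bijective g -> bijective f1 -> bijective f2 -> bijective g1 -> bijective g2 ->
  splitc (sumf f1 f2 \o f) (sumf g1 g2 \o g) c k l = splitc f g c k l.
Proof.
move=> bf bg b1 b2 b3 b4; have bs := sumf_bij b1 b2; have bt := sumf_bij b3 b4.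
rewrite /splitc -act_comp //.
rewrite (dec_act _ b1 b3 b2 b4 (eps_form _ _ _ _ k l)) (osg_comp _ bf (bij_inj bs)) osg_sumf.
have -> : sweedler (dec (act f g c)) (fun _ x y => cf (eps (act (omap f1) g1 x)) k *
    cf (eps (act f2 (omap g2) y)) l : K^o) =
  osg K f1 * osg K f2 * sweedler (dec (act f g c)) (fun _ x y => cf (eps x) k * cf (eps y) l : K^o).
  rewrite mulr_sumr; apply: eq_bigr => t _.
  have o1 := omap_bij b1; have o4 := omap_bij b4.
  by rewrite !eps_act // !cf_act // osg_omap; ring.
rewrite -(bij_eq_card b1) (_ : _ * _ = osg K f * (-1) ^+ #|J1| * sweedler (dec (act f g c))
  (fun _ x y => cf (eps x) k * cf (eps y) l : K^o) * (osg K f1 * osg K f1) * (osg K f2 * osg K f2)); last by ring.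
by rewrite !osgK !mulr1.
Qed.

Lemma eq_splitc J I J1 I1 J2 I2 (f f' : J -> (J1 + J2)%type) (g g' : I -> (I1 + I2)%type)
    (c : C J I) k l : f =1 f' -> g =1 g' -> splitc f g c k l = splitc f' g' c k l.
Proof. by move=> /funext -> /funext ->. Qed.

End Coefficients.

(** * Corelations in terms of coefficients *)

Section Reduction.
Variables (K : fieldType) (G : lie12bi_generators K) (P : dioperad K) (j : bimod_hom G P).
Variables (C : codioperad K) (phi : bimod_hom C (shift 1 G)).
Implicit Types J I : finType.

(** The projection to the cogenerators, read in the coordinates of the model; it is zero outside the
    arities of the generators. *)
Definition geps J I (c : C J I) : msp K J I := psi (phi J I c : gens G J I).

Lemma geps_linear J I : linear (@geps J I).
Proof. by move=> a x y; rewrite /geps (@bh_linear _ _ _ phi) psi_linear. Qed.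

Lemma geps_act J J' I I' (f : J -> J') (g : I -> I') (x : C J I) :
  bijective f -> bijective g -> geps (act f g x) = mact f g (geps x).
Proof. by move=> bf bg; rewrite /geps (bh_act phi) //; exact: (psi_act (G := G)). Qed.

Definition pgen J I (k : nat) : P J I := j J I (phi0 G (ev K (dm J I) k)).

Lemma pgen_act J J' I I' (f : J -> J') (g : I -> I') k :
  bijective f -> bijective g -> act f g (pgen J I k) = osg K f *: pgen J' I' k.
Proof.
move=> bf bg; rewrite /pgen -bh_act // -phi0_act // mact_ev //.
by rewrite (linZ (@phi0_linear K G _ _)) (linZ (@bh_linear _ _ _ j _ _)).
Qed.

Lemma jphiE J I (c : C J I) :
  j J I (phi J I c) = \sum_(k < dm J I) cf (geps c) k *: pgen J I k.
Proof.
rewrite -[phi J I c](phi0_psi (G := G)) -/(geps c) {1}(ev_sum (geps c)).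
rewrite (lin_sum (@phi0_linear K G _ _)) (lin_sum (@bh_linear _ _ _ j _ _)).
apply: eq_bigr => k _.
by rewrite (linZ (@phi0_linear K G _ _)) (linZ (@bh_linear _ _ _ j _ _)).
Qed.

Definition gcomp J1 I1 J2 I2 (A : nat -> nat -> K) : P (J1 + J2)%type (I1 + I2)%type :=
  \sum_(k < dm (option J1) I1) \sum_(l < dm J2 (option I2))
    A k l *: comp (pgen (option J1) I1 k) (pgen J2 (option I2) l).

Lemma gcompE J1 I1 J2 I2 A : gcomp J1 I1 J2 I2 A =
  \sum_(0 <= k < dm (option J1) I1) \sum_(0 <= l < dm J2 (option I2))
    A k l *: comp (pgen (option J1) I1 k) (pgen J2 (option I2) l).
Proof. by rewrite big_mkord; apply: eq_bigr => k _; rewrite big_mkord. Qed.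

Lemma comp_suml J1 I1 J2 I2 (T : Type) (r : seq T) (F : T -> P (option J1) I1) (y : P J2 (option I2)) :
  comp (\sum_(i <- r) F i) y = \sum_(i <- r) comp (F i) y.
Proof. exact: (lin_sum (comp_linearl y)). Qed.
Lemma comp_sumr J1 I1 J2 I2 (T : Type) (r : seq T) (x : P (option J1) I1) (F : T -> P J2 (option I2)) :
  comp x (\sum_(i <- r) F i) = \sum_(i <- r) comp x (F i).
Proof. exact: (lin_sum (comp_linearr x)). Qed.
Lemma comp_Zl J1 I1 J2 I2 a (x : P (option J1) I1) (y : P J2 (option I2)) :
  comp (a *: x) y = a *: comp x y.
Proof. exact: (linZ (comp_linearl y)). Qed.
Lemma comp_Zr J1 I1 J2 I2 a (x : P (option J1) I1) (y : P J2 (option I2)) :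
  comp x (a *: y) = a *: comp x y.
Proof. exact: (linZ (comp_linearr x)). Qed.

(** The sign [ksgn K p] can be taken out of the sum: a term whose upper factor survives [phi] has
    the degree of a generator, so [p] is [- #|J1|]. *)
Lemma dec_gcomp J1 I1 J2 I2 (c : C (J1 + J2)%type (I1 + I2)%type) (s : K) (A : nat -> nat -> K) :
  (forall k l, s * (-1) ^+ #|J1| * sweedler (dec c) (fun _ x y => cf (geps x) k * cf (geps y) l : K^o) = A k l) ->
  s *: sweedler (dec c) (fun p x y => ksgn K p *: comp (j _ _ (phi _ _ x)) (j _ _ (phi _ _ y)))
  = gcomp J1 I1 J2 I2 A.
Proof.
move=> hA; rewrite /sweedler.
transitivity (s *: \sum_(t <- dec c) (-1) ^+ #|J1| *: comp (j _ _ (phi _ _ t.1.2)) (j _ _ (phi _ _ t.2))).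
  congr (_ *: _); rewrite !big_seq; apply: eq_bigr => t ht.
  have h := @bh_hdeg _ _ _ phi _ _ _ _ (dec_hdegl ht).
  have [e|->] := gens_deg (h : hdeg (1 + t.1.1) (phi _ _ t.1.2 : gens G _ _)).
    have -> : t.1.1 = - #|J1|%:Z.
      by move: e => /(addrI 1) ->; rewrite /mdeg card_option intS opprD addrA subrr add0r.
    by rewrite ksgnN ksgn_nat.
  rewrite (lin0 (@bh_linear _ _ _ j _ _)).
  by rewrite (lin0 (comp_linearl _)) !scaler0.
under eq_bigr => t _.
  rewrite !jphiE comp_suml scaler_sumr.
  under eq_bigr => k _.
    rewrite comp_Zl comp_sumr !scaler_sumr.
    under eq_bigr => l _ do rewrite comp_Zr !scalerA.
    over.
  over.
rewrite exchange_big scaler_sumr /=; apply: eq_bigr => k _.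
rewrite exchange_big scaler_sumr /=; apply: eq_bigr => l _.
rewrite -scaler_suml scalerA -hA; congr (_ *: _).
rewrite -mulrA; congr (_ * _); rewrite /sweedler mulr_sumr; apply: eq_bigr => t _.
by rewrite mulrA.
Qed.

Lemma gcomp_act J1 I1 J2 I2 J1' I1' J2' I2' (f1 : J1 -> J1') (f2 : J2 -> J2')
    (g1 : I1 -> I1') (g2 : I2 -> I2') A :
  bijective f1 -> bijective f2 -> bijective g1 -> bijective g2 ->
  act (sumf f1 f2) (sumf g1 g2) (gcomp J1 I1 J2 I2 A) =
  (osg K f1 * osg K f2) *: gcomp J1' I1' J2' I2' A.
Proof.
move=> b1 b2 b3 b4; have bs := sumf_bij b1 b2; have bt := sumf_bij b3 b4.
have o1 := omap_bij b1; have o4 := omap_bij b4.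
rewrite !gcompE (lin_sum (act_linear bs bt)) scaler_sumr.
apply: eq_bign => [|k _]; first by rewrite (dm_bij o1 b3).
rewrite (lin_sum (act_linear bs bt)) scaler_sumr.
apply: eq_bign => [|l _]; first by rewrite (dm_bij b2 o4).
rewrite (linZ (act_linear bs bt)) -comp_act // !pgen_act // comp_Zl comp_Zr.
by rewrite !scalerA osg_omap; congr (_ *: _); ring.
Qed.

Lemma desuspended_split J I (c : C J I) :
  desuspended_dec (fun J I x => j J I (phi J I x)) c =
  \sum_(a : {set J}) \sum_(b : {set I}) act (@join J a) (@join I b)
    (osg K (@split_set J a) *: gcomp _ _ _ _ (splitc geps (@split_set J a) (@split_set I b) c)).
Proof.
rewrite /desuspended_dec; apply: eq_bigr => a _; apply: eq_bigr => b _; congr act.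
have h k l : osg K (@split_set J a) * (-1) ^+ #|{: {x | x \in a}}| *
   sweedler (dec (act (@split_set J a) (@split_set I b) c)) (fun _ x y => cf (geps x) k * cf (geps y) l : K^o)
   = splitc geps (@split_set J a) (@split_set I b) c k l by [].
by rewrite -(dec_gcomp h) scalerA osgK scale1r.
Qed.

(** The splittings in [desuspended_dec] involve sigma types; they may be replaced by any concrete
    splitting with the same left parts, whose sign then appears. *)
Lemma split_term J I J1 I1 J2 I2 (f : J -> (J1 + J2)%type) (g : I -> (I1 + I2)%type) f' g'
    (a : {set J}) (b : {set I}) (c : C J I) :
  cancel f f' -> cancel f' f -> cancel g g' -> cancel g' g ->
  (forall x, (x \in a) = isl (f x)) -> (forall x, (x \in b) = isl (g x)) ->
  act (@join J a) (@join I b)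
    (osg K (@split_set J a) *: gcomp _ _ _ _ (splitc geps (@split_set J a) (@split_set I b) c))
  = osg K f *: act f' g' (gcomp J1 I1 J2 I2 (splitc geps f g c)).
Proof.
move=> fK f'K gK g'K ha hb.
have bf : bijective f by exists f'. have bf' : bijective f' by exists f.
have bg : bijective g by exists g'. have bg' : bijective g' by exists g.
have [f1 [f2 [b1 b2 ef]]] := split_factor bf ha.
have [g1 [g2 [b3 b4 eg]]] := split_factor bg hb.
have bs := sumf_bij b1 b2; have bt := sumf_bij b3 b4.
have -> : gcomp {x | x \in a} {x | x \in b} {x | x \notin a} {x | x \notin b}
     (splitc geps (@split_set J a) (@split_set I b) c) =
  gcomp {x | x \in a} {x | x \in b} {x | x \notin a} {x | x \notin b} (splitc geps f g c).
  apply: eq_bigr => k _; apply: eq_bigr => l _; congr (_ *: _).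
  rewrite -(splitc_equiv geps_linear geps_act _ _ _ bf bg b1 b2 b3 b4); exact: eq_splitc.
have -> : gcomp {x | x \in a} {x | x \in b} {x | x \notin a} {x | x \notin b} (splitc geps f g c)
  = (osg K f1 * osg K f2) *: act (sumf f1 f2) (sumf g1 g2) (gcomp J1 I1 J2 I2 (splitc geps f g c)).
  by rewrite gcomp_act // scalerA mulrACA !osgK mul1r scale1r.
rewrite (linZ (act_linear (join_bij a) (join_bij b))) (linZ (act_linear (join_bij a) (join_bij b))).
rewrite act_comp //; [|exact: join_bij|exact: join_bij].
rewrite scalerA; congr (_ *: _).
  rewrite (funext ef) (osg_comp _ bf (bij_inj bs)) osg_sumf.
  by rewrite -mulrA mulrACA !osgK !mulr1.
apply: eq_act => [u|u] /=.
  by rewrite -{1}[u]f'K -[X in join X = _]/((sumf f1 f2 \o f) _) -ef split_setK.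
by rewrite -{1}[u]g'K -[X in join X = _]/((sumf g1 g2 \o g) _) -eg split_setK.
Qed.

Lemma gcomp_out J1 I1 J2 I2 A : ~~ (weight1 (option J1) I1 && weight1 J2 (option I2)) ->
  gcomp J1 I1 J2 I2 A = 0.
Proof.
move=> h; rewrite /gcomp big1 // => k _; rewrite big1 // => l _.
rewrite /pgen; case: (boolP (weight1 (option J1) I1)) h => [_ /= h|h _].
  by rewrite [phi0 G (ev K (dm J2 _) l)]phi0_out // (lin0 (@bh_linear _ _ _ j _ _)) (lin0 (comp_linearr _)) scaler0.
by rewrite phi0_out // (lin0 (@bh_linear _ _ _ j _ _)) (lin0 (comp_linearl _)) scaler0.
Qed.

End Reduction.

(** * Two-vertex trees *)

Section SetSums.
Variables (V : nmodType) (J : finType).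

Lemma sum_card1 (F : {set J} -> V) : (forall a : {set J}, #|a| != 1%N -> F a = 0) ->
  \sum_a F a = \sum_x F [set x].
Proof.
move=> h; rewrite (bigID (fun a : {set J} => #|a| == 1%N)) /= [X in _ + X]big1 ?addr0 //.
rewrite -(big_imset _ (in2W set1_inj)) /=; apply: eq_bigl => a.
by apply/cards1P/imsetP => [[x ->]|[x _ ->]]; exists x.
Qed.

Lemma sum_cardC1 (F : {set J} -> V) : (forall a : {set J}, #|~: a| != 1%N -> F a = 0) ->
  \sum_a F a = \sum_x F (~: [set x]).
Proof.
move=> h; rewrite (reindex_inj (@setC_inj J)) /= sum_card1 // => a ha.
by apply: h; rewrite setCK.
Qed.

Lemma sum_card0 (F : {set J} -> V) : (forall a : {set J}, #|a| != 0%N -> F a = 0) ->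
  \sum_a F a = F set0.
Proof.
move=> h; rewrite (bigD1 set0) //= big1 ?addr0 // => a a0; apply: h.
by rewrite cards_eq0.
Qed.
Lemma sum_cardC0 (F : {set J} -> V) : (forall a : {set J}, #|~: a| != 0%N -> F a = 0) ->
  \sum_a F a = F (~: set0).
Proof.
move=> h; rewrite (reindex_inj (@setC_inj J)) /= sum_card0 // => a ha.
by apply: h; rewrite setCK.
Qed.
End SetSums.

Lemma card_sigin (J : finType) (a : {set J}) : #|{: {x | x \in a}}| = #|a|.
Proof. by rewrite card_sig; apply: eq_card => x; rewrite !inE. Qed.

Lemma card_signotin (J : finType) (a : {set J}) : #|{: {x | x \notin a}}| = #|~: a|.
Proof. by rewrite card_sig; apply: eq_card => x; rewrite !inE. Qed.

Lemma rlt_ord n (i j : 'I_n) : rlt i j = (i < j)%N.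
Proof. by rewrite /rlt !index_enum_ord. Qed.

(** [cutr] and [cutl] isolate [k] and list the two other labels in cyclic order after it, as in the
    arguments [(ordS k) (ordS (ordS k)) k] of the quadratic composites. *)
Definition cutr (k x : 'I_3) : (bool + unit)%type :=
  if x == k then inr tt else inl (x == ordS (ordS k)).
Definition cutrV (k : 'I_3) (u : (bool + unit)%type) : 'I_3 :=
  match u with inl false => ordS k | inl true => ordS (ordS k) | inr _ => k end.
Definition cutl (k x : 'I_3) : (unit + bool)%type :=
  if x == k then inl tt else inr (x == ordS (ordS k)).
Definition cutlV (k : 'I_3) (u : (unit + bool)%type) : 'I_3 :=
  match u with inr false => ordS k | inr true => ordS (ordS k) | inl _ => k end.

Lemma cutrK k : cancel (cutr k) (cutrV k).
Proof.
by case: k => -[|[|[|//]]] hk; case=> -[|[|[|//]]] hx; rewrite /cutr /= -?val_eqE /=; exact: val_inj.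
Qed.
Lemma cutrVK k : cancel (cutrV k) (cutr k).
Proof.
by case: k => -[|[|[|//]]] hk; case=> [[]|[]]; rewrite /cutr /= -?val_eqE /=.
Qed.
Lemma cutlK k : cancel (cutl k) (cutlV k).
Proof.
by case: k => -[|[|[|//]]] hk; case=> -[|[|[|//]]] hx; rewrite /cutl /= -?val_eqE /=; exact: val_inj.
Qed.
Lemma cutlVK k : cancel (cutlV k) (cutl k).
Proof.
by case: k => -[|[|[|//]]] hk; case=> [[]|[]]; rewrite /cutl /= -?val_eqE /=.
Qed.

Definition cutb (k x : bool) : (unit + unit)%type := if x == k then inl tt else inr tt.
Definition cutbV (k : bool) (u : (unit + unit)%type) : bool := if u is inl _ then k else ~~ k.
Lemma cutbK k : cancel (cutb k) (cutbV k). Proof. by case: k => -[]. Qed.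
Lemma cutbVK k : cancel (cutbV k) (cutb k). Proof. by case: k => -[[]|[]]. Qed.

(** The sign is independent of [k] because cyclic rotations of three labels are even; it is -1
    because [ordS k] goes to [false], which is enumerated after [true]. *)
Lemma osg_cutl (K : fieldType) k : osg K (cutl k) = -1.
Proof.
have h (b : bool) : (b < 1)%N = ~~ b by case: b.
rewrite /osg /ninv !big_ord_recl !big_ord0 !rlt_ord /=.
case: k => -[|[|[|//]]] hk; rewrite /cutl /= -?val_eqE /= ?rltE /=. all: by rewrite -signr_odd expr1.
Qed.

Lemma osg_cutb (K : fieldType) k : osg K (cutb k) = if k then 1 else -1.
Proof.
by rewrite /osg /ninv !big_bool /= !rltE /=; case: k; rewrite /cutb /= !rltE.
Qed.

(** Global copies of the relabelings that are local to the section defining the relations. *)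
Definition oonly (u : unit) : option void := None.
Definition ofirst (b : bool) : option unit := if b then Some tt else None.
Definition osecond (b : bool) : option unit := if b then None else Some tt.

Lemma oonly_bij : bijective oonly.
Proof. by exists (fun=> tt) => [[]|[[]|]]. Qed.
Lemma ofirst_bij : bijective ofirst.
Proof. by exists (fun o => if o is Some _ then true else false) => [[]|[[]|]]. Qed.
Lemma osecond_bij : bijective osecond.
Proof. by exists (fun o => if o is Some _ then false else true) => [[]|[[]|]]. Qed.

Section WeightTwo.
Variables (K : fieldType) (G : lie12bi_generators K) (P : dioperad K) (j : bimod_hom G P).
Variables (C : codioperad K) (phi : bimod_hom C (shift 1 G)).
Let L := j _ _ (ell G).
Let D x := j _ _ (delta G x).
Let desus J I (c : C J I) := desuspended_dec (fun J I x => j J I (phi J I x)) c.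

Lemma pgen_l (J I : finType) (f : unit -> J) (g : bool -> I) :
  bijective f -> bijective g -> pgen j J I 0 = act f g L.
Proof.
move=> bf bg; rewrite /pgen (phi0_lE _ _ bf bg).
have hJ : #|J| = 1%N by rewrite -(bij_eq_card bf) card_unit.
have hI : #|I| = 2%N by rewrite -(bij_eq_card bg) card_bool.
by rewrite cf_ev ?dm_weight1l // eqxx scale1r bh_act.
Qed.

Lemma pgen_d (J I : finType) (f : bool -> J) (g : unit -> I) (x : 'I_2) :
  bijective f -> bijective g -> pgen j J I x = bsgn K f *: act f g (D x).
Proof.
move=> bf bg; rewrite /pgen (phi0_dE _ _ bf bg).
have hJ : #|J| = 2%N by rewrite -(bij_eq_card bf) card_bool.
have hI : #|I| = 1%N by rewrite -(bij_eq_card bg) card_unit.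
rewrite (linZ (@bh_linear _ _ _ j _ _)) bh_act //; congr (_ *: act _ _ (j _ _ _)).
rewrite /dcomb (bigD1 x) //= cf_ev ?dm_weight1d // eqxx scale1r big1 ?addr0 // => y hy.
by rewrite cf_ev ?dm_weight1d // val_eqE (negbTE hy) scale0r.
Qed.

Definition dterm (J I : finType) (c : C J I) (a : {set J}) (b : {set I}) : P J I :=
  act (@join J a) (@join I b)
    (osg K (@split_set J a) *: gcomp j _ _ _ _ (splitc (geps phi) (@split_set J a) (@split_set I b) c)).

Lemma term_out (J I : finType) (c : C J I) (a : {set J}) (b : {set I}) :
  ~~ (weight1 (option {x | x \in a}) {x | x \in b} && weight1 {x | x \notin a} (option {x | x \notin b})) ->
  act (@join J a) (@join I b)
    (osg K (@split_set J a) *: gcomp j _ _ _ _ (splitc (geps phi) (@split_set J a) (@split_set I b) c)) = 0.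
Proof.
move=> h; rewrite gcomp_out // scaler0.
by rewrite (lin0 (act_linear (join_bij a) (join_bij b))).
Qed.

(** Both vertices must have the arity of [ell]; counting labels leaves the trees whose upper vertex
    has two of the three inputs and the edge as only output. *)
Lemma desus_13 (c : C unit 'I_3) : desus c =
  \sum_(k : 'I_3) splitc (geps phi) (@inr void unit) (cutr k) c 0 0 *:
     ell_ell L (ordS k) (ordS (ordS k)) k.
Proof.
rewrite /desus desuspended_split sum_card0 => [|a ha]; last first.
  rewrite big1 // => b _; apply: term_out; rewrite /weight1 !card_option !card_sigin !card_signotin.
  by have := cardsC a; rewrite card_unit; move: ha; lia.
rewrite sum_cardC1 => [|b hb]; last first.
  apply: term_out; rewrite /weight1 !card_option !card_sigin !card_signotin.
  by have := cardsC b; rewrite card_ord cards0; move: hb; lia.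
apply: eq_bigr => k _.
rewrite (@split_term _ _ _ j _ phi _ _ _ _ _ _ (@inr void unit) (cutr k) (@unvoidl unit) (cutrV k)) //;
  try by [case=> [[]|]|exact: cutrK|exact: cutrVK].
- rewrite /osg ninv_inr scale1r gcompE !dm_weight1l ?card_optvoid ?card_unit ?card_bool ?card_option ?card_unit //.
  rewrite !big_nat1 (pgen_l oonly_bij (id_bij _)) (pgen_l (id_bij _) ofirst_bij).
  rewrite (linZ (act_linear (unvoidl_bij _) _)); last by exists (cutr k); [exact: cutrVK|exact: cutrK].
  by congr (_ *: _); apply: eq_act => -[[]|[]].
- by move=> x; rewrite in_set0.
- by move=> x; rewrite in_setC in_set1 /cutr; case: eqP.
Qed.

(** Counting forces two vertices of the arity of [delta], the upper one with the input and a single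
    output [k]. The sign of [cutl k] cancels that of the lower [delta]. *)
Lemma desus_31 (c : C 'I_3 unit) : desus c =
  \sum_(k : 'I_3) \sum_(x < 2) \sum_(y < 2) splitc (geps phi) (cutl k) (@inl unit void) c x y *:
     delta_delta D x y (ordS k) (ordS (ordS k)) k.
Proof.
have bV k : bijective (cutlV k) by exists (cutl k); [exact: cutlVK|exact: cutlK].
rewrite /desus desuspended_split sum_card1 => [|a ha]; last first.
  rewrite big1 // => b _; apply: term_out; rewrite /weight1 !card_option !card_sigin !card_signotin.
  by have := cardsC a; have := cardsC b; rewrite card_ord card_unit; move: ha; lia.
apply: eq_bigr => k _.
rewrite sum_cardC0 => [|b hb]; last first.
  apply: term_out; rewrite /weight1 !card_option !card_sigin !card_signotin cards1.
  by have := cardsC b; rewrite card_unit; move: hb; lia.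
rewrite (@split_term _ _ _ j _ phi _ _ _ _ _ _ (cutl k) (@inl unit void) (cutlV k) (@unvoidr unit)) //;
  try by [case=> [|[]]|exact: cutlK|exact: cutlVK].
- rewrite osg_cutl gcompE !dm_weight1d ?card_optvoid ?card_unit ?card_bool ?card_option ?card_unit //.
  rewrite big_mkord -(linZ (act_linear (bV k) (unvoidr_bij _))) scaler_sumr.
  rewrite (lin_sum (act_linear (bV k) (unvoidr_bij _))); apply: eq_bigr => x _.
  rewrite big_mkord scaler_sumr (lin_sum (act_linear (bV k) (unvoidr_bij _))).
  apply: eq_bigr => y _.
  rewrite (pgen_d x ofirst_bij (id_bij _)) (pgen_d y (id_bij _) oonly_bij).
  rewrite /bsgn /= !rltE /= scale1r (linZ (comp_linearr _)) !scaleN1r scalerN opprK.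
  rewrite (linZ (act_linear (bV k) (unvoidr_bij _))).
  by congr (_ *: _); apply: eq_act => -[[]|[]].
- by move=> x; rewrite in_set1 /cutl; case: eqP.
- by move=> x; rewrite in_setC in_set0.
Qed.

(** Two kinds of trees remain: [ell] above [delta], and [delta] above [ell] with one output and one
    input at the upper vertex. The minus sign of the first comes from [bsgn] on [bool]; that of the
    second from [cutb k] and from marking the second output of [delta]. *)
Lemma desus_22 (c : C bool bool) : desus c =
  - (\sum_(x < 2) splitc (geps phi) (@inr void bool) (@inl bool void) c 0 x *: delta_ell L D x)
  + \sum_(k : bool) \sum_(i : bool) \sum_(x < 2) (if k then -1 else 1) *: (
     splitc (geps phi) (cutb k) (cutb i) c x 0 *: cross L D x i (~~ i) k (~~ k)).
Proof.
have bV k : bijective (cutbV k) by exists (cutb k); [exact: cutbVK|exact: cutbK].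
pose F (a b : {set bool}) := dterm c a b.
have F0 (a b : {set bool}) : ~~ (((#|a| == 0%N) && (#|~: b| == 0%N)) || ((#|a| == 1%N) && (#|b| == 1%N))) -> F a b = 0.
  move=> h; apply: term_out; rewrite /weight1 !card_option !card_sigin !card_signotin.
  by have := cardsC b; have := cardsC a; rewrite card_bool; move: h; lia.
rewrite /desus desuspended_split.
rewrite -[LHS]/(\sum_a \sum_b F a b).
have -> : \sum_a \sum_b F a b = F set0 (~: set0) + \sum_k \sum_i F [set k] [set i].
  rewrite (bigD1 set0) //= sum_cardC0 => [|b hb]; last by apply: F0; rewrite cards0 (negbTE hb).
  congr (_ + _).
  transitivity (\sum_a (if a != set0 then \sum_b F a b else 0)); first by rewrite -big_mkcond.
  rewrite sum_card1 => [|a ha]; last first.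
    case: ifP => // a0; rewrite big1 // => b _; apply: F0.
    by rewrite cards_eq0 (negbTE a0) (negbTE ha).
  apply: eq_bigr => k _; have -> : [set k] != set0 by rewrite -cards_eq0 cards1.
  by rewrite sum_card1 // => b hb; apply: F0; rewrite !cards1 (negbTE hb).
congr (_ + _).
  rewrite /F /dterm (@split_term _ _ _ j _ phi _ _ _ _ _ _ (@inr void bool) (@inl bool void) (@unvoidl bool) (@unvoidr bool)) //;
    try by [case=> [[]|]|case=> [|[]]].
  - rewrite /osg ninv_inr scale1r gcompE (@dm_weight1l _ bool) ?card_optvoid ?card_bool // big_nat1.
    rewrite dm_weight1d ?card_optvoid ?card_bool // big_mkord.
    rewrite (lin_sum (act_linear (unvoidl_bij _) (unvoidr_bij _))) -sumrN; apply: eq_bigr => x _.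
    rewrite (pgen_l oonly_bij (id_bij _)) (pgen_d x (id_bij _) oonly_bij).
    rewrite /bsgn /= !rltE /= (linZ (comp_linearr _)) scaleN1r scalerN.
    by rewrite (linN (act_linear (unvoidl_bij _) (unvoidr_bij _))) (linZ (act_linear (unvoidl_bij _) (unvoidr_bij _))).
  - by move=> x; rewrite in_set0.
  - by move=> x; rewrite in_setC in_set0.
apply: eq_bigr => k _; apply: eq_bigr => i _.
rewrite /F /dterm (@split_term _ _ _ j _ phi _ _ _ _ _ _ (cutb k) (cutb i) (cutbV k) (cutbV i)) //;
  try by [exact: cutbK|exact: cutbVK].
- rewrite osg_cutb gcompE dm_weight1d ?card_option ?card_unit // dm_weight1l ?card_option ?card_unit //.
  rewrite big_mkord (lin_sum (act_linear (bV k) (bV i))) scaler_sumr; apply: eq_bigr => x _.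
  rewrite big_nat1 (pgen_d x osecond_bij (id_bij _)) (pgen_l (id_bij _) ofirst_bij).
  rewrite /bsgn /= !rltE /= (linZ (comp_linearl _)) scaleN1r scalerN.
  rewrite (linN (act_linear (bV k) (bV i))) (linZ (act_linear (bV k) (bV i))).
  rewrite /cross.
  have -> (X : P bool bool) : (if k then 1 else -1) *: - X = (if k then -1 else 1) *: X.
    by case: k; rewrite ?scaleN1r ?scale1r ?opprK.
  by congr (_ *: (_ *: _)); apply: eq_act => -[[]|[]].
- by move=> x; rewrite in_set1 /cutb; case: eqP.
- by move=> x; rewrite in_set1 /cutb; case: eqP.
Qed.

End WeightTwo.

Lemma set_reindex (V : nmodType) (J J' : finType) (h : J -> J') (F : {set J'} -> V) :
  bijective h -> \sum_a F a = \sum_(a : {set J}) F (h @: a).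
Proof.
move=> [h' hK h'K]; rewrite (reindex (fun a : {set J} => h @: a)) //=.
exists (fun a : {set J'} => h' @: a) => a _; rewrite -imset_comp.
  by rewrite -[RHS]imset_id; apply: eq_imset.
by rewrite -[RHS]imset_id; apply: eq_imset.
Qed.

(** * Naturality of the desuspended decomposition *)

Section Natural.
Variables (K : fieldType) (G : lie12bi_generators K) (P : dioperad K) (j : bimod_hom G P).
Variables (C : codioperad K) (phi : bimod_hom C (shift 1 G)).
Implicit Types J I : finType.
Let desus J I (c : C J I) := desuspended_dec (fun J I x => j J I (phi J I x)) c.

Lemma splitc_act (eps : forall J I, C J I -> msp K J I) J I J' I' J1 I1 J2 I2
    (h : J -> J') (k : I -> I') (f : J' -> (J1 + J2)%type) (g : I' -> (I1 + I2)%type) (c : C J I) :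
  bijective h -> bijective k -> bijective f -> bijective g ->
  forall a b, splitc eps f g (act h k c) a b = osg K h * splitc eps (f \o h) (g \o k) c a b.
Proof.
move=> bh bk bf bg a b; rewrite /splitc act_comp // (osg_comp _ bh (bij_inj bf)).
by rewrite !mulrA osgK mul1r.
Qed.

(** This reduces each arity to one standard choice among [unit], [bool] and ['I_3]. The sign of [h]
    occurs once in the splitting and once in its coefficients, and cancels. *)
Lemma desus_natural J I J' I' (h : J -> J') (k : I -> I') (c : C J I) :
  bijective h -> bijective k -> desus (act h k c) = act h k (desus c).
Proof.
move=> bh bk; rewrite /desus !desuspended_split (set_reindex _ bh).
rewrite (lin_sum (act_linear bh bk)); apply: eq_bigr => a _.
rewrite (set_reindex _ bk) (lin_sum (act_linear bh bk)); apply: eq_bigr => b _.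
case: (bh) (bk) => h' hK h'K [k' kK k'K].
have bh' : bijective h' by exists h. have bk' : bijective k' by exists k.
rewrite (@split_term _ _ _ j _ phi _ _ _ _ _ _ (@split_set J a \o h') (@split_set I b \o k')
  (h \o @join J a) (k \o @join I b)).
- rewrite (osg_comp _ bh' (bij_inj (split_bij a))).
  have -> : osg K h' = osg K h.
    have := osg_comp K bh (bij_inj bh').
    rewrite (_ : h' \o h = id); last by apply/funext.
    by rewrite osg_id => e; rewrite -[LHS]mul1r -(osgK K h) -mulrA -e mulr1.
  have E x y : splitc (geps phi) (@split_set J a \o h') (@split_set I b \o k') (act h k c) x y =
     osg K h * splitc (geps phi) (@split_set J a) (@split_set I b) c x y.
    rewrite splitc_act //; [|by apply: bij_comp => //; exact: split_bij..].
    by congr (_ * _); apply: eq_splitc => z /=; rewrite ?hK ?kK.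
  have -> : gcomp j {x | x \in a} {x | x \in b} {x | x \notin a} {x | x \notin b}
     (splitc (geps phi) (@split_set J a \o h') (@split_set I b \o k') (act h k c)) =
     osg K h *: gcomp j {x | x \in a} {x | x \in b} {x | x \notin a} {x | x \notin b}
      (splitc (geps phi) (@split_set J a) (@split_set I b) c).
    rewrite /gcomp scaler_sumr; apply: eq_bigr => x _; rewrite scaler_sumr; apply: eq_bigr => y _.
    by rewrite E scalerA.
  have b1 := join_bij a; have b2 := join_bij b.
  rewrite -[act (h \o _) _ _]act_comp // !(linZ (act_linear b1 b2)) !(linZ (act_linear bh bk)).
  by rewrite scalerA mulrAC osgK mul1r.
- by move=> x /=; rewrite split_setK h'K.
- by move=> x /=; rewrite hK joinK.
- by move=> x /=; rewrite split_setK k'K.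
- by move=> x /=; rewrite kK joinK.
- move=> x /=; rewrite -{1}[x]h'K (mem_imset _ _ (bij_inj bh)).
  by pattern (@split_set J a (h' x)); apply: split_setP => h0 /=; rewrite ?h0 ?(negbTE h0).
- move=> x /=; rewrite -{1}[x]k'K (mem_imset _ _ (bij_inj bk)).
  by pattern (@split_set I b (k' x)); apply: split_setP => h0 /=; rewrite ?h0 ?(negbTE h0).
Qed.

Lemma desus_out J I (c : C J I) :
  (#|J|, #|I|) \notin [:: (1, 3); (3, 1); (2, 2)]%N -> desus c = 0.
Proof.
move=> h; rewrite /desus desuspended_split big1 // => a _; rewrite big1 // => b _.
apply: term_out; move: h; rewrite !inE !xpair_eqE /weight1 !card_option !card_sigin !card_signotin.
by have := cardsC b; have := cardsC a; lia.
Qed.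
End Natural.

(** * The model satisfies the corelations *)

Section ModelCorelations.
Variables (K : fieldType) (P : lie12bi K).
Local Notation G := (lb_gens P).
Implicit Types J I : finType.

Lemma model_splitc J I J1 I1 J2 I2 (f : J -> (J1 + J2)%type) (g : I -> (I1 + I2)%type)
  (eps : forall J I, model K J I -> msp K J I) (u : msp K J I) k l :
  bijective f -> bijective g ->
  (forall J I, linear (@eps J I)) ->
  (forall u, eps (option J1) I1 u = u) -> (forall u, eps J2 (option I2) u = u) ->
  (k < dm (option J1) I1)%N -> (l < dm J2 (option I2))%N ->
  splitc (C := model K) eps f g u k l = cf u (k + l).
Proof.
move=> bf bg elin e1 e2 hk hl; rewrite /splitc /=.
rewrite (@mdecT K _ _ _ _ _ (fun x y => cf (eps _ _ x) k * cf (eps _ _ y) l)); last exact: (eps_form (C := model K) elin).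
under eq_big_nat => a /andP[_ ha].
  under eq_big_nat => b /andP[_ hb].
    rewrite e1 e2 !cf_ev // cf_act // (_ : _ * _ * _ = (l == b)%:R * ((-1) ^+ #|J1| * osg K f * cf u (a + b) * (k == a)%:R)); last by ring.
    over.
  rewrite (big_nat_eq (fun b => (-1) ^+ #|J1| * osg K f * cf u (a + b) * (k == a)%:R)) // mulrC.
  over.
rewrite (big_nat_eq (fun a => (-1) ^+ #|J1| * osg K f * cf u (a + l))) //.
rewrite (_ : _ * _ = (osg K f * osg K f) * ((-1) ^+ #|J1| * (-1) ^+ #|J1|) * cf u (k + l)); last by ring.
by rewrite osgK -exprMn mulrNN mulr1 expr1n !mul1r.
Qed.

Lemma geps_model J I (u : msp K J I) : weight1 J I -> geps (phi0_hom G) u = u.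
Proof. by move=> h; rewrite /geps /= psi_phi0. Qed.

Lemma model_splitc1 J I J1 I1 J2 I2 (f : J -> (J1 + J2)%type) (g : I -> (I1 + I2)%type)
  (u : msp K J I) k l :
  bijective f -> bijective g -> weight1 (option J1) I1 -> weight1 J2 (option I2) ->
  (k < dm (option J1) I1)%N -> (l < dm J2 (option I2))%N ->
  splitc (C := model K) (geps (phi0_hom G)) f g u k l = cf u (k + l).
Proof.
move=> bf bg w1 w2; apply: model_splitc => //.
- exact: geps_linear.
- by move=> v; exact: geps_model.
- by move=> v; exact: geps_model.
Qed.

(** The coefficients of two-vertex trees are [cf u (x + y)], so the sum regroups into multiples of
    the relations. In arity (3, 1) the indices 0 and 2 carry the co-Jacobi relations of [delta 0]
    and [delta 1], and index 1 carries the mixed one. *)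
Lemma model_corelations : corelations (lb_incl P) (phi0_hom G).
Proof.
have [r1 r2 r3 r4] := lb_relations P.
move=> J I c.
case: (boolP ((#|J|, #|I|) \in [:: (1, 3); (3, 1); (2, 2)]%N)) => [|/(desus_out (lb_incl P) (phi0_hom G))//].
have o0 : inord 0 = 0 :> 'I_3 by apply: val_inj; rewrite /= inordK.
have o1 : inord 1 = 1 :> 'I_3 by apply: val_inj; rewrite /= inordK.
have o2 : inord 2 = (2%:R : 'I_3) by apply: val_inj; rewrite /= inordK.
have s0 : ordS (0 : 'I_3) = 1 by apply: val_inj.
have s1 : ordS (1 : 'I_3) = 2%:R by apply: val_inj.
have s2 : ordS (2%:R : 'I_3) = 0 by apply: val_inj.
have l1 : lift ord0 (ord0 : 'I_2) = (1 : 'I_3) by apply: val_inj.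
have l2 : lift ord0 (lift ord0 (ord0 : 'I_1)) = (2%:R : 'I_3) by apply: val_inj.
have m1 : lift ord0 (ord0 : 'I_1) = (1 : 'I_2) by apply: val_inj.
rewrite !inE !xpair_eqE => /orP[|/orP[]] /andP[/eqP hJ /eqP hI].
- have [f bf] : exists f : unit -> J, bijective f by apply: card_bij; rewrite card_unit hJ.
  have [g bg] : exists g : 'I_3 -> I, bijective g by apply: card_bij; rewrite card_ord hI.
  have [u ->] := act_surj c bf bg.
  rewrite (desus_natural (lb_incl P) (phi0_hom G)) //.
  rewrite (desus_13 (lb_incl P) (phi0_hom G)).
  under eq_bigr => k _.
    rewrite model_splitc1 ?dm_weight1l /weight1 ?card_optvoid ?card_option ?card_unit ?card_bool //; last 2 first.
    + by exists (@unvoidl unit) => // -[[]|].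
    + by exists (cutrV k); [exact: cutrK|exact: cutrVK].
    over.
  rewrite -scaler_sumr !big_ord_recl big_ord0 addr0 l1 l2.
  rewrite -[ord0]/(0 : 'I_3) !(s0, s1, s2, o0, o1, o2) in r1 *.
  rewrite (_ : _ + _ = 0) ?scaler0; first by rewrite (lin0 (act_linear bf bg)).
  by rewrite addrA addrC addrA.
- have [f bf] : exists f : 'I_3 -> J, bijective f by apply: card_bij; rewrite card_ord hJ.
  have [g bg] : exists g : unit -> I, bijective g by apply: card_bij; rewrite card_unit hI.
  have [u ->] := act_surj c bf bg.
  rewrite (desus_natural (lb_incl P) (phi0_hom G)) //.
  rewrite (desus_31 (lb_incl P) (phi0_hom G)).
  pose dd x y k := delta_delta (fun x => lb_incl P _ _ (delta G x)) x y (ordS k) (ordS (ordS k)) k.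
  pose SS x y := \sum_k dd x y k.
  have SE x y : SS x y = delta_delta (fun x => lb_incl P _ _ (delta G x)) x y (inord 0) (inord 1) (inord 2)
     + delta_delta (fun x => lb_incl P _ _ (delta G x)) x y (inord 1) (inord 2) (inord 0)
     + delta_delta (fun x => lb_incl P _ _ (delta G x)) x y (inord 2) (inord 0) (inord 1).
    rewrite /SS /dd !big_ord_recl big_ord0 addr0 l1 l2 -[ord0]/(0 : 'I_3) !(s0, s1, s2, o0, o1, o2).
    by rewrite addrA addrC addrA.
  transitivity (act f g (\sum_(x < 2) \sum_(y < 2) cf (u : msp K 'I_3 unit) (x + y) *: SS x y)).
    congr act; rewrite exchange_big; apply: eq_bigr => x _; rewrite exchange_big; apply: eq_bigr => y _.
    rewrite scaler_sumr; apply: eq_bigr => k _.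
    rewrite model_splitc1 ?dm_weight1d /weight1 ?card_optvoid ?card_option ?card_unit ?card_bool //.
    + by exists (cutlV k); [exact: cutlK|exact: cutlVK].
    + by exists (@unvoidr unit) => // -[|[]].
  rewrite !big_ord_recl !big_ord0 /= !addr0 m1 -[ord0]/(0 : 'I_2) !SE !r2 !scaler0 add0r addr0.
  rewrite -scalerDr (_ : _ + _ = 0) ?scaler0; first by rewrite (lin0 (act_linear bf bg)).
  by rewrite -[RHS]r3 [LHS](AC (3*3) ((1*4)*(2*5)*(3*6))).
- have [f bf] : exists f : bool -> J, bijective f by apply: card_bij; rewrite card_bool hJ.
  have [g bg] : exists g : bool -> I, bijective g by apply: card_bij; rewrite card_bool hI.
  have [u ->] := act_surj c bf bg.
  rewrite (desus_natural (lb_incl P) (phi0_hom G)) //.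
  rewrite (desus_22 (lb_incl P) (phi0_hom G)).
  pose cr x i k := cross (lb_incl P _ _ (ell G)) (fun x => lb_incl P _ _ (delta G x)) x i (~~ i) k (~~ k).
  pose de x := delta_ell (lb_incl P _ _ (ell G)) (fun x => lb_incl P _ _ (delta G x)) x.
  transitivity (act f g (\sum_(x < 2) cf (u : msp K bool bool) x *: (
      - de x + (\sum_(k : bool) \sum_(i : bool) (if k then -1 else 1) *: cr x i k)))).
    congr act; rewrite -sumrN.
    have -> : \sum_(k : bool) \sum_(i : bool) \sum_(x < 2) (if k then -1 else 1) *: (
      splitc (geps (phi0_hom G)) (cutb k) (cutb i) u x 0 *: cr x i k)
      = \sum_(x < 2) \sum_(k : bool) \sum_(i : bool) (if k then -1 else 1) *: (
       splitc (geps (phi0_hom G)) (cutb k) (cutb i) u x 0 *: cr x i k).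
      under eq_bigr => k _ do rewrite exchange_big.
      by rewrite exchange_big.
    rewrite -big_split; apply: eq_bigr => x _; rewrite scalerDr; congr (_ + _).
      rewrite model_splitc1 ?(dm_weight1d card_bool card_optvoid) ?(dm_weight1l card_optvoid card_bool)
        /weight1 ?card_optvoid ?card_option ?card_unit ?card_bool //.
      + by rewrite add0n scalerN.
      + by exists (@unvoidl bool) => // -[[]|].
      + by exists (@unvoidr bool) => // -[|[]].
    rewrite scaler_sumr; apply: eq_bigr => k _; rewrite scaler_sumr; apply: eq_bigr => i _.
    rewrite model_splitc1 ?(dm_weight1d (etrans (card_option _) (congr1 S card_unit)) card_unit) ?(dm_weight1l card_unit (etrans (card_option _) (congr1 S card_unit))) /weight1 ?card_optvoid ?card_option ?card_unit ?card_bool //.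
    + by rewrite addn0 !scalerA mulrC.
    + by exists (cutbV k); [exact: cutbK|exact: cutbVK].
    + by exists (cutbV i); [exact: cutbK|exact: cutbVK].
  rewrite big1 ?(lin0 (act_linear bf bg)) // => x _.
  rewrite !big_bool /= !scaleN1r !scale1r.
  rewrite (_ : _ + _ = 0) ?scaler0 //.
  rewrite -[RHS]oppr0 -(r4 x) /cr /de /=; rewrite !opprD !opprK.
  by rewrite [LHS](AC (1*(2*2)) (1*5*4*3*2)).
Qed.

End ModelCorelations.

Lemma desus_hom (K : fieldType) (C : codioperad K) (D D' : dioperad K) (h : dioperad_hom D D')
    (F : forall J I : finType, C J I -> D J I) (J I : finType) (c : C J I) :
  h _ _ (desuspended_dec F c) = desuspended_dec (fun J I x => h J I (F J I x)) c.
Proof.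
rewrite /desuspended_dec (lin_sum (@bh_linear _ _ _ h _ _)); apply: eq_bigr => a _.
rewrite (lin_sum (@bh_linear _ _ _ h _ _)); apply: eq_bigr => b _.
rewrite bh_act; [|exact: join_bij..]; congr act; rewrite /sweedler.
rewrite (lin_sum (@bh_linear _ _ _ h _ _)); apply: eq_bigr => t _.
by rewrite (linZ (@bh_linear _ _ _ h _ _)) dh_comp.
Qed.

(** * The generators in the test dioperad *)

Section TestHom.
Variables (K : fieldType) (G : lie12bi_generators K).
Implicit Types J I : finType.
Local Notation D := (test_dioperad K).

Definition sep (J : finType) (j : J) (j' : J) : bool := j' != j.
Definition tt_of (I : finType) (i : I) : unit := tt.

Lemma sep_bij J (j : J) : #|J| = 2%N -> bijective (sep j).
Proof.
move=> h; apply: inj_card_bij; last by rewrite h card_bool.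
move=> a b; rewrite /sep; case: (eqVneq a j) => [->|ha]; case: (eqVneq b j) => [->|hb] // _.
apply/eqP; apply/negPn/negP => ab.
have u : uniq [:: a; b; j] by rewrite /= !inE negb_or ab ha hb.
by have := max_card (mem [:: a; b; j]); rewrite (card_uniqP u) h.
Qed.

(** The coordinate at [j] is the coefficient in the labeling where [j] is the first output; the
    minus sign offsets that of [bsgn] on [bool]. For [ell] the sum over both labelings avoids a
    choice and doubles the coefficient: this is the origin of the factors 2 and 4 in the coordinates
    of the composites. *)
Definition tcoef J I (m : gens G J I) (z : yix J I) : K :=
  match z with
  | inl (inl (x, j)) => if (#|J| == 2%N) && (#|I| == 1%N)
      then - cf (psi (act (sep j) (@tt_of I) m : gens G bool unit)) x else 0
  | inl (inr _) => if (#|J| == 1%N) && (#|I| == 2%N)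
      then \sum_(i : I) cf (psi (act (@tt_of J) (sep i) m : gens G unit bool)) 0 else 0
  | inr _ => 0
  end.

Definition tmap J I (m : gens G J I) : D J I := (0, [ffun z => tcoef m z]).

Lemma tmap_linear J I : linear (@tmap J I).
Proof.
move=> a m m'; apply: dsp_eq => /=; first by rewrite scaler0 addr0.
apply/ffunP => -[[[x j]|[]]|z]; rewrite !ffunE /=; last by rewrite addr0; exact/esym/mulr0.
- case: ifP => [/andP[/eqP h1 /eqP h2]|_]; last by rewrite addr0; exact/esym/mulr0.
  rewrite (act_linear (sep_bij j h1) (to_unit_bij _ h2)) psi_linear cf_linear opprD.
  by rewrite -mulrN.
- case: ifP => [/andP[/eqP h1 /eqP h2]|_]; last by rewrite addr0; exact/esym/mulr0.
  rewrite scaler_sumr -big_split; apply: eq_bigr => i _ /=.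
  by rewrite (act_linear (to_unit_bij _ h1) (sep_bij i h2)) psi_linear cf_linear.
Qed.

Lemma tmap_act J J' I I' (f : J -> J') (g : I -> I') (m : gens G J I) :
  bijective f -> bijective g -> tmap (act f g m) = act f g (tmap m).
Proof.
move=> bf bg; apply: dsp_eq => /=; first by rewrite (lin0 (uact_linear f g)).
case: (bf) (bg) => f' fK f'K [g' gK g'K].
apply/ffunP => z; rewrite (yactV _ _ fK f'K gK g'K) !ffunE.
case: z => [[[x j]|[]]|[[[? []]|[? []]]|[]]] //=; rewrite -(bij_eq_card bf) -(bij_eq_card bg);
  case: ifP => // /andP[/eqP h1 /eqP h2].
- rewrite act_comp //; [|apply: sep_bij; by rewrite -(bij_eq_card bf)|apply: to_unit_bij; by rewrite -(bij_eq_card bg)].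
  rewrite (@eq_act _ _ _ _ _ _ _ (sep (f' j)) _ (@tt_of I)) // => k; rewrite /sep /= -{1}[j]f'K.
  by rewrite (inj_eq (bij_inj bf)).
- rewrite (reindex g) /=; last by exists g' => ? _.
  apply: eq_bigr => i _; rewrite act_comp //;
   [|apply: to_unit_bij; by rewrite -(bij_eq_card bf)|apply: sep_bij; by rewrite -(bij_eq_card bg)].
  rewrite (@eq_act _ _ _ _ _ _ _ (@tt_of J) _ (sep i)) // => k; rewrite /sep /=.
  by rewrite (inj_eq (bij_inj bg)).
Qed.

Lemma tmap_hdeg J I p (m : gens G J I) : hdeg p m -> hdeg p (tmap m).
Proof.
move=> hm; split; first by right.
move=> z hz; rewrite ffunE; have [e|->] := gens_deg hm; last first.
  have E : tmap (0 : gens G J I) = 0 by exact: (lin0 (@tmap_linear J I)).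
  by have := congr1 (fun X : D J I => X.2 z) E; rewrite /= !ffunE.
move: hz; rewrite e /mdeg; case: z => [[[x j]|[]]|z] //=; case: ifP => // /andP[/eqP-> _] //.
Qed.

Definition test_hom : bimod_hom G D :=
  @BimodHom K G D tmap tmap_linear tmap_hdeg
    (fun J J' I I' f g m bf bg => tmap_act m bf bg).

Definition tL : ysp K unit bool := (tmap (ell G)).2.
Definition tD (x : 'I_2) : ysp K bool unit := (tmap (delta G x)).2.

Lemma tL_l : yl tL = 2%:R.
Proof.
rewrite /yl /tL /= ffunE /= card_unit card_bool /=.
have psiE : psi (ell G) = ev K _ 0.
  apply: psi_eq; first by rewrite /weight1 card_unit card_bool.
  rewrite (phi0_lE _ _ (id_bij _) (id_bij _)) act_id.
  by rewrite cf_ev ?(dm_weight1l card_unit card_bool) // eqxx scale1r.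
have c1 : cf (psi (ell G)) 0 = 1.
  by rewrite psiE cf_ev ?(dm_weight1l card_unit card_bool) // eqxx.
rewrite big_bool /=.
have -> : act (@tt_of unit) (sep true) (ell G) = ell G.
  by rewrite -[RHS]ell_sym; apply: eq_act => -[].
have -> : act (@tt_of unit) (sep false) (ell G) = ell G.
  by rewrite -[RHS](act_id (b := G)); apply: eq_act => -[].
by rewrite c1.
Qed.

Lemma tL_d x j : yd tL x j = 0.
Proof. by rewrite /yd /tL /= ffunE /= card_unit. Qed.

Lemma tD_l x : yl (tD x) = 0.
Proof. by rewrite /yl /tD /= ffunE /= card_bool. Qed.

Lemma tD_d x y b : yd (tD x) y b = (x == y)%:R * (if b then -1 else 1).
Proof.
rewrite /yd /tD /= ffunE /= card_unit card_bool /=.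
have psiE : psi (delta G x) = - ev K _ x.
  apply: psi_eq; first by rewrite /weight1 card_unit card_bool.
  rewrite (phi0_dE _ _ (id_bij _) (id_bij _)) act_id /bsgn /= rltE /= scaleN1r.
  rewrite -scaleN1r -(linZ (@dcomb_linear _ G _)) scaleN1r opprK.
  rewrite /dcomb (bigD1 x) //= cf_ev ?(dm_weight1d card_bool card_unit) // eqxx scale1r big1 ?addr0 // => y' hy.
  by rewrite cf_ev ?(dm_weight1d card_bool card_unit) // val_eqE (negbTE hy) scale0r.
have cN d (u : {ffun 'I_d -> K^o}) k : cf (- u) k = - cf u k.
  by rewrite -scaleN1r -[-1 *: u]addr0 cf_linear mulN1r /cf; case: insub => [i|] /=; rewrite ?ffunE addr0.
have c1 : cf (psi (delta G x)) y = - (x == y)%:R.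
  by rewrite psiE cN cf_ev ?(dm_weight1d card_bool card_unit) // val_eqE eq_sym.
case: b.
  have -> : act (sep true) (@tt_of unit) (delta G x) = - delta G x.
    by rewrite -delta_skew; apply: eq_act => -[].
  rewrite -scaleN1r (linZ (@psi_linear _ G _ _)) scaleN1r cN c1; ring.
have -> : act (sep false) (@tt_of unit) (delta G x) = delta G x.
  by rewrite -[RHS](act_id (b := G)); apply: eq_act => -[].
rewrite c1; ring.
Qed.

Definition tin J I (F : ysp K J I) : D J I := (0, F).

Lemma tin_act J J' I I' (f : J -> J') (g : I -> I') (F : ysp K J I) :
  act f g (tin F) = tin (yact f g F).
Proof. by apply: dsp_eq => //=; exact: (lin0 (uact_linear f g)). Qed.

Lemma tin_comp J1 I1 J2 I2 (F : ysp K (option J1) I1) (F' : ysp K J2 (option I2)) :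
  comp (tin F) (tin F') = tin (ymu F F').
Proof.
apply: dsp_eq => /=; first exact: umul0l.
by rewrite (lin0 (lam_linl _)) (lin0 (rho_linr _)) !addr0.
Qed.

Lemma yl_act J J' I I' (f : J -> J') (g : I -> I') (F : ysp K J I) :
  bijective f -> bijective g -> yl (yact f g F) = yl F.
Proof. by move=> [f' h1 h2] [g' h3 h4]; rewrite /yl (yactV _ _ h1 h2 h3 h4). Qed.

Lemma yd_act J J' I I' (f : J -> J') (g : I -> I') (F : ysp K J I) x j :
  bijective f -> bijective g -> yd (yact f g F) x (f j) = yd F x j.
Proof. by move=> [f' h1 h2] [g' h3 h4]; rewrite /yd (yactV _ _ h1 h2 h3 h4) /= h1. Qed.

Lemma ell_ellT (k : 'I_3) (z : yix unit 'I_3) :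
  (ell_ell (test_hom _ _ (ell G)) (ordS k) (ordS (ordS k)) k).2 z =
  if z is inr (inr (p, q)) then 4%:R * ((p == k)%:R - (q == k)%:R) else 0.
Proof.
have [e1 e2] := (id_bij bool, id_bij unit).
have -> : ell_ell (test_hom _ _ (ell G)) (ordS k) (ordS (ordS k)) k =
   act (@unvoidl unit) (cutrV k) (comp (act oonly id (tin tL)) (act id ofirst (tin tL))).
  by apply: eq_act => -[[]|[]].
rewrite !tin_act tin_comp tin_act /=.
rewrite (@yactV _ _ _ _ _ _ _ (@inr void unit) (cutr k));
  [|by case=> [[]|]|by []|exact: cutrVK|exact: cutrK].
have d1 x : yd (yact oonly id tL) x None = 0.
  by rewrite -[None]/(oonly tt) (yd_act _ _ _ oonly_bij e1) tL_d.
have d2 x j : yd (yact id ofirst tL) x j = 0.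
  by rewrite -[j]/(id j) (yd_act _ _ _ e2 ofirst_bij) tL_d.
have l1 : yl (yact oonly id tL) = 2%:R by rewrite (yl_act _ oonly_bij e1) tL_l.
have l2 : yl (yact id ofirst tL) = 2%:R by rewrite (yl_act _ e2 ofirst_bij) tL_l.
rewrite /ymu ffunE; case: z => [[[x j]|u]|[[[[x y] [p q]]|[x [k' i]]]|[p q]]] //=.
- by rewrite /muE /= addr0.
- by rewrite d2 mulr0 oppr0.
- rewrite l1 l2 -natrM; congr (_ * (_ - _)); rewrite /cutr; by case: eqP.
Qed.

(** The coordinate at [q] of a lower [delta] with outputs [ordS k] and [ordS (ordS k)]. As a
    function of both arguments it is the cyclic orientation of the three labels. *)
Definition rsgn (k q : 'I_3) : K :=
  if q == k then 0 else if q == ordS (ordS k) then -1 else 1.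

Lemma delta_deltaT (x y : 'I_2) (k : 'I_3) (z : yix 'I_3 unit) :
  (delta_delta (fun x => test_hom _ _ (delta G x)) x y (ordS k) (ordS (ordS k)) k).2 z =
  if z is inr (inl (inl (xy, (p, q)))) then
    ((x == xy.1) && (y == xy.2) && (p == k))%:R * rsgn k q
    + ((x == xy.2) && (y == xy.1) && (q == k))%:R * rsgn k p else 0.
Proof.
have [e1 e2] := (id_bij bool, id_bij unit).
have -> : delta_delta (fun x => test_hom _ _ (delta G x)) x y (ordS k) (ordS (ordS k)) k =
   act (cutlV k) (@unvoidr unit) (comp (act ofirst id (tin (tD x))) (act id oonly (tin (tD y)))).
  by apply: eq_act => -[[]|[]].
rewrite !tin_act tin_comp tin_act /=.
rewrite (@yactV _ _ _ _ _ _ _ (cutl k) (@inl unit void));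
  [|exact: cutlVK|exact: cutlK|by case=> [|[]]|by []].
have d1 x' : yd (yact ofirst id (tD x)) x' None = (x == x')%:R.
  by rewrite -[None]/(ofirst false) (yd_act _ _ _ ofirst_bij e2) tD_d mulr1.
have d2 x' j : yd (yact id oonly (tD y)) x' j = (y == x')%:R * (if j then -1 else 1).
  by rewrite -[in LHS]/(id j) (yd_act _ _ _ e1 oonly_bij) tD_d.
have l1 : yl (yact ofirst id (tD x)) = 0 by rewrite (yl_act _ ofirst_bij e2) tD_l.
have l2 : yl (yact id oonly (tD y)) = 0 by rewrite (yl_act _ e1 oonly_bij) tD_l.
rewrite /ymu ffunE; case: z => [[[x' j]|u]|[[[[x' y'] [p q]]|[x' [k' []]]]|[p q]]] //=.
- rewrite /muE /rsgn /cutl /=.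
  case: (p == k); case: (q == k) => /=; rewrite ?andbF ?andbT ?mul0r ?mulr0 ?addr0 ?add0r //.
    by rewrite d1 d2 mulrA -mulnb natrM.
  by rewrite d1 d2 mulrA -mulnb natrM.
- by rewrite /cutl; case: ifP => _; rewrite ?l2 ?mulr0 // l1 mul0r oppr0.
- by rewrite l1 !mul0r.
Qed.

Definition sgnb (k : bool) : K := if k then -1 else 1.

Lemma delta_ellT (x : 'I_2) (z : yix bool bool) :
  (delta_ell (test_hom _ _ (ell G)) (fun x => test_hom _ _ (delta G x)) x).2 z =
  if z is inr (inl (inr (x', (k, i)))) then - 2%:R * ((x == x')%:R * sgnb k) else 0.
Proof.
have [e1 e2] := (id_bij bool, id_bij unit).
have -> : delta_ell (test_hom _ _ (ell G)) (fun x => test_hom _ _ (delta G x)) x =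
   act (@unvoidl bool) (@unvoidr bool) (comp (act oonly id (tin tL)) (act id oonly (tin (tD x)))) by [].
rewrite !tin_act tin_comp tin_act /=.
rewrite (@yactV _ _ _ _ _ _ _ (@inr void bool) (@inl bool void));
  [|by case=> [[]|]|by []|by case=> [|[]]|by []].
have d1 x' : yd (yact oonly id tL) x' None = 0.
  by rewrite -[None]/(oonly tt) (yd_act _ _ _ oonly_bij e1) tL_d.
have d2 x' j : yd (yact id oonly (tD x)) x' j = (x == x')%:R * sgnb j.
  by rewrite -[in LHS]/(id j) (yd_act _ _ _ e1 oonly_bij) tD_d.
have l1 : yl (yact oonly id tL) = 2%:R by rewrite (yl_act _ oonly_bij e1) tL_l.
rewrite /ymu ffunE; case: z => [[[x' j]|u]|[[[[x' y'] [p q]]|[x' [k i]]]|[p q]]] //=.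
- by rewrite /muE /= addr0.
- by rewrite l1 d2 mulNr.
- by rewrite subrr mulr0.
Qed.

Lemma crossT (x : 'I_2) (i k : bool) (z : yix bool bool) :
  (cross (test_hom _ _ (ell G)) (fun x => test_hom _ _ (delta G x)) x i (~~ i) k (~~ k)).2 z =
  if z is inr (inl (inr (x', (k', i')))) then
     - 2%:R * ((x == x') && (k' == k) && (i' == i))%:R else 0.
Proof.
have [e1 e2] := (id_bij bool, id_bij unit).
have -> : cross (test_hom _ _ (ell G)) (fun x => test_hom _ _ (delta G x)) x i (~~ i) k (~~ k) =
   act (cutbV k) (cutbV i) (comp (act osecond id (tin (tD x))) (act id ofirst (tin tL))).
  by apply: eq_act => -[[]|[]].
rewrite !tin_act tin_comp tin_act /=.
rewrite (@yactV _ _ _ _ _ _ _ (cutb k) (cutb i));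
  [|exact: cutbVK|exact: cutbK|exact: cutbVK|exact: cutbK].
have d1 x' : yd (yact osecond id (tD x)) x' None = - (x == x')%:R.
  by rewrite -[None]/(osecond true) (yd_act _ _ _ osecond_bij e2) tD_d mulrN1.
have d2 x' j : yd (yact id ofirst tL) x' j = 0.
  by rewrite -[j]/(id j) (yd_act _ _ _ e2 ofirst_bij) tL_d.
have l1 : yl (yact osecond id (tD x)) = 0 by rewrite (yl_act _ osecond_bij e2) tD_l.
have l2 : yl (yact id ofirst tL) = 2%:R by rewrite (yl_act _ e2 ofirst_bij) tL_l.
rewrite /ymu ffunE; case: z => [[[x' j]|u]|[[[[x' y'] [p q]]|[x' [k' i']]]|[p q]]] //=.
- by rewrite /muE /cutb; case: (p == k); case: (q == k); rewrite /= ?d2 ?mulr0 ?addr0.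
- rewrite /cutb; case: (k' == k); case: (i' == i); rewrite /= ?andbT ?andbF ?mulr0 ?l1 ?mul0r ?oppr0 //.
  by rewrite d1 l2 mulrC mulrN mulNr.
- by rewrite l1 mul0r mul0r.
Qed.

End TestHom.

Lemma D_eq (K : fieldType) (J I : finType) (X Y : test_dioperad K J I) :
  (#|J| == 1%N) && (#|I| == 1%N) = false -> X.2 = Y.2 -> X = Y.
Proof. by move=> h e; apply: dsp_eq => //; apply: uv_eq; rewrite !uv_out. Qed.

Lemma D_sum2 (K : fieldType) (J I : finType) (T : Type) (r : seq T) (F : T -> test_dioperad K J I) z :
  (\sum_(i <- r) F i).2 z = \sum_(i <- r) (F i).2 z.
Proof.
by elim: r => [|i r IH]; rewrite ?big_nil ?ffunE // !big_cons -IH ffunE.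
Qed.

Lemma D_add2 (K : fieldType) (J I : finType) (X Y : test_dioperad K J I) z :
  (X + Y).2 z = X.2 z + Y.2 z.
Proof. by rewrite ffunE. Qed.
Lemma D_opp2 (K : fieldType) (J I : finType) (X : test_dioperad K J I) z :
  (- X).2 z = - X.2 z.
Proof. by rewrite ffunE. Qed.

Lemma ord3_inord : (inord 0 = ordS (inord 2) :> 'I_3) * (inord 1 = ordS (inord 0) :> 'I_3) *
  (inord 2 = ordS (inord 1) :> 'I_3).
Proof. by split; [split|]; apply: val_inj; rewrite /= !inordK. Qed.

Section TestRelations.
Variables (K : fieldType) (G : lie12bi_generators K).

Lemma rsgn_anti (p q : 'I_3) : rsgn K p q + rsgn K q p = 0.
Proof.
case: p q => -[|[|[|//]]] h [] [|[|[|//]]] h'; rewrite /rsgn -!val_eqE /= ?addr0 ?subrr ?addNr //.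
Qed.

(** In coordinates: the indicators of [p] and [q] cancel in the cyclic sum of [ell_ell]; the
    co-Jacobi relations reduce to the antisymmetry of [rsgn]; and a coordinate [(x, (k, i))] meets
    [delta_ell x] and exactly one cross, with opposite contributions. *)
Lemma test_relations : lie12bi_relations (test_hom G _ _ (ell G)) (fun x => test_hom G _ _ (delta G x)).
Proof.
have [[o0 o1] o2] := ord3_inord.
pose EE k := ell_ell (test_hom G _ _ (ell G)) (ordS k) (ordS (ordS k)) k.
pose DD x y k := delta_delta (fun x => test_hom G _ _ (delta G x)) x y (ordS k) (ordS (ordS k)) k.
have e3 : ell_ell (test_hom G _ _ (ell G)) (inord 0) (inord 1) (inord 2) = EE (inord 2) by rewrite /EE -o0 -o1.
have e1 : ell_ell (test_hom G _ _ (ell G)) (inord 1) (inord 2) (inord 0) = EE (inord 0) by rewrite /EE -o1 -o2.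
have e2 : ell_ell (test_hom G _ _ (ell G)) (inord 2) (inord 0) (inord 1) = EE (inord 1) by rewrite /EE -o2 -o0.
have d3 x y : delta_delta (fun x => test_hom G _ _ (delta G x)) x y (inord 0) (inord 1) (inord 2) = DD x y (inord 2) by rewrite /DD -o0 -o1.
have d1 x y : delta_delta (fun x => test_hom G _ _ (delta G x)) x y (inord 1) (inord 2) (inord 0) = DD x y (inord 0) by rewrite /DD -o1 -o2.
have d2 x y : delta_delta (fun x => test_hom G _ _ (delta G x)) x y (inord 2) (inord 0) (inord 1) = DD x y (inord 1) by rewrite /DD -o2 -o0.
have all3 (V : nmodType) (F : 'I_3 -> V) : F (inord 2) + F (inord 0) + F (inord 1) = \sum_i F i.
  have -> : inord 0 = ord0 :> 'I_3 by apply: val_inj; rewrite /= inordK.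
  have -> : inord 1 = lift ord0 ord0 :> 'I_3 by apply: val_inj; rewrite /= inordK.
  have -> : inord 2 = lift ord0 (lift ord0 ord0) :> 'I_3 by apply: val_inj; rewrite /= inordK.
  by rewrite !big_ord_recl big_ord0 addr0 -addrA addrC -addrA.
have pick1 (p : 'I_3) (F : 'I_3 -> K) : \sum_k (p == k)%:R * F k = F p.
  rewrite (bigD1 p) //= eqxx mul1r big1 ?addr0 // => i.
  by rewrite eq_sym => /negbTE->; rewrite mul0r.
have pick1' (p : 'I_3) : \sum_k (p == k)%:R = 1 :> K.
  by rewrite -[RHS](pick1 p (fun=> 1)); apply: eq_bigr => k _; rewrite mulr1.
have n13 : (#|{: unit}| == 1%N) && (#|{: 'I_3}| == 1%N) = false by rewrite card_ord andbF.
have n31 : (#|{: 'I_3}| == 1%N) && (#|{: unit}| == 1%N) = false by rewrite card_ord.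
have n22 : (#|{: bool}| == 1%N) && (#|{: bool}| == 1%N) = false by rewrite card_bool.
split.
- rewrite e1 e2 e3 all3; apply: (D_eq n13); apply/ffunP => z; rewrite D_sum2 [RHS]ffunE.
  under eq_bigr do rewrite ell_ellT.
  case: z => [z|[z|[p q]]]; try by rewrite big1.
  by rewrite -mulr_sumr sumrB !pick1' subrr mulr0.
- move=> x; rewrite d1 d2 d3 all3; apply: (D_eq n31); apply/ffunP => z; rewrite D_sum2 [RHS]ffunE.
  under eq_bigr do rewrite delta_deltaT.
  case: z => [z|[[[[x' y'] [p q]]|z]|z]] /=; try by rewrite big1.
  rewrite big_split /= [(x == x') && _]andbC; case: ((x == y') && (x == x')); last first.
    by rewrite !big1 ?addr0 // => k _; rewrite mul0r.
  by rewrite !pick1 rsgn_anti.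
- rewrite !d1 !d2 !d3 (all3 _ (fun k => DD 0 1 k + DD 1 0 k)).
  apply: (D_eq n31); apply/ffunP => z; rewrite D_sum2 [RHS]ffunE.
  under eq_bigr do rewrite D_add2 !delta_deltaT.
  case: z => [z|[[[[x' y'] [p q]]|z]|z]] /=; try by rewrite big1 // => k _; rewrite addr0.
  rewrite ![(_ == y') && _]andbC.
  set b01 := (0 == x') && (1 == y'); set b10 := (1 == x') && (0 == y').
  transitivity (\sum_k (b01%:R * ((p == k)%:R * rsgn K k q) + b10%:R * ((q == k)%:R * rsgn K k p)
    + (b10%:R * ((p == k)%:R * rsgn K k q) + b01%:R * ((q == k)%:R * rsgn K k p)))).
    by apply: eq_bigr => k _; rewrite -!mulnb !natrM !mulrA.
  rewrite !big_split /= -!mulr_sumr !pick1.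
  transitivity ((b01%:R + b10%:R) * (rsgn K p q + rsgn K q p)); last by rewrite rsgn_anti mulr0.
  move: (b01%:R : K) (b10%:R : K) (rsgn K p q) (rsgn K q p) => x y u v; ring.
- move=> x.
  pose c i k := cross (test_hom G _ _ (ell G)) (fun x => test_hom G _ _ (delta G x)) x i (~~ i) k (~~ k).
  pose de := delta_ell (test_hom G _ _ (ell G)) (fun x => test_hom G _ _ (delta G x)) x.
  have aux (t u v w r : test_dioperad K bool bool) z : (t - u - v + w + r).2 z =
      t.2 z - u.2 z - v.2 z + w.2 z + r.2 z by rewrite !D_add2 !D_opp2.
  apply: (D_eq n22); apply/ffunP => z; rewrite [RHS]ffunE.
  transitivity ((de - c false false - c true false + c false true + c true true).2 z); first by [].
  have cE i k : (c i k).2 z = _ := crossT G x i k z.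
  have dE : de.2 z = _ := delta_ellT G x z.
  clearbody c de.
  refine (etrans (aux de (c false false) (c true false) (c false true) (c true true) z) _).
  rewrite dE.
  rewrite !cE; clear cE dE.
  case: z => [z|[[z|[x' [k i]]]|z]]; rewrite ?subr0 ?addr0 //.
  by case: (x == x'); case: k; case: i; rewrite /sgnb /=; ring.
Qed.
End TestRelations.

Lemma D_lin (K : fieldType) (J I : finType) (T : finType) (a : T -> K) (X : T -> test_dioperad K J I) z :
  (\sum_i a i *: X i).2 z = \sum_i a i * (X i).2 z.
Proof. by rewrite D_sum2; apply: eq_bigr => i _; rewrite ffunE. Qed.

(** * Linear constraints forced by the corelations *)

Section WeightTwoRelations.
Variables (K : fieldType) (P : lie12bi K).
Local Notation G := (lb_gens P).
Variables (C : codioperad K) (phi : bimod_hom C (shift 1 G)).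
Hypothesis phi_cor : corelations (lb_incl P) phi.
Hypothesis two_neq0 : 2%:R != 0 :> K.
Implicit Types J I : finType.

(** The universal property of [P] gives a map to the test dioperad, which carries the corelations to
    equations that can be read in coordinates. *)
Lemma desus_test J I (c : C J I) :
  desuspended_dec (fun J I x => test_hom G J I (phi J I x)) c = 0.
Proof.
have [h [hE _]] := lb_universal (test_relations G).
have E : (fun (J I : finType) (x : C J I) => h J I (lb_incl P J I (phi J I x)))
   = (fun (J I : finType) (x : C J I) => test_hom G J I (phi J I x)).
  by apply/functional_extensionality_dep => J'; apply/functional_extensionality_dep => I'; apply/funext => x; exact: hE.
have e := desus_hom h (fun (J I : finType) (x : C J I) => lb_incl P J I (phi J I x)) c.
rewrite E in e; rewrite -e (phi_cor c); exact: (lin0 (@bh_linear _ _ _ h _ _)).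
Qed.

Lemma sum_pick (T : finType) (p : T) (F : T -> K) : \sum_k F k * (p == k)%:R = F p.
Proof.
rewrite (bigD1 p) //= eqxx mulr1 big1 ?addr0 // => i.
by rewrite eq_sym => /negbTE->; rewrite mulr0.
Qed.

(** Coordinate [(p, q)] of the corelation is 4 times the difference of the two sides. *)
Lemma splitc_13 (c : C unit 'I_3) p q :
  splitc (geps phi) (@inr void unit) (cutr p) c 0 0 = splitc (geps phi) (@inr void unit) (cutr q) c 0 0.
Proof.
set A := fun k => splitc (geps phi) (@inr void unit) (cutr k) c 0 0.
have := desus_test c; rewrite (desus_13 (test_hom G) phi) -/A => e.
have := D_lin A (fun k => ell_ell (test_hom G _ _ (ell G)) (ordS k) (ordS (ordS k)) k) (inr (inr (p, q))).
rewrite e ffunE.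
have -> : \sum_i A i * (ell_ell (test_hom G _ _ (ell G)) (ordS i) (ordS (ordS i)) i).2 (inr (inr (p, q)))
   = 4%:R * (A p - A q).
  rewrite -(sum_pick p A) -(sum_pick q A) -sumrB mulr_sumr; apply: eq_bigr => k _.
  rewrite ell_ellT; ring.
move/esym/eqP.
by rewrite mulf_eq0 (natrM _ 2 2) mulf_eq0 !(negbTE two_neq0) /= subr_eq0 => /eqP.
Qed.

(** The coordinate with indices [(x, y)] and outputs [(p, q)] sees only the trees with [p] or [q] at
    the upper vertex, with weights [rsgn K p q] and [rsgn K q p]; these are opposite and nonzero. *)
Lemma splitc_31_swap (c : C 'I_3 unit) p q (x y : 'I_2) : p != q ->
  splitc (geps phi) (cutl p) (@inl unit void) c x y = splitc (geps phi) (cutl q) (@inl unit void) c y x.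
Proof.
move=> pq; pose A (k : 'I_3) (x y : 'I_2) := splitc (geps phi) (cutl k) (@inl unit void) c x y.
have := desus_test c; rewrite (desus_31 (test_hom G) phi) => e.
pose X (t : 'I_3 * ('I_2 * 'I_2)) := delta_delta (fun x => test_hom G _ _ (delta G x)) t.2.1 t.2.2 (ordS t.1) (ordS (ordS t.1)) t.1.
pose z : yix 'I_3 unit := inr (inl (inl ((x, y), (p, q)))).
have e' : \sum_(t : 'I_3 * ('I_2 * 'I_2)) A t.1 t.2.1 t.2.2 *: X t = 0.
  rewrite -[RHS]e; under [RHS]eq_bigr => k _ do rewrite pair_bigA.
  by rewrite pair_bigA.
have := D_lin (fun t => A t.1 t.2.1 t.2.2) X z; rewrite e' ffunE.
have -> : \sum_i A i.1 i.2.1 i.2.2 * (X i).2 z = A p x y * rsgn K p q + A q y x * rsgn K q p.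
  rewrite -(sum_pick (p, (x, y)) (fun t => A t.1 t.2.1 t.2.2 * rsgn K t.1 q)).
  rewrite -(sum_pick (q, (y, x)) (fun t => A t.1 t.2.1 t.2.2 * rsgn K t.1 p)).
  rewrite -big_split; apply: eq_bigr => -[k [x' y']] _ /=.
  rewrite /X delta_deltaT /= !xpair_eqE [x' == x]eq_sym [y' == y]eq_sym [x' == y]eq_sym [y' == x]eq_sym.
  have h1 : (x == x') && (y == y') && (p == k) = (p == k) && ((x == x') && (y == y')) by rewrite andbC.
  have h2 : (y == x') && (x == y') && (q == k) = (q == k) && ((y == x') && (x == y')) by rewrite andbC.
  by rewrite h1 h2 mulrDr; congr (_ + _); rewrite mulrA mulrAC.
have := rsgn_anti K p q => /eqP; rewrite addr_eq0 => /eqP->.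
rewrite mulrN -mulNr -mulrDl => /esym/eqP; rewrite mulf_eq0 => /orP[|].
  by rewrite addrC subr_eq0 => /eqP.
by rewrite /rsgn (negbTE pq); case: ifP => _; rewrite ?oppr_eq0 oner_eq0.
Qed.

(** Going once around the three outputs exchanges [x] and [y] an odd number of times, so the
    coefficient is symmetric in them; hence it does not depend on the output either. For indices 0
    and 1 the sum determines the pair up to order. *)
Lemma splitc_31 (c : C 'I_3 unit) p q (x y x' y' : 'I_2) : (x + y = x' + y')%N ->
  splitc (geps phi) (cutl p) (@inl unit void) c x y = splitc (geps phi) (cutl q) (@inl unit void) c x' y'.
Proof.
pose A (k : 'I_3) (x y : 'I_2) := splitc (geps phi) (cutl k) (@inl unit void) c x y.
have sw k l a b : k != l -> A k a b = A l b a by exact: splitc_31_swap.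
have n1 (k : 'I_3) : k != ordS k by case: k => -[|[|[|//]]] h.
have n2 (k : 'I_3) : k != ordS (ordS k) by case: k => -[|[|[|//]]] h.
have sy k a b : A k a b = A k b a.
  by rewrite (sw k (ordS k)) // (sw (ordS k) (ordS (ordS k))) // [RHS](sw k (ordS (ordS k))) // sw // eq_sym.
have in_ k l a b : A k a b = A l a b.
  by case: (eqVneq k l) => [->//|/sw->]; exact: sy.
move=> e; rewrite -/(A p x y) -/(A q x' y') (in_ p q).
have [[-> ->]|[-> ->]] : x = x' /\ y = y' \/ x = y' /\ y = x'; [|by []|exact: sy].
by case: x y x' y' e => -[|[|//]] hx [] [|[|//]] hy [] [|[|//]] hx' [] [|[|//]] hy' //= _;
  by [left; split; exact: val_inj|right; split; exact: val_inj].
Qed.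

(** Coordinate [(x, (k, i))] of the corelation is, up to sign, twice the difference of the two
    sides, since it meets one cross and [delta_ell x]. *)
Lemma splitc_22 (c : C bool bool) k i (x : 'I_2) :
  splitc (geps phi) (cutb k) (cutb i) c x 0 = splitc (geps phi) (@inr void bool) (@inl bool void) c 0 x.
Proof.
pose A (k i : bool) (x : 'I_2) := splitc (geps phi) (cutb k) (cutb i) c x 0.
pose B (x : 'I_2) := splitc (geps phi) (@inr void bool) (@inl bool void) c 0 x.
have := desus_test c; rewrite (desus_22 (test_hom G) phi) => e.
pose X (t : bool * (bool * 'I_2)) := cross (test_hom G _ _ (ell G)) (fun x => test_hom G _ _ (delta G x)) t.2.2 t.2.1 (~~ t.2.1) t.1 (~~ t.1).
pose Y x := delta_ell (test_hom G _ _ (ell G)) (fun x => test_hom G _ _ (delta G x)) x.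
pose z : yix bool bool := inr (inl (inr (x, (k, i)))).
have e' : - (\sum_x B x *: Y x) + \sum_(t : bool * (bool * 'I_2)) ((sgnb K t.1) * A t.1 t.2.1 t.2.2) *: X t = 0.
  rewrite -[RHS]e; congr (_ + _); under [RHS]eq_bigr => k' _ do rewrite pair_bigA.
  by rewrite pair_bigA; apply: eq_bigr => t _; rewrite scalerA.
have := D_lin (fun t => sgnb K t.1 * A t.1 t.2.1 t.2.2) X z.
have := D_lin B Y z.
move=> e1 e2; have := congr1 (fun T : test_dioperad K bool bool => T.2 z) e'.
rewrite D_add2 D_opp2 e1 e2 [RHS]ffunE.
have -> : \sum_i B i * (Y i).2 z = - 2%:R * (B x * sgnb K k).
  rewrite -(sum_pick x (fun x => B x * sgnb K k)) mulr_sumr; apply: eq_bigr => x' _.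
  rewrite /Y delta_ellT /z [x' == x]eq_sym; ring.
have -> : \sum_i sgnb K i.1 * A i.1 i.2.1 i.2.2 * (X i).2 z = - 2%:R * (A k i x * sgnb K k).
  rewrite -(sum_pick (k, (i, x)) (fun t => A t.1 t.2.1 t.2.2 * sgnb K t.1)) mulr_sumr.
  apply: eq_bigr => -[k' [i' x']] _ /=.
  rewrite /X crossT /z /= !xpair_eqE [x' == x]eq_sym.
  have -> : ((x == x') && (k == k') && (i == i')) = ((k == k') && ((i == i') && (x == x'))).
    by rewrite andbC andbCA [(k == _) && _]andbC -andbA andbCA.
  ring.
rewrite -mulrN -mulrDr [X in _ * X](_ : _ = (A k i x - B x) * sgnb K k); last by ring.
move/eqP; rewrite mulf_eq0 oppr_eq0 (negbTE two_neq0) /= mulf_eq0 => /orP[|].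
  by rewrite subr_eq0 => /eqP.
by rewrite /sgnb; case: ifP => _; rewrite ?oppr_eq0 oner_eq0.
Qed.

End WeightTwoRelations.

(** * Splittings of larger arities *)

(* The two vertices of the tree cut out by the outputs [a] and inputs [b] of the
   upper one are stable. *)
Definition valid_split (J I : finType) (a : {set J}) (b : {set I}) : bool :=
  [&& 1 <= #|b|, 2 <= #|a| + #|b|, 1 <= #|~: a| & 2 <= #|~: a| + #|~: b|]%N.

Section Connectivity.
Local Open Scope nat_scope.
Variables (J I : finType) (T : Type).
Variable SC : {set J} -> {set I} -> nat -> nat -> T.
Hypothesis move : forall (a a' : {set J}) (b b' : {set I}) a1 a2 a3,
  a \subset a' -> b \subset b' ->
  1 <= #|b| -> 2 <= #|a| + #|b| -> #|a| + #|b| < #|a'| + #|b'| ->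
  1 <= #|~: a'| -> 2 <= #|~: a'| + #|~: b'| ->
  a1 <= #|a| -> #|a| + a2 <= #|a'| -> a3 < #|~: a'| ->
  SC a' b' (a1 + a2) a3 = SC a b a1 (a2 + a3).

(** Coefficients depend only on [k + l]. The hypothesis [move] records the two ways of contracting
    an edge in a chain of three stable vertices with indices [a1], [a2], [a3]. *)
Let homogeneous := exists U : nat -> T, forall (a : {set J}) (b : {set I}) k l,
  valid_split a b -> k <= #|a| -> l < #|~: a| -> SC a b k l = U (k + l).

(** The reference tree has all inputs above and all outputs below. If two inputs are above, the
    upper outputs are moved down and then the other inputs up. Otherwise an input is first moved up
    or an output down, for which total arity 5 leaves room. *)
Lemma connect_mn : 2 <= #|J| -> 2 <= #|I| -> 5 <= #|J| + #|I| -> homogeneous.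
Proof.
move=> hm hn hmn; exists (fun t => SC set0 setT 0 t).
have s1 (a : {set J}) (b : {set I}) k l : valid_split a b -> 2 <= #|b| -> k <= #|a| -> l < #|~: a| ->
    SC a b k l = SC set0 setT 0 (k + l).
  move=> /and4P[v1 v2 v3 v4] hb hk hl; have ca := cardsC a; have cb := cardsC b.
  have e1 : SC a b k l = SC set0 b 0 (k + l).
    case: (posnP #|a|) => [a0|a0].
      by have /eqP := a0; rewrite cards_eq0 => /eqP ->; move: hk; rewrite a0 leqn0 => /eqP->.
    rewrite -[k in LHS]add0n; apply: move; rewrite ?sub0set ?subxx ?cards0 //; lia.
  rewrite e1; case: (ltnP #|b| #|I|) => hb'; last first.
    by have -> // : b = setT; apply/eqP; rewrite eqEcard subsetT cardsT.
  have := @move set0 set0 b setT 0 0 (k + l); rewrite !add0n => <- //;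
    rewrite ?subxx ?subsetT ?setC0 ?setCT ?cards0 ?cardsT //; lia.
have s2 (a : {set J}) (b : {set I}) k l : valid_split a b -> 2 <= #|~: a| -> k <= #|a| -> l < #|~: a| ->
    SC a b k l = SC set0 setT 0 (k + l).
  move=> v hb hk hl; have ca := cardsC a; have cb := cardsC b.
  case/and4P: (v) => [v1 v2 v3 v4].
  case: (leqP 2 #|b|) => hb'; first by rewrite s1.
  have := @move a a b setT k 0 l; rewrite !addn0 !add0n => <-; rewrite ?subxx ?subsetT ?setCT ?cards0 ?cardsT //; try lia.
  by rewrite s1 /valid_split ?setCT ?cards0 ?cardsT //; lia.
move=> a b k l v hk hl; have ca := cardsC a; have cb := cardsC b.
case/and4P: (v) => [v1 v2 v3 v4].
case: (leqP 2 #|b|) => hb; first by rewrite s1.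
case: (leqP 2 #|~: a|) => ha; first by rewrite s2.
case: (leqP 3 #|I|) => h3.
  have /card_gt0P[i] : 0 < #|~: b| by lia.
  rewrite inE => ib; have cb' : #|i |: b| = #|b|.+1 by rewrite cardsU1 ib.
  have cbC := cardsC (i |: b).
  have := @move a a b (i |: b) k 0 l; rewrite !addn0 !add0n => <-; rewrite ?subxx ?subsetUr //; try lia.
  by rewrite s1 /valid_split //; lia.
have /card_gt0P[j ja] : 0 < #|a| by lia.
have ca' : #|a :\ j| = #|a|.-1 by rewrite (cardsD1 j a) ja.
have caC := cardsC (a :\ j).
have := @move (a :\ j) a b b (k - 1) (k - (k - 1)) l; rewrite subnKC ?leq_subr // => ->;
  rewrite ?subxx ?subD1set //; try lia.
rewrite s2 //; [|rewrite /valid_split|..]; try lia.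
by congr SC; lia.
Qed.

(** All indices are 0 and a tree is a set of upper inputs. Complements of two points are compared
    through the complement of both, which has at least two elements because there are four
    inputs. *)
Lemma connect_1n : #|J| = 1 -> 4 <= #|I| -> homogeneous.
Proof.
move=> hm hn; have /card_gt0P[z0 _] : 0 < #|I| by lia.
exists (fun _ => SC set0 (~: [set z0]) 0 0) => a b k l /and4P[v1 v2 v3 v4] hk hl.
have ca := cardsC a; have cb := cardsC b.
have a0 : a = set0 by apply: cards0_eq; lia.
rewrite a0 setC0 cards0 cardsT hm in hk hl v2 v4 *.
have -> : k = 0 by lia. have -> : l = 0 by lia.
have up (b1 b2 : {set I}) : b1 \subset b2 -> 2 <= #|b1| -> 1 <= #|~: b2| -> SC set0 b2 0 0 = SC set0 b1 0 0.
  move=> s h1 h2; case: (eqVneq b1 b2) => [->//|ne].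
  have lt : #|b1| < #|b2| by rewrite proper_card // properEneq ne.
  by apply: (@move set0 set0 b1 b2 0 0 0); rewrite ?subxx ?setC0 ?cards0 ?cardsT //; lia.
have /card_gt0P[z] : 0 < #|~: b| by lia.
rewrite inE => zb.
rewrite -(@up b (~: [set z])); [|by rewrite subsetC sub1set inE|lia|by rewrite setCK cards1].
have c2 : 2 <= #|~: [set z; z0]|.
  by have := cardsC [set z; z0]; have := cards2 z z0; lia.
rewrite (@up (~: [set z; z0])) ?setCS ?sub1set ?inE ?eqxx ?setCK ?cards1 //.
by rewrite -(@up (~: [set z; z0]) (~: [set z0])) ?setCS ?sub1set ?inE ?eqxx ?orbT ?setCK ?cards1.
Qed.

(** The input is always above, and every tree is compared with the one whose only upper output is
    [z]. If [z] is below, it is moved up when three outputs are below; otherwise the upper set is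
    first shrunk to one output, after which at least three are below. *)
Lemma connect_m1 : #|I| = 1 -> 4 <= #|J| -> homogeneous.
Proof.
move=> hn hm; have /card_gt0P[z _] : 0 < #|J| by lia.
(* For the upper set [[set z]] the indices satisfy [k <= 1] and [l <= #|J| - 2], so the top value
   [#|J| - 1] of [k + l] is reached only with [k = 1]. *)
exists (fun t => if t <= #|J| - 2 then SC [set z] setT 0 t else SC [set z] setT 1 (#|J| - 2)).
have cz x : #|~: [set x : J]| = #|J|.-1 by have := cardsC [set x]; rewrite cards1; lia.
have mv (a a' : {set J}) a1 a2 a3 : a \subset a' -> 1 <= #|a| -> #|a| < #|a'| -> 2 <= #|~: a'| ->
    a1 <= #|a| -> #|a| + a2 <= #|a'| -> a3 < #|~: a'| ->
    SC a' setT (a1 + a2) a3 = SC a setT a1 (a2 + a3).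
  by move=> *; apply: move; rewrite ?subxx ?setCT ?cards0 ?cardsT ?hn //; lia.
have base e t : e <= 1 -> t <= #|J| - 2 -> SC [set z] setT e t =
    if e + t <= #|J| - 2 then SC [set z] setT 0 (e + t) else SC [set z] setT 1 (#|J| - 2).
  case: e => [|[|//]] _ ht; first by rewrite add0n ht.
  case: ifP => h; last by congr SC; lia.
  have /card_gt0P[w] : 0 < #|~: [set z]| by rewrite cz; lia.
  rewrite !inE => wz.
  have c2 : #|[set z; w]| = 2 by rewrite cards2 eq_sym wz.
  have c3 := cardsC [set z; w].
  have zs : [set z] \subset [set z; w] by rewrite sub1set !inE eqxx.
  have e1 := mv [set z] [set z; w] 1 0 t zs; have e2 := mv [set z] [set z; w] 0 1 t zs.
  rewrite -e2 ?cards1 -?e1 ?cards1 //; lia.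
have s1 (a : {set J}) k l : z \in a -> 2 <= #|~: a| -> k <= #|a| -> l < #|~: a| -> SC a setT k l =
    if k + l <= #|J| - 2 then SC [set z] setT 0 (k + l) else SC [set z] setT 1 (#|J| - 2).
  move=> za ha hk hl; have ca := cardsC a.
  have zs : [set z] \subset a by rewrite sub1set.
  case: (leqP 2 #|a|) => a2; last first.
    have -> : a = [set z] by apply/esym/eqP; rewrite eqEcard zs cards1.
    by apply: base; have : 0 < #|a| by [apply/card_gt0P; exists z]; lia.
  (* A vertex with one output besides the edge carries an index at most 1; the rest of [k] goes to
     the middle vertex. *)
  have := mv [set z] a (minn k 1) (k - minn k 1) l zs; rewrite subnKC ?geq_minl // => ->;
    rewrite ?cards1 //; try lia.
  by rewrite base; [congr (if _ <= _ then SC _ _ _ _ else _)|..]; lia.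
have s2 (a : {set J}) k l : 1 <= #|a| -> 3 <= #|~: a| -> k <= #|a| -> l < #|~: a| -> SC a setT k l =
    if k + l <= #|J| - 2 then SC [set z] setT 0 (k + l) else SC [set z] setT 1 (#|J| - 2).
  move=> a1 ha hk hl; have ca := cardsC a.
  case: (boolP (z \in a)) => za; first by apply: s1 => //; lia.
  have cz' : #|z |: a| = #|a|.+1 by rewrite cardsU1 za.
  have caC := cardsC (z |: a).
  have := mv a (z |: a) k (minn l 1) (l - minn l 1); rewrite subnKC ?geq_minl // => <-;
    rewrite ?subsetUr //; try lia.
  rewrite s1 ?inE ?eqxx //; try lia.
  by rewrite -addnA subnKC ?geq_minl.
move=> a b k l /and4P[v1 v2 v3 v4] hk hl; have ca := cardsC a; have cb := cardsC b.
have -> : b = setT by apply/eqP; rewrite eqEcard subsetT cardsT; lia.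
case: (leqP 3 #|~: a|) => h3; first by apply: s2 => //; lia.
case: (boolP (z \in a)) => za; first by apply: s1 => //; lia.
have /card_gt0P[j ja] : 0 < #|a| by lia.
have js : [set j] \subset a by rewrite sub1set.
have := mv [set j] a (minn k 1) (k - minn k 1) l js; rewrite subnKC ?geq_minl // => ->;
  rewrite ?cards1 //; try lia.
rewrite s2 ?cards1 ?cz //; try lia.
by rewrite addnA subnKC ?geq_minl.
Qed.

Lemma connect_split : 5 <= #|J| + #|I| -> 1 <= #|J| -> 1 <= #|I| -> homogeneous.
Proof.
move=> h hJ hI; case: (leqP 2 #|J|) => h1; last by apply: connect_1n; lia.
by case: (leqP 2 #|I|) => h2; [exact: connect_mn|apply: connect_m1; lia].
Qed.

End Connectivity.

(** * The model is the Koszul dual *)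

Section DualCodioperad.
Variables (K : fieldType) (P : lie12bi K).
Local Notation G := (lb_gens P).
Variables (C : codioperad K) (kappa : bimod_hom C (shift 1 G)).
Hypothesis C_dual : is_koszul_dual (lb_incl P) kappa.
Hypothesis two_neq0 : 2%:R != 0 :> K.
Variable h0 : codioperad_hom (model K) C.
Hypothesis kappa_h0 : forall J I (u : model K J I), kappa J I (h0 J I u) = phi0_hom G J I u.
Implicit Types J I : finType.

Definition good J I := exists g : C J I -> msp K J I, cancel (h0 J I) g /\ cancel g (h0 J I).

Lemma goodP J I : injective (h0 J I) -> (forall c, exists u, c = h0 J I u) -> good J I.
Proof.
move=> inj surj; exists (fun c => projT1 (cid (surj c))); split=> [u|c]; case: cid => v /=.
  by move/inj.
by [].
Qed.

Lemma h0_linear J I : linear (h0 J I : msp K J I -> C J I).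
Proof. exact: (@bh_linear _ _ _ h0 J I). Qed.

Lemma h0_act J J' I I' (f : J -> J') (g : I -> I') (u : msp K J I) :
  bijective f -> bijective g -> h0 J' I' (mact f g u) = act f g (h0 J I u).
Proof. exact: (@bh_act _ _ _ h0). Qed.

(* The inverse of [h0] where it exists, and the junk value 0 elsewhere. *)
Definition eps J I (c : C J I) : msp K J I :=
  if pselect (good J I) is left h then projT1 (cid h) c else 0.

Lemma eps_h0 J I u : good J I -> eps (h0 J I u) = u.
Proof. by rewrite /eps; case: pselect => // h _; case: cid => g /= [-> _]. Qed.

Lemma h0_eps J I (c : C J I) : good J I -> h0 J I (eps c) = c.
Proof. by rewrite /eps; case: pselect => // h _; case: cid => g /= [_ ->]. Qed.

Lemma eps_bad J I (c : C J I) : ~ good J I -> eps c = 0.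
Proof. by rewrite /eps; case: pselect. Qed.

Lemma eps_linear J I : linear (@eps J I).
Proof.
move=> a x y; case: (pselect (good J I)) => h; last by rewrite !eps_bad // scaler0 addr0.
by rewrite -{1}(h0_eps x h) -{1}(h0_eps y h) -(h0_linear a) eps_h0.
Qed.

Lemma good_act J J' I I' (f : J -> J') (g : I -> I') :
  bijective f -> bijective g -> good J I -> good J' I'.
Proof.
move=> bf bg h; apply: goodP => [u v e|c].
  have [f' fK f'K] := bf; have [g' gK g'K] := bg.
  have bf' : bijective f' by exists f. have bg' : bijective g' by exists g.
  have /= := congr1 (act f' g') e; rewrite -!h0_act // => /(congr1 (@eps J I)); rewrite !eps_h0 //.
  by move/(@act_inj _ (model K) _ _ _ _ _ _ bf' bg').
have [x ->] := act_surj c bf bg.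
by exists (mact f g (eps x)); rewrite h0_act // h0_eps.
Qed.

Lemma eps_act J J' I I' (f : J -> J') (g : I -> I') (x : C J I) :
  bijective f -> bijective g -> eps (act f g x) = mact f g (eps x).
Proof.
move=> bf bg; case: (pselect (good J I)) => h.
  by rewrite -{1}(h0_eps x h) -h0_act // eps_h0 //; exact: (good_act bf bg h).
rewrite !eps_bad //; first by rewrite (lin0 (mact_linear bf bg)).
have [f' fK f'K] := bf; have [g' gK g'K] := bg.
by move=> h'; apply: h; apply: good_act h'; [exists f|exists g].
Qed.

Lemma eps_deg J I p (x : C J I) : hdeg p x -> p != mdeg J -> eps x = 0.
Proof.
move=> hp ne; case: (pselect (good J I)) => [h|/eps_bad->//].
have hq : hdeg (mdeg J) x.
  by rewrite -(h0_eps x h); apply: (@bh_hdeg _ _ _ h0); left.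
by rewrite (hdeg_uniq (hdeg_grading _ _ _) hp hq ne) (lin0 (@eps_linear _ _)).
Qed.

Lemma split_h0 J I J1 I1 J2 I2 (f : J -> (J1 + J2)%type) (g : I -> (I1 + I2)%type) (u : msp K J I) k l :
  bijective f -> bijective g -> good (option J1) I1 -> good J2 (option I2) ->
  (k < dm (option J1) I1)%N -> (l < dm J2 (option I2))%N ->
  splitc eps f g (h0 J I u) k l = cf u (k + l).
Proof.
move=> bf bg h1 h2 hk hl.
rewrite -(@model_splitc K J I J1 I1 J2 I2 f g (fun J I x => eps (h0 J I x)) u k l) //.
- by rewrite /splitc -h0_act // (ch_dec h0 _ (eps_form eps_linear _ _ _ _ k l)).
- by move=> J' I' a x y; rewrite h0_linear eps_linear.
- by move=> v; exact: eps_h0.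
- by move=> v; exact: eps_h0.
Qed.

(** Where [h0] is bijective at both vertices, a decomposition is determined by its coefficients; the
    prefactor undoes the sign built into [splitc]. *)
Lemma split_expand J I J1 I1 J2 I2 (f : J -> (J1 + J2)%type) (g : I -> (I1 + I2)%type) (c : C J I)
    (T : C (option J1) I1 -> C J2 (option I2) -> K) :
  bilinear_form T -> good (option J1) I1 -> good J2 (option I2) ->
  sweedler (dec (act f g c)) (fun _ x y => T x y : K^o) =
  \sum_(k < dm (option J1) I1) \sum_(l < dm J2 (option I2))
    osg K f * (-1) ^+ #|J1| * splitc eps f g c k l * T (h0 _ _ (ev K _ k)) (h0 _ _ (ev K _ l)).
Proof.
move=> [Tl Tr] h1 h2.
have E x y : T x y = \sum_(k < dm (option J1) I1) \sum_(l < dm J2 (option I2))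
   cf (eps x) k * cf (eps y) l * T (h0 _ _ (ev K _ k)) (h0 _ _ (ev K _ l)).
  rewrite -{1}(h0_eps x h1) -{1}(h0_eps y h2) {1}(ev_sum (eps x)) {1}(ev_sum (eps y)).
  rewrite !(lin_sum (@h0_linear _ _)) (scalar_sum (Tl _)); apply: eq_bigr => k _.
  rewrite (scalar_sum (Tr _)); apply: eq_bigr => l _.
  rewrite !(linZ (@h0_linear _ _)) (scalarZ (Tl _)) (scalarZ (Tr _)); exact: mulrA.
rewrite /sweedler; under eq_bigr => t _ do rewrite E.
rewrite exchange_big; apply: eq_bigr => k _; rewrite exchange_big; apply: eq_bigr => l _.
rewrite -mulr_suml /splitc; congr (_ * _).
by rewrite mulrA mulrACA osgK -exprMn mulrNN mulr1 expr1n !mul1r.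
Qed.

(** Coassociativity is paired with the product of the three coefficient functionals. The vertex that
    is decomposed a second time is good, so its decomposition is that of the model and merges two
    indices into their sum. *)
Lemma split_chain J I J1 I1 J2 I2 J3 I3 (f : J -> ((J1 + J2) + J3)%type) (g : I -> ((I1 + I2) + I3)%type)
    (c : C J I) a1 a2 a3 :
  bijective f -> bijective g ->
  good (option J1) I1 -> good (option J2) (option I2) -> good J3 (option I3) ->
  good (option (J1 + J2)%type) (I1 + I2)%type -> good (J2 + J3)%type (option (I2 + I3)%type) ->
  (a1 < dm (option J1) I1)%N -> (a2 < dm (option J2) (option I2))%N -> (a3 < dm J3 (option I3))%N ->
  splitc eps f g c (a1 + a2) a3 = splitc eps (@sumA _ _ _ \o f) (@sumA _ _ _ \o g) c a1 (a2 + a3).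
Proof.
move=> bf bg g1 g2 g3 g12 g23 l1 l2 l3.
pose T (x : C (option J1) I1) (y : C (option J2) (option I2)) (z : C J3 (option I3)) : K :=
  cf (eps x) a1 * cf (eps y) a2 * cf (eps z) a3.
have hT : trilinear_form T.
  by split=> [y z|x z|x y] a u v; rewrite /T eps_linear cf_linear; ring.
have := dec_chain (act f g c) hT.
have -> : sweedler (dec (act f g c)) (fun _ u z =>
      sweedler (dec (act (@optrV J1 J2) id u)) (fun _ x y => T x y z : K^o)) =
   sweedler (dec (act f g c)) (fun _ u z => cf (eps u) (a1 + a2) * cf (eps z) a3 : K^o).
  apply: eq_bigr => t _; rewrite /sweedler -mulr_suml; congr (_ * _).
  have := split_h0 (eps t.1.2) (@optrV_bij J1 J2) (@id_bij _) g1 g2 l1 l2.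
  by rewrite h0_eps // => <-; rewrite /splitc /osg ninv_optrV -exprMn mulrNN mulr1 expr1n mul1r.
have -> : sweedler (dec (act (@sumA J1 J2 J3) (@sumA I1 I2 I3) (act f g c))) (fun _ x v =>
      sweedler (dec (act id (@optlV I2 I3) v)) (fun _ y z => T x y z : K^o)) =
  (-1) ^+ #|J2| * sweedler (dec (act (@sumA J1 J2 J3) (@sumA I1 I2 I3) (act f g c)))
    (fun _ x v => cf (eps x) a1 * cf (eps v) (a2 + a3) : K^o).
  rewrite /sweedler mulr_sumr; apply: eq_bigr => t _.
  have := split_h0 (eps t.2) (@id_bij (J2 + J3)%type) (@optlV_bij I2 I3) g2 g3 l2 l3.
  rewrite h0_eps // => <-; rewrite /splitc /osg ninv_id /sweedler.
  under eq_bigr => s _ do rewrite /T -mulrA.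
  rewrite -mulr_sumr mul1r mulrCA; congr (_ * _).
  by rewrite mulrA -exprMn mulrNN mulr1 expr1n mul1r.
rewrite act_comp //; try exact: sumA_bij.
rewrite /splitc (osg_comp _ bf (bij_inj (@sumA_bij _ _ _))) card_sum exprD => ->.
have -> : osg K (@sumA J1 J2 J3) = 1 by rewrite /osg ninv_sumA.
set s := sweedler _ _; have h : (-1) ^+ #|J2| * (-1) ^+ #|J2| = 1 :> K by rewrite -exprMn mulrNN mulr1 expr1n.
transitivity (osg K f * (-1) ^+ #|J1| * s * ((-1) ^+ #|J2| * (-1) ^+ #|J2|)); first by ring.
by rewrite h !mulr1.
Qed.

Definition SC J I (c : C J I) (a : {set J}) (b : {set I}) k l :=
  splitc eps (@split_set J a) (@split_set I b) c k l.

Lemma splitc_isl J I J1 I1 J2 I2 (f : J -> (J1 + J2)%type) (g : I -> (I1 + I2)%type) (c : C J I) (a : {set J}) (b : {set I}) k l :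
  bijective f -> bijective g -> (forall x, (x \in a) = isl (f x)) -> (forall x, (x \in b) = isl (g x)) ->
  SC c a b k l = splitc eps f g c k l.
Proof.
move=> bf bg ha hb; have [f1 [f2 [b1 b2 e1]]] := split_factor bf ha.
have [g1 [g2 [b3 b4 e2]]] := split_factor bg hb.
by rewrite /SC (eq_splitc _ _ _ _ e1 e2) (splitc_equiv eps_linear eps_act).
Qed.

Lemma isl_cards J J1 J2 (f : J -> (J1 + J2)%type) (a : {set J}) : bijective f ->
  (forall x, (x \in a) = isl (f x)) -> #|a| = #|J1| /\ #|~: a| = #|J2|.
Proof.
move=> bf ha; have [f1 [f2 [b1 b2 _]]] := split_factor bf ha.
by rewrite (bij_eq_card b1) (bij_eq_card b2) card_sigin card_signotin.
Qed.

Lemma cf0 d k : cf (0 : {ffun 'I_d -> K^o}) k = 0.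
Proof. by rewrite /cf; case: insub => [?|] //=; rewrite ffunE. Qed.

Lemma isl_split J (a : {set J}) x : isl (@split_set J a x) = (x \in a).
Proof. by pattern (split_set a x); apply: split_setP => h /=; rewrite ?h ?(negbTE h). Qed.

Lemma isl_sumA (X Y Z : Type) (u : (X + Y) + Z) : isl (sumA u) = if u is inl v then isl v else false.
Proof. by case: u => [[]|]. Qed.

Lemma mem_isl J J1 J2 (f : J -> (J1 + J2)%type) x : (x \in [set y | isl (f y)]) = isl (f x).
Proof. by rewrite inE. Qed.

Lemma unstable_eq0 J I (c : C J I) : ~~ stable J I -> c = 0.
Proof. exact: cod_reduced. Qed.

Lemma dm_stable J I : stable J I -> dm J I = #|J|.
Proof. by rewrite /dm => ->. Qed.

Lemma good_unstable J I : ~~ stable J I -> good J I.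
Proof.
move=> h; apply: goodP => [u v _|c]; last first.
  by exists 0; rewrite (lin0 (@h0_linear J I)); exact: unstable_eq0.
by apply: cfP => k hk; exfalso; move: hk; rewrite /dm (negbTE h).
Qed.

Lemma good_weight1 J I : good J I -> weight1 J I -> forall c : C J I, eps c = geps kappa c.
Proof. by move=> h w c; rewrite -{2}(h0_eps c h) /geps kappa_h0 /= psi_phi0. Qed.

Section Induction.
Variables (J I : finType).
Hypothesis IH : forall J' I', (#|J'| + #|I'| < #|J| + #|I|)%N -> good J' I'.

(** Stable vertices of a splitting have smaller total arity, so the induction hypothesis expands the
    decomposition in coefficients; terms with an unstable vertex vanish because [C] is reduced. *)
Lemma primitive_crit (c : C J I) :
  (forall (a : {set J}) (b : {set I}) k l, valid_split a b -> (k <= #|a|)%N -> (l < #|~: a|)%N ->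
     SC c a b k l = 0) -> primitive c.
Proof.
move=> h J1 I1 J2 I2 f g T bf bg hT.
have [c1 c2] := isl_cards bf (mem_isl f); have [c3 c4] := isl_cards bg (mem_isl g).
have cJ := cardsC [set y | isl (f y)]; have cI := cardsC [set y | isl (g y)].
case: (boolP (stable (option J1) I1)) => s1; last first.
  rewrite /sweedler big1 // => t _; rewrite (unstable_eq0 t.1.2 s1).
  by case: hT => h1 _; exact: (scalar0 (h1 _)).
case: (boolP (stable J2 (option I2))) => s2; last first.
  rewrite /sweedler big1 // => t _; rewrite (unstable_eq0 t.2 s2).
  by case: hT => _ h1; exact: (scalar0 (h1 _)).
move: (s1) (s2); rewrite /stable !card_option => /and3P[_ n1 n2] /and3P[n3 _ n4].
rewrite (split_expand _ _ _ hT); [|by apply: IH; rewrite card_option; lia..].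
rewrite big1 // => k _; rewrite big1 // => l _.
rewrite -(splitc_isl c k l bf bg (mem_isl f) (mem_isl g)) h ?mulr0 ?mul0r //.
- by rewrite /valid_split; lia.
- by rewrite -ltnS; apply: leq_trans (ltn_ord k) _; rewrite (dm_stable s1) card_option c1.
- by apply: leq_trans (ltn_ord l) _; rewrite (dm_stable s2) c2.
Qed.

Lemma SC_h0 (u : msp K J I) (a : {set J}) (b : {set I}) k l :
  valid_split a b -> (k <= #|a|)%N -> (l < #|~: a|)%N -> SC (h0 J I u) a b k l = cf u (k + l).
Proof.
move=> /and4P[v1 v2 v3 v4] hk hl; have cJ := cardsC a; have cI := cardsC b.
apply: split_h0; try exact: split_bij.
- by apply: IH; rewrite card_option !card_sigin; lia.
- by apply: IH; rewrite card_option !card_signotin; lia.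
- by rewrite /dm /stable !card_option !card_sigin; case: ifP; lia.
- by rewrite /dm /stable !card_option !card_signotin; case: ifP; lia.
Qed.

Lemma SC_linear (a : {set J}) (b : {set I}) k l : scalar (fun c : C J I => SC c a b k l).
Proof. by apply: (splitc_linear eps_linear); exact: split_bij. Qed.

(** The chain has the labels in [a] and [b] above, the differences to [a'] and [b'] in the middle
    and the complements of [a'] and [b'] below; the strict inequality of cardinals is the stability
    of the middle vertex. *)
Lemma SC_move (c : C J I) (a a' : {set J}) (b b' : {set I}) a1 a2 a3 :
  (a \subset a' -> b \subset b' ->
  1 <= #|b| -> 2 <= #|a| + #|b| -> #|a| + #|b| < #|a'| + #|b'| ->
  1 <= #|~: a'| -> 2 <= #|~: a'| + #|~: b'| ->
  a1 <= #|a| -> #|a| + a2 <= #|a'| -> a3 < #|~: a'| ->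
  SC c a' b' (a1 + a2) a3 = SC c a b a1 (a2 + a3))%N.
Proof.
move=> sa sb h1 h2 h3 h4 h5 l1 l2 l3.
have [f [bf fa fa']] : exists f : J -> (({y | y \in [set y : {x | x \in a'} | val y \in a]} +
   {y | y \notin [set y : {x | x \in a'} | val y \in a]}) + {x | x \notin a'})%type,
   [/\ bijective f, forall x, (x \in a') = isl (f x) & forall x, (x \in a) = isl (sumA (f x))].
  exists (sumf (@split_set _ [set y : {x | x \in a'} | val y \in a]) id \o @split_set J a'); split.
  - by apply: bij_comp; [apply: sumf_bij; [exact: split_bij|exact: id_bij]|exact: split_bij].
  - by move=> x /=; rewrite -isl_split; case: split_set.
  - move=> x /=; rewrite isl_sumA; pattern (split_set a' x); apply: split_setP => h /=.
      by rewrite isl_split inE.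
    by apply/negbTE; apply: contra h; exact: (subsetP sa).
have [g [bg gb gb']] : exists g : I -> (({y | y \in [set y : {x | x \in b'} | val y \in b]} +
   {y | y \notin [set y : {x | x \in b'} | val y \in b]}) + {x | x \notin b'})%type,
   [/\ bijective g, forall x, (x \in b') = isl (g x) & forall x, (x \in b) = isl (sumA (g x))].
  exists (sumf (@split_set _ [set y : {x | x \in b'} | val y \in b]) id \o @split_set I b'); split.
  - by apply: bij_comp; [apply: sumf_bij; [exact: split_bij|exact: id_bij]|exact: split_bij].
  - by move=> x /=; rewrite -isl_split; case: split_set.
  - move=> x /=; rewrite isl_sumA; pattern (split_set b' x); apply: split_setP => h /=.
      by rewrite isl_split inE.
    by apply/negbTE; apply: contra h; exact: (subsetP sb).
have bf' : bijective (@sumA _ _ _ \o f) by apply: bij_comp => //; exact: sumA_bij.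
have bg' : bijective (@sumA _ _ _ \o g) by apply: bij_comp => //; exact: sumA_bij.
rewrite (splitc_isl c _ _ bf bg fa gb) (splitc_isl c _ _ bf' bg' fa' gb').
have [c1 c2] := isl_cards bf fa; have [c3 c4] := isl_cards bg gb.
have [c5 c6] := isl_cards bf' fa'; have [c7 c8] := isl_cards bg' gb'.
have cJ := cardsC a; have cI := cardsC b; have cJ' := cardsC a'; have cI' := cardsC b'.
clear fa fa' gb gb' bf' bg' sa sb.
rewrite card_sum in c1; rewrite card_sum in c3; rewrite card_sum in c6; rewrite card_sum in c8.
apply: split_chain => //; try (apply: IH); rewrite /dm /stable ?card_option ?card_sum ?card_option; try (case: ifP); lia.
Qed.

Hypothesis kappa_cor : corelations (lb_incl P) kappa.

(** At vertices with the arity of a generator, good by induction, the coordinates [eps] agree with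
    the projection [geps], for which the corelations give equations. *)
Lemma SC_geps (c : C J I) J1 I1 J2 I2 (f : J -> (J1 + J2)%type) (g : I -> (I1 + I2)%type)
   (a : {set J}) (b : {set I}) k l :
  bijective f -> bijective g -> (forall x, (x \in a) = isl (f x)) -> (forall x, (x \in b) = isl (g x)) ->
  weight1 (option J1) I1 -> weight1 J2 (option I2) -> (4 <= #|J| + #|I|)%N ->
  SC c a b k l = splitc (geps kappa) f g c k l.
Proof.
move=> bf bg ha hb w1 w2 hn; rewrite (splitc_isl c k l bf bg ha hb) /splitc; congr (_ * _).
move: (w1) (w2); rewrite /weight1 !card_option => w1' w2'.
by apply: eq_bigr => t _; rewrite !good_weight1 //; apply: IH; rewrite card_option; lia.
Qed.

Lemma set0P0 (T : finType) (a : {set T}) : #|a| = 0%N -> forall x, (x \in a) = false.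
Proof. by move=> h x; rewrite (cards0_eq h) inE. Qed.

Lemma setTP0 (T : finType) (a : {set T}) : #|~: a| = 0%N -> forall x, (x \in a) = true.
Proof. by move=> h x; have := set0P0 h x; rewrite inE => /negbFE. Qed.

Lemma weight2_13 (c : C J I) : #|J| = 1%N -> #|I| = 3%N ->
  exists U : nat -> K, forall (a : {set J}) (b : {set I}) k l,
    valid_split a b -> (k <= #|a|)%N -> (l < #|~: a|)%N -> SC c a b k l = U (k + l)%N.
Proof.
move=> hJ hI; have [h bh] : exists h : J -> unit, bijective h by apply: card_bij; rewrite card_unit.
have [k' bk] : exists k : I -> 'I_3, bijective k by apply: card_bij; rewrite card_ord.
exists (fun _ => osg K h * splitc (geps kappa) (@inr void unit) (cutr 0) (act h k' c) 0 0).
move=> a b k l /and4P[v1 v2 v3 v4] hk hl; have cJ := cardsC a; have cI := cardsC b.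
have a0 : #|a| = 0%N by lia.
have -> : k = 0%N by lia. have -> : l = 0%N by lia.
have /eqP/cards1P[i bi] : #|~: b| = 1%N by lia.
have bc : bijective (cutr (k' i)) by exists (cutrV (k' i)); [exact: cutrK|exact: cutrVK].
have br : bijective (@inr void unit) by apply: inr_bij0; exact: card_void.
have bhr : bijective (@inr void unit \o h) by exact: bij_comp.
have bkr : bijective (cutr (k' i) \o k') by exact: bij_comp.
have ha x : (x \in a) = isl ((@inr void unit \o h) x) by rewrite set0P0.
have hb x : (x \in b) = isl ((cutr (k' i) \o k') x).
  rewrite -[b]setCK bi !inE /= /cutr -(inj_eq (bij_inj bk)).
  by case: eqP => //= ?; case: ifP.
rewrite (SC_geps c 0 0 bhr bkr ha hb) /weight1 ?card_option ?card_void ?card_unit ?card_bool ?hJ ?hI //.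
rewrite (splitc_13 kappa_cor two_neq0 _ 0 (k' i)) splitc_act // mulrA osgK mul1r.
by [].
Qed.

Lemma weight2_31 (c : C J I) : #|J| = 3%N -> #|I| = 1%N ->
  exists U : nat -> K, forall (a : {set J}) (b : {set I}) k l,
    valid_split a b -> (k <= #|a|)%N -> (l < #|~: a|)%N -> SC c a b k l = U (k + l)%N.
Proof.
move=> hJ hI; have [h bh] : exists h : J -> 'I_3, bijective h by apply: card_bij; rewrite card_ord.
have [k' bk] : exists k : I -> unit, bijective k by apply: card_bij; rewrite card_unit.
(* A total index [t] among 0, 1, 2 is written as a sum of two indices that are at most 1. *)
exists (fun t => osg K h * splitc (geps kappa) (cutl 0) (@inl unit void) (act h k' c)
  (inord (minn t 1) : 'I_2) (inord (t - minn t 1) : 'I_2)).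
move=> a b k l /and4P[v1 v2 v3 v4] hk hl; have cJ := cardsC a; have cI := cardsC b.
have b0 : #|~: b| = 0%N by lia.
have /eqP/cards1P[i ai] : #|a| = 1%N by lia.
have bc : bijective (cutl (h i)) by exists (cutlV (h i)); [exact: cutlK|exact: cutlVK].
have br : bijective (@inl unit void) by apply: inl_bij0; exact: card_void.
have bhr : bijective (cutl (h i) \o h) by exact: bij_comp.
have bkr : bijective (@inl unit void \o k') by exact: bij_comp.
have hb x : (x \in b) = isl ((@inl unit void \o k') x) by rewrite setTP0.
have ha x : (x \in a) = isl ((cutl (h i) \o h) x).
  rewrite ai !inE /= /cutl -(inj_eq (bij_inj bh)).
  by case: eqP => //= ?; case: ifP.
rewrite (SC_geps c k l bhr bkr ha hb) /weight1 ?card_option ?card_void ?card_unit ?card_bool ?hJ ?hI //.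
have k2 : (k < 2)%N by lia. have l2 : (l < 2)%N by lia.
rewrite (splitc_31 kappa_cor _ 0 (h i) (x' := Ordinal k2) (y' := Ordinal l2)).
  by rewrite splitc_act // mulrA osgK mul1r.
by rewrite !inordK /=; lia.
Qed.

Lemma weight2_22 (c : C J I) : #|J| = 2%N -> #|I| = 2%N ->
  exists U : nat -> K, forall (a : {set J}) (b : {set I}) k l,
    valid_split a b -> (k <= #|a|)%N -> (l < #|~: a|)%N -> SC c a b k l = U (k + l)%N.
Proof.
move=> hJ hI; have [h bh] : exists h : J -> bool, bijective h by apply: card_bij; rewrite card_bool.
have [k' bk] : exists k : I -> bool, bijective k by apply: card_bij; rewrite card_bool.
exists (fun t => osg K h * splitc (geps kappa) (@inr void bool) (@inl bool void) (act h k' c) 0 t).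
move=> a b k l /and4P[v1 v2 v3 v4] hk hl; have cJ := cardsC a; have cI := cardsC b.
have br : bijective (@inr void bool) by apply: inr_bij0; exact: card_void.
have bl : bijective (@inl bool void) by apply: inl_bij0; exact: card_void.
case: (posnP #|a|) => [a0|a_gt0].
  have b0 : #|~: b| = 0%N by lia.
  have bhr : bijective (@inr void bool \o h) by exact: bij_comp.
  have bkr : bijective (@inl bool void \o k') by exact: bij_comp.
  have hb x : (x \in b) = isl ((@inl bool void \o k') x) by rewrite setTP0.
  have ha x : (x \in a) = isl ((@inr void bool \o h) x) by rewrite set0P0.
  rewrite (SC_geps c k l bhr bkr ha hb) /weight1 ?card_option ?card_void ?card_unit ?card_bool ?hJ ?hI //.
  have -> : k = 0%N by lia.
  by rewrite splitc_act // mulrA osgK mul1r.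
have /eqP/cards1P[j aj] : #|a| = 1%N by lia.
have /eqP/cards1P[i bi] : #|b| = 1%N by lia.
have bc x : bijective (cutb x) by exists (cutbV x); [exact: cutbK|exact: cutbVK].
have bhr : bijective (cutb (h j) \o h) by exact: bij_comp.
have bkr : bijective (cutb (k' i) \o k') by exact: bij_comp.
have ha x : (x \in a) = isl ((cutb (h j) \o h) x).
  by rewrite aj !inE /= /cutb -(inj_eq (bij_inj bh)); case: eqP.
have hb x : (x \in b) = isl ((cutb (k' i) \o k') x).
  by rewrite bi !inE /= /cutb -(inj_eq (bij_inj bk)); case: eqP.
rewrite (SC_geps c k l bhr bkr ha hb) /weight1 ?card_option ?card_void ?card_unit ?card_bool ?hJ ?hI //.
have k2 : (k < 2)%N by lia. have -> : l = 0%N by lia.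
rewrite addn0 -[k]/(val (Ordinal k2)) -(splitc_22 kappa_cor two_neq0 _ (h j) (k' i)).
by rewrite splitc_act // mulrA osgK mul1r.
Qed.

Lemma SC_homogeneous (c : C J I) : stable J I -> (4 <= #|J| + #|I|)%N ->
  exists U : nat -> K, forall (a : {set J}) (b : {set I}) k l,
    valid_split a b -> (k <= #|a|)%N -> (l < #|~: a|)%N -> SC c a b k l = U (k + l)%N.
Proof.
case/and3P=> h1 h2 h3 h4; case: (leqP 5 (#|J| + #|I|)) => h5.
  by apply: connect_split => // *; exact: SC_move.
case: (ltngtP #|J| 2) => hJ; [apply: weight2_13|apply: weight2_31|apply: weight2_22]; lia.
Qed.

(** In the arities of the generators this is injectivity of [phi0]. Elsewhere every coefficient [t]
    is visible in a decomposition, so it suffices to exhibit a valid splitting with indices of sum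
    [t]. *)
Lemma h0_inj_step : stable J I -> injective (h0 J I).
Proof.
move=> st u v e; case: (boolP (weight1 J I)) => w.
  by apply: (@phi0_inj K G) => //; have := congr1 (kappa J I) e; rewrite !kappa_h0.
have /and3P[h1 h2 h3] := st; rewrite /weight1 in w.
apply: cfP => t ht; have {}ht : (t < #|J|)%N by apply: leq_trans ht _; rewrite dm_stable.
have [a [b [k [l [vab hk hl <-]]]]] : exists (a : {set J}) (b : {set I}) k l,
   [/\ valid_split a b, k <= #|a|, l < #|~: a| & k + l = t]%N; last by rewrite -(SC_h0 u vab) // -(SC_h0 v vab) // e.
case: (leqP #|I| 1) => hI.
  have /card_gt0P[j _] : (0 < #|J|)%N by lia.
  have := cardsC [set j]; rewrite cards1 => cj.
  exists [set j], setT, (minn t 1), (t - minn t 1)%N; split; rewrite /valid_split ?cards1 ?setCT ?cards0 ?cardsT; lia.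
case: (leqP #|J| 1) => hJ; last first.
  by exists set0, setT, 0%N, t; split; rewrite /valid_split ?setC0 ?setCT ?cards0 ?cardsT; lia.
have /card_gt0P[i _] : (0 < #|I|)%N by lia.
have := cardsC [set i]; rewrite cards1 => ci.
by exists set0, (~: [set i]), 0%N, t; split; rewrite /valid_split ?setC0 ?setCK ?cards1 ?cards0 ?cardsT; lia.
Qed.

(** An element in the degree of the model has the decompositions and projection of some model
    element, and the difference vanishes by detection of zero; a homogeneous element of any other
    degree is itself zero by the same detection. *)
Lemma h0_surj_step : stable J I -> forall c, exists u, c = h0 J I u.
Proof.
move=> st c; have [s [f [hf ->]]] := hdeg_span (hdeg_grading C J I) c.
suff H p x : hdeg p x -> exists u, x = h0 J I u.
  exists (\sum_(p <- s) projT1 (cid (H _ _ (hf p)))); rewrite (lin_sum (@h0_linear J I)).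
  by apply: eq_bigr => p _; case: cid.
move=> hp; case: (eqVneq p (mdeg J)) => [e|ne]; last first.
  exists 0; rewrite (lin0 (@h0_linear J I)); apply: (primitive_eq0 C_dual hp); last first.
    case: (gens_deg (bh_hdeg kappa hp)) => // /addrI e; by rewrite e eqxx in ne.
  (* The degrees of the two factors add up to [p], so one of them differs from the degree of the
     model, and [eps] kills that factor. *)
  apply: primitive_crit => a b k l v hk hl; rewrite /SC /splitc.
  rewrite /sweedler big_seq big1 ?mulr0 // => t ht.
  have hact := act_hdeg (split_bij a) (split_bij b) hp.
  have h1 := dec_hdegl ht; have h2 := dec_hdegr hact ht.
  case: (eqVneq t.1.1 (mdeg (option {x | x \in a}))) => e1; last first.
    by rewrite (eps_deg h1 e1) cf0 mul0r.
  rewrite (eps_deg h2) ?cf0 ?mulr0 //.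
  move: ne; rewrite e1 /mdeg card_option card_sigin card_signotin; have := cardsC a; lia.
have fin u : (forall (a : {set J}) (b : {set I}) k l, valid_split a b -> (k <= #|a|)%N -> (l < #|~: a|)%N ->
     SC x a b k l = cf u (k + l)) -> kappa J I x = phi0 G u -> exists u, x = h0 J I u.
  move=> hu ku; exists u; apply/eqP; rewrite -subr_eq0; apply/eqP.
  have hm : hdeg p (x - h0 J I u).
    rewrite addrC -scaleN1r; apply: (hdegP (hdeg_grading C J I)) => //.
    by rewrite e; apply: (@bh_hdeg _ _ _ h0); left.
  apply: (primitive_eq0 C_dual hm).
    apply: primitive_crit => a b k l v hk hl.
    rewrite addrC -scaleN1r (SC_linear a b k l) hu // SC_h0 // mulN1r; exact: addNr.
  rewrite (linB (@bh_linear _ _ _ kappa _ _)) kappa_h0 ku; exact: subrr.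
have /and3P[h1 h2 h3] := st.
case: (leqP 4 (#|J| + #|I|)) => h4.
  have [U hU] := SC_homogeneous x st h4.
  apply: (fin [ffun i : 'I_(dm J I) => U i]) => [a b k l v hk hl|].
    rewrite hU // (cf_ffun _ U) (dm_stable st); case: ifP => //.
    by have := cardsC a; lia.
  have w : ~~ weight1 J I by rewrite /weight1; lia.
  by rewrite -(phi0_psi (kappa J I x)) psi_out // !phi0_out.
(* In total arity 3 there is no valid splitting, so only the projection has to match. *)
apply: (fin (psi (kappa J I x))); last by rewrite phi0_psi.
move=> a b k l /and4P[v1 v2 v3 v4]; have := cardsC a; have := cardsC b; lia.
Qed.

End Induction.

Theorem h0_bij J I : good J I.
Proof.
have [n] := ubnP (#|J| + #|I|); elim: n J I => // n IH J I hn.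
case: (boolP (stable J I)) => st; last exact: good_unstable.
have IH' J' I' : (#|J'| + #|I'| < #|J| + #|I|)%N -> good J' I' by move=> h; apply: IH; lia.
have [kc _] := C_dual.
by apply: goodP; [exact: h0_inj_step|exact: h0_surj_step].
Qed.

End DualCodioperad.

(** * Formal power series *)

Section Series.
Variables (K : fieldType) (n : nat).
Local Notation midx := {ffun 'I_n -> nat}.
Local Notation series := (series K n).
Implicit Types (f g : series) (m : midx).

Definition madd m (l : 'I_n) : midx := [ffun i => (m i + (i == l))%N].

Definition bfun N (b : {ffun 'I_n -> 'I_N.+1}) : midx := [ffun i => b i : nat].

(** The index type in [mul_series] depends on [m]; a common bound [N] makes sums for different
    multi-indices comparable. *)
Lemma mul_seriesE N f g m : (forall i, m i <= N)%N ->
  mul_series f g m = \sum_(b : {ffun 'I_n -> 'I_N.+1} | [forall i, b i <= m i]%N)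
     f (bfun b) * g [ffun i => (m i - b i)%N].
Proof.
move=> hN; rewrite /mul_series.
rewrite (reindex_onto (fun b : {dffun forall i : 'I_n, 'I_(m i).+1} => [ffun i => inord (b i)] : {ffun 'I_n -> 'I_N.+1})
  (fun b => [ffun i => inord (b i)])); last first.
  move=> b /forallP hb; apply/ffunP => i; rewrite !ffunE; apply: val_inj.
  by rewrite /= !inordK // ?ltnS // (hb i).
have bN (b : {dffun forall i : 'I_n, 'I_(m i).+1}) i : (b i < N.+1)%N.
  by apply: leq_trans (ltn_ord (b i)) _; rewrite ltnS.
apply: eq_big => [b|b _].
  apply/esym/andP; split; first by apply/forallP => i; rewrite !ffunE inordK // -ltnS.
  by apply/eqP/ffunP => i; rewrite !ffunE; apply: val_inj; rewrite /= !inordK.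
by congr (f _ * g _); apply/ffunP => i; rewrite !ffunE inordK.
Qed.

(** In the term [b] of the coefficient at [madd m l], the weight [(m l).+1] is written as [b l] plus
    [(m l).+1 - b l]: the first part differentiates [f], after a shift of [b], and the second
    differentiates [g]. *)
Lemma deriv_mul l f g m : deriv_series l (mul_series f g) m =
  mul_series (deriv_series l f) g m + mul_series f (deriv_series l g) m.
Proof.
(* One more than the total degree, so as to bound [madd m l] as well. *)
pose N := (\sum_i m i).+1.
have mN i : (m i < N)%N by rewrite ltnS (bigD1 i) //= leq_addr.
have mN1 i : (m i <= N)%N by exact: ltnW.
have mN2 i : (madd m l i <= N)%N by rewrite ffunE; case: (i == l); rewrite ?addn1 ?addn0.
rewrite {1}/deriv_series -/(madd m l) (mul_seriesE _ _ mN2) !(mul_seriesE _ _ mN1) mulr_sumr.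
pose A (b : {ffun 'I_n -> 'I_N.+1}) := (b l)%:R * (f (bfun b) * g [ffun i => (madd m l i - b i)%N]).
pose B (b : {ffun 'I_n -> 'I_N.+1}) := ((m l).+1 - b l)%:R * (f (bfun b) * g [ffun i => (madd m l i - b i)%N]).
rewrite (eq_bigr (fun b => A b + B b)); last first.
  move=> b /forallP hb; rewrite /A /B -mulrDl -natrD subnKC //.
  by have := hb l; rewrite ffunE eqxx addn1.
rewrite big_split /=; congr (_ + _).
- rewrite (bigID (fun b : {ffun 'I_n -> 'I_N.+1} => (b l : nat) == 0%N)) /= big1 ?add0r; last first.
    by move=> b /andP[_ /eqP h]; rewrite /A h mul0r.
  rewrite (reindex_onto (fun b : {ffun 'I_n -> 'I_N.+1} => [ffun i => inord (b i + (i == l))] : {ffun 'I_n -> 'I_N.+1})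
    (fun b => [ffun i => inord (b i - (i == l))])); last first.
    move=> b /andP[/forallP hb hl]; apply/ffunP => i; rewrite !ffunE; apply: val_inj => /=.
    have := ltn_ord (b i); rewrite ltnS => hbi.
    rewrite [inord (b i - _) : nat]inordK; last by rewrite ltnS (leq_trans (leq_subr _ _)).
    case: (eqVneq i l) => [e|_]; last by rewrite subn0 addn0 inordK.
    by rewrite e subnK ?inordK // lt0n.
  rewrite [LHS](eq_bigl (fun b : {ffun 'I_n -> 'I_N.+1} => [forall i, (b i <= m i)%N])); last first.
    move=> b; apply/idP/idP.
      move=> /andP[/andP[/forallP h1 h2] /eqP h3]; apply/forallP => i.
      have := h1 i; rewrite !ffunE; case: (eqVneq i l) => [e|_]; last by rewrite !addn0 inord_val.
      (* Out of range [inord] would return 0, which [h2] excludes. *)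
      have lt : (b l + 1 < N.+1)%N.
        rewrite ltnNge; apply/negP => hN; move: h2; rewrite ffunE eqxx.
        have := ltn_ord (b l) => bl; have e' : (b l + 1 = N.+1)%N by lia.
        by rewrite e' /inord val_insubd ltnn.
      by rewrite e !addn1 inordK ?addn1 // -addn1.
    move=> /forallP hb; have lt i : (b i + (i == l) < N.+1)%N.
      by rewrite ltnS; apply: leq_trans (mN2 i); rewrite ffunE leq_add2r.
    rewrite -andbA; apply/and3P; split.
    - by apply/forallP => i; rewrite !ffunE inordK // leq_add2r.
    - by rewrite ffunE inordK // eqxx addn1.
    - by apply/eqP/ffunP => i; rewrite !ffunE inordK // addnK inord_val.
  apply: eq_bigr => b /forallP hb; have lt i : (b i + (i == l) < N.+1)%N.
    by rewrite ltnS; apply: leq_trans (mN2 i); rewrite ffunE leq_add2r.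
  rewrite /A /deriv_series ffunE inordK // eqxx addn1 ffunE mulrA; congr (_%:R * f _ * g _).
  + by apply/ffunP => i; rewrite !ffunE inordK.
  + by apply/ffunP => i; rewrite !ffunE inordK // subnDr.
- rewrite [RHS]big_mkcond [LHS]big_mkcond; apply: eq_bigr => b _.
  case: (boolP [forall i, (b i <= m i)%N]) => [/forallP hb|hb].
    rewrite ifT; last by apply/forallP => i; rewrite ffunE (leq_trans (hb i)) // leq_addr.
    rewrite /B /deriv_series ffunE subSn // mulrCA; congr (_ * (_ * g _)).
    by apply/ffunP => i; rewrite !ffunE addnBAC.
  case: ifP => // /forallP hb'; rewrite /B.
  suff -> : ((m l).+1 - b l = 0)%N by rewrite mul0r.
  apply/eqP; rewrite subn_eq0; move: hb; apply: contraR; rewrite -ltnNge => hbl.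
  apply/forallP => i; have := hb' i; rewrite ffunE; case: (eqVneq i l) => [->|_]; last by rewrite addn0.
  by move=> _; rewrite -ltnS.
Qed.

(** The partial derivative of [f] of multi-index [m] at the origin. *)
Definition tc f m : K := (\prod_l (m l)`!)%:R * f m.

Lemma tc_madd f m l : tc f (madd m l) = tc (deriv_series l f) m.
Proof.
rewrite /tc /deriv_series -/(madd m l) mulrA -natrM; congr (_%:R * _).
rewrite [in LHS](bigD1 l) //= [in RHS](bigD1 l) //= ffunE eqxx addn1 factS -mulnA mulnC; congr (_ * _)%N.
by congr (_ * _)%N; apply: eq_bigr => i /negbTE h; rewrite ffunE h addn0.
Qed.

(** The multi-index of the word [w] restricted to the positions in [D]. *)
Definition cnt (I : finType) (D : {set I}) (w : I -> 'I_n) : midx := [ffun l => #|[set i in D | w i == l]|].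

Lemma cntU1 (I : finType) (D : {set I}) (w : I -> 'I_n) i : i \notin D -> cnt (i |: D) w = madd (cnt D w) (w i).
Proof.
move=> hi; apply/ffunP => l; rewrite !ffunE.
have [e|e] := eqVneq l (w i).
  have -> : [set j in i |: D | w j == l] = i |: [set j in D | w j == l].
    by apply/setP => j; rewrite !inE andb_orl; case: (eqVneq j i) => // ->; rewrite e eqxx.
  by rewrite cardsU1 !inE (negbTE hi) /= addnC.
rewrite addn0; congr #|pred_of_set _|; apply/setP => j; rewrite !inE.
by case: (eqVneq j i) => // ->; rewrite (negbTE hi) eq_sym (negbTE e).
Qed.

Lemma tcD f g m : tc (fun m => f m + g m) m = tc f m + tc g m.
Proof. exact: mulrDr. Qed.

Lemma eq_tc f g m : f =1 g -> tc f m = tc g m.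
Proof. by move=> h; rewrite /tc h. Qed.

Lemma big_subset_U1 (V : nmodType) (I : finType) (D : {set I}) i (F : {set I} -> V) : i \notin D ->
  \sum_(b : {set I} | b \subset i |: D) F b = \sum_(b : {set I} | b \subset D) (F (i |: b) + F b).
Proof.
move=> hi; rewrite big_split /= (bigID (fun b : {set I} => i \in b)) /=; congr (_ + _).
  rewrite (reindex_onto (fun b => i |: b) (fun b => b :\ i)) /=.
    apply: eq_bigl => b; rewrite subUset !sub1set !inE eqxx /= andbT.
    apply/andP/idP => [[h1 /eqP h2]|h].
      apply/subsetP => x xb; have := subsetP h1 x xb; rewrite !inE => /orP[/eqP e|//].
      by move: xb; rewrite -h2 !inE e eqxx.
    split; first by apply: subset_trans h _; exact: subsetUr.
    rewrite setU1K //; apply: contra hi; exact: (subsetP h).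
  by move=> b /andP[_ ib]; rewrite setD1K.
apply: eq_bigl => b; apply/andP/idP => [[h1 h2]|h].
  apply/subsetP => x xb; have := subsetP h1 x xb; rewrite !inE => /orP[/eqP e|//].
  by move: h2; rewrite -e xb.
split; first by apply: subset_trans h _; exact: subsetUr.
by apply: contra hi; exact: (subsetP h).
Qed.

(** Induction on [D]: removing a position [i] differentiates the product along [w i], and the two
    terms of the product rule account for the subsets with and without [i]. *)
Lemma leibniz_set (I : finType) (w : I -> 'I_n) (D : {set I}) f g :
  tc (mul_series f g) (cnt D w) =
  \sum_(b : {set I} | b \subset D) tc f (cnt b w) * tc g (cnt (D :\: b) w).
Proof.
have [k] := ubnP #|D|; elim: k D f g => // k IH D f g hD.
case: (set_0Vmem D) => [->|[i iD]].
  rewrite (big_pred1 set0); last by move=> b; rewrite subset0.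
  have c0 : cnt (set0 : {set I}) w = [ffun => 0%N].
    by apply/ffunP => l; rewrite !ffunE; apply/eqP; rewrite cards_eq0; apply/eqP/setP => j; rewrite !inE.
  rewrite setD0 c0 /tc.
  have -> : (\prod_(l < n) (([ffun=> 0] : midx) l)`! = 1)%N by apply: big1 => l _; rewrite ffunE.
  rewrite !mul1r (@mul_seriesE 0); last by move=> j; rewrite ffunE.
  rewrite (big_pred1 [ffun => ord0]); last first.
    move=> b; rewrite /=; apply/forallP/eqP => [_|_ j]; last by rewrite !ord1.
    by apply/ffunP => j; rewrite !ord1.
  by congr (f _ * g _); apply/ffunP => l; rewrite !ffunE.
have iD' : i \notin D :\ i by rewrite !inE eqxx.
have hD' : (#|D :\ i| < k)%N by move: hD; rewrite (cardsD1 i) iD ltnS.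
rewrite -{1 2}(setD1K iD) cntU1 // tc_madd (eq_tc _ (deriv_mul _ f g)) tcD !IH // big_subset_U1 // -big_split.
apply: eq_bigr => b hb /=.
have ib : i \notin b by apply: contra iD'; exact: (subsetP hb).
rewrite cntU1 // tc_madd; congr (_ * tc _ (cnt _ _) + _).
  by apply/setP => x; rewrite !inE negb_or; case: (x == i); case: (x \in b).
rewrite -tc_madd -cntU1; last by rewrite !inE eqxx andbF.
congr (_ * tc _ (cnt _ _)); apply/setP => x; rewrite !inE.
by case: eqP => [->|//]; rewrite iD (negbTE ib).
Qed.

(** Words are indexed by arbitrary finite types, so that the inputs of a vertex of a tree can serve
    as positions. *)
Definition tay (I : finType) f (w : {ffun I -> 'I_n}) : K := tc f (cnt setT w).

Lemma cnt_sub (I : finType) (p : pred I) (D : {set I}) (w : {ffun I -> 'I_n}) : (forall i, p i = (i \in D)) ->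
  cnt setT [ffun i : {i | p i} => w (val i)] = cnt D w.
Proof.
move=> hp; apply/ffunP => l; rewrite !ffunE -(card_imset _ val_inj); congr #|pred_of_set _|.
apply/setP => i; rewrite !inE; apply/imsetP/andP.
  by move=> [[j hj]]; rewrite !inE ffunE /= => h ->; rewrite -hp hj.
move=> [h1 h2]; have h : p i by rewrite hp.
by exists (exist _ i h) => //; rewrite !inE ffunE.
Qed.

Lemma leibniz (I : finType) (w : {ffun I -> 'I_n}) f g :
  tay (mul_series f g) w = \sum_(b : {set I}) tay f [ffun i : {i | i \in b} => w (val i)]
      * tay g [ffun i : {i | i \notin b} => w (val i)].
Proof.
rewrite /tay leibniz_set (eq_bigl predT); last by move=> b; rewrite subsetT.
apply: eq_bigr => b _; rewrite (@cnt_sub _ _ b) // (@cnt_sub _ _ (setT :\: b)) //.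
by move=> i; rewrite !inE andbT.
Qed.

Lemma tay_ocons (I : finType) (w : {ffun I -> 'I_n}) f s : tay f (ocons s w) = tay (deriv_series s f) w.
Proof.
rewrite /tay -tc_madd; congr tc; apply/ffunP => l; rewrite !ffunE.
rewrite (cardsD1 None) !inE !ffunE addnC eq_sym; congr (_ + _)%N.
have si : injective (@Some I) by move=> ? ? [].
rewrite -(card_imset _ si); congr #|pred_of_set _|; apply/setP => -[i|]; rewrite !inE.
  by rewrite mem_imset // !inE ffunE.
by apply/esym/negbTE/imsetP => -[].
Qed.

Lemma taylorE f k (a : {ffun 'I_k -> 'I_n}) : taylor f a = tay f a.
Proof.
rewrite /taylor /tay /const_coef.
(* The induction on the word changes the multi-index, so [m] is general here; the goal is the case
   of the zero multi-index. *)
have H (s : seq 'I_n) m : (\prod_l (m l)`!)%:R * foldr (fun x g => deriv_series x g) f s m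
    = (\prod_l (m l + count_mem l s)`!)%:R * f [ffun l => (m l + count_mem l s)%N].
  elim: s m => [|x s IH] m /=.
    congr (_%:R * f _); first by apply: eq_bigr => l _; rewrite addn0.
    by apply/ffunP => l; rewrite ffunE addn0.
  have := IH (madd m x); rewrite -/(tc (foldr _ f s) (madd m x)) tc_madd /tc => ->.
  congr (_%:R * f _); first by apply: eq_bigr => l _; rewrite ffunE eq_sym addnA.
  by apply/ffunP => l; rewrite !ffunE eq_sym addnA.
have := H [seq a i | i <- enum 'I_k] [ffun => 0%N].
rewrite foldr_map big1; last by move=> l _; rewrite ffunE.
rewrite mul1r => ->; rewrite /tc.
have E l : (([ffun => 0%N] : midx) l + count_mem l [seq a i | i <- enum 'I_k])%N = cnt setT a l.
  rewrite !ffunE add0n count_map -sum1_count big_enum_cond -sum1_card.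
  by apply: eq_bigl => i; rewrite !inE.
congr (_%:R * f _); first by apply: eq_bigr => l _; rewrite E.
by apply/ffunP => l; rewrite ffunE E.
Qed.

End Series.

(** * Words with a given multi-index *)

Section Realization.
Variable n : nat.
Local Notation midx := {ffun 'I_n -> nat}.

Lemma sum_cnt (I : finType) (w : I -> 'I_n) : (\sum_l cnt setT w l = #|I|)%N.
Proof.
rewrite -sum1_card (partition_big w predT) //=; apply: eq_bigr => l _.
by rewrite ffunE -sum1_card; apply: eq_bigl => i; rewrite !inE.
Qed.

Lemma cnt_realize (m : midx) k : (\sum_l m l = k)%N -> exists w : {ffun 'I_k -> 'I_n}, cnt setT w = m.
Proof.
move=> <-; set k' := (\sum_l m l)%N.
(* Positions are matched with the disjoint union of [m l] copies of each letter [l]. *)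
have h : #|{: 'I_k'}| = #|{: {l : 'I_n & 'I_(m l)}}|.
  by rewrite card_tagged card_ord sumnE big_map big_enum; apply: eq_bigr => l _; rewrite card_ord.
have [f bf] := card_bij h; exists [ffun i => tag (f i)]; apply/ffunP => l; rewrite !ffunE.
rewrite -[RHS]card_ord -[RHS](card_imset _ (f := fun x : 'I_(m l) => Tagged (fun l => 'I_(m l)) x)); last first.
  by move=> x y /eqP; rewrite eq_Tagged => /eqP.
rewrite -(card_imset _ (bij_inj bf)); congr #|pred_of_set _|; apply/setP => y; apply/imsetP/imsetP.
  move=> [x]; rewrite !inE ffunE => /eqP e ->; case: (f x) e => l' z /= e.
  by subst l'; exists z.
move=> [x _ ->]; have [f' fK f'K] := bf; exists (f' (Tagged (fun l => 'I_(m l)) x)); last by rewrite f'K.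
by rewrite !inE ffunE f'K /= eqxx.
Qed.

Lemma cnt_perm k (a b : {ffun 'I_k -> 'I_n}) : cnt setT a = cnt setT b ->
  exists2 s : 'I_k -> 'I_k, bijective s & forall i, a i = b (s i).
Proof.
move=> e; have /tuple_permP[p hp] : perm_eq [tuple a i | i < k] [tuple b i | i < k].
  apply/allP => l _ /=; apply/eqP; have := congr1 (fun m : midx => m l) e; rewrite !ffunE.
  have E (c : {ffun 'I_k -> 'I_n}) : count_mem l [seq c i | i <- enum 'I_k] = #|[set i in setT | c i == l]|.
    by rewrite count_map -sum1_count big_enum_cond -sum1_card; apply: eq_bigl => i; rewrite !inE.
  by rewrite !E.
exists p; first by exists (perm_inv p) => i; [exact: permK|exact: permKV].
move=> i; have := congr1 (fun s : seq 'I_n => nth (a i) s i) hp.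
by rewrite -!tnth_nth !tnth_mktuple.
Qed.

Lemma cnt_bij (I I' : finType) (g : I -> I') (w : I' -> 'I_n) : bijective g ->
  cnt setT (fun i => w (g i)) = cnt setT w.
Proof.
move=> bg; apply/ffunP => l; rewrite !ffunE -(card_imset _ (bij_inj bg)).
congr #|pred_of_set _|; apply/setP => y; have [g' gK g'K] := bg; rewrite !inE.
apply/imsetP/idP => [[x]|h]; first by rewrite !inE => h ->.
by exists (g' y); rewrite ?inE g'K.
Qed.

End Realization.

(** * Series with given Taylor coefficients *)

Section CharZero.
Variables (K : numFieldType) (n : nat).
Local Notation midx := {ffun 'I_n -> nat}.

Lemma fact_neq0 (m : midx) : (\prod_l (m l)`!)%:R != 0 :> K.
Proof. by rewrite pnatr_eq0 -lt0n prodn_gt0 // => l; exact: fact_gt0. Qed.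

Lemma series0P (f : series K n) : const_coef f = 0 ->
  (forall k (a : {ffun 'I_k.+1 -> 'I_n}), tay f a = 0) -> forall m, f m = 0.
Proof.
move=> h0 h m; case e : (\sum_l m l)%N => [|k].
  rewrite -h0; congr f; apply/ffunP => l; rewrite ffunE; apply/eqP; rewrite -leqn0 -e.
  by rewrite (bigD1 l) //= leq_addr.
have [w hw] := cnt_realize e; have := h k w; rewrite /tay hw /tc => /eqP.
by rewrite mulf_eq0 (negbTE (fact_neq0 m)) => /eqP.
Qed.

(** The coefficient at [m] uses some chosen word of multi-index [m]. Words here are nonempty, so the
    zero multi-index has none and the constant coefficient is 0. *)
Definition ser (t : forall k, {ffun 'I_k.+1 -> 'I_n} -> K) : series K n := fun m =>
  if pselect (exists ka : {k & {ffun 'I_k.+1 -> 'I_n}}, cnt setT (tagged ka) = m) is left h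
  then t _ (tagged (projT1 (cid h))) / (\prod_l (m l)`!)%:R else 0.

Lemma ser_const t : const_coef (ser t) = 0.
Proof.
rewrite /const_coef /ser; case: pselect => // -[[k a] h].
by exfalso; have := sum_cnt a; rewrite /= in h; rewrite h card_ord big1 // => l _; rewrite ffunE.
Qed.

Lemma tay_ser t : (forall k (a b : {ffun 'I_k.+1 -> 'I_n}), cnt setT a = cnt setT b -> t k a = t k b) ->
  forall k (a : {ffun 'I_k.+1 -> 'I_n}), tay (ser t) a = t k a.
Proof.
move=> ht k a; rewrite /tay /tc /ser; case: pselect => [h|[]]; last by exists (Tagged (fun k => {ffun 'I_k.+1 -> 'I_n}) a).
case: cid => -[k' b] /= e; rewrite mulrCA mulfV ?fact_neq0 // mulr1.
have kk : k' = k.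
  by have := sum_cnt b; have := sum_cnt a; rewrite e => ->; rewrite !card_ord => -[].
by subst k'; exact: ht.
Qed.

(** No symmetry of [t] is assumed: the chosen word depends on [m] alone and is the same on both
    sides. *)
Lemma ser_opp t t' : (forall k a, t k a = - t' k a) -> forall m, ser t m = - ser t' m.
Proof. by move=> h m; rewrite /ser; case: pselect => // [?|]; rewrite ?h ?mulNr ?oppr0. Qed.

End CharZero.

(** * Bivector fields on the model *)

Section Evaluation.
Variables (K : fieldType) (n : nat).
Variable G : 'I_2 -> bivector K n.
Implicit Types J I : finType.

Lemma eq_cnt (I : finType) (D : {set I}) (w w' : I -> 'I_n) : w =1 w' -> cnt D w = cnt D w'.
Proof. by move=> h; congr cnt; exact/funext. Qed.

Lemma tay_bij I I' (g : I -> I') (f : series K n) (w : {ffun I' -> 'I_n}) : bijective g ->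
  tay f [ffun i => w (g i)] = tay f w.
Proof.
move=> bg; rewrite /tay -(cnt_bij w bg); congr tc; apply: eq_cnt => i; exact: ffunE.
Qed.

Lemma tayN I (f g : series K n) (w : {ffun I -> 'I_n}) : (forall m, f m = - g m) -> tay f w = - tay g w.
Proof. by move=> h; rewrite /tay /tc h mulrN. Qed.

Lemma pair_sum J (f : bool -> J) (S : J -> J -> K) : bijective f -> (forall a b, S a b = - S b a) ->
  \sum_(p : J * J | rlt p.1 p.2) S p.1 p.2 = bsgn K f * S (f false) (f true).
Proof.
move=> bf hS; have fne : f false != f true by rewrite (inj_eq (bij_inj bf)).
have fsurj j : j = f false \/ j = f true.
  by case: bf => f' _ fK; rewrite -(fK j); case: (f' j); [right|left].
rewrite /bsgn; case: ifP => h; rewrite ?mul1r ?mulN1r.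
  rewrite (big_pred1 (f false, f true)) => [//|[a b] /=].
  rewrite xpair_eqE; apply/idP/andP => [|[/eqP-> /eqP->]//].
  case: (fsurj a) => ->; case: (fsurj b) => ->; rewrite ?rltE ?eqxx //.
  by move=> k; have := rlt2N (f false) (f true); rewrite h k.
have h' : rlt (f true) (f false) by rewrite (rlt_total fne) h.
rewrite (big_pred1 (f true, f false)) => [|[a b] /=]; first exact: hS.
rewrite xpair_eqE; apply/idP/andP => [|[/eqP-> /eqP->]//].
by case: (fsurj a) => ->; case: (fsurj b) => ->; rewrite ?rltE ?eqxx ?h.
Qed.

(** The map from the model to endomorphisms determined by the pair [G], concentrated on two outputs.
    The sum over increasing pairs has one term, the enumeration order of the outputs. *)
Definition EV J I (u : msp K J I) : hom_tensor K n J I := [ffun v : {ffun J -> 'I_n} * {ffun I -> 'I_n} =>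
  if #|J| == 2%N then \sum_(x < 2) cf u x *
    \sum_(p : J * J | rlt p.1 p.2) tay (G x (v.1 p.1) (v.1 p.2)) v.2 else 0].

Lemma EVE J I (f : bool -> J) (u : msp K J I) v : bijective f ->
  EV u v = bsgn K f * \sum_(x < 2) cf u x * tay (G x (v.1 (f false)) (v.1 (f true))) v.2.
Proof.
move=> bf; rewrite ffunE -(bij_eq_card bf) card_bool /= mulr_sumr; apply: eq_bigr => x _.
rewrite (pair_sum (S := fun a b => tay (G x (v.1 a) (v.1 b)) v.2) bf); first by rewrite mulrCA.
by move=> a b; apply: tayN => m; exact: bv_skew.
Qed.

Lemma EV_out J I (u : msp K J I) : #|J| != 2%N -> EV u = 0.
Proof. by move=> h; apply/ffunP => v; rewrite !ffunE (negbTE h). Qed.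

Lemma EV_linear J I : linear (@EV J I).
Proof.
move=> a u u'; apply/ffunP => v; rewrite !ffunE; case: ifP => _; last by rewrite scaler0 addr0.
rewrite scaler_sumr -big_split; apply: eq_bigr => x _ /=.
by rewrite cf_linear mulrDl; congr (_ + _); exact/esym/mulrA.
Qed.

Lemma EV_act J J' I I' (f : J -> J') (g : I -> I') (u : msp K J I) :
  bijective f -> bijective g -> EV (mact f g u) = end_act f g (EV u).
Proof.
move=> bf bg; case: (eqVneq #|J| 2%N) => [hJ|hJ]; last first.
  by rewrite !EV_out ?(bij_eq_card bf) // -?(bij_eq_card bf) //; apply/ffunP => v; rewrite !ffunE.
have [b bb] : exists b : bool -> J, bijective b by apply: card_bij; rewrite card_bool hJ.
apply/ffunP => v; rewrite (EVE _ _ (bij_comp bf bb)) ffunE (EVE _ _ bb) !bsgnE.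
rewrite (osg_comp _ bb (bij_inj bf)) -mulNr -mulrA; congr (_ * _); rewrite mulr_sumr; apply: eq_bigr => x _.
by rewrite cf_act // -mulrA mulrA mulrA osgK mul1r /= !ffunE tay_bij.
Qed.

Variables (C : codioperad K) (h0 : codioperad_hom (model K) C).
Hypothesis h0_good : forall J I, good h0 J I.
Hypothesis G0 : forall x i j, const_coef (G x i j) = 0.

Let F J I (c : C J I) : hom_tensor K n J I := EV (eps h0 c).

Lemma tay0 I f (w : {ffun I -> 'I_n}) : #|I| = 0%N -> tay f w = const_coef (f : series K n).
Proof.
move=> h; rewrite /tay /tc /const_coef.
have -> : cnt setT w = [ffun => 0%N].
  by apply/ffunP => l; rewrite !ffunE; apply/eqP; rewrite -leqn0 -h max_card.
by rewrite big1 ?mul1r // => l _; rewrite ffunE.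
Qed.

Lemma EV_form J1 I1 J2 I2 v1 v2 (w1 : 'I_n -> _) (w2 : 'I_n -> _) :
  bilinear_form (fun (x : C J1 I1) (y : C J2 I2) => \sum_(s < n) (F x (w1 s, v1) : K) * F y (v2, w2 s)).
Proof.
have FP J I a (c c' : C J I) v : F (a *: c + c') v = a * F c v + F c' v.
  by rewrite /F (@eps_linear _ _ h0) EV_linear !ffunE.
split=> [y|x] a c c'; rewrite mulr_sumr -big_split; apply: eq_bigr => s _ /=; rewrite FP; first by rewrite mulrDl mulrA.
by rewrite mulrDr mulrCA.
Qed.

Lemma ksgn_mdeg_option J : ksgn K (mdeg (option J)) = (-1) ^+ #|J|.
Proof. by rewrite -ksgn_nat -ksgnN; congr ksgn; rewrite /mdeg card_option; lia. Qed.

(** The sign of the degree of the upper factor cancels that of the decomposition, leaving only the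
    sign of the splitting of outputs. *)
Lemma desus_term J I (a : {set J}) (b : {set I}) (u : msp K J I) v :
  (act (b := end_dioperad K n) (@join J a) (@join I b)
      (sweedler (dec (act (@split_set J a) (@split_set I b) (h0 J I u)))
        (fun p x y => ksgn K p *: comp (d := end_dioperad K n) (F x) (F y))) : hom_tensor K n J I) v
  = osg K (@split_set J a) * \sum_(k < dm (option {x | x \in a}) {x | x \in b}) \sum_(l < dm {x | x \notin a} (option {x | x \notin b}))
      cf u (k + l) * \sum_(s < n)
        EV (ev K _ k : msp K (option {x | x \in a}) {x | x \in b}) (ocons s (fun j => v.1 (val j)), [ffun i => v.2 (val i)])
      * EV (ev K _ l : msp K {x | x \notin a} (option {x | x \notin b})) ([ffun j => v.1 (val j)], ocons s (fun i => v.2 (val i))).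
Proof.
rewrite [LHS]ffunE /sweedler sum_ffunE /=.
pose T (x : C (option {x | x \in a}) {x | x \in b}) (y : C {x | x \notin a} (option {x | x \notin b})) : K :=
  \sum_(s < n) F x (ocons s (fun j => v.1 (val j)), [ffun i => v.2 (val i)])
      * F y ([ffun j => v.1 (val j)], ocons s (fun i => v.2 (val i))).
have hT : bilinear_form T by exact: EV_form.
rewrite big_seq (eq_bigr (fun t => ksgn K (mdeg (option {x | x \in a})) * T t.1.2 t.2)); last first.
  move=> t ht; rewrite ffunE [X in _ *: X]ffunE.
  have -> : T t.1.2 t.2 = \sum_(s < n) (F t.1.2 (ocons s (fun j => [ffun j0 => v.1 (join (a := a) j0)] (inl j)), [ffun i => [ffun i0 => v.2 (join (a := b) i0)] (inl i)]) : K) *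
     F t.2 ([ffun j => [ffun j0 => v.1 (join (a := a) j0)] (inr j)], ocons s (fun i => [ffun i0 => v.2 (join (a := b) i0)] (inr i))).
    apply: eq_bigr => s _; congr (F t.1.2 _ * F t.2 _); congr (_, _); apply/ffunP => z; rewrite !ffunE ?ffunE //=.
      by case: z => // z; rewrite ffunE.
    by case: z => // z; rewrite ffunE.
  have := dec_hdegl ht; case: (eqVneq t.1.1 (mdeg (option {x | x \in a}))) => [->//|ne h].
  by rewrite !big1 ?mulr0 ?scaler0 // => s _; rewrite /F (eps_deg _ h ne) (lin0 (@EV_linear _ _)) ffunE mul0r.
have E := split_expand (@split_set J a) (@split_set I b) (h0 J I u) hT (h0_good _ _) (h0_good _ _).
rewrite -big_seq -mulr_sumr; move: E; rewrite /sweedler => ->; rewrite ksgn_mdeg_option card_sigin !mulr_sumr.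
apply: eq_bigr => k _; rewrite !mulr_sumr; apply: eq_bigr => l _.
rewrite (split_h0 _ (split_bij a) (split_bij b)) ?ltn_ord //.
have h : (-1) ^+ #|a| * (-1) ^+ #|a| = 1 :> K by rewrite -exprMn mulrNN mulr1 expr1n.
rewrite /T /F !eps_h0 //; set s := \sum_(_ < _) _.
transitivity (((-1) ^+ #|a| * (-1) ^+ #|a|) * osg K (@split_set J a) * cf u (k + l) * s); first by ring.
by rewrite h mul1r mulrA.
Qed.

(** A nonzero term needs two outputs at each vertex, and the edge uses up one of the four. *)
Lemma desus_EV_out J I (u : msp K J I) : #|J| != 3%N ->
  desuspended_dec (D := end_dioperad K n) F (h0 J I u) = 0 :> hom_tensor K n J I.
Proof.
move=> hJ; apply/ffunP => v; rewrite /desuspended_dec sum_ffunE big1 ?ffunE // => a _.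
rewrite sum_ffunE big1 // => b _; rewrite desus_term.
rewrite big1 ?mulr0 // => k _; rewrite big1 // => l _; rewrite big1 ?mulr0 // => s _.
have := cardsC a; have := card_sigin a; have := card_signotin a => h1 h2 h3.
case: (eqVneq #|{: option {x | x \in a}}| 2%N) => h4; last by rewrite EV_out // ffunE mul0r.
rewrite [X in _ * X](_ : _ = 0) ?mulr0 // EV_out ?ffunE //.
by rewrite h1; move: h4; rewrite card_option h2; lia.
Qed.

Lemma collapse22 d1 d2 (U : nat -> K) (e1 e2 : K) (A B : 'I_2 -> 'I_n -> K) : d1 = 2%N -> d2 = 2%N ->
  \sum_(k < d1) \sum_(l < d2) U (k + l)%N * \sum_(s < n)
     (e1 * \sum_(x < 2) cf (ev K d1 k) x * A x s) * (e2 * \sum_(y < 2) cf (ev K d2 l) y * B y s)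
  = e1 * e2 * \sum_(x < 2) \sum_(y < 2) U (x + y)%N * \sum_(s < n) A x s * B y s.
Proof.
move=> -> ->; have E (H : 'I_2 -> K) (x : 'I_2) : \sum_(z < 2) cf (ev K 2 x) z * H z = H x.
  rewrite (bigD1 x) //= cf_ev // eqxx mul1r big1 ?addr0 // => z /negbTE h.
  by rewrite cf_ev // val_eqE h mul0r.
rewrite mulr_sumr; apply: eq_bigr => x _; rewrite mulr_sumr; apply: eq_bigr => y _.
rewrite mulrCA; congr (_ * _); rewrite mulr_sumr; apply: eq_bigr => s _.
by rewrite (E (fun z => A z s)) (E (fun z => B z s)) mulrACA.
Qed.

Lemma osg_unit (A : finType) (f : unit -> A) : osg K f = 1.
Proof.
rewrite /osg /ninv big1 // => -[] _; rewrite big1 // => -[] _.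
by rewrite rlt_irr.
Qed.

(** The sign does not depend on [k], since rotations of three labels are even; the -1 of [cutl k] is
    absorbed by the one in [bsgn]. *)
Lemma osg_split3 J (e : 'I_3 -> J) k (f : bool -> {x | x \notin [set e k]}) :
  bijective e -> (forall x, val (f x) = e (cutlV k (inr x))) -> bijective f ->
  osg K (@split_set J [set e k]) * bsgn K f = osg K e.
Proof.
move=> be hf bf; pose f0 (u : unit) : {x | x \in [set e k]} := exist _ (e k) (set11 _).
have bc : bijective (cutl k) by exists (cutlV k); [exact: cutlK|exact: cutlVK].
have b0 : bijective f0 by apply: unit_bij; rewrite card_sigin cards1.
have E : @split_set J [set e k] \o e = sumf f0 f \o cutl k.
  apply/funext => x; apply: (can_inj (@joinK J [set e k])); rewrite /= split_setK.
  rewrite -{1}(cutlK k x); case: (cutl k x) => [[]|y] //=.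
  by rewrite hf.
have := osg_comp K be (bij_inj (split_bij [set e k])); rewrite E.
rewrite (osg_comp K bc (bij_inj (sumf_bij b0 bf))) osg_sumf osg_unit mul1r osg_cutl mulN1r -bsgnE => ->.
by rewrite mulrCA osgK mulr1.
Qed.

(** The upper vertex carries the output [e k] and the inputs in [b]. The label [s] of the edge is an
    additional letter of the lower Taylor coefficient, that is, a derivative in direction [s]. *)
Lemma desus_term3 J I (e : 'I_3 -> J) k (b : {set I}) (u : msp K J I) v : bijective e ->
  (act (b := end_dioperad K n) (@join J [set e k]) (@join I b)
      (sweedler (dec (act (@split_set J [set e k]) (@split_set I b) (h0 J I u)))
        (fun p x y => ksgn K p *: comp (d := end_dioperad K n) (F x) (F y))) : hom_tensor K n J I) v
  = osg K e * \sum_(x < 2) \sum_(y < 2) cf u (x + y) * \sum_(s < n)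
     tay (G x s (v.1 (e k))) [ffun i : {i | i \in b} => v.2 (val i)]
     * tay (deriv_series s (G y (v.1 (e (ordS k))) (v.1 (e (ordS (ordS k))))))
         [ffun i : {i | i \notin b} => v.2 (val i)].
Proof.
move=> be; rewrite desus_term.
pose f1 (x : bool) : option {x | x \in [set e k]} := if x then Some (exist _ (e k) (set11 _)) else None.
have h2 (x : bool) : e (cutlV k (inr x)) \notin [set e k].
  rewrite inE (inj_eq (bij_inj be)) -(inj_eq (can_inj (@cutlK k))) cutlVK.
  by rewrite /cutl eqxx.
pose f2 (x : bool) : {x | x \notin [set e k]} := exist _ (e (cutlV k (inr x))) (h2 x).
have b1 : bijective f1.
  by apply: inj_card_bij; [case; case|rewrite card_option card_sigin cards1 card_bool].
have cJ : #|J| = 3%N by rewrite -(bij_eq_card be) card_ord.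
have cC : #|~: [set e k]| = 2%N by have := cardsC [set e k]; rewrite cards1 cJ => -[].
have b2 : bijective f2.
  apply: inj_card_bij; last by rewrite card_signotin cC card_bool.
  move=> x y /(congr1 val) h; have h' : cutlV k (inr x) = cutlV k (inr y) := bij_inj be h.
  by case: (can_inj (@cutlVK k) h').
rewrite -(osg_split3 be (f := f2)) // -mulrA; congr (_ * _).
under eq_bigr => k' _ do under eq_bigr => l _ do under eq_bigr => s _ do rewrite (EVE _ _ b1) (EVE _ _ b2) /=.
have s1 : bsgn K f1 = 1 by rewrite /bsgn /f1 rlt_None.
case: (posnP #|b|) => hb; last first.
  rewrite (@collapse22 _ _ (fun t => cf u t) (bsgn K f1) (bsgn K f2)
    (fun x s => tay (G x (ocons s (fun j : {j | j \in [set e k]} => v.1 (val j)) (f1 false))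
       (ocons s (fun j : {j | j \in [set e k]} => v.1 (val j)) (f1 true))) [ffun i : {i | i \in b} => v.2 (val i)])
    (fun y s => tay (G y ([ffun j : {j | j \notin [set e k]} => v.1 (val j)] (f2 false))
       ([ffun j : {j | j \notin [set e k]} => v.1 (val j)] (f2 true))) (ocons s (fun i : {i | i \notin b} => v.2 (val i))))).
  - rewrite s1 mul1r; congr (_ * _); apply: eq_bigr => x _; apply: eq_bigr => y _; congr (_ * _).
    apply: eq_bigr => s _; rewrite !ffunE /= -tay_ocons; congr (_ * tay _ _).
    by apply/ffunP => -[i|]; rewrite !ffunE //= ffunE.
  - by rewrite dm_stable ?card_option ?card_sigin ?cards1 // /stable !card_option !card_sigin cards1; lia.
  - by rewrite dm_stable ?card_signotin ?cC // /stable !card_option !card_signotin cC; lia.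
(* Without inputs the upper vertex is unstable and the left side is 0. On the right this term
   contains the value of [G x] at the origin, which is 0 by [G0]. *)
rewrite [LHS]big1; last first.
  move=> k' _; exfalso; have d0 : dm (option {x | x \in [set e k]}) {x | x \in b} = 0%N.
    by rewrite /dm /stable card_sigin hb andbF.
  by have := leq_trans (ltn_ord k') (eq_leq d0).
rewrite big1 ?mulr0 // => x _; rewrite big1 // => y _; rewrite big1 ?mulr0 // => s _.
by rewrite tay0 ?card_sigin // G0 mul0r.
Qed.

(** The sum over the sets of upper inputs is the Leibniz rule for words, and the sum over the upper
    output is the cyclic sum of a Schouten bracket. *)
Lemma desus_EV J I (e : 'I_3 -> J) (u : msp K J I) v : bijective e ->
  (desuspended_dec (D := end_dioperad K n) F (h0 J I u) : hom_tensor K n J I) v =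
  osg K e * \sum_(x < 2) \sum_(y < 2) cf u (x + y) * \sum_(k < 3) \sum_(s < n)
    tay (mul_series (G x s (v.1 (e k)))
          (deriv_series s (G y (v.1 (e (ordS k))) (v.1 (e (ordS (ordS k))))))) v.2.
Proof.
move=> be; rewrite /desuspended_dec sum_ffunE sum_card1; last first.
  move=> a ha; rewrite sum_ffunE big1 // => b _; rewrite desus_term big1 ?mulr0 // => k _.
  rewrite big1 // => l _; rewrite big1 ?mulr0 // => s _.
  by rewrite EV_out ?ffunE ?mul0r // card_option card_sigin; case: #|a| ha => [|[|]].
rewrite (reindex e) /=; last exact: onW_bij.
transitivity (\sum_(k < 3) osg K e * \sum_(x < 2) \sum_(y < 2) cf u (x + y) * \sum_(s < n)
    tay (mul_series (G x s (v.1 (e k)))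
          (deriv_series s (G y (v.1 (e (ordS k))) (v.1 (e (ordS (ordS k))))))) v.2).
  apply: eq_bigr => k _; rewrite sum_ffunE.
  under eq_bigr => b _ do rewrite (desus_term3 k b u v be).
  rewrite -mulr_sumr; congr (_ * _); rewrite exchange_big; apply: eq_bigr => x _.
  rewrite exchange_big; apply: eq_bigr => y _; rewrite -mulr_sumr; congr (_ * _).
  rewrite exchange_big; apply: eq_bigr => s _; exact/esym/leibniz.
rewrite -mulr_sumr; congr (_ * _); rewrite exchange_big; apply: eq_bigr => x _.
by rewrite exchange_big; apply: eq_bigr => y _; rewrite -mulr_sumr.
Qed.

End Evaluation.

(** * The correspondence *)

Section Schouten.
Variables (K : fieldType) (n : nat).
Implicit Types (I : finType) (G H : bivector K n).

(** One half of [schouten_term]: a tree has one field above and the other below, so its contribution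
    is not symmetric in the two fields. *)
Definition half_bracket I G H (i j k : 'I_n) (w : {ffun I -> 'I_n}) : K :=
  \sum_(l < n) tay (mul_series (G l i) (deriv_series l (H j k))) w.

Definition cyc_bracket I G H (v : 'I_3 -> 'I_n) (w : {ffun I -> 'I_n}) : K :=
  \sum_(k < 3) half_bracket G H (v k) (v (ordS k)) (v (ordS (ordS k))) w.

Lemma tay_schouten I G H (v : 'I_3 -> 'I_n) (w : {ffun I -> 'I_n}) :
  tay (schouten G H (v 0) (v 1) (v 2%:R)) w = cyc_bracket G H v w + cyc_bracket H G v w.
Proof.
have E i j k : tay (schouten_term G H i j k) w = half_bracket G H i j k w + half_bracket H G i j k w.
  by rewrite /half_bracket /tay /tc /schouten_term -big_split mulr_sumr; apply: eq_bigr => l _; rewrite mulrDr.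
rewrite {1}/tay /tc /schouten !mulrDr -!/(tc _ _) -!/(tay _ w) !E.
rewrite /cyc_bracket !big_ord_recl !big_ord0.
have e0 : ordS (ord0 : 'I_3) = 1 by exact: val_inj.
have e1 : lift ord0 ord0 = 1 :> 'I_3 by exact: val_inj.
have e2 : ordS (1 : 'I_3) = 2%:R by exact: val_inj.
have e3 : lift ord0 (lift ord0 ord0) = 2%:R :> 'I_3 by exact: val_inj.
have e4 : ordS (2%:R : 'I_3) = 0 by exact: val_inj.
have e5 : ord0 = 0 :> 'I_3 by exact: val_inj.
rewrite !e3 !e1 !e0 !e2 !e4 !e5 !e0; ring.
Qed.
End Schouten.

Section Correspondence.
Variables (R : realType) (P : lie12bi R) (Q : koszul_resolution P).
Local Notation C := (kr_dual Q).
Variable h0 : codioperad_hom (model R) C.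
Hypothesis kappa_h0 : forall J I (u : model R J I), kr_kappa Q J I (h0 J I u) = phi0_hom (lb_gens P) J I u.
Implicit Types J I : finType.

Let two_neq0 : 2%:R != 0 :> R. Proof. by rewrite pnatr_eq0. Qed.

Let h0_good J I : good h0 J I.
Proof. exact: (h0_bij (kr_koszul_dual Q) two_neq0 kappa_h0). Qed.

Let h0_lin J I : linear (h0 J I : msp R J I -> C J I).
Proof. exact: (@bh_linear _ _ _ h0 J I). Qed.

(* The sign makes [cgen x 0] lie over [delta x]: in the labels bool, [true] is
   enumerated first. *)
Definition cgen (x : 'I_2) (k : nat) : C bool 'I_k.+1 := - h0 bool 'I_k.+1 (ev R _ x).

Lemma dm_bool k : dm bool 'I_k.+1 = 2%N.
Proof. by rewrite dm_stable /stable card_bool ?card_ord. Qed.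

Lemma eps_cgen x k : eps h0 (cgen x k) = - ev R _ x.
Proof. by rewrite /cgen (linN (@eps_linear _ _ h0 _ _)) eps_h0. Qed.

Lemma cgen_expand k (c : C bool 'I_k.+1) : c = \sum_(x < 2) (- cf (eps h0 c) x) *: cgen x k.
Proof.
rewrite -{1}(h0_eps c (h0_good _ _)) {1}(ev_sum (eps h0 c)) (lin_sum (@h0_lin _ _)).
(* The dimension occurs in the type of the basis vectors, so the range of the sum is changed by
   generalizing over it. *)
have : forall d, d = 2%N -> forall F : nat -> C bool 'I_k.+1, \sum_(i < d) F i = \sum_(i < 2) F i by move=> d ->.
move=> /(_ _ (dm_bool k) (fun x => h0 bool 'I_k.+1 (cf (eps h0 c) x *: ev R _ x))) => ->.
by apply: eq_bigr => x _; rewrite (linZ (@h0_lin _ _)) /cgen scalerN scaleNr opprK.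
Qed.

Lemma cf_evb x y k : cf (ev R (dm bool 'I_k.+1) (x : 'I_2)) (y : 'I_2) = (y == x)%:R.
Proof. by rewrite cf_ev // dm_bool. Qed.

Lemma cgen_generators : generators_2_k cgen.
Proof.
split=> [x|k u]; last first.
  exists (- cf (eps h0 u) 0, - cf (eps h0 u) 1); split=> /=.
    rewrite {1}(cgen_expand u) big_ord_recl big_ord1.
    by congr (_ *: cgen _ _ + _ *: cgen _ _); exact: val_inj.
  move=> [a b] /= e; have : eps h0 u = - (a *: ev R _ 0) - (b *: ev R _ 1).
    have L := @eps_linear _ _ h0 bool 'I_k.+1.
    by rewrite e (linD L) !(linZ L) (eps_cgen 0) (eps_cgen 1) !scalerN.
  move=> ->; rewrite -!scaleNr.
  have Z (y : 'I_2) : cf ((- a) *: ev R (dm bool 'I_k.+1) 0 + (- b) *: ev R _ 1) y = - a * (y == 0)%:R + - b * (y == 1)%:R.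
    have := cf_linear (- a) (ev R (dm bool 'I_k.+1) 0) ((- b) *: ev R _ 1) y => ->.
    have := cf_linear (- b) (ev R (dm bool 'I_k.+1) 1) 0 y; rewrite addr0 cf0 addr0 => ->.
    by rewrite (cf_evb 0) (cf_evb 1).
  have Z0 := Z 0; have Z1 := Z 1; rewrite /= in Z0 Z1; rewrite Z0 Z1.
  by congr (_, _); rewrite /=; ring.
rewrite /cgen (linN (@bh_linear _ _ _ (kr_kappa Q) _ _)) kappa_h0.
have bt : bijective (fun _ : 'I_1 => tt) by exists (fun _ => ord0); [move=> i; rewrite (ord1 i)|case].
rewrite (linN (act_linear (@id_bij bool) bt)) /=.
have := @phi0_act _ (lb_gens P) _ _ _ _ _ _ (ev R (dm bool 'I_1) x) (@id_bij bool) bt.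
rewrite mact_ev //; last exact: id_bij.
rewrite (_ : osg R _ = 1); last exact: osg_id.
rewrite scale1r => <-.
rewrite (phi0_dE _ _ (@id_bij bool) (@id_bij unit)) act_id /bsgn rltE scaleN1r opprK.
rewrite /dcomb (bigD1 x) //= cf_ev ?eqxx ?scale1r; last by rewrite dm_stable /stable card_bool ?card_unit.
rewrite big1 ?addr0 // => y /negbTE h; rewrite cf_ev ?val_eqE ?h ?scale0r //.
by rewrite dm_stable /stable card_bool ?card_unit.
Qed.

(** * Representations and bi-Hamiltonian structures in dimension n *)

Section Dimension.
Variable n : nat.

Definition swapij (i j : 'I_n) : {ffun bool -> 'I_n} := [ffun o : bool => if o then j else i].

Definition frep (rho : representation Q n) J I (c : C J I) : hom_tensor R n J I := rho J I (kr_iota Q J I c).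

Lemma frep_linear rho J I : linear (@frep rho J I).
Proof. by move=> a x y; rewrite /frep (@bh_linear _ _ _ (kr_iota Q)) (@bh_linear _ _ _ rho). Qed.

Lemma frep_act rho J J' I I' (f : J -> J') (g : I -> I') (c : C J I) : bijective f -> bijective g ->
  frep rho (act f g c) = end_act f g (frep rho c).
Proof.
move=> bf bg; rewrite /frep; have e := bh_act (kr_iota Q) c bf bg; rewrite /= in e.
by rewrite e (bh_act rho).
Qed.

(** A generator with m outputs has degree 2 - m in the cobar construction, while endomorphisms of a
    space in degree 0 vanish outside degree 0. *)
Lemma frep_out rho J I (c : C J I) : #|J| != 2%N -> frep rho c = 0.
Proof.
move=> hJ; have hc : hdeg (mdeg J) c.
  by rewrite -(h0_eps c (h0_good _ _)); apply: (@bh_hdeg _ _ _ h0); left.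
have hc' : @hdeg _ (shift (-1) C) J I (1 + mdeg J) c by rewrite /= addKr.
have := @bh_hdeg _ _ _ rho _ _ _ _ (@bh_hdeg _ _ _ (kr_iota Q) _ _ _ _ hc').
by case=> // e; exfalso; move: e hJ; rewrite /mdeg; lia.
Qed.

(** The correspondence of components, stated for bivector fields whose brackets are not yet known to
    vanish. *)
Definition tay_rep (rho : representation Q n) (B : 'I_2 -> bivector R n) := forall x k i j (a : {ffun 'I_k.+1 -> 'I_n}),
  tay (B x i j) a = frep rho (cgen x k) (swapij i j, a).

(** Up to relabeling the [cgen x k] span the components with two outputs; both sides are linear and
    equivariant, and vanish for other numbers of outputs. *)
Lemma tay_rep_EV rho B : tay_rep rho B <-> forall J I (c : C J I), frep rho c = EV B (eps h0 c).
Proof.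
split=> [h J I c|h x k i j a]; last first.
  rewrite h eps_cgen (linN (@EV_linear _ _ B _ _)) [RHS]ffunE (EVE _ _ _ (@id_bij bool)) /bsgn rltE mulN1r opprK.
  rewrite (bigD1 x) //= cf_evb eqxx mul1r big1 ?addr0 ?ffunE // => y /negbTE hy.
  by rewrite cf_evb hy mul0r.
case: (eqVneq #|J| 2%N) => hJ; last by rewrite frep_out // EV_out.
case hI : #|I| => [|k].
  have -> : c = 0 by apply: unstable_eq0; rewrite /stable hI andbF.
  by rewrite (lin0 (@frep_linear _ _ _)) (lin0 (@eps_linear _ _ _ _ _)) (lin0 (@EV_linear _ _ _ _ _)).
have [f bf] : exists f : bool -> J, bijective f by apply: card_bij; rewrite card_bool hJ.
have [g bg] : exists g : 'I_k.+1 -> I, bijective g by apply: card_bij; rewrite card_ord hI.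
have [c' ->] := act_surj c bf bg.
rewrite frep_act // (eps_act h0) // EV_act //; congr end_act.
apply/ffunP => v; rewrite {1}(cgen_expand c') (lin_sum (@frep_linear _ _ _)) sum_ffunE.
rewrite (EVE _ _ _ (@id_bij bool)) /bsgn rltE mulN1r -sumrN; apply: eq_bigr => x _.
rewrite (linZ (@frep_linear _ _ _)) ffunE -mulNr; congr (_ * _); rewrite h.
case: v => v1 v2 /=; congr (frep rho _ (_, _)); apply/ffunP => o; rewrite !ffunE; by case: o.
Qed.

Lemma desus_dg (J I : finType) (f : forall J I, C J I -> hom_tensor R n J I) (h : dioperad_hom (kr_dg Q) (end_dioperad R n)) (c : C J I) :
  (forall J I (c : C J I), h J I (kr_iota Q J I c) = f J I c) ->
  h J I (diff (kr_iota Q J I c)) = desuspended_dec (D := end_dioperad R n) f c.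
Proof.
move=> hf; have [_ ->] := kr_cobar Q; rewrite desus_hom; apply: (congr1 (fun F => desuspended_dec (D := end_dioperad R n) F c)).
apply/functional_extensionality_dep => J'; apply/functional_extensionality_dep => I'; apply/funext => x.
exact: hf.
Qed.

Lemma bracket_sum (B : 'I_2 -> bivector R n) J I (e : 'I_3 -> J) (u : msp R J I) (v : {ffun J -> 'I_n} * {ffun I -> 'I_n}) :
  \sum_(x < 2) \sum_(y < 2) cf u (x + y) * \sum_(k < 3) \sum_(s < n)
    tay (mul_series (B x s (v.1 (e k))) (deriv_series s (B y (v.1 (e (ordS k))) (v.1 (e (ordS (ordS k))))))) v.2
  = cf u 0 * cyc_bracket (B 0) (B 0) (fun k => v.1 (e k)) v.2
  + cf u 1 * (cyc_bracket (B 0) (B 1) (fun k => v.1 (e k)) v.2 + cyc_bracket (B 1) (B 0) (fun k => v.1 (e k)) v.2)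
  + cf u 2 * cyc_bracket (B 1) (B 1) (fun k => v.1 (e k)) v.2 :> R.
Proof.
have e1 : lift ord0 ord0 = 1 :> 'I_2 by exact: val_inj.
have e0 : ord0 = 0 :> 'I_2 by exact: val_inj.
transitivity (\sum_(x < 2) \sum_(y < 2) cf u (x + y) * cyc_bracket (B x) (B y) (fun k => v.1 (e k)) v.2).
  by [].
move: (cyc_bracket (I := I)) => br.
rewrite !big_ord_recl !big_ord0 !e1 !e0 !addr0 mulrDr !addrA.
by [].
Qed.

(** The basis vectors of index 0, 1 and 2 isolate the three brackets. Constant coefficients are
    treated apart, because the generators have at least one input; they vanish since every product
    has a factor vanishing at the origin. *)
Lemma schouten_desus (B : 'I_2 -> bivector R n) : (forall x i j, const_coef (B x i j) = 0) ->
  (forall J I (c : C J I), desuspended_dec (D := end_dioperad R n) (fun J I c => EV B (eps h0 c)) c = 0) ->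
  [/\ schouten_commute (B 0) (B 0), schouten_commute (B 0) (B 1) & schouten_commute (B 1) (B 1)].
Proof.
move=> hB hd; have mul0s (f g : series R n) : const_coef f = 0 -> mul_series f g [ffun => 0%N] = 0.
  move=> hf; rewrite (@mul_seriesE _ _ 0); last by move=> i; rewrite ffunE.
  rewrite big1 // => b _; rewrite (_ : bfun b = [ffun => 0%N]) ?[f _]hf ?mul0r //.
  by apply/ffunP => l; rewrite !ffunE ord1.
have const0 x y i j k : const_coef (schouten (B x) (B y) i j k) = 0.
  rewrite /const_coef /schouten /schouten_term.
  by rewrite !big1 ?addr0 // => l _; rewrite !mul0s ?addr0 //; exact: hB.
have all0 (t : nat) k (v : 'I_3 -> 'I_n) (w : {ffun 'I_k.+1 -> 'I_n}) :
   let u := ev R (dm 'I_3 'I_k.+1) t : msp R 'I_3 'I_k.+1 in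
   cf u 0 * cyc_bracket (B 0) (B 0) v w
   + cf u 1 * (cyc_bracket (B 0) (B 1) v w + cyc_bracket (B 1) (B 0) v w)
   + cf u 2 * cyc_bracket (B 1) (B 1) v w = 0.
  move=> u; have := congr1 (fun f : hom_tensor R n 'I_3 'I_k.+1 => f ([ffun i => v i], w)) (hd _ _ (h0 _ _ u)).
  rewrite (desus_EV h0_good hB _ _ (@id_bij 'I_3)) [osg R _]osg_id mul1r (bracket_sum B (@id 'I_3) u) [RHS]ffunE => <-.
  have -> : (fun k : 'I_3 => ([ffun i => v i], w).1 (id k)) = v by apply/funext => i; rewrite ffunE.
  by [].
have dm3 k : dm 'I_3 'I_k.+1 = 3%N by rewrite dm_stable /stable ?card_ord.
have fin x y : (forall k (v : 'I_3 -> 'I_n) (w : {ffun 'I_k.+1 -> 'I_n}),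
    cyc_bracket (B x) (B y) v w + cyc_bracket (B y) (B x) v w = 0) -> schouten_commute (B x) (B y).
  move=> h i j k; apply: series0P => // d w.
  by have := tay_schouten (B x) (B y) (fun l : 'I_3 => if l == 0 then i else if l == 1 then j else k) w; rewrite h.
split; apply: fin => k v w.
- by have := all0 0%N k v w; rewrite /= !cf_ev ?dm3 // mul1r !mul0r !addr0 => ->; rewrite addr0.
- by have := all0 1%N k v w; rewrite /= !cf_ev ?dm3 // mul1r !mul0r !addr0 add0r.
- by have := all0 2%N k v w; rewrite /= !cf_ev ?dm3 // mul1r !mul0r !add0r => ->; rewrite addr0.
Qed.

Lemma desus_schouten (B : 'I_2 -> bivector R n) : (forall x i j, const_coef (B x i j) = 0) ->
  schouten_commute (B 0) (B 0) -> schouten_commute (B 0) (B 1) -> schouten_commute (B 1) (B 1) ->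
  forall J I (c : C J I), desuspended_dec (D := end_dioperad R n) (fun J I c => EV B (eps h0 c)) c = 0.
Proof.
move=> hB h00 h01 h11 J I c; rewrite -(h0_eps c (h0_good J I)).
case: (eqVneq #|J| 3%N) => hJ; last by apply: desus_EV_out.
have [e be] : exists e : 'I_3 -> J, bijective e by apply: card_bij; rewrite card_ord hJ.
have S x y (v : 'I_3 -> 'I_n) (w : {ffun I -> 'I_n}) : schouten_commute (B x) (B y) ->
    cyc_bracket (B x) (B y) v w + cyc_bracket (B y) (B x) v w = 0.
  by move=> h; rewrite -tay_schouten /tay /tc h mulr0.
(* The bracket of a field with itself is twice its cyclic sum, so 2 is cancelled here. *)
have S2 x (v : 'I_3 -> 'I_n) (w : {ffun I -> 'I_n}) : schouten_commute (B x) (B x) -> cyc_bracket (B x) (B x) v w = 0.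
  by move/(S x x v w)/eqP; rewrite -mulr2n mulrn_eq0 => /eqP.
apply/ffunP => v; rewrite (desus_EV h0_good hB _ _ be) bracket_sum (S 0 1) // (S2 0) // (S2 1) // !mulr0 !addr0 mulr0.
by rewrite ffunE.
Qed.

(** Freeness extends [EV] to a map of dioperads [h]. Compatibility with differentials means that [h]
    kills all [diff x]: on generators these are the bracket equations, and induction over the free
    dioperad extends this to composites. *)
Lemma rep_of_bihamiltonian (G : bihamiltonian0 R n) : exists rho : representation Q n, tay_rep rho (sval G).
Proof.
case: G => [[B h11 h12 h22]] /= hB; rewrite /vanishes_at_origin /= in hB.
have Flin J I : linear (fun c : C J I => EV B (eps h0 c)).
  by move=> a x y; rewrite (@eps_linear _ _ h0) EV_linear.
have Fdeg J I p (c : shift (-1) C J I) : hdeg p c -> @hdeg _ (end_dioperad R n) J I p (EV B (eps h0 c)).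
  move=> hp; case: (eqVneq #|J| 2%N) => hJ; last by right; exact: EV_out.
  case: (eqVneq (-1 + p) (mdeg J)) => [e|ne].
    by left; move: e; rewrite /mdeg hJ; lia.
  by right; rewrite (eps_deg h0 hp ne) (lin0 (@EV_linear _ _ _ _ _)).
have Fact J J' I I' (f : J -> J') (g : I -> I') (c : shift (-1) C J I) : bijective f -> bijective g ->
   EV B (eps h0 (act f g c)) = @act _ (end_dioperad R n) _ _ _ _ f g (EV B (eps h0 c)).
  by move=> bf bg; rewrite /= (eps_act h0) // EV_act.
pose F := @BimodHom R (shift (-1) C) (end_dioperad R n) (fun J I c => EV B (eps h0 c)) Flin Fdeg Fact.
have [free _] := kr_cobar Q; have [h [hF _]] := free _ F.
have hl J I : linear (h J I) := @bh_linear _ _ _ h J I.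
have hdl J I : linear (fun x : kr_dg Q J I => h J I (diff x) : hom_tensor R n J I).
  by move=> a x y; rewrite diff_linear hl.
(* The target lives in degree 0, so only degree -1 can contribute; this is what makes the submodule
   [S] graded. *)
have hneg J I p (x : kr_dg Q J I) : hdeg p x -> p != -1 -> h J I (diff x) = 0.
  move=> hp ne; case: (bh_hdeg h (diff_hdeg hp)) => // e; exfalso; move: ne.
  by rewrite -(addrK 1 p) e add0r eqxx.
have hd J I (x : kr_dg Q J I) : h J I (diff x) = 0.
  pose S J I := @LinearProp R (kr_dg Q J I) (fun x => h J I (diff x) = 0) (lin0 (@hdl J I))
    (fun a x y hx hy => etrans (@hdl J I a x y) (etrans (congr2 (fun u v => a *: u + v) hx hy) (etrans (addr0 _) (scaler0 _ a)))).
  have Sspan J' I' y : S J' I' y -> exists (s : seq int) (f : int -> kr_dg Q J' I'),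
     (forall p, hdeg p (f p) /\ S J' I' (f p)) /\ y = \sum_(p <- s) f p.
    move=> hy; have [s [f [us [hf yE fs]]]] := span_uniq (hdeg_grading (kr_dg Q) J' I') y.
    exists s, f; split=> // p; split; first exact: hf.
    (* In degree -1 the value on the component is the value on the whole sum [y], as all other
       components contribute 0. *)
    case: (eqVneq p (-1)) => [->|]; last exact: hneg (hf p).
    case: (boolP (-1 \in s)) => [ps|/fs->]; last exact: (lin0 (@hdl J' I')).
    move: hy; rewrite /= yE (lin_sum (@hdl J' I')) (bigD1_seq (-1)) //= big1 ?addr0 // => q ne.
    exact: hneg (hf q) ne.
  apply: (free_ind (S := S) free) => //.
  - by move=> J1 J2 I1 I2 f g y bf bg /= hy; rewrite diff_act // (bh_act h) // hy act0.
  - move=> J1 I1 J2 I2 y z hy hz; have [s [f [hf ->]]] := Sspan _ _ _ hy.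
    have -> : comp (\sum_(p <- s) f p) z = \sum_(p <- s) comp (f p) z.
      exact: (lin_sum (@comp_linearl _ (kr_dg Q) _ _ _ _ z)).
    rewrite /= (lin_sum (@hdl _ _)) big1_seq // => p _; have [h1 h2] := hf p.
    rewrite /= in h2 hz; rewrite (diff_comp z h1) (linD (@hl _ _)) (linZ (@hl _ _)) !dh_comp h2 hz.
    rewrite (lin0 (@comp_linearl _ (end_dioperad R n) _ _ _ _ _)) (lin0 (@comp_linearr _ (end_dioperad R n) _ _ _ _ _)).
    by rewrite scaler0 addr0.
  - exact: hneg (dunit_hdeg _) _.
  - move=> J' I' c; rewrite /= (desus_dg c hF).
    exact: desus_schouten.
unshelve eexists.
  apply: (@DgHom R (kr_dg Q) (dg0 (end_dioperad R n)) h).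
  by move=> J I x; exact: hd.
by apply/tay_rep_EV => J I c; exact: hF.
Qed.

(** Permutations of inputs fix [cgen x k] and the exchange of outputs negates it: the components are
    therefore Taylor coefficients of skew families of series. Compatibility of [rho] with the
    differentials then gives the bracket equations. *)
Lemma bihamiltonian_of_rep (rho : representation Q n) : exists G : bihamiltonian0 R n, tay_rep rho (sval G).
Proof.
pose t x i j k (a : {ffun 'I_k.+1 -> 'I_n}) : R := frep rho (cgen x k) (swapij i j, a).
have tsym x i j k (a b : {ffun 'I_k.+1 -> 'I_n}) : cnt setT a = cnt setT b -> t x i j k a = t x i j k b.
  move=> /cnt_perm[s bs hs]; have e : act id s (cgen x k) = cgen x k.
    rewrite /cgen (linN (act_linear (@id_bij bool) bs)) -(h0_act h0 _ (@id_bij bool) bs).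
    by rewrite mact_ev ?osg_id ?scale1r //; exact: id_bij.
  rewrite /t -[in RHS]e (frep_act _ _ (@id_bij bool) bs) ffunE /=.
  congr (frep rho _ (_, _)); apply/ffunP => z; rewrite !ffunE ?hs //.
have tskew x i j k a : t x i j k a = - t x j i k a.
  have bn : bijective negb by exists negb => -[].
  have e : act negb id (cgen x k) = - cgen x k.
    rewrite /cgen (linN (act_linear bn (@id_bij 'I_k.+1))) -(h0_act h0 _ bn (@id_bij 'I_k.+1)).
    rewrite mact_ev //; last exact: id_bij.
    have -> : osg R negb = -1 by have := bsgnE R negb; rewrite /bsgn rltE /= => ->; rewrite opprK.
    by rewrite scaleN1r (linN (@h0_lin _ _)).
  have := frep_act rho (cgen x k) bn (@id_bij 'I_k.+1); rewrite e (linN (@frep_linear rho _ _)).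
  move=> /(congr1 (fun f : hom_tensor R n bool 'I_k.+1 => - f (swapij i j, a))); rewrite ffunE opprK /t => ->.
  rewrite ffunE /=; congr (- frep rho _ (_, _)); apply/ffunP => z; rewrite !ffunE //.
  by case: z.
pose B x : bivector R n := @Bivector R n (fun i j => ser (t x i j)) (fun i j m => ser_opp (tskew x i j) m).
have B0 x i j : const_coef (B x i j) = 0 by exact: ser_const.
have Bt : tay_rep rho B by move=> x k i j a; exact: (tay_ser (@tsym x i j)).
have BE := (tay_rep_EV rho B).1 Bt.
have hd J I (c : C J I) : desuspended_dec (D := end_dioperad R n) (fun J I c => EV B (eps h0 c)) c = 0.
  rewrite -(desus_dg (h := rho) c BE) (dgh_diff rho).
  by [].
have [h11 h12 h22] := schouten_desus B0 hd.
by exists (exist _ (BiHamiltonian h11 h12 h22) B0).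
Qed.

(** The two representations agree on generators, hence everywhere by freeness; equality of the
    records then rests on extensionality and proof irrelevance. *)
Lemma tay_rep_rho (rho rho' : representation Q n) B : tay_rep rho B -> tay_rep rho' B -> rho = rho'.
Proof.
move=> /tay_rep_EV h /tay_rep_EV h'; have [free _] := kr_cobar Q.
have @F : bimod_hom (shift (-1) C) (end_dioperad R n) := comp_hom rho (kr_iota Q).
have [g [_ gu]] := free _ F.
have e J I x : rho J I x = rho' J I x.
  rewrite (gu rho) //; apply/esym/(gu rho') => J' I' c.
  by have := h J' I' c; have := h' J' I' c; rewrite /frep => -> <-.
case: rho rho' e {h h' F g gu} => [[[f1 l1 d1 a1] c1 u1] dd1] [[[f2 l2 d2 a2] c2 u2] dd2] /= e.
have ef : f1 = f2.
  by apply/functional_extensionality_dep => J; apply/functional_extensionality_dep => I; apply/funext => x; exact: e.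
subst f2; clear e.
have el : l1 = l2 by exact: Prop_irrelevance.
have ed : d1 = d2 by exact: Prop_irrelevance.
have ea : a1 = a2 by exact: Prop_irrelevance.
subst l2 d2 a2.
have ec : c1 = c2 by exact: Prop_irrelevance.
have eu : u1 = u2 by exact: Prop_irrelevance.
subst c2 u2; congr DgHom; exact: Prop_irrelevance.
Qed.

(** Taylor coefficients of positive order agree, and the constant coefficients vanish on both
    sides. *)
Lemma tay_rep_G (rho : representation Q n) (G G' : bihamiltonian0 R n) :
  tay_rep rho (sval G) -> tay_rep rho (sval G') -> G = G'.
Proof.
case: G G' => [[B h11 h12 h22] B0] [[B' h11' h12' h22'] B0'] /= h h'.
have eB : B = B'.
  apply/funext => x; have e : bv_coef (B x) = bv_coef (B' x).
    apply/funext => i; apply/funext => j; apply/funext => m; apply/eqP; rewrite -subr_eq0; apply/eqP.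
    apply: (@series0P R n (fun m => B x i j m - B' x i j m)) => [|k a].
      by have := B0 x i j; have := B0' x i j; rewrite /const_coef /= => -> ->; rewrite subrr.
    have := h x k i j a; rewrite -(h' x k i j a) /tay /tc => e; by rewrite mulrBr e subrr.
  case: (B x) (B' x) e => [b s] [b' s'] /= e; subst b'; congr Bivector; exact: Prop_irrelevance.
subst B'; have e1 : h11 = h11' by exact: Prop_irrelevance.
have e2 : h12 = h12' by exact: Prop_irrelevance.
have e3 : h22 = h22' by exact: Prop_irrelevance.
by subst h11' h12' h22'; congr exist; exact: Prop_irrelevance.
Qed.

Lemma tay_rep_taylor (rho : representation Q n) (G : bihamiltonian0 R n) :
  tay_rep rho (sval G) <-> taylor_components cgen rho G.
Proof. by split=> h x k i j a; have := h x k i j a; rewrite taylorE. Qed.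

End Dimension.
End Correspondence.

Theorem theorem1 (R : realType) (P : lie12bi R) (Pinf : koszul_resolution P) :
  exists c : 'I_2 -> forall k : nat, kr_dual Pinf bool 'I_k.+1,
    generators_2_k c
    /\ forall n : nat,
         exists2 Phi : representation Pinf n -> bihamiltonian0 R n,
           bijective Phi
           & forall rho : representation Pinf n, taylor_components c rho (Phi rho).
Proof.
have [_ univ] := kr_koszul_dual Pinf.
have [h0 [kappa_h0 _]] := univ _ _ (model_corelations P).
exists (cgen h0); split=> [|n]; first exact: cgen_generators.
pose Phi rho := projT1 (cid (bihamiltonian_of_rep kappa_h0 (n := n) rho)).
have PhiP rho : tay_rep h0 rho (sval (Phi rho)) by rewrite /Phi; case: cid.
pose Psi G := projT1 (cid (rep_of_bihamiltonian kappa_h0 (n := n) G)).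
have PsiP G : tay_rep h0 (Psi G) (sval G) by rewrite /Psi; case: cid.
exists Phi; last by move=> rho; apply/tay_rep_taylor.
(* Structure and representation related by [tay_rep] determine each other, so the two choice
   functions are mutually inverse. *)
exists Psi => [rho|G].
  exact: (tay_rep_rho kappa_h0 (PsiP _) (PhiP _)).
exact: (tay_rep_G (PhiP _) (PsiP _)).
Qed.
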